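(* Let $(M,g)$ be a complete gradient shrinking Ricci soliton with potential function $f$, i.e. $Ric+Hess(f)=\frac12 g$. If for some $\lambda<1$ we have $\int_M |Rm|^2e^{-\lambda f}<\infty$, then $$\int_M|\nabla Ric|^2e^{-f}=\int_M|div(Rm)|^2e^{-f}<\infty .$$
   Context: A gradient shrinking Ricci soliton is a (connected, smooth) manifold $M$ with a complete Riemannian metric $g$ and a smooth function $f$ on $M$ (the potential) such that $Ric+Hess(f)=\frac12 g$. After adding a constant to $f$ one has the normalization $|\nabla f|^2+R=f$, where $R$ is the scalar curvature. $Rm$ is the Riemann curvature tensor with components $R_{ijkl}$ and $R_{ij}$ are the components of the Ricci tensor. In an orthonormal frame, $|\nabla Ric|^2=\sum_{i,j,k}|\nabla_kR_{ij}|^2$, $div(Rm)_{jkl}=\sum_i\nabla_iR_{ijkl}$, and $|div(Rm)|^2=\sum_{j,k,l}|div(Rm)_{jkl}|^2$. Integrals are with respect to the Riemannian volume of $g$. *)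

(* Defs.v *)
From HB Require Import structures.
From mathcomp Require Import all_boot all_order all_algebra.
From mathcomp Require Import all_classical all_reals all_analysis.

Set Implicit Arguments.
Unset Strict Implicit.
Unset Printing Implicit Defensive.

Import Order.TTheory GRing.Theory Num.Theory.
Import numFieldNormedType.Exports.

Local Open Scope classical_set_scope.
Local Open Scope ring_scope.

(** * Calculus on open subsets of R^n *)
Section Euclidean.
Variables (R : realType) (n : nat).
Implicit Types (U : set 'rV[R]_n) (F : 'rV[R]_n -> R).

Definition basis_vec (i : 'I_n) : 'rV[R]_n := delta_mx 0 i.

Definition partial (i : 'I_n) F : 'rV[R]_n -> R := fun x => 'D_(basis_vec i) F x.

(* Meant for open U. *)
Fixpoint Ck_on (k : nat) U F : Prop :=
  (forall x, U x -> {for x, continuous F}) /\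
  (if k is k'.+1 then
     forall i, (forall x, U x -> derivable F x (basis_vec i)) /\
               Ck_on k' U (partial i F)
   else True).

Definition smooth_on U F : Prop := forall k, Ck_on k U F.

End Euclidean.

(* The Lebesgue integral over R^n of a nonnegative Borel function, written as
   an iterated one-dimensional integral (Tonelli). *)
Fixpoint int_Rn (R : realType) (n : nat) : ('rV[R]_n -> \bar R) -> \bar R :=
  if n is n'.+1 return ('rV[R]_n -> \bar R) -> \bar R then
    fun F => (\int[@lebesgue_measure R]_(t in [set: R])
      int_Rn (fun y : 'rV[R]_n' => F (row_mx (t%:M : 'rV[R]_1) y)))%E
  else fun F => F 0.

(** * Riemannian geometry in one coordinate chart *)
Section Coordinates.
Variables (R : realType) (n : nat).

(* [gtrace G T] is $g^{ab} T_{ab}$; [gtrace_orthonormal] below says that this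
   is $\sum_i T(e_i,e_i)$ for any orthonormal frame $(e_i)$. *)
Definition gtrace (G : 'M[R]_n) (T : 'I_n -> 'I_n -> R) : R :=
  \sum_a \sum_b invmx G a b * T a b.

(* Components of covariant k-tensors, in curried form. *)
Fixpoint tensor (k : nat) : Type :=
  if k is k'.+1 then 'I_n -> tensor k' else R.

(* $g^{a_1b_1} \cdots g^{a_kb_k} S_{a_1 \dots a_k} T_{b_1 \dots b_k}$ *)
Fixpoint tinner (G : 'M[R]_n) (k : nat) : tensor k -> tensor k -> R :=
  if k is k'.+1 return tensor k -> tensor k -> R then
    fun S T => gtrace G (fun a b => tinner G (S a) (T b))
  else fun s t => s * t.

Definition tnorm2 (G : 'M[R]_n) (k : nat) (T : tensor k) : R := tinner G T T.

Lemma gtrace_orthonormal (G E : 'M[R]_n) (T : 'I_n -> 'I_n -> R) :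
  E *m G *m E^T = 1%:M ->
  gtrace G T = \sum_i \sum_a \sum_b E i a * E i b * T a b.
Proof.
move=> EGE.
have GV : G *m (E^T *m E) = 1%:M.
  by apply: mulmx1C; rewrite -mulmxA; exact: mulmx1C.
have Gu : G \in unitmx by case: (mulmx1_unit GV).
have -> : gtrace G T = \sum_a \sum_b (E^T *m E) a b * T a b.
  rewrite /gtrace; have -> : invmx G = E^T *m E => [|//].
  by rewrite -[RHS](mulKmx Gu) GV mulmx1.
rewrite exchange_big /=; under [RHS]eq_bigr do rewrite exchange_big /=.
rewrite [RHS]exchange_big /=; apply: eq_bigr => b _.
rewrite [RHS]exchange_big /=; apply: eq_bigr => a _.
by rewrite mxE mulr_suml; apply: eq_bigr => i _; rewrite mxE.
Qed.

Variable g : 'rV[R]_n -> 'M[R]_n.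

Definition gcomp (i j : 'I_n) : 'rV[R]_n -> R := fun x => g x i j.

(* $\Gamma^k_{ij}$ *)
Definition christoffel (k i j : 'I_n) : 'rV[R]_n -> R := fun x =>
  2^-1 * \sum_l invmx (g x) k l *
    (partial i (gcomp j l) x + partial j (gcomp i l) x - partial l (gcomp i j) x).

(* $R_{ijk}{}^l$, where $R(\partial_i,\partial_j)\partial_k = R_{ijk}{}^l\partial_l$ and
   $R(X,Y) = \nabla_X\nabla_Y - \nabla_Y\nabla_X - \nabla_{[X,Y]}$. *)
Definition Rm_up (i j k l : 'I_n) : 'rV[R]_n -> R := fun x =>
  partial i (christoffel l j k) x - partial j (christoffel l i k) x
  + \sum_p (christoffel l i p x * christoffel p j k x
            - christoffel l j p x * christoffel p i k x).

Definition Rm (i j k l : 'I_n) : 'rV[R]_n -> R := fun x =>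
  \sum_m g x l m * Rm_up i j k m x.

(* Positive on round spheres. *)
Definition Ric (j k : 'I_n) : 'rV[R]_n -> R := fun x => \sum_i Rm_up i j k i x.

(* $\nabla_k R_{ij}$ *)
Definition nabla_Ric (k i j : 'I_n) : 'rV[R]_n -> R := fun x =>
  partial k (Ric i j) x
  - \sum_p christoffel p k i x * Ric p j x
  - \sum_p christoffel p k j x * Ric i p x.

(* $\nabla_m R_{ijkl}$ *)
Definition nabla_Rm (m i j k l : 'I_n) : 'rV[R]_n -> R := fun x =>
  partial m (Rm i j k l) x
  - \sum_p christoffel p m i x * Rm p j k l x
  - \sum_p christoffel p m j x * Rm i p k l x
  - \sum_p christoffel p m k x * Rm i j p l x
  - \sum_p christoffel p m l x * Rm i j k p x.

Definition div_Rm (j k l : 'I_n) : 'rV[R]_n -> R := fun x =>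
  gtrace (g x) (fun m i => nabla_Rm m i j k l x).

Definition Hess (F : 'rV[R]_n -> R) (i j : 'I_n) : 'rV[R]_n -> R := fun x =>
  partial i (partial j F) x - \sum_k christoffel k i j x * partial k F x.

Definition Rm_norm2 (x : 'rV[R]_n) : R :=
  @tnorm2 (g x) 4 (fun i j k l => Rm i j k l x).

Definition nabla_Ric_norm2 (x : 'rV[R]_n) : R :=
  @tnorm2 (g x) 3 (fun k i j => nabla_Ric k i j x).

Definition div_Rm_norm2 (x : 'rV[R]_n) : R :=
  @tnorm2 (g x) 3 (fun j k l => div_Rm j k l x).

End Coordinates.

(** * Smooth manifolds and Riemannian metrics *)

(* A smooth structure given by an atlas, not required to be maximal.
   [chart_inv i] is only relevant on the image of the i-th chart; [chart_at]
   selects a chart around each point and is used to evaluate quantities that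
   do not depend on the chart. *)
Record smooth_atlas (R : realType) (n : nat) (M : topologicalType) := SmoothAtlas {
  chart_idx : Type;
  chart_dom : chart_idx -> set M;
  chart : chart_idx -> M -> 'rV[R]_n;
  chart_inv : chart_idx -> 'rV[R]_n -> M;
  chart_at : M -> chart_idx;
  chart_atP : forall x, chart_dom (chart_at x) x;
  chart_dom_open : forall i, open (chart_dom i);
  chart_img_open : forall i, open (chart i @` chart_dom i);
  chartK : forall i x, chart_dom i x -> chart_inv i (chart i x) = x;
  chart_continuous : forall i x, chart_dom i x -> {for x, continuous (chart i)};
  chart_inv_continuous : forall i y, (chart i @` chart_dom i) y ->
    {for y, continuous (chart_inv i)};
  chart_smooth : forall i j (k : 'I_n),
    smooth_on (chart i @` (chart_dom i `&` chart_dom j))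
              (fun y => chart j (chart_inv i y) 0 k)
}.

Section Manifold.
Variables (R : realType) (n : nat).

Section Metric.
Variables (M : topologicalType) (A : smooth_atlas R n M).

Definition chart_img (i : chart_idx A) : set 'rV[R]_n :=
  chart i @` chart_dom i.

Definition smooth_fun (f : M -> R) : Prop :=
  forall i : chart_idx A, smooth_on (chart_img i) (f \o chart_inv i).

(* Entry (a, c) is $\partial \tau^c / \partial y^a$ at y, where $\tau$ is the
   transition map from chart i to chart j. *)
Definition transition_mx (i j : chart_idx A) (y : 'rV[R]_n) : 'M[R]_n :=
  \matrix_(a, c) partial a (fun z => chart j (chart_inv i z) 0 c) y.

(* [metric i y] is the matrix of components $(g_{ab})$ in the i-th chart, at
   the point with coordinates y. *)
Record riemannian_metric := RiemannianMetric {
  metric :> chart_idx A -> 'rV[R]_n -> 'M[R]_n;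
  metric_smooth : forall i a b, smooth_on (chart_img i) (gcomp (metric i) a b);
  metric_sym : forall i y, chart_img i y -> (metric i y)^T = metric i y;
  metric_pos : forall i y (v : 'rV[R]_n), chart_img i y -> v != 0 ->
    0 < (v *m metric i y *m v^T) 0 0;
  metric_compat : forall i j x, chart_dom i x -> chart_dom j x ->
    let J := transition_mx i j (chart i x) in
    metric i (chart i x) = J *m metric j (chart j x) *m J^T
}.

Variable g : riemannian_metric.

(* In every chart the coordinates $c^k$ of the curve satisfy
   $\ddot c^k + \Gamma^k_{ab} \dot c^a \dot c^b = 0$. *)
Definition geodesic (gam : R -> M) : Prop :=
  continuous gam /\
  forall (i : chart_idx A) (t : R), chart_dom i (gam t) ->
    let c (k : 'I_n) : R -> R := fun s => chart i (gam s) 0 k in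
    forall k,
      [/\ derivable (c k) t 1, derivable (derive1 (c k)) t 1 &
          derive1 (derive1 (c k)) t = - \sum_a \sum_b
            christoffel (g i) k a b (chart i (gam t)) *
            derive1 (c a) t * derive1 (c b) t].

(* Geodesic completeness: the geodesic with any given initial position and
   velocity (the latter given by its components v in a chart) is defined for
   all times. *)
Definition complete_metric : Prop :=
  forall (i : chart_idx A) (x : M) (v : 'rV[R]_n), chart_dom i x ->
    exists gam : R -> M,
      [/\ geodesic gam, gam 0 = x &
          forall k : 'I_n, derive1 (fun s : R => chart i (gam s) 0 k) 0 = v 0 k].

(* $Ric + Hess(f) = \frac12 g$ *)
Definition shrinking_soliton (f : M -> R) : Prop :=
  smooth_fun f /\
  forall (i : chart_idx A) (y : 'rV[R]_n), chart_img i y -> forall a b : 'I_n,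
    Ric (g i) a b y + Hess (g i) (f \o chart_inv i) a b y = 2^-1 * g i y a b.

(* The value at x of a scalar given by its coordinate expression. *)
Definition at_point (q : ('rV[R]_n -> 'M[R]_n) -> 'rV[R]_n -> R) (x : M) : R :=
  q (g (chart_at A x)) (chart (chart_at A x) x).

End Metric.

Section Volume.
Variables (M : ptopologicalType) (A : smooth_atlas R n M).

Definition borel := g_sigma_algebraType (@open M).

(* The Riemannian volume is the unique Borel measure whose restriction to each
   chart domain is $\sqrt{\det g}\,dy$. *)
Definition riemannian_volume (g : riemannian_metric A)
    (vol : {measure set borel -> \bar R}) : Prop :=
  forall (i : chart_idx A) (B : set borel), measurable B -> B `<=` chart_dom i ->
    vol B = int_Rn (fun y : 'rV[R]_n =>
      (\1_(chart i @` B) y * Num.sqrt (\det (g i y)))%:E).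

End Volume.
End Manifold.

(* Main.v *)
(** Normalize $f$ so that $|\nabla f|^2 + R = f$.  A broken-geodesic distance and a Hopf-Rinow
argument produce compactly supported cutoffs $\psi_k \to 1$ with Lipschitz constant $4/(k+1)$.
Testing $\Delta_f R = R - 2|Ric|^2$ with $\psi_k^{2p} (1+e^{-f})^{-(1-\lambda)} e^{-f} R_-^p$ for $p$ large
gives $R \ge 0$, hence $|\nabla f|^2 \le f$.  The identity
$div_f W = |\nabla Ric|^2 - |div Rm|^2$ holds for $W_i = R^{jk}(2\nabla_j R_{ik} - \nabla_i R_{jk})$, and
$div(Rm)_{jkl} = \nabla_l R_{kj} - \nabla_k R_{lj}$ is $Rm(\cdot,\cdot,\cdot,\nabla f)$ up to sign and order.  So
$|div Rm|^2 e^{-f} \le f |Rm|^2 e^{-f}$ is integrable; testing the identity with $\psi_k^2 e^{-f}$ bounds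
$\int |\nabla Ric|^2 e^{-f}$, and the cutoff error then tends to $0$. *)

Require Import Defs.
From HB Require Import structures.
From mathcomp Require Import all_boot all_order all_algebra.
From mathcomp Require Import all_classical all_reals all_analysis.
From mathcomp Require Import perm measurable_realfun ring lra.

Import Order.TTheory GRing.Theory Num.Theory.
Import numFieldNormedType.Exports.

Local Open Scope classical_set_scope.
Local Open Scope ring_scope.

Set Implicit Arguments.
Unset Strict Implicit.
Unset Printing Implicit Defensive.

(** Before $R \ge 0$ is known, $f$ has no lower bound and $e^{-f}$ is not controlled by $e^{-\lambda
    f}$. The factor $(1+e^{-f})^{-(1-\lambda)}$ repairs this; its logarithmic derivative is a
    multiple of $q \nabla f$ with $0 \le q \le 1$ and $q f \le 1$ (for the normalized $f$), and a
    large power $p$ absorbs it. The cutoffs are only Lipschitz, so the divergence theorem appears as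
    an inequality: in a chart the flux is differenced, translation invariance moves the difference
    onto $\psi^{m+1}$, and $|\int \psi^{m+1} div(\varphi w)| \le 2n(m+1)L \int \psi^m |\varphi| |w|$
    results. The constant is harmless because $L \to 0$. Completeness is geodesic: an energy
    inequality for broken geodesics takes the role of the Gauss lemma, and continuity of the
    exponential map is obtained by following geodesics over short time windows. Tensor identities
    are proved at the origin of normal coordinates, where they are identities between finite sums;
    invariance under coordinate changes returns them to every chart. *)

Notation bv := (basis_vec _).
Notation is_der t := (is_derive t 1).
Tactic Notation "sumr" ident(i) := apply: eq_bigr => i _.
Tactic Notation "sumr" ident(i) ident(j) := sumr i; sumr j.
Tactic Notation "sumx" ident(i) := rewrite exchange_big /=; sumr i.
Tactic Notation "fext" ident(x) := apply/funext => x.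

Lemma cvg_sumr {K : numFieldType} {V : pseudoMetricNormedZmodType K} {T I : Type} (F : set_system T)
 {FF : Filter F} (r : seq I) (P : pred I) (f : I -> T -> V) (a : I -> V) :
 (forall i, P i -> f i x @[x --> F] --> a i) ->
 \sum_(i <- r | P i) f i x @[x --> F] --> \sum_(i <- r | P i) a i.
Proof.
move=> fa; elim: r => [|i r IH]; first by under eq_fun do rewrite big_nil; rewrite big_nil; exact: cvg_cst.
rewrite big_cons; under eq_fun do rewrite big_cons.
by case: ifPn => // Pi; apply: cvgD => //; exact: fa.
Qed.

(** * Pointwise continuity and row vectors *)

Section PointwiseContinuity.
Context {T : topologicalType} {R : realType}.
Implicit Types (F G : T -> R) (x : T).

Lemma ctD F G x : {for x, continuous F} -> {for x, continuous G} ->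
 {for x, continuous (fun y => F y + G y)}.
Proof. exact: continuousD. Qed.

Lemma ctN F x : {for x, continuous F} -> {for x, continuous (fun y => - F y)}.
Proof. exact: continuousN. Qed.

Lemma ctB F G x : {for x, continuous F} -> {for x, continuous G} ->
 {for x, continuous (fun y => F y - G y)}.
Proof. by move=> cF cG; apply: ctD => //; exact: ctN. Qed.

Lemma ctM F G x : {for x, continuous F} -> {for x, continuous G} ->
 {for x, continuous (fun y => F y * G y)}.
Proof. exact: continuousM. Qed.

Lemma ctV F x : F x != 0 -> {for x, continuous F} -> {for x, continuous (fun y => (F y)^-1)}.
Proof. exact: continuousV. Qed.

Lemma ct_cst (a : R) x : {for x, continuous (fun _ : T => a)}.
Proof. exact: cst_continuous. Qed.

Lemma ct_sum (I : Type) (r : seq I) (P : pred I) (f : I -> T -> R) x :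
 (forall i, P i -> {for x, continuous (f i)}) ->
 {for x, continuous (fun y => \sum_(i <- r | P i) f i y)}.
Proof. by move=> fi; apply: (@cvg_sumr _ _ _ _ (nbhs x)). Qed.

Lemma ct_comp {T' : topologicalType} (h : T' -> T) F (x : T') :
 {for x, continuous h} -> {for h x, continuous F} -> {for x, continuous (fun y => F (h y))}.
Proof. exact: continuous_comp. Qed.

Lemma ct_rcomp F (h : R -> R) x : {for x, continuous F} -> {for F x, continuous h} ->
 {for x, continuous (fun y => h (F y))}.
Proof. exact: continuous_comp. Qed.

Lemma ct_near F G x : (\forall y \near x, F y = G y) ->
 {for x, continuous F} -> {for x, continuous G}.
Proof.
move=> FG; rewrite /prop_for /continuous_at (nbhs_singleton FG).
apply: cvg_trans; apply: near_eq_cvg.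
by move: FG; apply: filterS => y /= ->.
Qed.

End PointwiseContinuity.

Section RowVectors.
Context {R : realType} {n : nat}.
Implicit Types (x v h : 'rV[R]_n).

Lemma coord_le {m p} (x : 'M[R]_(m, p)) i j : `|x i j| <= `|x|.
Proof.
rewrite [`|x|]mx_normrE.
exact: (@le_bigmax _ R _ 0 (fun k : 'I_m * 'I_p => `|x k.1 k.2| : R) (i, j)).
Qed.

Lemma row_normP {m p} (x : 'M[R]_(m, p)) (r : R) : 0 <= r -> (forall i j, `|x i j| <= r) -> `|x| <= r.
Proof.
move=> r0 xr; rewrite [`|x|]mx_normrE; by apply: bigmax_le.
Qed.

Lemma is_derive_line {V W : normedModType R} (F : V -> W) (x v : V) (t : R) :
 derivable F (x + t *: v) v ->
 is_der t (fun s : R => F (x + s *: v)) ('D_v F (x + t *: v)).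
Proof.
move=> dF.
have E : (fun h : R => h^-1 *: (((fun s : R => F (x + s *: v)) \o shift t) (h *: (1 : R)) - F (x + t *: v)))
 = (fun h : R => h^-1 *: ((F \o shift (x + t *: v)) (h *: v) - F (x + t *: v))).
 apply/funext => h /=; congr (_ *: (F _ - _)).
 by rewrite [h *: 1]mulr1 scalerDl addrCA.
split; first by rewrite /derivable E.
by rewrite /derive E.
Qed.

Lemma MVT_line (F : 'rV[R]_n -> R) x v (a : R) :
 (forall t, `|t| <= `|a| -> derivable F (x + t *: v) v) ->
 exists2 t, `|t| <= `|a| & F (x + a *: v) - F x = a * 'D_v F (x + t *: v).
Proof.
move=> dF.
have iD t : `|t| <= `|a| -> is_derive t (1:R) (fun s : R => F (x + s *: v)) ('D_v F (x + t *: v)).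
 by move=> ta; apply: is_derive_line; exact: dF.
have ct t : `|t| <= `|a| -> {for t, continuous (fun s : R => F (x + s *: v))}.
 by move=> /iD [d _]; apply: differentiable_continuous; apply/derivable1_diffP.
have [a0|a0|->] := ltgtP a 0.
- have [||c ca] := @MVT R (fun s : R => F (x + s *: v)) (fun t => 'D_v F (x + t *: v)) a 0 a0.
 + move=> t; rewrite in_itv /= => /andP[at_ t0]; apply: iD.
  by rewrite !ltr0_norm // lerN2 ltW.
 + apply: continuous_in_subspaceT => t; rewrite inE /= in_itv /= => /andP[at_ t0].
  by apply: ct; rewrite ler0_norm // ltr0_norm // lerN2.
 rewrite scale0r addr0 => e; exists c.
  by move: ca; rewrite in_itv /= => /andP[ac c0]; rewrite !ltr0_norm // lerN2 ltW.
 by rewrite -opprB e sub0r mulrC mulNr opprK.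
- have [||c ca] := @MVT R (fun s : R => F (x + s *: v)) (fun t => 'D_v F (x + t *: v)) 0 a a0.
 + move=> t; rewrite in_itv /= => /andP[at_ t0]; apply: iD.
  by rewrite !gtr0_norm // ltW.
 + apply: continuous_in_subspaceT => t; rewrite inE /= in_itv /= => /andP[at_ t0].
  by apply: ct; rewrite ger0_norm // gtr0_norm.
 rewrite scale0r addr0 => e; exists c.
  by move: ca; rewrite in_itv /= => /andP[ac c0]; rewrite !gtr0_norm // ltW.
 by rewrite e subr0 mulrC.
- by exists 0; rewrite ?normr0 // scale0r addr0 subrr mul0r.
Qed.

(* [trunc_row k h] keeps the first [k] entries of [h]; consecutive truncations
 differ in one coordinate, which reduces increments to partial derivatives. *)
Definition trunc_row (k : nat) h : 'rV[R]_n := \row_i (if (i < k)%N then h 0 i else 0).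

Lemma trunc_row0 h : trunc_row 0 h = 0.
Proof. by apply/rowP => i; rewrite !mxE. Qed.

Lemma trunc_rown h : trunc_row n h = h.
Proof. by apply/rowP => i; rewrite !mxE ltn_ord. Qed.

Lemma trunc_rowS (k : 'I_n) h : trunc_row k.+1 h = trunc_row k h + h 0 k *: bv k.
Proof.
apply/rowP => i; rewrite !mxE eqxx /= ltnS leq_eqVlt.
have [->|ik] /= := eqVneq i k; first by rewrite eqxx ltnn add0r mulr1.
by rewrite val_eqE (negbTE ik) mulr0 addr0.
Qed.

Lemma trunc_row_near (k : 'I_n) h t : `|t| <= `|h 0 k| ->
 `|trunc_row k h + t *: bv k| <= `|h|.
Proof.
move=> th; apply: row_normP => // i j; rewrite !mxE ord1 eqxx /= -val_eqE.
have [->|jk] /= := eqVneq (j : nat) k.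
 by rewrite ltnn add0r mulr1 (le_trans th)// coord_le.
rewrite mulr0 addr0; case: ifP => _; first exact: coord_le.
by rewrite normr0.
Qed.

Lemma norm_basis_vec_le (i : 'I_n) : `|basis_vec R i| <= 1.
Proof.
apply: row_normP => // a b; rewrite mxE; case: (_ && _); by rewrite ?normr1 ?normr0.
Qed.

Lemma row_sum_basis h : h = \sum_i h 0 i *: bv i.
Proof. by rewrite [LHS]row_sum_delta. Qed.

End RowVectors.

(** * Calculus of $C^k$ functions on open subsets of $R^n$ *)

Section Differentiability.
Context {R : realType} {n : nat}.
Local Notation rV := 'rV[R]_n.
Implicit Types (U : set rV) (F G : rV -> R).

Lemma open_ball_sub U x : open U -> U x -> exists2 r : R, 0 < r & forall h, `|h| <= r -> U (x + h).
Proof.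
move=> oU Ux; have /nbhs_ballP[r /= r0 rU] : nbhs x U by exact: open_nbhs_nbhs.
exists (r / 2); first by rewrite divr_gt0.
move=> h hr; apply: rU; rewrite -ball_normE /= opprD addrA subrr add0r normrN.
by rewrite (le_lt_trans hr)// ltr_pdivrMr// ltr_pMr// ltr1n.
Qed.

Lemma near_normP (P : rV -> Prop) (x : rV) : (\forall y \near x, P y) ->
 exists2 r : R, 0 < r & forall h : rV, `|h| < r -> P (x + h).
Proof.
move=> xP; have /nbhs_ballP[r /= r0 rU] : nbhs x [set y | P y] by exact: xP.
exists r => // h hr; apply: rU; rewrite -ball_normE /= opprD addrA subrr add0r normrN.
exact: hr.
Qed.

(** The increment along [h] telescopes over the truncations of [h]; the mean value theorem turns
    each summand into a partial derivative at a nearby point, and continuity of the partials at [x]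
    compares it with the value there. *)
Lemma C1_differentiable_at F x :
 (\forall y \near x, forall i, derivable F y (bv i)) ->
 (forall i, {for x, continuous (partial i F)}) ->
 differentiable F x /\ 'd F x = (fun v => \sum_i v 0 i * partial i F x) :> (_ -> _).
Proof.
move=> dF cF.
pose L (v : rV) : R := \sum_i v 0 i * partial i F x.
have Llin : linear L.
 move=> a u v; rewrite /L scaler_sumr -big_split /=; sumr i.
 by rewrite !mxE mulrDl [a *: _]mulrA.
have Lc : continuous L.
 rewrite /L => v; apply: (@cvg_sumr _ _ _ _ (nbhs v)) => i _; apply: cvgMr_tmp; exact: coord_continuous.
pose L' := GRing.isLinear.Build R rV R *:%R L Llin.
pose Lp : {linear rV -> R} := HB.pack L L'.
have key : F \o shift x = cst (F x) + Lp +o_ (0 : rV) id.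
 apply/eqaddoP => e e0.
 (* Each of the [n] coordinates may contribute this share of [e]; [n.+1] keeps the divisor nonzero
    when [n = 0]. *)
 have e1 : 0 < e / n.+1%:R by rewrite divr_gt0.
 have cF' : \forall y \near x, forall i, `|partial i F x - partial i F y| <= e / n.+1%:R.
  apply: (@filter_forall _ _ _ (nbhs x)) => i.
  have /cvgrPdist_le/(_ _ e1) := cF i; exact.
 have [r r0 rP] := near_normP (filterI dF cF').
 near=> h.
 have hr : `|h| < r.
  near: h; have := @nbhs0_lt R rV r r0; exact.
 have rB (y : rV) : `|y| <= `|h| -> `|y| < r by move=> yh; exact: le_lt_trans hr.
 have step (k : 'I_n) : `|F (x + trunc_row k.+1 h) - F (x + trunc_row k h)
   - h 0 k * partial k F x| <= e / n.+1%:R * `|h|.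
  have [|t th et] := @MVT_line R n F (x + trunc_row k h) (bv k) (h 0 k).
   move=> t th; rewrite -addrA.
   by case: (rP _ (rB _ (trunc_row_near th))) => d _; exact: d.
  rewrite trunc_rowS addrA et -mulrBr normrM mulrC ler_pM//; last exact: coord_le.
  rewrite distrC -/(partial k F _) -addrA.
  by case: (rP _ (rB _ (trunc_row_near th))) => _; exact.
 have tele : F (x + h) - F x = \sum_(k < n) (F (x + trunc_row k.+1 h) - F (x + trunc_row k h)).
  rewrite -(big_mkord xpredT (fun k => F (x + trunc_row k.+1 h) - F (x + trunc_row k h))).
  by rewrite telescope_sumr// trunc_rown trunc_row0 addr0.
 rewrite !fctE /= opprD addrA [h + x]addrC tele /L -sumrB.
 apply: le_trans (ler_norm_sum _ _ _) _.
 apply: (@le_trans _ _ (\sum_(k < n) e / n.+1%:R * `|h|)).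
  by apply: ler_sum => k _; exact: step.
 rewrite sumr_const card_ord -[leLHS]mulr_natl mulrA ler_wpM2r//.
 by rewrite mulrA ler_pdivrMr// mulrC ler_pM2l// ler_nat.
have du : 'd F x = Lp :> (_ -> _) by apply: diff_unique.
split => //; apply/diff_locallyP; rewrite du; split => //.
Unshelve. all: by end_near.
Qed.

Lemma Ck_cts {k U F x} : Ck_on k U F -> U x -> {for x, continuous F}.
Proof. by case: k => [|k] [c _] Ux; exact: c. Qed.

Lemma Ck_der {k U F x} i : Ck_on k.+1 U F -> U x -> derivable F x (bv i).
Proof. by move=> [_ /(_ i)[d _]] /d. Qed.
Arguments Ck_der {k U F x} i _ _.

Lemma Ck_partial {k U F} i : Ck_on k.+1 U F -> Ck_on k U (partial i F).
Proof. by move=> [_ /(_ i)[]]. Qed.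

Lemma Ck_onW {k U F} : Ck_on k.+1 U F -> Ck_on k U F.
Proof.
elim: k F => [|k IH] F [c d]; split => // i.
by have [d1 d2] := d i; split => //; exact: IH.
Qed.

Lemma Ck_on_le k l U F : (k <= l)%N -> Ck_on l U F -> Ck_on k U F.
Proof.
move=> /subnKC <-; elim: (l - k)%N => [|m IH]; first by rewrite addn0.
by rewrite addnS => /Ck_onW.
Qed.

Lemma C1_diffP {k U F x} : open U -> Ck_on k.+1 U F -> U x ->
 differentiable F x /\ 'd F x = (fun v => \sum_i v 0 i * partial i F x) :> (_ -> _).
Proof.
move=> oU CF Ux; apply: C1_differentiable_at.
- have : \forall y \near x, U y by exact: open_nbhs_nbhs.
 by apply: filterS => y Uy i; apply: Ck_der CF Uy.
- by move=> i; apply: Ck_cts (Ck_partial i CF) Ux.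
Qed.

Lemma Ck_diff {k U F x} : open U -> Ck_on k.+1 U F -> U x -> differentiable F x.
Proof. by move=> oU CF /(C1_diffP oU CF)[]. Qed.

Lemma C1_derive {k U F x} v : open U -> Ck_on k.+1 U F -> U x ->
 'D_v F x = \sum_i v 0 i * partial i F x.
Proof. by move=> oU CF Ux; have [d e] := C1_diffP oU CF Ux; rewrite deriveE// e. Qed.

Lemma near_partial i F G x : (\forall y \near x, F y = G y) -> partial i F x = partial i G x.
Proof. by move=> FG; apply: near_eq_derive; exact: FG. Qed.

Lemma pd_eq_on {U F G x} i : open U -> (forall y, U y -> F y = G y) -> U x ->
 partial i F x = partial i G x.
Proof.
move=> oU FG Ux; apply: near_partial.
by have : \forall y \near x, U y by [exact: open_nbhs_nbhs]; apply: filterS.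
Qed.

Lemma Ck_on0 U F : (forall x, U x -> {for x, continuous F}) -> Ck_on 0 U F.
Proof. by []. Qed.

Lemma Ck_onSI k U F : (forall x, U x -> {for x, continuous F}) ->
 (forall i x, U x -> derivable F x (bv i)) ->
 (forall i, Ck_on k U (partial i F)) -> Ck_on k.+1 U F.
Proof. by move=> cF dF pF; split=> // i; split=> // x; exact: dF. Qed.

Lemma near_open U x : open U -> U x -> \forall y \near x, U y.
Proof. by move=> oU Ux; exact: open_nbhs_nbhs. Qed.

Lemma Ck_on_eq k U F G : open U -> (forall y, U y -> F y = G y) -> Ck_on k U F -> Ck_on k U G.
Proof.
move=> oU; elim: k F G => [|k IH] F G FG CF; have nFG x : U x -> \forall y \near x, F y = G y.
- by move=> Ux; apply: filterS FG _; exact: near_open.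
- by apply: Ck_on0 => x Ux; apply: ct_near (nFG x Ux) (Ck_cts CF Ux).
- by move=> Ux; apply: filterS FG _; exact: near_open.
apply: Ck_onSI => [x Ux|i x Ux|i].
- exact: ct_near (nFG x Ux) (Ck_cts CF Ux).
- exact: (@near_eq_derivable R _ _ F G x (bv i) (nFG x Ux) (Ck_der i CF Ux)).
- by apply: IH (Ck_partial i CF) => y Uy; apply: pd_eq_on Uy.
Qed.

Lemma Ck_cst k U (a : R) : open U -> Ck_on k U (fun=> a).
Proof.
move=> oU; elim: k a => [|k IH] a; first by apply: Ck_on0 => x _; exact: ct_cst.
apply: Ck_onSI => [x _|i x _|i]; [exact: ct_cst|exact: derivable_cst|].
by apply: Ck_on_eq (IH 0) => // y _; rewrite /partial derive_cst.
Qed.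

Lemma partial_coord i j (x : rV) : partial i (fun y : rV => y 0 j) x = (i == j)%:R.
Proof.
rewrite /partial /derive; under eq_fun do rewrite /= !mxE addrK.
rewrite eqxx /=; apply: lim_near_cst => //.
near=> h; rewrite /= [_ *: _]mulrA mulVf ?mul1r 1?eq_sym//.
by near: h; apply: filterS (@nbhs_dnbhs_neq R 0) => h; rewrite eq_sym.
Unshelve. all: by end_near. Qed.

Lemma Ck_coord k U j : open U -> Ck_on k U (fun x : rV => x 0 j).
Proof.
move=> oU; have d x : differentiable (fun y : rV => y 0 j) x by exact: differentiable_coord.
case: k => [|k]; first by apply: Ck_on0 => x _; exact: coord_continuous.
apply: Ck_onSI => [x _|i x _|i]; [exact: coord_continuous|exact: diff_derivable|].
apply: Ck_on_eq (Ck_cst k (i == j)%:R oU) => // y _.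
by rewrite partial_coord.
Qed.

Lemma partialD i F G x : derivable F x (bv i) -> derivable G x (bv i) ->
 partial i (fun y => F y + G y) x = partial i F x + partial i G x.
Proof. exact: deriveD. Qed.

Lemma partialN i F x : derivable F x (bv i) ->
 partial i (fun y => - F y) x = - partial i F x.
Proof. exact: deriveN. Qed.

Lemma partialB i F G x : derivable F x (bv i) -> derivable G x (bv i) ->
 partial i (fun y => F y - G y) x = partial i F x - partial i G x.
Proof. exact: deriveB. Qed.

Lemma partialM i F G x : derivable F x (bv i) -> derivable G x (bv i) ->
 partial i (fun y => F y * G y) x = partial i F x * G x + F x * partial i G x.
Proof. by move=> dF dG; rewrite /partial (deriveM dF dG) addrC [_ *: 'D__ F x]mulrC. Qed.

Lemma partialV i F x : F x != 0 -> derivable F x (bv i) ->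
 partial i (fun y => (F y)^-1) x = - (F x ^- 2 * partial i F x).
Proof. by move=> F0 dF; rewrite /partial (deriveV F0 dF) scaleNr. Qed.

Lemma partial_cst i (a : R) (x : rV) : partial i (fun=> a) x = 0.
Proof. exact: derive_cst. Qed.

Lemma derivable_sumr (I : Type) (r : seq I) (P : pred I) (f : I -> rV -> R) x v :
 (forall i, P i -> derivable (f i) x v) ->
 derivable (fun y => \sum_(i <- r | P i) f i y) x v /\
 'D_v (fun y => \sum_(i <- r | P i) f i y) x = \sum_(i <- r | P i) 'D_v (f i) x.
Proof.
move=> df; elim: r => [|i r [IH1 IH2]].
 rewrite big_nil; under eq_fun do rewrite big_nil.
 by split; [exact: derivable_cst|exact: derive_cst].
rewrite big_cons; under eq_fun do rewrite big_cons.
case: (boolP (P i)) => // Pi; have dfi := df i Pi; split; first exact: (derivableD dfi IH1).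
by rewrite (deriveD dfi IH1) IH2.
Qed.

Lemma partial_sum i (I : Type) (r : seq I) (P : pred I) (f : I -> rV -> R) x :
 (forall j, P j -> derivable (f j) x (bv i)) ->
 partial i (fun y => \sum_(j <- r | P j) f j y) x = \sum_(j <- r | P j) partial i (f j) x.
Proof. by move=> df; case: (derivable_sumr r df). Qed.

Lemma CkD k U F G : open U -> Ck_on k U F -> Ck_on k U G -> Ck_on k U (fun x => F x + G x).
Proof.
move=> oU; elim: k F G => [|k IH] F G CF CG; have cFG x (Ux : U x) : {for x, continuous (fun x => F x + G x)}.
- by apply: ctD; [exact: Ck_cts CF Ux|exact: Ck_cts CG Ux].
- exact: Ck_on0.
- by apply: ctD; [exact: Ck_cts CF Ux|exact: Ck_cts CG Ux].
apply: Ck_onSI => [//|i x Ux|i]; first by apply: derivableD; [exact: Ck_der CF Ux|exact: Ck_der CG Ux].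
apply: Ck_on_eq (IH _ _ (Ck_partial i CF) (Ck_partial i CG)) => // x Ux.
by rewrite partialD//; [exact: Ck_der CF Ux|exact: Ck_der CG Ux].
Qed.

Lemma CkM k U F G : open U -> Ck_on k U F -> Ck_on k U G -> Ck_on k U (fun x => F x * G x).
Proof.
move=> oU; elim: k F G => [|k IH] F G CF CG; have cFG x (Ux : U x) : {for x, continuous (fun x => F x * G x)}.
- by apply: ctM; [exact: Ck_cts CF Ux|exact: Ck_cts CG Ux].
- exact: Ck_on0.
- by apply: ctM; [exact: Ck_cts CF Ux|exact: Ck_cts CG Ux].
apply: Ck_onSI => [//|i x Ux|i]; first by apply: derivableM; [exact: Ck_der CF Ux|exact: Ck_der CG Ux].
have CF' := IH _ _ (Ck_partial i CF) (Ck_onW CG).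
have CG' := IH _ _ (Ck_onW CF) (Ck_partial i CG).
apply: Ck_on_eq (CkD oU CF' CG') => // x Ux.
by rewrite partialM//; [exact: Ck_der CF Ux|exact: Ck_der CG Ux].
Qed.

Lemma CkN k U F : open U -> Ck_on k U F -> Ck_on k U (fun x => - F x).
Proof.
move=> oU CF; have CG := CkM oU (Ck_cst k (-1) oU) CF.
by apply: Ck_on_eq CG => // x _; rewrite mulN1r.
Qed.

Lemma CkB k U F G : open U -> Ck_on k U F -> Ck_on k U G -> Ck_on k U (fun x => F x - G x).
Proof. by move=> oU CF CG; apply: CkD => //; exact: CkN. Qed.

Lemma CkV k U F : open U -> (forall x, U x -> F x != 0) -> Ck_on k U F -> Ck_on k U (fun x => (F x)^-1).
Proof.
move=> oU F0; elim: k => [|k IH] CF; have cF x (Ux : U x) : {for x, continuous (fun x => (F x)^-1)}.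
- by apply: ctV; [exact: F0|exact: Ck_cts CF Ux].
- exact: Ck_on0.
- by apply: ctV; [exact: F0|exact: Ck_cts CF Ux].
apply: Ck_onSI => [//|i x Ux|i]; first by apply: derivableV; [exact: F0|exact: Ck_der CF Ux].
have C1 := IH (Ck_onW CF).
have C2 := CkN oU (CkM oU (CkM oU C1 C1) (Ck_partial i CF)).
apply: Ck_on_eq C2 => // x Ux.
rewrite partialV ?F0//; last exact: Ck_der CF Ux.
by rewrite -expr2 exprVn.
Qed.

Lemma Ck_sum k U (I : Type) (r : seq I) (P : pred I) (f : I -> rV -> R) : open U ->
 (forall i, P i -> Ck_on k U (f i)) -> Ck_on k U (fun x => \sum_(i <- r | P i) f i x).
Proof.
move=> oU fi; elim: r => [|i r IH]; first by under eq_fun do rewrite big_nil; exact: Ck_cst.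
under eq_fun do rewrite big_cons.
case: (boolP (P i)) => // Pi; apply: CkD => //; exact: fi.
Qed.

Lemma Ck_prod k U (I : Type) (r : seq I) (P : pred I) (f : I -> rV -> R) : open U ->
 (forall i, P i -> Ck_on k U (f i)) -> Ck_on k U (fun x => \prod_(i <- r | P i) f i x).
Proof.
move=> oU fi; elim: r => [|i r IH]; first by under eq_fun do rewrite big_nil; exact: Ck_cst.
under eq_fun do rewrite big_cons.
case: (boolP (P i)) => // Pi; apply: CkM => //; exact: fi.
Qed.

Lemma Ck_on_sub k U V F : (forall x, V x -> U x) -> Ck_on k U F -> Ck_on k V F.
Proof.
move=> VU; elim: k F => [|k IH] F [c d]; first by split=> // x /VU/c.
split=> [x /VU/c//|i].
by have [d1 d2] := d i; split=> [x /VU/d1//|]; exact: IH.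
Qed.

Lemma diff_cts_partial U F x v : open U -> Ck_on 1 U F -> U x ->
 'd F x v = \sum_i v 0 i * partial i F x.
Proof. by move=> oU CF Ux; have [_ ->] := C1_diffP oU CF Ux. Qed.

(** Schwarz's theorem. The second difference over the square with sides [t *: bv i] and [t *: bv j]
    does not see the order of the two directions, while two applications of the mean value theorem
    show that, divided by $t^2$, it tends to either mixed derivative. *)
Lemma partialC U F x i j : open U -> Ck_on 2 U F -> U x ->
 partial i (partial j F) x = partial j (partial i F) x.
Proof.
move=> oU CF Ux.
have key (a b : 'I_n) (e : R) : 0 < e -> \forall t \near (0 : R)^'+,
 `|(F (x + t *: bv a + t *: bv b) - F (x + t *: bv a)
  - (F (x + t *: bv b) - F x)) / (t * t) - partial b (partial a F) x| <= e.
 move=> e0.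
 have cF : {for x, continuous (partial b (partial a F))} by apply: Ck_cts (Ck_partial b (Ck_partial a CF)) Ux.
 have /cvgrPdist_le/(_ _ e0) cF' := cF.
 have nU : \forall y \near x, U y by exact: open_nbhs_nbhs.
 have [r r0 rP] := near_normP (filterI cF' nU).
 near=> t.
 have t0 : 0 < t by [].
 have tr : t + t < r.
  have : t < r / 2 by near: t; apply: nbhs_right_lt; rewrite divr_gt0.
  by move=> tr; rewrite [ltRHS](splitr r) ltrD.
 have inB s u : `|s| <= `|t| -> `|u| <= `|t| -> `|s *: bv a + u *: bv b| < r.
  move=> st ut; apply: le_lt_trans tr; rewrite -(gtr0_norm t0).
  apply: le_trans (ler_normD _ _) _; apply: lerD; rewrite normrZ.
   by apply: le_trans st; rewrite ler_piMr// norm_basis_vec_le.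
  by apply: le_trans ut; rewrite ler_piMr// norm_basis_vec_le.
 have UB s u : `|s| <= `|t| -> `|u| <= `|t| -> U (x + s *: bv a + u *: bv b).
  by move=> st ut; rewrite -addrA; case: (rP _ (inB s u st ut)).
 (* The first mean value theorem is applied to [H] in direction [a], the second to [partial a F] in
    direction [b]. *)
 pose H y := F (y + t *: bv b) - F y.
 have dsh y : derivable F (y + t *: bv b) (bv a) ->
  is_derive y (bv a) (fun y => F (y + t *: bv b)) (partial a F (y + t *: bv b)).
  move=> dy.
  have E : (fun h : R => h^-1 *: (((fun y => F (y + t *: bv b)) \o shift y) (h *: bv a) - F (y + t *: bv b)))
   = (fun h : R => h^-1 *: ((F \o shift (y + t *: bv b)) (h *: bv a) - F (y + t *: bv b))).
   by apply/funext => h /=; rewrite -addrA.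
  split; first by rewrite /derivable E.
  by rewrite /partial /derive E.
 have UB0 s : `|s| <= `|t| -> U (x + s *: bv a).
  by move=> st; have := UB s 0 st; rewrite normr0 scale0r addr0; apply.
 have dH s : `|s| <= `|t| -> is_derive (x + s *: bv a) (bv a) H
  (partial a F (x + s *: bv a + t *: bv b) - partial a F (x + s *: bv a)).
  move=> st; apply: is_deriveB.
   exact: (dsh _ (Ck_der a CF (UB s t st (lexx _)))).
  exact: (derivableP (Ck_der a CF (UB0 s st))).
 have [|s st es] := @MVT_line R n H x (bv a) t.
  by move=> s /dH[].
 have [|u ut eu] := @MVT_line R n (partial a F) (x + s *: bv a) (bv b) t.
  by move=> u ut; exact: (Ck_der b (Ck_partial a CF) (UB s u st ut)).
 have [_ eH] := dH s st.
 have -> : F (x + t *: bv a + t *: bv b) - F (x + t *: bv a)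
  - (F (x + t *: bv b) - F x) = t * (t * partial b (partial a F) (x + s *: bv a + u *: bv b)).
  by rewrite -eu -eH -es.
 rewrite mulrA mulrAC divff ?mulf_neq0 ?gt_eqF// mul1r distrC -addrA.
 by case: (rP _ (inB s u st ut)).
apply/eqP; rewrite -subr_eq0 -normr_le0; apply/ler_addgt0Pl => e e0; rewrite addr0.
have e2 : 0 < e / 2 by rewrite divr_gt0.
have [t [/= ti tj]] := @filter_ex _ _ (at_right_proper_filter (0 : R)) _ (filterI (key i j _ e2) (key j i _ e2)).
rewrite [leRHS]splitr.
have -> : partial i (partial j F) x - partial j (partial i F) x =
 ((F (x + t *: bv i + t *: bv j) - F (x + t *: bv i)
  - (F (x + t *: bv j) - F x)) / (t * t) - partial j (partial i F) x) -
 ((F (x + t *: bv j + t *: bv i) - F (x + t *: bv j)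
  - (F (x + t *: bv i) - F x)) / (t * t) - partial i (partial j F) x).
 rewrite -[x + _ + t *: bv i]addrA [t *: bv j + _]addrC addrA.
 have alg (a b d e' q p r : R) : r - p = (a - b - (d - e')) * q - p - ((a - d - (b - e')) * q - r) by ring.
 exact: alg.
exact: le_trans (ler_normB _ _) (lerD ti tj).
Unshelve. all: by end_near. Qed.

End Differentiability.
Arguments Ck_der {R n k U F x} i _ _.

Section ChainRule.
Context {R : realType} {n m : nat}.
Implicit Types (U : set 'rV[R]_n) (V : set 'rV[R]_m) (F : 'rV[R]_n -> R) (tau : 'rV[R]_m -> 'rV[R]_n).

Lemma row_fun_sum (T : Type) (tau : T -> 'rV[R]_n) :
 tau = (fun z => \sum_(c < n) tau z 0 c *: bv c).
Proof. by fext z; exact: row_sum_basis. Qed.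

Lemma ct_row (T : topologicalType) (tau : T -> 'rV[R]_n) y :
 (forall c, {for y, continuous (fun z => tau z 0 c)}) -> {for y, continuous tau}.
Proof.
move=> ct; rewrite (row_fun_sum tau); apply: (@cvg_sumr _ _ _ _ (nbhs y)) => c _.
by apply: cvgZr_tmp; exact: ct.
Qed.

Lemma differentiable_row (W : normedModType R) (tau : W -> 'rV[R]_n) y :
 (forall c, differentiable (fun z => tau z 0 c) y) -> differentiable tau y.
Proof.
move=> dt; rewrite (row_fun_sum tau).
have -> : (fun z => \sum_(c < n) tau z 0 c *: bv c) = \sum_(c < n) (fun z => tau z 0 c *: bv c).
 by fext z; rewrite fct_sumE.
by apply: differentiable_sum => c; apply: differentiableZl.
Qed.

Lemma diff_row_coord (W : normedModType R) (tau : W -> 'rV[R]_n) y v c :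
 differentiable tau y -> 'd tau y v 0 c = 'D_v (fun z => tau z 0 c) y.
Proof.
move=> dt.
have dc : differentiable (fun z : 'rV[R]_n => z 0 c : R) (tau y) by exact: differentiable_coord.
have dct : differentiable ((fun z : 'rV[R]_n => z 0 c) \o tau) y by exact: differentiable_comp.
rewrite -[fun z => tau z 0 c]/((fun z : 'rV[R]_n => z 0 c) \o tau) (deriveE v dct).
have -> : 'd ((fun z : 'rV[R]_n => z 0 c) \o tau) y v = 'd (fun z : 'rV[R]_n => z 0 c) (tau y) ('d tau y v).
 by rewrite (diff_comp dt dc).
rewrite (diff_cts_partial _ openT (Ck_coord 1 c openT))//.
under eq_bigr do rewrite partial_coord.
by rewrite (bigD1 c)//= eqxx mulr1 big1 ?addr0// => i /negbTE ->; rewrite mulr0.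
Qed.

Lemma derive_comp_row V U F tau y a :
 open V -> open U -> (forall c, Ck_on 1 V (fun z => tau z 0 c)) -> Ck_on 1 U F -> V y -> U (tau y) ->
 differentiable (fun z => F (tau z)) y /\
 partial a (fun z => F (tau z)) y = \sum_c partial a (fun z => tau z 0 c) y * partial c F (tau y).
Proof.
move=> oV oU Ct CF Vy Uty.
have dt : differentiable tau y by apply: differentiable_row => c; exact: Ck_diff oV (Ct c) Vy.
have dF := Ck_diff oU CF Uty.
have dFt : differentiable (F \o tau) y by exact: differentiable_comp.
split=> //; rewrite /partial deriveE// -[fun z => F (tau z)]/(F \o tau) diff_comp//=.
rewrite (diff_cts_partial _ oU CF Uty); sumr c; congr (_ * _).
exact: diff_row_coord.
Qed.

Lemma Ck_comp k V U F tau :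
 open V -> open U -> (forall c, Ck_on k V (fun z => tau z 0 c)) -> Ck_on k U F ->
 (forall y, V y -> U (tau y)) -> Ck_on k V (fun z => F (tau z)).
Proof.
move=> oV oU; elim: k F => [|k IH] F Ct CF VU.
 apply: Ck_on0 => y Vy; apply: ct_comp; last exact: Ck_cts CF (VU _ Vy).
 by apply: ct_row => c; exact: Ck_cts (Ct c) Vy.
have Ct1 c : Ck_on 1 V (fun z => tau z 0 c) by apply: Ck_on_le (Ct c).
have CF1 : Ck_on 1 U F by apply: Ck_on_le CF.
have P a y (Vy : V y) := derive_comp_row a oV oU Ct1 CF1 Vy (VU _ Vy).
apply: Ck_onSI => [y Vy|a y Vy|a].
- by apply: ct_comp; [apply: ct_row => c; exact: Ck_cts (Ct c) Vy|exact: Ck_cts CF (VU _ Vy)].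
- by have [d _] := P a y Vy; exact: diff_derivable.
apply: (@Ck_on_eq _ _ k V (fun y => \sum_c partial a (fun z => tau z 0 c) y * partial c F (tau y))) => //.
 by move=> y Vy; have [_ ->] := P a y Vy.
apply: Ck_sum => // c _; apply: CkM => //; first exact: Ck_partial (Ct c).
by apply: IH => [c'||//]; [exact: Ck_onW|exact: Ck_partial].
Qed.

Lemma derive_curve U F (c : R -> 'rV[R]_n) t : open U -> Ck_on 1 U F -> U (c t) ->
 (forall k, derivable (fun s => c s 0 k) t 1) ->
 is_der t (fun s => F (c s)) (\sum_k 'D_1 (fun s => c s 0 k) t * partial k F (c t)).
Proof.
move=> oU CF Uc dc.
have dt : differentiable c t by apply: differentiable_row => k; exact/derivable1_diffP.
have dF := Ck_diff oU CF Uc.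
have dFt : differentiable (F \o c) t by exact: differentiable_comp.
split; first exact: diff_derivable.
rewrite deriveE// -[fun z => F (c z)]/(F \o c) diff_comp//=.
rewrite (diff_cts_partial _ oU CF Uc); sumr k; congr (_ * _).
exact: diff_row_coord.
Qed.

End ChainRule.

(** * Smooth matrix-valued functions *)

Section SmoothMatrices.
Context {R : realType} {n : nat}.
Local Notation rV := 'rV[R]_n.
Implicit Types (U : set rV) (F G : rV -> R).

Lemma smooth_eq U F G : open U -> (forall y, U y -> F y = G y) -> smooth_on U F -> smooth_on U G.
Proof. by move=> oU FG sF k; exact: Ck_on_eq (sF k). Qed.

Lemma smooth_partial U F i : smooth_on U F -> smooth_on U (partial i F).
Proof. by move=> sF k; exact: Ck_partial (sF k.+1). Qed.

Lemma smooth_der U F x i : smooth_on U F -> U x -> derivable F x (bv i).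
Proof. by move=> sF Ux; exact: Ck_der (sF 1) Ux. Qed.
Arguments smooth_der {U F x} i _ _.

Lemma smooth_sub U V F : (forall x, V x -> U x) -> smooth_on U F -> smooth_on V F.
Proof. by move=> VU sF k; exact: Ck_on_sub (sF k). Qed.

Definition smx {p q} U (A : rV -> 'M[R]_(p, q)) :=
 forall i j, smooth_on U (fun x => A x i j).

Definition dmx {p q} (a : 'I_n) (A : rV -> 'M[R]_(p, q)) (x : rV) : 'M[R]_(p, q) :=
 \matrix_(i, j) partial a (fun z => A z i j) x.

Lemma smx_eq p q U (A B : rV -> 'M[R]_(p, q)) : open U ->
 (forall y, U y -> A y = B y) -> smx U A -> smx U B.
Proof. by move=> oU AB sA i j; apply: smooth_eq (sA i j) => // y Uy; rewrite AB. Qed.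

Lemma dmx_eq p q U (A B : rV -> 'M[R]_(p, q)) a x : open U ->
 (forall y, U y -> A y = B y) -> U x -> dmx a A x = dmx a B x.
Proof.
move=> oU AB Ux; apply/matrixP => i j; rewrite !mxE.
by apply: pd_eq_on Ux => // y Uy; rewrite AB.
Qed.

Section Rules.
Variables (U : set rV) (oU : open U).

Lemma smxM p q r (A : rV -> 'M[R]_(p, q)) (B : rV -> 'M[R]_(q, r)) :
 smx U A -> smx U B -> smx U (fun x => A x *m B x).
Proof.
move=> sA sB i j; apply: (@smooth_eq _ (fun x => \sum_k A x i k * B x k j)) => // [y _|k].
 by rewrite mxE.
by apply: Ck_sum => // l _; apply: CkM => //; [exact: sA|exact: sB].
Qed.

Lemma smxD p q (A B : rV -> 'M[R]_(p, q)) :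
 smx U A -> smx U B -> smx U (fun x => A x + B x).
Proof.
move=> sA sB i j; apply: (@smooth_eq _ (fun x => A x i j + B x i j)) => // [y _|k].
 by rewrite mxE.
by apply: CkD => //; [exact: sA|exact: sB].
Qed.

Lemma smxN p q (A : rV -> 'M[R]_(p, q)) :
 smx U A -> smx U (fun x => - A x).
Proof.
move=> sA i j; apply: (@smooth_eq _ (fun x => - A x i j)) => // [y _|k].
 by rewrite mxE.
by apply: CkN => //; exact: sA.
Qed.

Lemma smxB p q (A B : rV -> 'M[R]_(p, q)) :
 smx U A -> smx U B -> smx U (fun x => A x - B x).
Proof. by move=> sA sB; apply: smxD => //; exact: smxN. Qed.

Lemma smxT p q (A : rV -> 'M[R]_(p, q)) :
 smx U A -> smx U (fun x => (A x)^T).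
Proof. by move=> sA i j; apply: smooth_eq (sA j i) => // y _; rewrite mxE. Qed.

Lemma smxZ p q F (A : rV -> 'M[R]_(p, q)) :
 smooth_on U F -> smx U A -> smx U (fun x => F x *: A x).
Proof.
move=> sF sA i j; apply: (@smooth_eq _ (fun x => F x * A x i j)) => // [y _|k].
 by rewrite mxE.
by apply: CkM => //; exact: sA.
Qed.

Lemma smx_sum p q (I : Type) (r : seq I) (P : pred I) (A : I -> rV -> 'M[R]_(p, q)) :
 (forall i, P i -> smx U (A i)) -> smx U (fun x => \sum_(i <- r | P i) A i x).
Proof.
move=> sA i j; apply: (@smooth_eq _ (fun x => \sum_(l <- r | P l) A l x i j)) => // [y _|k].
 by rewrite summxE.
by apply: Ck_sum => // l Pl; exact: sA.
Qed.

Lemma smooth_dmx p q (A : rV -> 'M[R]_(p, q)) a : smx U A -> smx U (dmx a A).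
Proof.
move=> sA i j; apply: smooth_eq (smooth_partial a (sA i j)) => // y _.
by rewrite mxE.
Qed.

Lemma smooth_det m (A : rV -> 'M[R]_m) : smx U A -> smooth_on U (fun x => \det (A x)).
Proof.
move=> sA k; rewrite /determinant; apply: Ck_sum => // s _; apply: CkM => //.
 exact: Ck_cst.
by apply: Ck_prod => // i _; exact: sA.
Qed.

(** By Cramer's rule the inverse is the adjugate over the determinant, both polynomial in the
    entries. *)
Lemma smooth_inv m (A : rV -> 'M[R]_m) : (forall x, U x -> A x \in unitmx) ->
 smx U A -> smx U (fun x => invmx (A x)).
Proof.
move=> uA sA.
apply: (@smx_eq _ _ _ (fun x => (\det (A x))^-1 *: \adj (A x))) => //.
 by move=> y Uy; rewrite /invmx uA.
apply: smxZ.
 by move=> k; apply: CkV => // [x Ux|]; [rewrite -unitfE; exact: uA|exact: smooth_det].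
move=> i j; apply: (@smooth_eq _ (fun x => (-1) ^+ (j + i) * \det (row' j (col' i (A x))))) => //.
 by move=> y _; rewrite mxE.
move=> k; apply: CkM => //; first exact: Ck_cst.
apply: smooth_det => a b.
by apply: smooth_eq (sA (lift j a) (lift i b)) => // y _; rewrite !mxE.
Qed.

Variables (x : rV) (Ux : U x) (a : 'I_n).

Lemma dmxM p q r (A : rV -> 'M[R]_(p, q)) (B : rV -> 'M[R]_(q, r)) :
 smx U A -> smx U B ->
 dmx a (fun x => A x *m B x) x = dmx a A x *m B x + A x *m dmx a B x.
Proof.
move=> sA sB; apply/matrixP => i j; rewrite !mxE.
under eq_fun do rewrite mxE.
have dA k := smooth_der a (sA i k) Ux; have dB k := smooth_der a (sB k j) Ux.
rewrite partial_sum => [|k _]; last exact: derivableM.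
rewrite -big_split; sumr k => /=.
by rewrite !mxE partialM.
Qed.

Lemma dmxD p q (A B : rV -> 'M[R]_(p, q)) : smx U A -> smx U B ->
 dmx a (fun x => A x + B x) x = dmx a A x + dmx a B x.
Proof.
move=> sA sB; apply/matrixP => i j; rewrite !mxE; under eq_fun do rewrite mxE.
by rewrite partialD//; exact: smooth_der Ux.
Qed.

Lemma dmxN p q (A : rV -> 'M[R]_(p, q)) : smx U A ->
 dmx a (fun x => - A x) x = - dmx a A x.
Proof.
move=> sA; apply/matrixP => i j; rewrite !mxE; under eq_fun do rewrite mxE.
by rewrite partialN//; exact: smooth_der Ux.
Qed.

Lemma dmxB p q (A B : rV -> 'M[R]_(p, q)) : smx U A -> smx U B ->
 dmx a (fun x => A x - B x) x = dmx a A x - dmx a B x.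
Proof. by move=> sA sB; rewrite dmxD ?dmxN//; exact: smxN. Qed.

Lemma dmxT p q (A : rV -> 'M[R]_(p, q)) : dmx a (fun x => (A x)^T) x = (dmx a A x)^T.
Proof. by apply/matrixP => i j; rewrite !mxE; under eq_fun do rewrite mxE. Qed.

Lemma dmxZ p q F (A : rV -> 'M[R]_(p, q)) : smooth_on U F -> smx U A ->
 dmx a (fun x => F x *: A x) x = partial a F x *: A x + F x *: dmx a A x.
Proof.
move=> sF sA; apply/matrixP => i j; rewrite !mxE; under eq_fun do rewrite mxE.
by rewrite partialM//; exact: smooth_der Ux.
Qed.

Lemma dmx_sum p q (I : Type) (r : seq I) (P : pred I) (A : I -> rV -> 'M[R]_(p, q)) :
 (forall i, P i -> smx U (A i)) ->
 dmx a (fun x => \sum_(i <- r | P i) A i x) x = \sum_(i <- r | P i) dmx a (A i) x.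
Proof.
move=> sA; apply/matrixP => i j; rewrite !mxE summxE; under eq_fun do rewrite summxE.
rewrite partial_sum => [|k Pk]; first by sumr k; rewrite mxE.
by apply: smooth_der Ux; exact: sA.
Qed.

Lemma dmxC p q (A : rV -> 'M[R]_(p, q)) b : smx U A ->
 dmx a (dmx b A) x = dmx b (dmx a A) x.
Proof.
move=> sA; apply/matrixP => i j.
have E c : (fun z => dmx c A z i j) = partial c (fun z => A z i j) by fext z; rewrite mxE.
by rewrite [LHS]mxE [RHS]mxE !E; exact: partialC (sA i j 2) Ux.
Qed.

Lemma dmx_cst p q (A : 'M[R]_(p, q)) : dmx a (fun=> A) x = 0.
Proof. by apply/matrixP => i j; rewrite !mxE partial_cst. Qed.

End Rules.
End SmoothMatrices.

Lemma dmx_comp (R : realType) (n m p q : nat) (V : set 'rV[R]_m) (U : set 'rV[R]_n)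
 (A : 'rV[R]_n -> 'M[R]_(p, q)) (tau : 'rV[R]_m -> 'rV[R]_n) y a :
 open V -> open U -> (forall c, smooth_on V (fun z => tau z 0 c)) -> smx U A ->
 V y -> U (tau y) ->
 dmx a (fun z => A (tau z)) y = \sum_c partial a (fun z => tau z 0 c) y *: dmx c A (tau y).
Proof.
move=> oV oU st sA Vy Uy; apply/matrixP => i j; rewrite !mxE summxE.
have [_ ->] := derive_comp_row a oV oU (fun c => st c 1) (sA i j 1) Vy Uy.
by sumr c; rewrite !mxE.
Qed.

Lemma smooth_comp (R : realType) (n m : nat) (V : set 'rV[R]_m) (U : set 'rV[R]_n)
 (F : 'rV[R]_n -> R) (tau : 'rV[R]_m -> 'rV[R]_n) :
 open V -> open U -> (forall c, smooth_on V (fun z => tau z 0 c)) -> smooth_on U F ->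
 (forall y, V y -> U (tau y)) -> smooth_on V (fun z => F (tau z)).
Proof. by move=> oV oU st sF VU k; apply: (@Ck_comp _ _ _ k V U) => // c; exact: st. Qed.

Lemma mul_delta_sum (R : pzSemiRingType) (n : nat) (F : 'I_n -> R) i :
 \sum_j (i == j)%:R * F j = F i.
Proof.
rewrite (bigD1 i)//= eqxx mul1r big1 ?addr0// => j; rewrite eq_sym => /negbTE ->.
by rewrite mul0r.
Qed.

Lemma mxaddE (V : nmodType) p q (A B : 'M[V]_(p, q)) i j : (A + B) i j = A i j + B i j.
Proof. by rewrite mxE. Qed.

Lemma mxsubE (V : zmodType) p q (A B : 'M[V]_(p, q)) i j : (A - B) i j = A i j - B i j.
Proof. by rewrite !mxE. Qed.

Lemma mxoppE (V : zmodType) p q (A : 'M[V]_(p, q)) i j : (- A) i j = - A i j.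
Proof. by rewrite mxE. Qed.

Lemma mxscaleE (K : pzRingType) p q (a : K) (A : 'M[K]_(p, q)) i j : (a *: A) i j = a * A i j.
Proof. by rewrite mxE. Qed.

Lemma mxmulE (K : pzRingType) p q r (A : 'M[K]_(p, q)) (B : 'M[K]_(q, r)) i j :
 (A *m B) i j = \sum_k A i k * B k j.
Proof. by rewrite mxE. Qed.

Lemma mxtrE (V : Type) p q (A : 'M[V]_(p, q)) i j : A^T i j = A j i.
Proof. by rewrite mxE. Qed.

Lemma mulmx_row_eq (K : pzRingType) m p q r (A : 'M[K]_(m, q)) (B : 'M[K]_(p, q)) (G : 'M[K]_(q, r)) i j l :
 (forall k, A i k = B j k) -> (A *m G) i l = (B *m G) j l.
Proof. by move=> AB; rewrite !mxE; sumr k; rewrite AB. Qed.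

(** Entry form of the covariant derivative of a four-slot tensor kept as a family of matrices: the
    matrix products treat the last two slots, the sums over [B] and [B'] the first two. *)
Lemma nabla4_entry (K : pzRingType) n (D C A : 'M[K]_n) (B B' : 'I_n -> 'M[K]_n) (c c' : 'I_n -> K) k l :
 (D - C *m A - A *m C^T - \sum_p c p *: B p - \sum_p c' p *: B' p) k l =
 D k l - \sum_p C k p * A p l - \sum_p A k p * C l p - \sum_p c p * B p k l - \sum_p c' p * B' p k l.
Proof.
rewrite !mxE !summxE; congr (_ - _ - _ - _ - _); sumr p; rewrite ?mxE//.
Qed.

Lemma reorder5 (V : zmodType) (d s1 s2 s3 s4 r1 r2 r3 r4 : V) : s1 = r1 -> s2 = r2 -> s3 = r3 -> s4 = r4 ->
 d - s1 - s2 - s3 - s4 = d - r3 - r4 - r1 - r2.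
Proof. by move=> -> -> -> ->; rewrite -!addrA; congr (_ + _); rewrite addrA [LHS]addrC -!addrA. Qed.

(** * The Levi-Civita connection and its curvature as matrices *)

Section Connection.
Context {R : realType} {n : nat}.
Local Notation rV := 'rV[R]_n.
Variables (U : set rV) (g : rV -> 'M[R]_n).

Record local_metric : Prop := LocalMetric {
 lm_open : open U;
 lm_smooth : smx U g;
 lm_sym : forall x, U x -> (g x)^T = g x;
 lm_unit : forall x, U x -> g x \in unitmx
}.

(* [conn a x] is the matrix whose (b, k) entry is $\Gamma^k_{ab}$. *)
Definition conn (a : 'I_n) (x : rV) : 'M[R]_n := \matrix_(b, k) christoffel g k a b x.

Lemma connE a b k x : conn a x b k = christoffel g k a b x.
Proof. by rewrite mxE. Qed.

(** Covectors are columns and covariant 2-tensors are matrices, so that $\nabla_a$ becomes matrix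
    algebra with the connection matrix; [cov2] is the same derivative for 2-tensors. *)
Definition cov1 (a : 'I_n) (w : rV -> 'cV[R]_n) (x : rV) : 'cV[R]_n :=
 dmx a w x - conn a x *m w x.

Definition cov2 (a : 'I_n) (T : rV -> 'M[R]_n) (x : rV) : 'M[R]_n :=
 dmx a T x - conn a x *m T x - T x *m (conn a x)^T.

(* The (k, l) entry is $R_{abk}{}^l$. *)
Definition curv (a b : 'I_n) (x : rV) : 'M[R]_n :=
 dmx a (conn b) x - dmx b (conn a) x - conn a x *m conn b x + conn b x *m conn a x.

Lemma curvE a b k l x : curv a b x k l = Rm_up g a b k l x.
Proof.
have E c d e : (fun z => conn c z d e) = christoffel g e c d by fext z; rewrite mxE.
rewrite !mxE !E /Rm_up sumrB -[LHS]addrA; congr (_ + _); rewrite addrC.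
have cE c d e : conn c x d e = christoffel g e c d x by rewrite mxE.
by congr (_ - _); sumr p; rewrite !cE// mulrC.
Qed.

Hypothesis lm : local_metric.
Let oU := lm_open lm.
Let sg := lm_smooth lm.

Lemma smooth_gcomp i j : smooth_on U (gcomp g i j).
Proof. exact: sg. Qed.

Lemma smooth_ginv : smx U (fun x => invmx (g x)).
Proof. exact: (smooth_inv oU (lm_unit lm) sg). Qed.

Lemma smooth_conn a : smx U (conn a).
Proof.
move=> b k.
apply: (@smooth_eq _ _ _ (fun x => 2^-1 * \sum_l invmx (g x) k l *
  (partial a (gcomp g b l) x + partial b (gcomp g a l) x - partial l (gcomp g a b) x))) => //.
 by move=> y _; rewrite mxE.
move=> m; apply: CkM => //; first exact: Ck_cst.
apply: Ck_sum => // l _; apply: CkM => //; first exact: smooth_ginv.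
by apply: CkB => //; first apply: CkD => //; apply: Ck_partial; exact: smooth_gcomp.
Qed.

Lemma gcompC i j x : U x -> g x i j = g x j i.
Proof. by move=> Ux; rewrite -[in LHS](lm_sym lm Ux) mxE. Qed.

Lemma pgcompC a i j x : U x -> partial a (gcomp g i j) x = partial a (gcomp g j i) x.
Proof. by move=> Ux; apply: pd_eq_on Ux => // y Uy; exact: gcompC. Qed.

Lemma conn_sym a b k x : U x -> conn a x b k = conn b x a k.
Proof.
move=> Ux; rewrite !mxE /christoffel; congr (_ * _); sumr l; congr (_ * _).
by rewrite (pgcompC _ a b Ux) [partial a _ _ + _]addrC.
Qed.

Lemma invmx_sym x : U x -> (invmx (g x))^T = invmx (g x).
Proof. by move=> Ux; rewrite trmx_inv (lm_sym lm Ux). Qed.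

(** Lowering the upper index cancels the inverse metric in the Christoffel symbols. *)
Lemma conn_lower a x b l : U x -> (conn a x *m g x) b l =
 2^-1 * (partial a (gcomp g b l) x + partial b (gcomp g a l) x - partial l (gcomp g a b) x).
Proof.
move=> Ux.
pose T : rV := \row_m (partial a (gcomp g b m) x + partial b (gcomp g a m) x - partial m (gcomp g a b) x).
transitivity (2^-1 * (T *m invmx (g x) *m g x) 0 l); last first.
 by rewrite mulmxKV ?(lm_unit lm Ux)// mxE.
rewrite !mxE mulr_sumr; sumr k; rewrite !mxE /christoffel -mulrA.
congr (_ * (_ * _)); sumr m; rewrite !mxE mulrC; congr (_ * _).
by rewrite -[in LHS](invmx_sym Ux) mxE.
Qed.

Lemma conn_compat a x : U x -> dmx a g x = conn a x *m g x + g x *m (conn a x)^T.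
Proof.
move=> Ux; apply/matrixP => b l; rewrite mxE.
have -> : g x *m (conn a x)^T = (conn a x *m g x)^T by rewrite trmx_mul (lm_sym lm Ux).
rewrite [RHS]mxE [in X in _ + X]mxE !conn_lower// (pgcompC a l b Ux).
rewrite (pgcompC l a b Ux) (pgcompC b a l Ux) -/(gcomp g b l).
rewrite (pgcompC l b a Ux) (pgcompC b l a Ux); lra.
Qed.

(** Using the two symmetries alternately, three times each, returns the indices to their original
    order with the opposite sign. *)
Lemma sym_skew_eq0 (T : 'I_n -> 'I_n -> 'I_n -> R) :
 (forall a b l, T a b l = T b a l) -> (forall a b l, T a b l = - T a l b) ->
 forall a b l, T a b l = 0.
Proof.
move=> s k a b l; have e : T a b l = - T a b l; last lra.
by rewrite {1}k s k s opprK [LHS]k s.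
Qed.

(** The difference of two torsion-free metric connections, with its index lowered, is symmetric in
    one pair of slots and skew in another. This identifies the Christoffel symbols in new
    coordinates without recomputing them from their definition. *)
Lemma levi_civita_unique x (L : 'I_n -> 'M[R]_n) : U x ->
 (forall a b k, L a b k = L b a k) ->
 (forall a, dmx a g x = L a *m g x + g x *m (L a)^T) -> forall a, L a = conn a x.
Proof.
move=> Ux Ls Lc a.
pose T a b l := ((L a - conn a x) *m g x) b l.
have T0 : forall a b l, T a b l = 0.
 apply: sym_skew_eq0 => c b l.
  by apply: mulmx_row_eq => k; rewrite 2!mxsubE Ls conn_sym.
 have E : (L c - conn c x) *m g x + ((L c - conn c x) *m g x)^T = 0.
  rewrite trmx_mul (lm_sym lm Ux) raddfB /= mulmxBl mulmxBr addrACA -opprD.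
  by rewrite -(conn_compat c Ux) -Lc subrr.
 by move/matrixP/(_ b l): E; rewrite mxaddE mxtrE [RHS]mxE => /eqP; rewrite addr_eq0 => /eqP.
apply/eqP; rewrite -subr_eq0; apply/eqP.
rewrite -[LHS](mulmxK (lm_unit lm Ux)).
have -> : (L a - conn a x) *m g x = 0 by apply/matrixP => b l; rewrite [RHS]mxE; exact: T0.
by rewrite mul0mx.
Qed.

Definition grad (F : rV -> R) (x : rV) : 'cV[R]_n := \col_i partial i F x.

Definition hessm (F : rV -> R) (x : rV) : 'M[R]_n := \matrix_(i, j) Hess g F i j x.

Definition ricm (x : rV) : 'M[R]_n := \matrix_(i, j) Ric g i j x.

(* The (k, l) entry is $R_{ijkl}$. *)
Definition riem (i j : 'I_n) (x : rV) : 'M[R]_n := curv i j x *m g x.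

(** [cov2] differentiates the two slots inside the matrix; the sums correct for the slots [i] and
    [j] that index the family. *)
Definition nriem (m i j : 'I_n) (x : rV) : 'M[R]_n :=
 cov2 m (riem i j) x - \sum_p conn m x i p *: riem p j x - \sum_p conn m x j p *: riem i p x.

Lemma smooth_grad F : smooth_on U F -> smx U (grad F).
Proof. by move=> sF i j; apply: smooth_eq (smooth_partial i sF) => // y _; rewrite mxE. Qed.

Lemma smooth_cov1 a w : smx U w -> smx U (cov1 a w).
Proof.
move=> sw; apply: smxB => //; first exact: smooth_dmx.
by apply: smxM => //; exact: smooth_conn.
Qed.

Lemma smooth_cov2 a T : smx U T -> smx U (cov2 a T).
Proof.
move=> sT; apply: smxB => //; last first.
 by apply: smxM => //; apply: smxT => //; exact: smooth_conn.
apply: smxB => //; first exact: smooth_dmx.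
by apply: smxM => //; exact: smooth_conn.
Qed.

Lemma smooth_curv a b : smx U (curv a b).
Proof.
have sc := smooth_conn; apply: smxD => //; last exact: smxM.
apply: smxB => //; last exact: smxM.
by apply: smxB => //; exact: smooth_dmx.
Qed.

Lemma smooth_riem a b : smx U (riem a b).
Proof. by apply: smxM => //; exact: smooth_curv. Qed.

Lemma hessmE F i j x : hessm F x i j = cov1 i (grad F) x j 0.
Proof.
rewrite !mxE /Hess; congr (_ - _).
 by congr (partial _ _ x); fext z; rewrite mxE.
by sumr k; rewrite !mxE.
Qed.

Lemma smooth_hessm F : smooth_on U F -> smx U (hessm F).
Proof.
move=> sF i j; apply: smooth_eq (smooth_cov1 i (smooth_grad sF) j 0) => // y _.
by rewrite hessmE.
Qed.

Lemma hessm_sym F x : smooth_on U F -> U x -> (hessm F x)^T = hessm F x.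
Proof.
move=> sF Ux; apply/matrixP => i j; rewrite mxE !mxE /Hess (partialC _ _ oU (sF 2) Ux).
congr (_ - _); sumr k; congr (_ * _).
by have := conn_sym i j k Ux; rewrite !mxE.
Qed.

Lemma ricmE i j x : ricm x i j = \sum_k curv k i x j k.
Proof. by rewrite mxE /Ric; sumr k; rewrite curvE. Qed.

Lemma smooth_ricm : smx U ricm.
Proof.
move=> i j; apply: (@smooth_eq _ _ _ (fun x => \sum_k curv k i x j k)) => // [y _|m].
 by rewrite ricmE.
by apply: Ck_sum => // k _; exact: smooth_curv.
Qed.

Lemma riemE i j k l x : U x -> riem i j x k l = Rm g i j k l x.
Proof.
move=> Ux; rewrite mxE; sumr m.
by rewrite curvE mulrC gcompC.
Qed.

Lemma nabla_RicE k i j x : nabla_Ric g k i j x = cov2 k ricm x i j.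
Proof.
rewrite /nabla_Ric !mxE; congr (_ - _ - _).
- by congr (partial _ _ x); fext z; rewrite mxE.
- by sumr p; rewrite !mxE.
by sumr p; rewrite !mxE mulrC.
Qed.

Opaque christoffel Rm conn riem curv.

Lemma nabla_RmE m i j k l x : U x -> nabla_Rm g m i j k l x = nriem m i j x k l.
Proof.
move=> Ux; rewrite /nabla_Rm /nriem /cov2.
have cE a b c : conn a x b c = christoffel g c a b x by exact: connE.
have -> : partial m (Rm g i j k l) x = dmx m (riem i j) x k l.
 by rewrite mxE; apply: pd_eq_on Ux => // y Uy; rewrite riemE.
have rE a b c d : riem a b x c d = Rm g a b c d x by exact: riemE.
rewrite [RHS]nabla4_entry.
by apply: reorder5; sumr p; rewrite cE rE // mulrC.
Qed.

End Connection.

(** * Pullback of covariant tensors *)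

Section Pull.
Context {R : realType} {n : nat}.
Implicit Types (G J : 'M[R]_n).

(** Contracts the first slot with [c] and keeps the others in order; iterated through [tpull] it
    applies [J] to every slot. *)
Fixpoint tcomb (k : nat) (c : 'I_n -> R) : ('I_n -> tensor R n k) -> tensor R n k :=
 if k is k'.+1 return ('I_n -> tensor R n k) -> tensor R n k then
  fun T i => @tcomb k' c (fun a => T a i)
 else fun T => \sum_a c a * T a.

Fixpoint tpull (J : 'M[R]_n) (k : nat) : tensor R n k -> tensor R n k :=
 if k is k'.+1 return tensor R n k -> tensor R n k then
  fun T i => @tcomb k' (J i) (fun a => tpull J (T a))
 else id.

Lemma gtraceE G (T : 'I_n -> 'I_n -> R) : gtrace G T = \tr (invmx G *m (\matrix_(i, j) T i j)^T).
Proof.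
rewrite /gtrace /mxtrace; sumr a; rewrite mxE; sumr b.
by rewrite !mxE.
Qed.

Lemma gtrace1 (T : 'I_n -> 'I_n -> R) : gtrace 1%:M T = \sum_i T i i.
Proof.
rewrite /gtrace invmx1; sumr a.
by under eq_bigr do rewrite mxE; rewrite mul_delta_sum.
Qed.

Lemma eq_gtrace G (S T : 'I_n -> 'I_n -> R) : (forall a b, S a b = T a b) -> gtrace G S = gtrace G T.
Proof. by move=> ST; sumr a b; rewrite ST. Qed.

(** The inverse of $JGJ^T$ brings factors $J^{-1}$ that cancel those of the pulled-back tensor under
    the cyclic trace. *)
Lemma gtrace_pull G J (T : 'I_n -> 'I_n -> R) : G \in unitmx -> J \in unitmx ->
 gtrace (J *m G *m J^T) (fun a b => \sum_c J a c * \sum_d J b d * T c d) = gtrace G T.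
Proof.
move=> Gu Ju; rewrite !gtraceE.
have -> : (\matrix_(a, b) \sum_c J a c * \sum_d J b d * T c d) = J *m (\matrix_(i, j) T i j) *m J^T.
 apply/matrixP => a b; rewrite -mulmxA [LHS]mxE [RHS]mxE; sumr c; congr (_ * _).
 by rewrite !mxE; sumr d; rewrite !mxE mulrC.
have JTu : J^T \in unitmx by rewrite unitmx_tr.
rewrite !trmx_mul trmxK.
have -> : invmx (J *m G *m J^T) = invmx J^T *m (invmx G *m invmx J).
 rewrite -[LHS]mulmx1; apply: (canLR (mulKmx _)); first by rewrite !unitmx_mul Ju Gu JTu.
 by rewrite mulmxA -!mulmxA (mulKVmx JTu) (mulKVmx Gu) mulmxV.
rewrite mxtrace_mulC !mulmxA -[_ *m J^T *m _]mulmxA mulmxV// mulmx1.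
by rewrite mxtrace_mulC !mulmxA mulVmx// mul1mx mxtrace_mulC.
Qed.

Lemma gtrace_sum G (I : Type) (r : seq I) (c : I -> R) (T : I -> 'I_n -> 'I_n -> R) :
 gtrace G (fun a b => \sum_(i <- r) c i * T i a b) = \sum_(i <- r) c i * gtrace G (T i).
Proof.
rewrite /gtrace.
transitivity (\sum_a \sum_b \sum_(i <- r) c i * (invmx G a b * T i a b)).
 sumr a b; rewrite mulr_sumr.
 by sumr i; rewrite mulrCA.
under eq_bigr do rewrite exchange_big /=.
sumx i; rewrite mulr_sumr.
by sumr a; rewrite mulr_sumr.
Qed.

Lemma tinner_combl G k c (S : 'I_n -> tensor R n k) (T : tensor R n k) :
 tinner G (tcomb c S) T = \sum_a c a * tinner G (S a) T.
Proof.
elim: k c S T => [|k IH] c S T /=; first by rewrite mulr_suml; sumr a; rewrite mulrA.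
by rewrite -gtrace_sum; apply: eq_gtrace => a b; exact: IH.
Qed.

Lemma tinner_combr G k c (S : 'I_n -> tensor R n k) (T : tensor R n k) :
 tinner G T (tcomb c S) = \sum_a c a * tinner G T (S a).
Proof.
elim: k c S T => [|k IH] c S T /=; first by rewrite mulr_sumr; sumr a; rewrite mulrCA.
by rewrite -gtrace_sum; apply: eq_gtrace => a b; exact: IH.
Qed.

Lemma tinner_pull G J k (S T : tensor R n k) : G \in unitmx -> J \in unitmx ->
 tinner (J *m G *m J^T) (tpull J S) (tpull J T) = tinner G S T.
Proof.
move=> Gu Ju; elim: k S T => [//|k IH] S T /=.
rewrite -(gtrace_pull (fun a b => tinner G (S a) (T b)) Gu Ju).
apply: eq_gtrace => a b; rewrite tinner_combl; sumr c; congr (_ * _).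
by rewrite tinner_combr; sumr d; rewrite IH.
Qed.

End Pull.

Section Defining.
Context {R : realType} {n : nat} (g : 'rV[R]_n -> 'M[R]_n).

Lemma cov1E a w x : cov1 g a w x = dmx a w x - conn g a x *m w x.
Proof. by []. Qed.

Lemma cov2E a T x : cov2 g a T x = dmx a T x - conn g a x *m T x - T x *m (conn g a x)^T.
Proof. by []. Qed.

Lemma curvdE a b x : curv g a b x =
 dmx a (conn g b) x - dmx b (conn g a) x - conn g a x *m conn g b x + conn g b x *m conn g a x.
Proof. by []. Qed.

Lemma riemdE i j x : riem g i j x = curv g i j x *m g x.
Proof. by []. Qed.

Lemma nriemdE m i j x : nriem g m i j x = cov2 g m (riem g i j) x
 - \sum_p conn g m x i p *: riem g p j x - \sum_p conn g m x j p *: riem g i p x.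
Proof. by []. Qed.
End Defining.
Lemma dmx_pd (R : realType) (n : nat) p q a (A : 'rV[R]_n -> 'M[R]_(p, q)) x i j :
 partial a (fun z => A z i j) x = dmx a A x i j.
Proof. by rewrite mxE. Qed.

Opaque christoffel Rm Ric conn riem curv cov1 cov2 dmx nriem hessm ricm.

(** * Algebra of the transformation law of connections *)

Section GaugeAlgebra.
Context {R : realType} {n : nat}.
Implicit Types (A B C D E X j : 'M[R]_n).

(** [K *m j = D + j *m k] is the transformation law of connection matrices: [j] is the Jacobian, [D]
    its derivative, [K] and [k] the new and the old connection. The inhomogeneous term [D] cancels
    in covariant derivatives. *)
Lemma gauge1 p (D K : 'M[R]_n) (w w' : 'M[R]_(n, p)) j k : K *m j = D + j *m k ->
 D *m w + j *m w' - K *m (j *m w) = j *m (w' - k *m w).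
Proof.
move=> e; rewrite mulmxA e mulmxDl mulmxBr opprD addrACA subrr add0r mulmxA.
by [].
Qed.

Lemma gauge2 (D K X X' j k : 'M[R]_n) : K *m j = D + j *m k ->
 (D *m X + j *m X') *m j^T + j *m X *m D^T - K *m (j *m X *m j^T) - j *m X *m j^T *m K^T =
 j *m (X' - k *m X - X *m k^T) *m j^T.
Proof.
move=> e.
have eT : j^T *m K^T = D^T + k^T *m j^T by rewrite -trmx_mul e raddfD /= trmx_mul.
rewrite -[j *m X *m j^T *m K^T]mulmxA eT !mulmxA e !(mulmxDl, mulmxDr, mulmxBl, mulmxBr, mulNmx, mulmxN, mulmxA).
move: (D *m X *m j^T) (j *m X' *m j^T) (j *m X *m D^T) (j *m k *m X *m j^T) (j *m X *m k^T *m j^T).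
by move=> a b c d f; apply/matrixP => r s; rewrite !mxE; ring.
Qed.

(** The third and fourth hypotheses are derivatives of the transformation law. The second
    derivatives [Dba] and [Dab] of the Jacobian agree and drop out of the antisymmetrisation, so the
    curvature is tensorial. *)
Lemma gauge_curv (dKba dKab Ka Kb Da Db Dba Dab ka kb dkba dkab j : 'M[R]_n) :
 Ka *m j = Da + j *m ka -> Kb *m j = Db + j *m kb ->
 dKba *m j + Kb *m Da = Dba + (Da *m kb + j *m dkba) ->
 dKab *m j + Ka *m Db = Dab + (Db *m ka + j *m dkab) -> Dba = Dab ->
 (dKba - dKab - Ka *m Kb + Kb *m Ka) *m j = j *m (dkba - dkab - ka *m kb + kb *m ka).
Proof.
move=> ea eb eba eab eD.
have {}eba : dKba *m j = Dba + (Da *m kb + j *m dkba) - Kb *m Da by rewrite -eba addrK.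
have {}eab : dKab *m j = Dab + (Db *m ka + j *m dkab) - Ka *m Db by rewrite -eab addrK.
rewrite mulmxDl !mulmxBl eba eab eD -!mulmxA ea eb !mulmxDr !mulmxN !mulmxA ea eb !mulmxDl.
move: (Da *m kb) (Db *m ka) (Ka *m Db) (Kb *m Da) (j *m dkba) (j *m dkab) (j *m ka *m kb) (j *m kb *m ka).
by move=> a b c d f h p q; apply/matrixP => r s; rewrite !mxE; ring.
Qed.

(** The product rule for $JGJ^T$, with metric compatibility of the old connection inserted, is
    metric compatibility of the transformed one. *)
Lemma gauge_metric (D J G K : 'M[R]_n) : G^T = G ->
 (D *m G + J *m (K *m G + G *m K^T)) *m J^T + J *m G *m D^T =
 (D + J *m K) *m G *m J^T + ((D + J *m K) *m G *m J^T)^T.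
Proof.
move=> sG; have e : (D + J *m K)^T = D^T + K^T *m J^T by rewrite linearD /= trmx_mul.
rewrite !trmx_mul trmxK sG e !(mulmxDl, mulmxDr, mulmxA).
move: (D *m G *m J^T) (J *m K *m G *m J^T) (J *m G *m D^T) (J *m G *m K^T *m J^T).
by move=> p q r s; apply/matrixP => i j; rewrite !mxE; ring.
Qed.

Lemma sumZ_swap p q (u v : 'I_n -> R) (F : 'I_n -> 'I_n -> 'M[R]_(p, q)) :
 \sum_d \sum_e (u d * v e) *: F d e = \sum_d \sum_e (v d * u e) *: F e d.
Proof. by sumx d; sumr e; rewrite mulrC. Qed.

Lemma mxadd_congr p q (A B C D : 'M[R]_(p, q)) r s k l : A r s = C k l -> B r s = D k l ->
 (A + B) r s = (C + D) k l.
Proof. by rewrite !mxE => -> ->. Qed.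

Lemma conjB3 (X Y Z j : 'M[R]_n) : j *m X *m j^T - j *m Y *m j^T - j *m Z *m j^T = j *m (X - Y - Z) *m j^T.
Proof. by rewrite !mulmxBr !mulmxBl. Qed.

Lemma sum4_rev (V : zmodType) (F : 'I_n -> 'I_n -> 'I_n -> 'I_n -> V) :
 \sum_a \sum_b \sum_c \sum_d F a b c d = \sum_d \sum_c \sum_b \sum_a F a b c d.
Proof.
transitivity (\sum_a \sum_d \sum_c \sum_b F a b c d).
 sumr a; rewrite exchange_big /=.
 by under eq_bigr do rewrite exchange_big /=; rewrite exchange_big.
sumx d.
sumx c.
by rewrite exchange_big.
Qed.

Lemma mxsumZl (I : Type) (r : seq I) (c : I -> R) p q s (A : I -> 'M[R]_(p, q)) (B : 'M[R]_(q, s)) :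
 (\sum_(i <- r) c i *: A i) *m B = \sum_(i <- r) c i *: (A i *m B).
Proof. by rewrite mulmx_suml; sumr i; rewrite scalemxAl. Qed.

Lemma mxsumZr (I : Type) (r : seq I) (c : I -> R) p q s (A : I -> 'M[R]_(p, q)) (B : 'M[R]_(s, p)) :
 B *m (\sum_(i <- r) c i *: A i) = \sum_(i <- r) c i *: (B *m A i).
Proof. by rewrite mulmx_sumr; sumr i; rewrite scalemxAr. Qed.

Lemma trmx_sumZ (I : Type) (r : seq I) (c : I -> R) p q (A : I -> 'M[R]_(p, q)) :
 (\sum_(i <- r) c i *: A i)^T = \sum_(i <- r) c i *: (A i)^T.
Proof. by rewrite raddf_sum; sumr i; exact: linearZ. Qed.

Lemma sumZB (I : Type) (r : seq I) (c : I -> R) p q (A B : I -> 'M[R]_(p, q)) :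
 \sum_(i <- r) c i *: (A i - B i) = \sum_(i <- r) c i *: A i - \sum_(i <- r) c i *: B i.
Proof. by rewrite -sumrB; sumr i; rewrite scalerBr. Qed.

Lemma sumZD (I : Type) (r : seq I) (c : I -> R) p q (A B : I -> 'M[R]_(p, q)) :
 \sum_(i <- r) c i *: (A i + B i) = \sum_(i <- r) c i *: A i + \sum_(i <- r) c i *: B i.
Proof. by rewrite -big_split; sumr i; rewrite scalerDr. Qed.

Lemma sumZ_mul2 (I : Type) (r s : seq I) (c d : I -> R) p q t (A : I -> 'M[R]_(p, q)) (B : I -> 'M[R]_(q, t)) :
 (\sum_(i <- r) c i *: A i) *m (\sum_(k <- s) d k *: B k) =
 \sum_(i <- r) \sum_(k <- s) (c i * d k) *: (A i *m B k).
Proof.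
rewrite mxsumZl; sumr i; rewrite mxsumZr scaler_sumr.
by sumr k; rewrite scalerA.
Qed.
End GaugeAlgebra.

(** * Change of coordinates *)
Section Transformation.
Context {R : realType} {n : nat}.
Local Notation rV := 'rV[R]_n.
Variables (U V : set rV) (g gt : rV -> 'M[R]_n) (tau : rV -> rV).

Definition jac (y : rV) : 'M[R]_n := \matrix_(a, c) partial a (fun z => tau z 0 c) y.

Record coord_change : Prop := CoordChange {
 cc_open : open V;
 cc_smooth : forall c, smooth_on V (fun z => tau z 0 c);
 cc_map : forall y, V y -> U (tau y);
 cc_jac : forall y, V y -> jac y \in unitmx;
 cc_metric : forall y, V y -> gt y = jac y *m g (tau y) *m (jac y)^T
}.

Hypothesis lm : local_metric U g.
Hypothesis cc : coord_change.
Let oU := lm_open lm.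
Let oV := cc_open cc.
Let st := cc_smooth cc.

Lemma smooth_jac : smx V jac.
Proof. by move=> a c; apply: smooth_eq (smooth_partial a (st c)) => // y _; rewrite mxE. Qed.

Lemma smooth_comp_mx p q (A : rV -> 'M[R]_(p, q)) : smx U A -> smx V (fun y => A (tau y)).
Proof. by move=> sA i j; apply: (smooth_comp oV oU st (sA i j)); exact: cc_map. Qed.

Lemma dmx_tau p q (A : rV -> 'M[R]_(p, q)) a y : smx U A -> V y ->
 dmx a (fun z => A (tau z)) y = \sum_c jac y a c *: dmx c A (tau y).
Proof.
move=> sA Vy; rewrite (dmx_comp a oV oU st sA Vy (cc_map cc Vy)).
by sumr c; rewrite mxE.
Qed.

Lemma new_metric : local_metric V gt.
Proof.
split=> //.
- apply: (@smx_eq _ _ _ _ _ (fun y => jac y *m g (tau y) *m (jac y)^T)) => //.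
  by move=> y Vy; rewrite (cc_metric cc Vy).
 apply: smxM => //; last by apply: smxT => //; exact: smooth_jac.
 by apply: smxM => //; [exact: smooth_jac|apply: smooth_comp_mx; exact: lm_smooth lm].
- move=> y Vy; rewrite (cc_metric cc Vy) !trmx_mul trmxK mulmxA.
 by rewrite (lm_sym lm (cc_map cc Vy)).
- move=> y Vy; rewrite (cc_metric cc Vy) !unitmx_mul unitmx_tr (cc_jac cc Vy).
 by rewrite (lm_unit lm (cc_map cc Vy)).
Qed.
Let lmt := new_metric.

(** The old connection in the new direction [a], before its remaining indices are transformed. *)
Definition kp (a : 'I_n) (y : rV) : 'M[R]_n := \sum_d jac y a d *: conn g d (tau y).

Lemma smooth_kp a : smx V (kp a).
Proof.
apply: smx_sum => // d _; apply: smxZ => //; first exact: smooth_jac.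
by apply: smooth_comp_mx; exact: (smooth_conn lm).
Qed.

Lemma dmx_jac_sym a b c y : V y -> dmx a jac y b c = dmx b jac y a c.
Proof.
move=> Vy.
have E d e : dmx d jac y e c = partial d (partial e (fun z => tau z 0 c)) y.
 by rewrite -dmx_pd; congr (partial d _ y); fext z; rewrite mxE.
exact: (etrans (E a b) (etrans (partialC a b oV (st c 2) Vy) (esym (E b a)))).
Qed.

(** [L] is defined so as to satisfy the transformation law. It is torsion-free because second
    derivatives of [tau] commute, and metric because the metric is pulled back, so uniqueness makes
    it the new Levi-Civita connection. *)
Lemma conn_tr a y : V y -> conn gt a y *m jac y = dmx a jac y + jac y *m kp a y.
Proof.
move=> Vy; have Uy := cc_map cc Vy; have Ju := cc_jac cc Vy.
pose L b := (dmx b jac y + jac y *m kp b y) *m invmx (jac y).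
have LE b : L b *m jac y = dmx b jac y + jac y *m kp b y by rewrite /L mulmxKV.
suff H : forall b, L b = conn gt b y by rewrite -H LE.
apply: (levi_civita_unique lmt Vy).
 move=> b c k; apply: mulmx_row_eq => d.
 apply: mxadd_congr; first exact: dmx_jac_sym.
 rewrite mxmulE [RHS]mxmulE.
 have kpE b' e d' : kp b' y e d' = \sum_d jac y b' d * conn g d (tau y) e d'.
  by rewrite /kp summxE; apply: eq_bigr => e' _; rewrite mxscaleE.
 transitivity (\sum_e \sum_e' jac y c e * (jac y b e' * conn g e' (tau y) e d)).
  by sumr e; rewrite kpE mulr_sumr.
 sumx e; rewrite kpE mulr_sumr; apply: eq_bigr => e' _.
 by rewrite (conn_sym lm e e' d Uy) mulrCA.
move=> b.
have sg := smooth_comp_mx (lm_smooth lm).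
have sJ := smooth_jac.
have -> : dmx b gt y = dmx b (fun y => jac y *m g (tau y) *m (jac y)^T) y.
 by apply: (dmx_eq _ oV _ Vy) => z Vz; rewrite (cc_metric cc Vz).
have sJg : smx V (fun y => jac y *m g (tau y)) by exact: smxM.
rewrite (dmxM Vy b sJg (smxT oV sJ)) (dmxM Vy b sJ sg) dmxT.
rewrite dmx_tau//; last exact: lm_smooth lm.
have -> : \sum_c jac y b c *: dmx c g (tau y) = kp b y *m g (tau y) + g (tau y) *m (kp b y)^T.
 rewrite /kp trmx_sumZ mxsumZl mxsumZr -sumZD; sumr c.
 by rewrite (conn_compat lm c Uy).
have -> : gt y *m (L b)^T = (L b *m gt y)^T by rewrite [RHS]trmx_mul (lm_sym lmt Vy).
have -> : L b *m gt y = (dmx b jac y + jac y *m kp b y) *m g (tau y) *m (jac y)^T.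
 by rewrite (cc_metric cc Vy) !mulmxA LE.
exact: gauge_metric (lm_sym lm Uy).
Qed.

Lemma cov1_tr a (w wt : rV -> 'cV[R]_n) y : smx U w ->
 (forall z, V z -> wt z = jac z *m w (tau z)) -> V y ->
 cov1 gt a wt y = jac y *m \sum_d jac y a d *: cov1 g d w (tau y).
Proof.
move=> sw wE Vy; rewrite cov1E (dmx_eq a oV wE Vy) wE//.
rewrite (dmxM Vy a smooth_jac (smooth_comp_mx sw)) dmx_tau//.
rewrite (gauge1 _ _ (conn_tr a Vy)); congr (_ *m _).
by rewrite /kp mxsumZl -sumZB.
Qed.

Lemma cov2_gauge a (X T : rV -> 'M[R]_n) y : smx V X ->
 (forall z, V z -> T z = jac z *m X z *m (jac z)^T) -> V y ->
 cov2 gt a T y = jac y *m (dmx a X y - kp a y *m X y - X y *m (kp a y)^T) *m (jac y)^T.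
Proof.
move=> sX TE Vy; rewrite cov2E (dmx_eq a oV TE Vy) TE//.
have sJ := smooth_jac; have sJX : smx V (fun y => jac y *m X y) by exact: smxM.
rewrite (dmxM Vy a sJX (smxT oV sJ)) (dmxM Vy a sJ sX) dmxT.
exact: gauge2 (conn_tr a Vy).
Qed.

Lemma cov2_tr a (T Tt : rV -> 'M[R]_n) y : smx U T ->
 (forall z, V z -> Tt z = jac z *m T (tau z) *m (jac z)^T) -> V y ->
 cov2 gt a Tt y = jac y *m (\sum_d jac y a d *: cov2 g d T (tau y)) *m (jac y)^T.
Proof.
move=> sT TE Vy; rewrite (cov2_gauge a (smooth_comp_mx sT) TE Vy) dmx_tau//.
by rewrite /kp trmx_sumZ mxsumZl mxsumZr -!sumZB.
Qed.

Lemma dmx_kp a b y : V y -> dmx a (kp b) y =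
 \sum_e dmx a jac y b e *: conn g e (tau y)
 + \sum_d \sum_e (jac y a d * jac y b e) *: dmx d (conn g e) (tau y).
Proof.
move=> Vy; rewrite (@dmx_sum _ _ _ _ Vy); last first.
 move=> e _; apply: smxZ => //; first exact: smooth_jac.
 by apply: smooth_comp_mx; exact: (smooth_conn lm).
rewrite exchange_big -big_split; sumr e => /=.
rewrite (dmxZ Vy a (smooth_jac b e) (smooth_comp_mx (smooth_conn lm e))).
rewrite dmx_tau//; last exact: (smooth_conn lm).
congr (_ + _).
 by congr (_ *: _); exact: dmx_pd.
by rewrite scaler_sumr; sumr d; rewrite scalerA mulrC.
Qed.

Lemma curv_tr a b y : V y -> curv gt a b y *m jac y =
 jac y *m \sum_d \sum_e (jac y a d * jac y b e) *: curv g d e (tau y).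
Proof.
move=> Vy; have sJ := smooth_jac.
(* The transformation law in direction [d], differentiated in direction [c]. *)
have D c d : dmx c (conn gt d) y *m jac y + conn gt d y *m dmx c jac y =
  dmx c (dmx d jac) y + (dmx c jac y *m kp d y + jac y *m dmx c (kp d) y).
 rewrite -(dmxM Vy c (smooth_conn lmt d) sJ).
 have -> : dmx c (fun x => conn gt d x *m jac x) y = dmx c (fun x => dmx d jac x + jac x *m kp d x) y.
  by apply: (dmx_eq _ oV _ Vy) => z; exact: conn_tr.
 rewrite (dmxD Vy c (smooth_dmx oV d sJ) (smxM oV sJ (smooth_kp d))).
 by rewrite (dmxM Vy c sJ (smooth_kp d)).
rewrite curvdE (gauge_curv (conn_tr a Vy) (conn_tr b Vy) (D a b) (D b a) (dmxC oV Vy a b sJ)).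
congr (_ *m _); rewrite !dmx_kp//.
have -> : \sum_e dmx a jac y b e *: conn g e (tau y) = \sum_e dmx b jac y a e *: conn g e (tau y).
 by sumr e; congr (_ *: _); exact: dmx_jac_sym.
rewrite opprD addrACA subrr add0r /kp !sumZ_mul2.
have -> : \sum_d \sum_e (jac y b d * jac y a e) *: dmx d (conn g e) (tau y) =
 \sum_d \sum_e (jac y a d * jac y b e) *: dmx e (conn g d) (tau y).
 exact: sumZ_swap.
have -> : \sum_i \sum_k (jac y b i * jac y a k) *: (conn g i (tau y) *m conn g k (tau y)) =
 \sum_d \sum_e (jac y a d * jac y b e) *: (conn g e (tau y) *m conn g d (tau y)).
 exact: sumZ_swap.
rewrite -!sumrB -big_split; sumr d => /=.
rewrite -!sumrB -big_split; sumr e => /=.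
by rewrite curvdE -!scalerBr -scalerDr.
Qed.

Lemma riem_tr a b y : V y -> riem gt a b y =
 jac y *m (\sum_d \sum_e (jac y a d * jac y b e) *: riem g d e (tau y)) *m (jac y)^T.
Proof.
move=> Vy; rewrite riemdE (cc_metric cc Vy) !mulmxA curv_tr// -!mulmxA; congr (_ *m _).
rewrite mulmxA; congr (_ *m _); rewrite mulmx_suml; sumr d.
by rewrite mxsumZl; sumr e; rewrite riemdE.
Qed.

Lemma grad_tr F y : smooth_on U F -> V y -> grad (fun z => F (tau z)) y = jac y *m grad F (tau y).
Proof.
move=> sF Vy; apply/matrixP => i j; rewrite !mxE.
have [_ ->] := derive_comp_row i oV oU (fun c => st c 1) (sF 1) Vy (cc_map cc Vy).
by sumr c; rewrite !mxE.
Qed.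

Lemma hessm_tr F y : smooth_on U F -> V y ->
 hessm gt (fun z => F (tau z)) y = jac y *m hessm g F (tau y) *m (jac y)^T.
Proof.
move=> sF Vy; apply/matrixP => i j.
rewrite hessmE (cov1_tr i (smooth_grad lm sF) (fun z Vz => grad_tr sF Vz) Vy).
rewrite -mulmxA mxmulE mxmulE.
under [RHS]eq_bigr do rewrite mxmulE mulr_sumr.
sumx c => /=; rewrite summxE mulr_sumr.
by sumr d; rewrite mxscaleE hessmE mxtrE mulrC mulrA.
Qed.

Lemma ricm_tr y : V y -> ricm gt y = jac y *m ricm g (tau y) *m (jac y)^T.
Proof.
move=> Vy; have Ju := cc_jac cc Vy.
have cE a b : curv gt a b y = jac y *m (\sum_d \sum_e (jac y a d * jac y b e) *: curv g d e (tau y)) *m invmx (jac y).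
 by rewrite -curv_tr// mulmxK.
apply/matrixP => i j; rewrite ricmE.
pose J := jac y; pose I := invmx J.
pose C d e p q := curv g d e (tau y) p q.
transitivity (\sum_k \sum_q \sum_p J j p * (\sum_d \sum_e J k d * J i e * C d e p q) * I q k).
 sumr k; rewrite cE mxmulE; sumr q.
 rewrite mxmulE mulr_suml; sumr p; congr (_ * _ * _).
 rewrite summxE; sumr d; rewrite summxE; sumr e.
 by rewrite mxscaleE.
have IJ q d : \sum_k I q k * J k d = (q == d)%:R by rewrite -mxmulE mulVmx// mxE.
transitivity (\sum_q \sum_p \sum_d \sum_e J j p * J i e * C d e p q * \sum_k I q k * J k d).
 sumx q; sumx p => /=.
 under eq_bigr do rewrite mulr_sumr mulr_suml.
 sumx d => /=.
 under eq_bigr do rewrite mulr_sumr mulr_suml.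
 sumx e => /=; rewrite mulr_sumr; sumr k.
 by ring.
transitivity (\sum_q \sum_p \sum_e J j p * J i e * C q e p q).
 sumr q p.
 transitivity (\sum_d (q == d)%:R * \sum_e J j p * J i e * C d e p q); last by rewrite mul_delta_sum.
 sumr d; rewrite mulr_sumr; sumr e; rewrite IJ mulrC//.
rewrite -mulmxA mxmulE exchange_big.
under eq_bigr do rewrite exchange_big /=.
sumx e => /=; rewrite mxmulE mulr_sumr; sumr p.
rewrite mxtrE ricmE mulr_suml mulr_sumr; sumr q; rewrite -/J /C; ring.
Qed.

(** The coefficients $J_i^d J_j^e$ of the transformed curvature are themselves functions; their
    derivatives cancel against the inhomogeneous part of the connection in the slots [i] and [j],
    while [cov2_gauge] handles the other two slots. *)
Lemma nriem_tr a i j y : V y -> nriem gt a i j y =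
 jac y *m (\sum_c \sum_d \sum_e (jac y a c * jac y i d * jac y j e) *: nriem g c d e (tau y)) *m (jac y)^T.
Proof.
move=> Vy; rewrite nriemdE.
pose X i j z := \sum_d \sum_e (jac z i d * jac z j e) *: riem g d e (tau z).
have sr d e := smooth_comp_mx (smooth_riem lm d e).
have sJJ k l d e : smooth_on V (fun z => jac z k d * jac z l e).
 by move=> m; apply: CkM => //; exact: smooth_jac.
have sX k l : smx V (X k l).
 apply: smx_sum => // d _; apply: smx_sum => // e _; exact: smxZ.
rewrite (cov2_gauge a (sX i j) (fun z Vz => riem_tr i j Vz) Vy).
pose W1 := \sum_p conn gt a y i p *: X p j y.
pose W2 := \sum_p conn gt a y j p *: X i p y.
transitivity (jac y *m (dmx a (X i j) y - kp a y *m X i j y - X i j y *m (kp a y)^T) *m (jac y)^T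
 - jac y *m W1 *m (jac y)^T - jac y *m W2 *m (jac y)^T).
 congr (_ - _ - _).
  by rewrite mxsumZr mxsumZl; sumr p; congr (_ *: _); exact: riem_tr.
 by rewrite mxsumZr mxsumZl; sumr p; congr (_ *: _); exact: riem_tr.
rewrite conjB3; congr (_ *m _ *m _).
have KJ k d : \sum_p conn gt a y k p * jac y p d =
  dmx a jac y k d + \sum_q \sum_c jac y k q * (jac y a c * conn g c (tau y) q d).
 rewrite -mxmulE conn_tr// mxaddE mxmulE; congr (_ + _); sumr q.
 by rewrite /kp summxE mulr_sumr; sumr c; rewrite mxscaleE.
(* Splits a connection correction by the transformation law: derivative of the Jacobian first,
   tensorial part second. It is stated for the first slot of [B]; the second slot follows by
   swapping the sums. *)
have EW k (v : 'I_n -> R) (B : 'I_n -> 'I_n -> 'M[R]_n) :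
  \sum_p conn gt a y k p *: \sum_d \sum_e (jac y p d * v e) *: B d e =
  \sum_d \sum_e (dmx a jac y k d * v e) *: B d e +
  \sum_c \sum_d \sum_e (jac y a c * jac y k d * v e) *: \sum_p conn g c (tau y) d p *: B p e.
 transitivity (\sum_d \sum_e ((\sum_p conn gt a y k p * jac y p d) * v e) *: B d e).
  under eq_bigr do rewrite scaler_sumr.
  sumx d; under eq_bigr do rewrite scaler_sumr.
  sumx e; rewrite mulr_suml scaler_suml.
  by sumr p; rewrite scalerA mulrA.
 transitivity (\sum_d \sum_e (dmx a jac y k d * v e) *: B d e +
   \sum_p \sum_e \sum_d \sum_c (jac y k d * (jac y a c * conn g c (tau y) d p) * v e) *: B p e).
  rewrite -big_split; sumr d => /=; rewrite -big_split; sumr e => /=.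
  rewrite KJ mulrDl scalerDl; congr (_ + _); rewrite mulr_suml scaler_suml.
  by sumr q; rewrite mulr_suml scaler_suml.
 congr (_ + _); rewrite sum4_rev; sumr c d; sumr e.
 rewrite scaler_sumr; sumr p; rewrite scalerA; congr (_ *: _); ring.
have E1 : W1 = \sum_d \sum_e (dmx a jac y i d * jac y j e) *: riem g d e (tau y) +
  \sum_c \sum_d \sum_e (jac y a c * jac y i d * jac y j e) *: \sum_p conn g c (tau y) d p *: riem g p e (tau y).
 exact: EW.
have E2 : W2 = \sum_d \sum_e (jac y i d * dmx a jac y j e) *: riem g d e (tau y) +
  \sum_c \sum_d \sum_e (jac y a c * jac y i d * jac y j e) *: \sum_p conn g c (tau y) e p *: riem g d p (tau y).
 rewrite /W2 /X; under eq_bigr do rewrite sumZ_swap.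
 have EQ := EW j (jac y i) (fun d e => riem g e d (tau y)).
 refine (etrans EQ _).
 refine (f_equal2 (fun P Q : 'M[R]_n => P + Q) _ _); last sumr c.
  exact: (sumZ_swap _ _ (fun d e => riem g e d (tau y))).
 rewrite [LHS]exchange_big; sumr d e; exact: (f_equal (fun z => z *: _) (mulrAC _ _ _)).
have E0 : dmx a (X i j) y = \sum_d \sum_e (dmx a jac y i d * jac y j e) *: riem g d e (tau y) +
 \sum_d \sum_e (jac y i d * dmx a jac y j e) *: riem g d e (tau y) +
 \sum_d \sum_e (jac y i d * jac y j e) *: \sum_c jac y a c *: dmx c (riem g d e) (tau y).
 rewrite /X (dmx_sum Vy) => [|d _]; last by apply: smx_sum => // e _; exact: smxZ.
 rewrite -!big_split; sumr d => /=.
 rewrite (dmx_sum Vy) => [|e _]; last exact: smxZ.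
 rewrite -!big_split; sumr e => /=.
 rewrite (dmxZ Vy a (sJJ i j d e) (sr d e)) dmx_tau//; last exact: (smooth_riem lm).
 rewrite -scalerDl; congr (_ *: _ + _).
 have dJ k l : derivable (fun z => jac z k l) y (bv a) by exact: smooth_der (smooth_jac k l) Vy.
 have pJ k l : partial a (fun z => jac z k l) y = dmx a jac y k l by exact: dmx_pd.
 by rewrite partialM// !pJ.
rewrite E0 E1 E2.
have E3 : \sum_d \sum_e (jac y i d * jac y j e) *: (\sum_c jac y a c *: dmx c (riem g d e) (tau y))
  - kp a y *m X i j y - X i j y *m (kp a y)^T =
  \sum_c \sum_d \sum_e (jac y a c * jac y i d * jac y j e) *: cov2 g c (riem g d e) (tau y).
 rewrite /X mulmx_sumr mulmx_suml -!sumrB.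
 rewrite [RHS]exchange_big; sumr d => /=.
 rewrite mxsumZr mxsumZl -!sumZB [RHS]exchange_big; sumr e => /=.
 rewrite /kp trmx_sumZ mxsumZl mxsumZr -!sumZB scaler_sumr; sumr c.
 by rewrite scalerA -cov2E; congr (_ *: _); ring.
have -> : \sum_c \sum_d \sum_e (jac y a c * jac y i d * jac y j e) *: nriem g c d e (tau y) =
 \sum_c \sum_d \sum_e (jac y a c * jac y i d * jac y j e) *: cov2 g c (riem g d e) (tau y)
 - \sum_c \sum_d \sum_e (jac y a c * jac y i d * jac y j e) *: \sum_p conn g c (tau y) d p *: riem g p e (tau y)
 - \sum_c \sum_d \sum_e (jac y a c * jac y i d * jac y j e) *: \sum_p conn g c (tau y) e p *: riem g d p (tau y).
 rewrite -!sumrB; sumr c; rewrite -!sumrB; sumr d.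
 by rewrite -!sumZB; sumr e; rewrite nriemdE.
rewrite -E3.
have alg (P A B M1 M2 C D : 'M[R]_n) : A + B + P - M1 - M2 - (A + C) - (B + D) = P - M1 - M2 - C - D.
 by apply/matrixP => r s; rewrite !mxE; ring.
exact: alg.
Qed.

End Transformation.

(** * Orthonormal frames and normal coordinates *)
Section Frames.
Context {R : realType}.

Definition posdef n (G : 'M[R]_n) := forall v : 'rV[R]_n, v != 0 -> 0 < (v *m G *m v^T) 0 0.

Lemma posdef_unit n (G : 'M[R]_n) : posdef G -> G \in unitmx.
Proof.
move=> pG; rewrite -row_free_unit; apply/inj_row_free => v vG.
by apply/eqP/negP => /negP/pG; rewrite vG mul0mx mxE ltxx.
Qed.

(* Gram-Schmidt in block form: the Schur complement of the corner entry is again positive definite. *)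
Lemma orthoframe n (G : 'M[R]_n) : G^T = G -> posdef G ->
 exists E : 'M[R]_n, E *m G *m E^T = 1%:M.
Proof.
elim: n G => [|n IH] G sG pG; first by exists 1%:M; apply/matrixP => -[].
pose G' : 'M[R]_(1 + n) := G.
have sG' : G'^T = G' by exact: sG.
pose a := G' 0 0.
pose b : 'rV[R]_n := ursubmx G'.
pose C := drsubmx G'.
have GE : G' = block_mx a%:M b b^T C.
 rewrite -[LHS]submxK; congr block_mx.
  by apply/matrixP => i j; rewrite !ord1 !mxE; congr (G _ _); apply/val_inj.
 by rewrite -[LHS]trmxK trmx_dlsub sG'.
have sC : C^T = C by rewrite /C trmx_drsub sG'.
have a0 : 0 < a.
 have := pG (delta_mx 0 0); rewrite -rowE -[(delta_mx 0 0)^T]trmxK trmx_delta trmxK.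
 rewrite -colE !mxE; apply.
 by apply/eqP => /matrixP/(_ 0 0); rewrite !mxE !eqxx => /eqP; rewrite oner_eq0.
have an0 : a != 0 by rewrite gt_eqF.
pose C' := C - a^-1 *: (b^T *m b).
have [||E EE] := IH C'.
- by rewrite /C' linearB /= linearZ /= trmx_mul trmxK sC.
- move=> v v0.
 pose w : 'rV[R]_(1 + n) := row_mx (- (a^-1 *: (v *m b^T))) v.
 have w0 : w != 0.
  by apply: contraNneq v0 => /(congr1 rsubmx); rewrite row_mxKr => ->; rewrite linear0.
 have pw : 0 < (w *m G' *m w^T) 0 0 by exact: pG.
 move: pw; rewrite GE /w mul_row_block tr_row_mx mul_row_col.
 rewrite mul_mx_scalar scalerN scalerA divff// scale1r addNr mul0mx add0r.
 by rewrite /C' mulmxBr mulNmx -scalemxAl -scalemxAr mulmxA [X in _ < (X *m _) _ _ -> _]addrC.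
pose s := Num.sqrt a.
have s0 : 0 < s by rewrite sqrtr_gt0.
have ss : s * s = a by rewrite -expr2 sqr_sqrtr// ltW.
have sn0 : s != 0 by rewrite gt_eqF.
pose M : 'M[R]_(1 + n) := block_mx (s^-1)%:M 0 (- (a^-1 *: (E *m b^T))) E.
have MG : M *m G' = block_mx (s^-1 * a)%:M (s^-1 *: b) 0 (E *m C').
 rewrite /M GE mulmx_block -scalar_mxM !mul0mx !addr0 mul_scalar_mx; congr block_mx.
  by rewrite mul_mx_scalar scalerN scalerA divff// scale1r addNr.
 by rewrite /C' mulmxBr mulNmx -scalemxAl -scalemxAr mulmxA addrC.
have MT : M^T = block_mx (s^-1)%:M (- (a^-1 *: (b *m E^T))) 0 E^T.
 by rewrite /M tr_block_mx tr_scalar_mx linear0 linearN /= linearZ /= trmx_mul trmxK.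
exists M; suff : M *m G' *m M^T = 1%:M by [].
rewrite MG MT mulmx_block !mul0mx !mulmx0 -scalar_mxM !addr0 add0r EE.
have -> : s^-1 * a * s^-1 = 1 by rewrite -ss mulrA mulVf// mul1r mulfV.
rewrite mul_scalar_mx scalerN scalerA -mulrA mulfV// mulr1 -scalemxAl addNr.
by rewrite -(@scalar_mx_block R 1 n 1).
Qed.
End Frames.

Section NormalCoordinates.
Context {R : realType} {n : nat}.
Local Notation rV := 'rV[R]_n.
Variables (U : set rV) (g : rV -> 'M[R]_n).
Hypothesis lm : local_metric U g.
Variables (x0 : rV) (Ux0 : U x0) (E : 'M[R]_n).
Hypothesis EgE : E *m g x0 *m E^T = 1%:M.

(** The Christoffel symbols at [x0] with the frame inserted in their lower indices: row [b] of [Q a]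
    is $\Gamma(E_a, E_b)$. *)
Let Q (a : 'I_n) : 'M[R]_n := \sum_d E a d *: (E *m conn g d x0).

Let QE a b c : Q a b c = \sum_d \sum_e E a d * E b e * conn g d x0 e c.
Proof.
rewrite /Q summxE; sumr d; rewrite mxscaleE mxmulE mulr_sumr.
by sumr e; rewrite mulrA.
Qed.

Let Qsym a b c : Q a b c = Q b a c.
Proof.
rewrite !QE exchange_big; sumr e d => /=.
by rewrite (conn_sym lm d e c Ux0) [E a d * _]mulrC.
Qed.

(* The quadratic correction makes the new Christoffel symbols vanish at the origin. *)
Definition nmap (z : rV) : rV :=
 x0 + z *m E - 2^-1 *: \sum_a z 0 a *: (z *m Q a).

Lemma normal_mapE z c : nmap z 0 c =
 x0 0 c + \sum_b z 0 b * E b c - 2^-1 * \sum_a \sum_b z 0 a * (z 0 b * Q a b c).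
Proof.
rewrite /nmap mxsubE mxaddE mxmulE mxscaleE summxE; congr (_ - _ * _).
by sumr a; rewrite mxscaleE mxmulE mulr_sumr.
Qed.

Lemma smooth_normal_map c : smooth_on setT (fun z => nmap z 0 c).
Proof.
have oT := @openT 'rV[R]_n.
move=> k; under eq_fun do rewrite normal_mapE.
apply: CkB => //.
 apply: CkD => //; first exact: Ck_cst.
 by apply: Ck_sum => // b _; apply: CkM => //; [exact: Ck_coord|exact: Ck_cst].
apply: CkM => //; first exact: Ck_cst.
apply: Ck_sum => // a _; apply: Ck_sum => // b _; apply: CkM => //; first exact: Ck_coord.
by apply: CkM => //; [exact: Ck_coord|exact: Ck_cst].
Qed.

Lemma dmx_id a (z : rV) : dmx a id z = bv a.
Proof.
apply/matrixP => i c; rewrite -dmx_pd ord1 partial_coord.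
by rewrite mxE eqxx eq_sym.
Qed.

Lemma jac_normal_map z : jac nmap z = E - \sum_a z 0 a *: Q a.
Proof.
have oT := @openT rV; have Tz : [set: rV] z by [].
have sid : smx setT (id : rV -> rV) by move=> i c k; rewrite ord1; exact: Ck_coord.
have scst p q (A : 'M[R]_(p, q)) : smx setT (fun _ : rV => A) by move=> i c k; exact: Ck_cst.
have szA (A : 'M[R]_n) : smx setT (fun z : rV => z *m A) by exact: smxM.
have szz b : smx setT (fun z : rV => z 0 b *: (z *m Q b)).
 by apply: smxZ => // k; exact: Ck_coord.
have dzA a (A : 'M[R]_n) : dmx a (fun z : rV => z *m A) z = row a A.
 by rewrite (dmxM Tz a sid (scst _ _ A)) dmx_id dmx_cst mulmx0 addr0 rowE.
have s1 : smx setT (fun z : rV => x0 + z *m E) by exact: smxD.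
have sS : smx setT (fun z : rV => \sum_a z 0 a *: (z *m Q a)).
 by apply: smx_sum => // a _.
have s2' : smooth_on setT (fun _ : rV => 2^-1 : R) by move=> k; exact: Ck_cst.
have s2 : smx setT (fun z : rV => 2^-1 *: \sum_a z 0 a *: (z *m Q a)) by exact: smxZ.
have D a : dmx a nmap z = row a E - \sum_b z 0 b *: row a (Q b).
 have -> : dmx a nmap z = dmx a (fun z => x0 + z *m E) z - dmx a (fun z => 2^-1 *: \sum_a z 0 a *: (z *m Q a)) z.
  exact: (dmxB oT Tz a s1 s2).
 rewrite (dmxD Tz a (scst _ _ x0) (szA E)) dmx_cst add0r dzA; congr (_ - _).
 rewrite (dmxZ Tz a s2' sS) partial_cst scale0r add0r (dmx_sum Tz) => [|b _]; last exact: szz.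
 have -> : \sum_b dmx a (fun z : rV => z 0 b *: (z *m Q b)) z =
  \sum_b ((a == b)%:R *: (z *m Q b) + z 0 b *: row a (Q b)).
  sumr b; have sb : smooth_on setT (fun z : rV => z 0 b) by move=> k; exact: Ck_coord.
  by rewrite (dmxZ Tz a sb (szA (Q b))) partial_coord dzA.
 (* Symmetry of [Q] makes the two terms of the product rule equal, which compensates the factor 1/2
    in the map. *)
 have e : z *m Q a = \sum_b z 0 b *: row a (Q b).
  rewrite mulmx_sum_row; sumr b; congr (_ *: _).
  by apply/rowP => c; rewrite !mxE -/(Q a b c) -/(Q b a c).
 rewrite big_split /= (bigD1 a)//= eqxx scale1r big1 ?addr0 => [|b]; last first.
  by rewrite eq_sym => /negbTE ->; rewrite scale0r.
 have half (v : rV) : 2^-1 *: (v + v) = v by apply/rowP => c; rewrite !mxE; lra.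
 by rewrite e half.
apply/matrixP => b c; rewrite mxE dmx_pd D mxsubE [in RHS]mxsubE summxE [in RHS]summxE mxE.
by congr (_ - _); sumr d; rewrite !mxscaleE mxE.
Qed.

Definition normal_dom : set rV := [set z | U (nmap z) /\ \det (jac nmap z) != 0].

Definition normal_metric (z : rV) : 'M[R]_n :=
 jac nmap z *m g (nmap z) *m (jac nmap z)^T.

Lemma smooth_jac_normal : smx setT (jac nmap).
Proof.
move=> a c; apply: smooth_eq (smooth_partial a (smooth_normal_map c)) => [|y _]; first exact: openT.
by rewrite mxE.
Qed.

Lemma normal_dom_open : open normal_dom.
Proof.
have cm : continuous nmap.
 by move=> z; apply: ct_row => c; exact: (Ck_cts (smooth_normal_map c 0)).
have cd : continuous (fun z => \det (jac nmap z)).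
 by move=> z; exact: (Ck_cts (smooth_det openT smooth_jac_normal 0)).
apply: openI.
 by apply: open_comp (lm_open lm) => z _; exact: cm.
by apply: (@open_comp _ _ (fun z => \det (jac nmap z)) [set r : R | r != 0]); [move=> z _; exact: cd|exact: open_neq].
Qed.

Lemma jac_normal0 : jac nmap 0 = E.
Proof.
by rewrite jac_normal_map big1 ?subr0// => a _; rewrite mxE scale0r.
Qed.

Lemma normal_map0 : nmap 0 = x0.
Proof.
by rewrite /nmap mul0mx addr0 big1 ?scaler0 ?subr0// => a _; rewrite mxE scale0r.
Qed.

Lemma frame_unit : E \in unitmx.
Proof. by have [] := mulmx1_unit EgE; rewrite unitmx_mul => /andP[]. Qed.

Lemma normal_dom0 : normal_dom 0.
Proof.
split; first by rewrite normal_map0.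
by rewrite jac_normal0 -unitfE; exact: frame_unit.
Qed.

Lemma normal_change : coord_change U normal_dom g normal_metric nmap.
Proof.
split; first exact: normal_dom_open.
- by move=> c; apply: smooth_sub (smooth_normal_map c).
- by move=> y [].
- by move=> y [_ d0]; rewrite unitmxE unitfE.
- by [].
Qed.

Lemma normal_metric0 : normal_metric 0 = 1%:M.
Proof. by rewrite /normal_metric normal_map0 jac_normal0. Qed.

(** At the origin the Jacobian has derivative [- Q a], which cancels the pulled-back connection in
    the transformation law; the Jacobian itself is the invertible matrix [E]. *)
Lemma conn_normal0 a : conn normal_metric a 0 = 0.
Proof.
have := conn_tr lm normal_change a normal_dom0; rewrite jac_normal0.
have -> : dmx a (jac nmap) 0 = - Q a.
 apply/matrixP => b c; rewrite -dmx_pd mxoppE.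
 have -> : (fun z => jac nmap z b c) = (fun z => E b c - \sum_d z 0 d * Q d b c).
  by fext z; rewrite jac_normal_map mxsubE summxE; congr (_ - _); sumr d; rewrite mxscaleE.
 have dk (r : R) : derivable (fun _ : rV => r) 0 (bv a) by exact: derivable_cst.
 have dc j : derivable (fun z : rV => z 0 j * Q j b c) 0 (bv a).
  by apply: derivableM => //; apply: diff_derivable; exact: differentiable_coord.
 rewrite partialB//; last first.
  by case: (derivable_sumr (index_enum _) (P := xpredT) (fun i _ => dc i)).
 rewrite partial_cst sub0r partial_sum//; congr (- _).
 rewrite -[RHS](mul_delta_sum (fun d => Q d b c)); sumr d.
 rewrite partialM ?partial_coord ?partial_cst ?mulr0 ?addr0//.
 by apply: diff_derivable; exact: differentiable_coord.
have -> : E *m kp g nmap a 0 = Q a.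
 rewrite /kp jac_normal0 normal_map0 mxsumZr; exact: eq_bigr.
rewrite addNr => e0.
by rewrite -[LHS](mulmxK frame_unit) e0 mul0mx.
Qed.

End NormalCoordinates.

(** * Symmetries of the curvature tensor *)
(** A linear combination of the four Bianchi identities on [a], [b], [c], [d]. The rewriting fixes
    representatives modulo the two skew symmetries, so that linear arithmetic finds it. *)
Lemma pair_symmetry (R : realFieldType) (I : Type) (r : I -> I -> I -> I -> R) :
 (forall a b c d, r a b c d = - r b a c d) -> (forall a b c d, r a b c d = - r a b d c) ->
 (forall a b c d, r a b c d + r b c a d + r c a b d = 0) ->
 forall a b c d, r a b c d = r c d a b.
Proof.
move=> s1 s2 b1 a b c d.
have := b1 a b c d; have := b1 b c d a; have := b1 c d a b; have := b1 d a b c.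
rewrite (s1 a b d c) (s2 b a d c) (s2 b c d a) (s1 c a b d) (s2 a c b d) (s1 a c d b) (s2 c a d b).
rewrite (s2 c d b a) (s1 d b c a) (s2 b d c a) (s1 b d a c) (s2 d b a c) (s2 d a c b) (s2 c d a b) (s2 a b c d).
rewrite ?(s1 a c b d) ?(s1 d b c a) ?(s1 d a b c) ?(s1 c b a d) ?(s1 b a c d) ?opprK.
have := s1 a b c d; have := s2 a b c d; have := s2 a b d c; have := s1 c d a b; have := s2 c d a b.
have := s1 c d b a; have := s1 a d b c; have := s2 a d b c; have := s1 b c a d; have := s2 b c a d.
have := s2 b c d a; have := s2 a d c b; have := s1 a c b d; have := s2 a c b d; have := s2 c a b d.
have := s1 b d a c; have := s2 b d a c; have := s2 d b a c; have := s1 d a b c; have := s2 d a b c.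
have := s1 a c d b; have := s1 b d c a; have := s1 d a c b; have := s1 c b a d.
lra.
Qed.

Section CurvatureSymmetries.
Context {R : realType} {n : nat}.
Variables (U : set 'rV[R]_n) (g : 'rV[R]_n -> 'M[R]_n).
Hypothesis lm : local_metric U g.
Let oU := lm_open lm.

Lemma curv_skew a b x : curv g b a x = - curv g a b x.
Proof.
rewrite !curvdE.
have alg (p q r s : 'M[R]_n) : q - p - s + r = - (p - q - r + s) by apply/matrixP => i j; rewrite !mxE; ring.
exact: alg.
Qed.

Lemma riem_skew a b k l x : riem g a b x k l = - riem g b a x k l.
Proof. by rewrite -mxoppE !riemdE curv_skew mulNmx. Qed.

(** Second derivatives of the metric commute; inserting metric compatibility twice leaves exactly
    the lowered curvature and its transpose. *)
Lemma riem_skewT a b x : U x -> (riem g a b x)^T = - riem g a b x.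
Proof.
move=> Ux; have sg := lm_smooth lm; have sc := smooth_conn lm.
pose K c := conn g c x; pose dK c d := dmx c (conn g d) x.
have D c d : dmx c (dmx d g) x = dK c d *m g x + K d *m (K c *m g x + g x *m (K c)^T)
  + ((K c *m g x + g x *m (K c)^T) *m (K d)^T + g x *m (dK c d)^T).
 have -> : dmx c (dmx d g) x = dmx c (fun z => conn g d z *m g z + g z *m (conn g d z)^T) x.
  by apply: (dmx_eq _ oU _ Ux) => z; exact: conn_compat.
 rewrite (dmxD Ux c (smxM oU (sc d) sg) (smxM oU sg (smxT oU (sc d)))).
 by rewrite (dmxM Ux c (sc d) sg) (dmxM Ux c sg (smxT oU (sc d))) dmxT -/(dK c d) (conn_compat lm c Ux).
have E := dmxC oU Ux a b sg; rewrite !D in E.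
have sgx := lm_sym lm Ux.
rewrite riemdE curvdE -/(K a) -/(K b) -/(dK a b) -/(dK b a).
have alg (G Ka Kb P Q : 'M[R]_n) : G^T = G ->
 P *m G + Kb *m (Ka *m G + G *m Ka^T) + ((Ka *m G + G *m Ka^T) *m Kb^T + G *m P^T) =
 Q *m G + Ka *m (Kb *m G + G *m Kb^T) + ((Kb *m G + G *m Kb^T) *m Ka^T + G *m Q^T) ->
 ((P - Q - Ka *m Kb + Kb *m Ka) *m G)^T = - ((P - Q - Ka *m Kb + Kb *m Ka) *m G).
 move=> sG; have lin (X Y Z W : 'M[R]_n) : (X - Y - Z + W)^T = X^T - Y^T - Z^T + W^T by apply/matrixP => i j; rewrite !mxE.
 rewrite trmx_mul sG lin !trmx_mul !(mulmxDl, mulmxDr, mulmxBl, mulmxBr, mulNmx, mulmxN, mulmxA).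
 move: (P *m G) (Kb *m Ka *m G) (Kb *m G *m Ka^T) (Ka *m G *m Kb^T) (G *m Ka^T *m Kb^T) (G *m P^T).
 move: (Q *m G) (Ka *m Kb *m G) (G *m Kb^T *m Ka^T) (G *m Q^T).
 move=> A1 A2 A3 A4 A5 A6 A7 A8 A9 A0 e; apply/matrixP => i j; move/matrixP/(_ i j): e.
 by rewrite !mxE => e; lra.
exact: alg sgx E.
Qed.

Lemma riem_skew2 a b k l x : U x -> riem g a b x k l = - riem g a b x l k.
Proof. by move=> Ux; rewrite -[LHS]mxtrE riem_skewT// mxoppE. Qed.

(** The derivative terms and the quadratic terms cancel pairwise in the cyclic sum, because
    Christoffel symbols are symmetric in their lower indices. *)
Lemma curv_bianchi a b c l x : U x -> curv g a b x c l + curv g b c x a l + curv g c a x b l = 0.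
Proof.
move=> Ux.
have dK p q r : dmx p (conn g q) x r l = dmx p (conn g r) x q l.
 have cs y (Uy : U y) : conn g q y r l = conn g r y q l by exact: (conn_sym lm q r l Uy).
 exact: (etrans (esym (dmx_pd p (conn g q) x r l))
  (etrans (pd_eq_on p oU cs Ux) (dmx_pd p (conn g r) x q l))).
have KK p q r : (conn g p x *m conn g q x) r l = (conn g r x *m conn g q x) p l.
 by apply: mulmx_row_eq => k; exact: (conn_sym lm).
have E p q r : curv g p q x r l = dmx p (conn g q) x r l - dmx q (conn g p) x r l
 - (conn g p x *m conn g q x) r l + (conn g q x *m conn g p x) r l.
 rewrite curvdE; have alg (A B C D : 'M[R]_n) i j : (A - B - C + D) i j = A i j - B i j - C i j + D i j by rewrite !mxE.
 exact: alg.
have alg (c1 c2 c3 p1 p2 p3 p4 p5 p6 m1 m2 m3 m4 m5 m6 : R) :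
 c1 = p1 - p2 - m1 + m2 -> c2 = p3 - p4 - m3 + m4 -> c3 = p5 - p6 - m5 + m6 ->
 p1 = p6 -> p2 = p3 -> p4 = p5 -> m1 = m4 -> m2 = m5 -> m3 = m6 -> c1 + c2 + c3 = 0.
 by move=> -> -> -> -> -> -> -> -> ->; ring.
exact: alg (E a b c) (E b c a) (E c a b) (dK a b c) (dK b a c) (dK c b a) (KK a b c) (KK b a c) (KK b c a).
Qed.

Lemma riem_bianchi a b c l x : U x -> riem g a b x c l + riem g b c x a l + riem g c a x b l = 0.
Proof.
move=> Ux; rewrite (riemdE g a b) (riemdE g b c) (riemdE g c a).
have alg (A B C G : 'M[R]_n) : (forall k, A c k + B a k + C b k = 0) ->
  (A *m G) c l + (B *m G) a l + (C *m G) b l = 0.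
 move=> e; rewrite !mxE -!big_split big1// => k _ /=.
 by rewrite -!mulrDl e mul0r.
by apply: alg => k; exact: curv_bianchi.
Qed.

Lemma riem_pair a b c d x : U x -> riem g a b x c d = riem g c d x a b.
Proof.
move=> Ux; apply: (pair_symmetry (r := fun a b c d => riem g a b x c d)) => *.
- exact: riem_skew.
- exact: riem_skew2.
- exact: riem_bianchi.
Qed.

End CurvatureSymmetries.

(** * Shrinking solitons in one chart *)

Section LocalSoliton.
Context {R : realType} {n : nat}.
Local Notation rV := 'rV[R]_n.

Record local_soliton (U : set rV) (g : rV -> 'M[R]_n) (F : rV -> R) : Prop := LocalSoliton {
 ls_metric : local_metric U g;
 ls_smooth : smooth_on U F;
 ls_eq : forall x, U x -> ricm g x = 2^-1 *: g x - hessm g F x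
}.

Definition dric (g : rV -> 'M[R]_n) (a : 'I_n) (x : rV) : 'M[R]_n := cov2 g a (ricm g) x.

Lemma soliton_change U V g gt tau F : coord_change U V g gt tau -> local_soliton U g F ->
 local_soliton V gt (fun z => F (tau z)).
Proof.
move=> cc ls; have lm := ls_metric ls; split.
- exact: new_metric lm cc.
- exact: (smooth_comp (cc_open cc) (lm_open lm) (cc_smooth cc) (ls_smooth ls) (cc_map cc)).
- move=> y Vy; rewrite (ricm_tr lm cc Vy) (ls_eq ls (cc_map cc Vy)) (hessm_tr lm cc (ls_smooth ls) Vy).
 by rewrite (cc_metric cc Vy) mulmxBr mulmxBl -scalemxAr -scalemxAl.
Qed.

Variables (U : set rV) (g : rV -> 'M[R]_n) (F : rV -> R).
Hypothesis ls : local_soliton U g F.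
Let lm := ls_metric ls.
Let oU := lm_open lm.

Lemma ricm_sym x : U x -> (ricm g x)^T = ricm g x.
Proof.
move=> Ux; rewrite (ls_eq ls Ux) linearB /= linearZ /= (lm_sym lm Ux).
by rewrite (hessm_sym lm (ls_smooth ls) Ux).
Qed.

(** The metric is parallel, so only the Hessian in the soliton equation contributes. *)
Lemma dricE a x : U x -> dric g a x = - cov2 g a (hessm g F) x.
Proof.
move=> Ux; rewrite /dric cov2E.
have sN := smooth_hessm lm (ls_smooth ls); have sg := lm_smooth lm.
have c2 : smooth_on U (fun _ : rV => 2^-1 : R) by move=> k; exact: Ck_cst.
have -> : dmx a (ricm g) x = 2^-1 *: dmx a g x - dmx a (hessm g F) x.
 have -> : dmx a (ricm g) x = dmx a (fun z => 2^-1 *: g z - hessm g F z) x.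
  by apply: (dmx_eq _ oU _ Ux) => z; exact: ls_eq.
 by rewrite (dmxB oU Ux a (smxZ oU c2 sg) sN) (dmxZ Ux a c2 sg) partial_cst scale0r add0r.
rewrite (ls_eq ls Ux) (conn_compat lm a Ux) cov2E.
have alg (K G N dN : 'M[R]_n) : 2^-1 *: (K *m G + G *m K^T) - dN - K *m (2^-1 *: G - N) - (2^-1 *: G - N) *m K^T
 = - (dN - K *m N - N *m K^T).
 rewrite mulmxBr mulmxBl -scalemxAr -scalemxAl.
 by move: (K *m G) (G *m K^T) (K *m N) (N *m K^T) => *; apply/matrixP => i j; rewrite !mxE; ring.
exact: alg.
Qed.

Lemma dric_sym a x : U x -> (dric g a x)^T = dric g a x.
Proof.
move=> Ux; rewrite /dric cov2E.
rewrite !linearB /= !trmx_mul !trmxK (ricm_sym Ux) addrAC.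
congr (_ - _ - _).
by rewrite -dmxT; apply: (dmx_eq _ oU _ Ux) => z Uz; rewrite ricm_sym.
Qed.

Lemma smooth_dric a : smx U (dric g a).
Proof. exact: smooth_cov2 (smooth_ricm lm). Qed.

(** Since $\nabla Ric = -\nabla\nabla\nabla f$, skew-symmetrising the two outer derivatives of the
    covector $df$ produces the curvature; the corrections for the index of the inner derivative are
    symmetric and cancel. *)
Lemma ricci_identity a b k x : U x ->
 dric g a x b k - dric g b x a k = \sum_l curv g a b x k l * grad F x l 0.
Proof.
move=> Ux; have sw := smooth_grad lm (ls_smooth ls); have sc := smooth_conn lm.
pose nn c z := cov1 g c (grad F) z.
have cov2N c d : cov2 g c (hessm g F) x d k = cov1 g c (nn d) x k 0 - \sum_p conn g c x d p * nn p x k 0.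
 rewrite cov2E cov1E.
 have alg (A B C : 'M[R]_n) i j : (A - B - C) i j = A i j - B i j - C i j by rewrite !mxE.
 have alg1 (A B : 'cV[R]_n) i j : (A - B) i j = A i j - B i j by rewrite !mxE.
 rewrite alg alg1 !mxmulE -!dmx_pd.
 have -> : (fun z => hessm g F z d k) = (fun z => nn d z k 0) by fext z; exact: hessmE.
 rewrite addrAC; congr (_ - _ - _).
  by sumr p; rewrite mxtrE hessmE mulrC.
 by sumr p; rewrite hessmE.
have dE c d : dric g c x d k = - (cov1 g c (nn d) x k 0 - \sum_p conn g c x d p * nn p x k 0).
 by rewrite (dricE c Ux) mxoppE cov2N.
have key : cov1 g b (nn a) x - cov1 g a (nn b) x = curv g a b x *m grad F x.
 have dn c d : dmx c (nn d) x = dmx c (dmx d (grad F)) x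
  - (dmx c (conn g d) x *m grad F x + conn g d x *m dmx c (grad F) x).
  by rewrite -(dmxM Ux c (sc d) sw) -(dmxB oU Ux c (smooth_dmx oU d sw) (smxM oU (sc d) sw)).
 rewrite !cov1E !dn curvdE (dmxC oU Ux a b sw) /nn !cov1E.
 have alg (H w wa wb : 'cV[R]_n) (P Q Ka Kb : 'M[R]_n) :
  H - (Q *m w + Ka *m wb) - Kb *m (wa - Ka *m w) - (H - (P *m w + Kb *m wa) - Ka *m (wb - Kb *m w))
  = (P - Q - Ka *m Kb + Kb *m Ka) *m w.
  rewrite !(mulmxBr, mulmxBl, mulmxDl, mulNmx, mulmxA).
  move: (Q *m w) (Ka *m wb) (Kb *m wa) (Kb *m Ka *m w) (P *m w) (Ka *m Kb *m w) => *.
  by apply/matrixP => i j; rewrite !mxE; ring.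
 exact: alg.
have sS : \sum_p conn g b x a p * nn p x k 0 = \sum_p conn g a x b p * nn p x k 0.
 by sumr p; rewrite (conn_sym lm).
transitivity ((cov1 g b (nn a) x - cov1 g a (nn b) x) k 0); last by rewrite key mxmulE.
have alg (A B : 'cV[R]_n) (S S' r1 r2 : R) : S = S' -> r1 = - (A k 0 - S') -> r2 = - (B k 0 - S) -> r1 - r2 = (B - A) k 0.
 by move=> -> -> ->; rewrite !mxE; ring.
exact: alg sS (dE a b) (dE b a).
Qed.

End LocalSoliton.

(** * Soliton identities at one point in an orthonormal frame *)

Section IndexAlgebra.
Context {R : realType} {n : nat}.
(** With $g = \delta$ and $\Gamma = 0$ at the point, [r] and [dr] stand for the curvature and its
    derivative, [s] for Ricci, [nn] for the Hessian of $f$, [d] and [dd] for the first and second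
    derivatives of Ricci (the last derivative taken comes first), and [w] for the gradient of
    $f$. *)
Variables (r : 'I_n -> 'I_n -> 'I_n -> 'I_n -> R) (dr : 'I_n -> 'I_n -> 'I_n -> 'I_n -> 'I_n -> R).
Variables (s nn : 'I_n -> 'I_n -> R) (d : 'I_n -> 'I_n -> 'I_n -> R).
Variables (dd : 'I_n -> 'I_n -> 'I_n -> 'I_n -> R) (w : 'I_n -> R).
Hypothesis r_sk1 : forall a b k l, r a b k l = - r b a k l.
Hypothesis r_sk2 : forall a b k l, r a b k l = - r a b l k.
Hypothesis r_pair : forall a b k l, r a b k l = r k l a b.
Hypothesis dr_sk2 : forall m a b k l, dr m a b k l = - dr m a b l k.
Hypothesis dr_pair : forall m a b k l, dr m a b k l = dr m k l a b.
Hypothesis dr_bianchi : forall m a b k l, dr m a b k l + dr a b m k l + dr b m a k l = 0.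
Hypothesis s_r : forall j k, s j k = \sum_i r i j k i.
Hypothesis d_dr : forall m j k, d m j k = \sum_i dr m i j k i.
Hypothesis s_sym : forall j k, s j k = s k j.
Hypothesis d_sym : forall m j k, d m j k = d m k j.
Hypothesis ricci : forall a b k, d a b k - d b a k = \sum_l r a b k l * w l.

(** Trace of the differential Bianchi identity: two of its three terms become derivatives of
    Ricci. *)
Lemma bianchi2c j k l : \sum_m dr m m j k l = d l k j - d k l j.
Proof.
transitivity (\sum_m (- dr k m j l m + dr l m k j m)).
 sumr m; have := dr_bianchi m k l m j.
 by rewrite (dr_pair m k l m j) (dr_pair k l m m j) (dr_sk2 l m k m j) => ?; lra.
by rewrite big_split /= sumrN -!d_dr (d_sym k j l) addrC.
Qed.

Lemma trace_dric l : 2 * \sum_m d m m l = \sum_j d l j j.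
Proof.
have E : \sum_m d m m l = \sum_j d l j j - \sum_j d j j l.
 transitivity (\sum_j \sum_m dr m m j j l).
  sumx m => /=; rewrite d_sym d_dr.
  by sumr i; rewrite dr_pair.
 by rewrite -sumrB; sumr j; rewrite bianchi2c (d_sym j l j).
by rewrite mulr_natl mulr2n {2}E; lra.
Qed.

(** Tracing [ricci] expresses $dR - div\,Ric$ by $Ric(\nabla f)$, and [trace_dric] says $dR =
    2\,div\,Ric$. *)
Lemma div_ric a : \sum_j d j j a = \sum_l s a l * w l.
Proof.
have E : \sum_j d a j j - \sum_j d j j a = \sum_l s a l * w l.
 rewrite -sumrB.
 transitivity (\sum_j \sum_l r a j j l * w l).
  by sumr j; rewrite -ricci (d_sym j a j).
 sumx l => /=; rewrite -mulr_suml; congr (_ * _).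
 by rewrite s_sym s_r; sumr j; rewrite r_pair.
by have := trace_dric a; move: E; lra.
Qed.

Hypothesis nn_s : forall i l, nn i l = 2^-1 * (i == l)%:R - s i l.
Hypothesis dricci : forall l a b k, dd l a b k - dd l b a k = \sum_q (dr l a b k q * w q + r a b k q * nn l q).
Hypothesis dd_comm : forall l a j k, dd l a j k - dd a l j k = - (\sum_p r l a j p * s p k) - \sum_p s j p * r l a k p.
Hypothesis ddiv : forall j k, \sum_i dd j i i k = \sum_l (d j k l * w l + s k l * nn j l).

(** Half of the drift Laplacian of Ricci: $\Delta_f R_{jk} = R_{jk} - 2R_{ijkl}R_{il} = 2Q_{jk}$ in
    this index convention. *)
Let Q j k := 2^-1 * s j k - \sum_i \sum_l r i j k l * s i l.

Let sum_nn (f : 'I_n -> R) i : \sum_l f l * nn i l = 2^-1 * f i - \sum_l f l * s i l.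
Proof.
rewrite -[in RHS](mul_delta_sum f i) mulr_sumr -sumrB; sumr l.
by rewrite nn_s; ring.
Qed.

(** Commuting derivatives turns $\nabla_i\nabla_j R_{ik}$ into $\nabla_j$ of the divergence of Ricci
    plus curvature terms. The quadratic Ricci term from the commutator cancels the one from the
    Hessian. *)
Lemma drift_lap_swap j k : \sum_i dd i j i k - \sum_i w i * d j i k = Q j k.
Proof.
have -> : \sum_i dd i j i k = \sum_i dd j i i k - \sum_i \sum_p r i j i p * s p k - \sum_i \sum_p s i p * r i j k p.
 by rewrite -!sumrB; sumr i; have := dd_comm i j i k; lra.
rewrite ddiv big_split /= sum_nn.
have -> : \sum_i \sum_p r i j i p * s p k = - \sum_p s k p * s j p.
 rewrite exchange_big -sumrN; sumr p => /=; rewrite -mulr_suml [s k p]s_sym -mulrN mulrC.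
 congr (_ * _); rewrite s_r -sumrN; sumr i; exact: r_sk2.
have -> : \sum_i w i * d j i k = \sum_l d j k l * w l.
 by sumr i; rewrite mulrC d_sym.
have -> : \sum_i \sum_p s i p * r i j k p = \sum_i \sum_l r i j k l * s i l.
 by sumr i p; rewrite mulrC.
by rewrite /Q (s_sym k j); ring.
Qed.

(** The difference from the swapped expression is the divergence of [ricci]. Its Hessian part is
    another [Q j k]; its part with $div(Rm)$ is again [ricci] contracted with $\nabla f$ and cancels
    the drift terms. *)
Lemma drift_lap j k : \sum_i dd i i j k - \sum_i w i * d i j k = 2 * Q j k.
Proof.
rewrite mulr_natl mulr2n -{1}drift_lap_swap.
suff : \sum_i dd i i j k - \sum_i w i * d i j k - (\sum_i dd i j i k - \sum_i w i * d j i k) = Q j k by lra.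
have -> : \sum_i dd i i j k - \sum_i w i * d i j k - (\sum_i dd i j i k - \sum_i w i * d j i k) =
 \sum_i (dd i i j k - dd i j i k) - \sum_i w i * (d i j k - d j i k).
 rewrite sumrB; under [X in _ = _ - X]eq_bigr do rewrite mulrBr.
 rewrite sumrB; ring.
under eq_bigr do rewrite dricci big_split /=.
rewrite big_split /=.
have -> : \sum_i \sum_l r i j k l * nn i l = Q j k.
 under eq_bigr do rewrite sum_nn.
 by rewrite sumrB -mulr_sumr -s_r.
have -> : \sum_i \sum_q dr i i j k q * w q = \sum_i w i * (d i j k - d j i k); last by ring.
rewrite exchange_big /=.
transitivity (\sum_q w q * \sum_m r m j k q * w m).
 sumr q; rewrite -mulr_suml bianchi2c ricci mulrC; congr (_ * _).
 by sumr m; rewrite (r_pair q k j m) (r_sk1 j m) (r_sk2 m j) opprK.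
transitivity (\sum_q \sum_m w q * (r m j k q * w m)); first by sumr q; rewrite mulr_sumr.
sumx m => /=; rewrite ricci mulr_sumr.
by sumr q; ring.
Qed.

(** The coefficients 2 and -1 in $W$ are chosen for this: in the terms with undifferentiated Ricci
    the swapped expression gives [2 * Q] and the Laplacian [- (2 * Q)]. What remains is quadratic in
    $\nabla Ric$. *)
Lemma div_W_algebra :
 \sum_i (\sum_j \sum_k (d i j k * (2 * d j i k - d i j k) + s j k * (2 * dd i j i k - dd i i j k))
  - w i * \sum_j \sum_k s j k * (2 * d j i k - d i j k)) =
 \sum_i \sum_j \sum_k d i j k * d i j k - \sum_a \sum_b \sum_k (d a b k - d b a k) * (d a b k - d b a k).
Proof.
have swap : \sum_a \sum_b \sum_k d b a k * d b a k = \sum_a \sum_b \sum_k d a b k * d a b k.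
 by rewrite exchange_big.
transitivity (\sum_i \sum_j \sum_k d i j k * (2 * d j i k - d i j k) +
 \sum_j \sum_k s j k * (2 * (\sum_i dd i j i k - \sum_i w i * d j i k) - (\sum_i dd i i j k - \sum_i w i * d i j k))).
 have -> : \sum_j \sum_k s j k * (2 * (\sum_i dd i j i k - \sum_i w i * d j i k) - (\sum_i dd i i j k - \sum_i w i * d i j k)) =
  \sum_i \sum_j \sum_k s j k * (2 * (dd i j i k - w i * d j i k) - (dd i i j k - w i * d i j k)).
  rewrite [RHS]exchange_big; sumr j; rewrite [RHS]exchange_big; sumr k => /=.
  by rewrite -mulr_sumr sumrB -mulr_sumr !sumrB.
 rewrite -big_split; sumr i => /=; rewrite mulr_sumr -big_split -sumrB; sumr j => /=.
 rewrite mulr_sumr -big_split -sumrB; sumr k => /=; ring.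
rewrite [X in _ + X]big1 ?addr0 => [|j _]; last first.
 by rewrite big1// => k _; rewrite drift_lap_swap drift_lap; ring.
have -> : \sum_a \sum_b \sum_k (d a b k - d b a k) * (d a b k - d b a k) =
 \sum_a \sum_b \sum_k d a b k * d a b k + \sum_a \sum_b \sum_k d b a k * d b a k
 - \sum_a \sum_b \sum_k 2 * (d a b k * d b a k).
 rewrite -big_split -sumrB; sumr a => /=; rewrite -big_split -sumrB; sumr b => /=.
 by rewrite -big_split -sumrB; sumr k => /=; ring.
rewrite swap; set T := \sum_a \sum_b \sum_k d a b k * d a b k.
have -> : T - (T + T - \sum_a \sum_b \sum_k 2 * (d a b k * d b a k)) = \sum_a \sum_b \sum_k 2 * (d a b k * d b a k) - T by ring.
rewrite /T -sumrB; sumr i; rewrite -sumrB; sumr j.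
by rewrite -sumrB; sumr k; ring.
Qed.

Lemma lap_scal_algebra :
 \sum_i (\sum_j dd i i j j - w i * \sum_j d i j j) = \sum_j s j j - 2 * \sum_i \sum_j s i j * s i j.
Proof.
transitivity (\sum_j (\sum_i dd i i j j - \sum_i w i * d i j j)).
 rewrite !sumrB exchange_big; congr (_ - _).
 by rewrite [RHS]exchange_big; sumr i; rewrite mulr_sumr.
under eq_bigr do rewrite drift_lap /Q mulrBr.
rewrite sumrB; congr (_ - _).
 by sumr j; rewrite mulrA mulfV ?pnatr_eq0// mul1r.
rewrite -mulr_sumr; congr (_ * _); sumx i => /=.
sumx l => /=; rewrite -mulr_suml; congr (_ * _).
by rewrite s_sym s_r; sumr j; rewrite r_pair.
Qed.

(** The left side is the derivative of $|\nabla f|^2 + R - f$; the soliton equation and $dR =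
    2\,Ric(\nabla f)$ make it vanish. *)
Lemma grad_constant_algebra a : 2 * (\sum_l w l * nn a l) + \sum_j d a j j - w a = 0.
Proof.
rewrite sum_nn -trace_dric div_ric.
have -> : \sum_l w l * s a l = \sum_l s a l * w l by sumr l; rewrite mulrC.
lra.
Qed.

End IndexAlgebra.

(** * Tensors assembled from matrices *)

Section Entries.
Context {R : realType} {n : nat}.
Implicit Types (J A : 'M[R]_n).

Lemma conj_entry J A b k : (J *m A *m J^T) b k = \sum_e J b e * \sum_f J k f * A e f.
Proof.
rewrite -mulmxA mxE; sumr e; congr (_ * _); rewrite mxE.
by sumr f; rewrite mxE mulrC.
Qed.

Lemma conj_sum_entry J (c : 'I_n -> R) (A : 'I_n -> 'M[R]_n) b k :
 (J *m (\sum_d c d *: A d) *m J^T) b k = \sum_d c d * \sum_e J b e * \sum_f J k f * A d e f.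
Proof.
rewrite mxsumZr mxsumZl summxE; sumr d.
by rewrite mxE conj_entry.
Qed.

Definition tens2 A : tensor R n 2 := fun i j => A i j.
Definition tens3 (A : 'I_n -> 'M[R]_n) : tensor R n 3 := fun a i j => A a i j.
Definition tens4 (A : 'I_n -> 'I_n -> 'M[R]_n) : tensor R n 4 := fun a b i j => A a b i j.

Lemma tens2_pull J A : tens2 (J *m A *m J^T) = tpull J (tens2 A).
Proof. by fext i; fext j; rewrite /tens2 conj_entry. Qed.

Lemma tens3_pull J (A A' : 'I_n -> 'M[R]_n) :
 (forall a, A' a = J *m (\sum_d J a d *: A d) *m J^T) -> tens3 A' = tpull J (tens3 A).
Proof.
move=> e; fext a; fext i; fext j.
by rewrite /tens3 e conj_sum_entry.
Qed.

Lemma tens4_pull J (A A' : 'I_n -> 'I_n -> 'M[R]_n) :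
 (forall a b, A' a b = J *m (\sum_d \sum_e (J a d * J b e) *: A d e) *m J^T) -> tens4 A' = tpull J (tens4 A).
Proof.
move=> E; fext a; fext b; fext i; fext j.
rewrite /tens4 E /= mulmx_sumr mulmx_suml summxE; sumr d.
rewrite mxsumZr mxsumZl summxE mulr_sumr; sumr e.
by rewrite mxE conj_entry mulrA.
Qed.

(** Applied to $\nabla Ric$, [tskew] is $div(Rm)$ up to the order of the indices, and [tmix] is the
    factor that Ricci is contracted with in $W$. *)
Definition tskew (A : 'I_n -> 'M[R]_n) : tensor R n 3 := fun a b k => A a b k - A b a k.
Definition tmix (A : 'I_n -> 'M[R]_n) : tensor R n 3 := fun i j k => 2 * A j i k - A i j k.

Lemma tskew_pull J (A A' : 'I_n -> 'M[R]_n) :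
 (forall a, A' a = J *m (\sum_d J a d *: A d) *m J^T) -> tskew A' = tpull J (tskew A).
Proof.
move=> E; fext a; fext b; fext k.
rewrite /tskew !E !conj_sum_entry /=.
under [X in _ - X]eq_bigr do rewrite mulr_sumr.
rewrite [X in _ - X]exchange_big /= -sumrB; sumr d.
rewrite mulr_sumr [RHS]mulr_sumr -sumrB; sumr e.
rewrite !mulr_sumr -sumrB; sumr f; ring.
Qed.

Lemma tmix_pull J (A A' : 'I_n -> 'M[R]_n) :
 (forall a, A' a = J *m (\sum_d J a d *: A d) *m J^T) -> tmix A' = tpull J (tmix A).
Proof.
move=> E; fext a; fext b; fext k.
rewrite /tmix !E !conj_sum_entry /=.
under [X in 2 * X - _]eq_bigr do rewrite mulr_sumr.
rewrite [X in 2 * X - _]exchange_big /= mulr_sumr -sumrB; sumr d.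
rewrite mulr_sumr [X in _ - X]mulr_sumr [RHS]mulr_sumr -sumrB; sumr e.
rewrite !mulr_sumr -sumrB; sumr f; ring.
Qed.

Definition tvec (w : 'cV[R]_n) : tensor R n 1 := fun i => w i 0.

Lemma tvec_pull J w : tvec (J *m w) = tpull J (tvec w).
Proof. by fext i; rewrite /tvec mxE. Qed.

Lemma tinner1_1 (S T : tensor R n 1) : tinner 1%:M S T = \sum_i S i * T i.
Proof. by rewrite /= gtrace1. Qed.

Lemma tinner1_2 (S T : tensor R n 2) : tinner 1%:M S T = \sum_i \sum_j S i j * T i j.
Proof. by rewrite /= gtrace1; sumr i; rewrite gtrace1. Qed.

Lemma tinner1_3 (S T : tensor R n 3) : tinner 1%:M S T = \sum_i \sum_j \sum_k S i j k * T i j k.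
Proof. by rewrite [LHS]gtrace1; sumr i; exact: tinner1_2. Qed.

Lemma tinner1_4 (S T : tensor R n 4) :
 tinner 1%:M S T = \sum_i \sum_j \sum_k \sum_l S i j k l * T i j k l.
Proof. by rewrite [LHS]gtrace1; sumr i; exact: tinner1_3. Qed.

End Entries.

Section PartialDerivation.
Context {R : realType} {n : nat}.
Implicit Types (F G : 'rV[R]_n -> R).

(** Derivability and value in one statement, so that the rules of calculus below compose without
    side conditions. *)
Definition pd i F x (v : R) := is_derive x (bv i) F v.

Lemma pd_val i F x v : pd i F x v -> partial i F x = v.
Proof. by case. Qed.

Lemma pdE i F x : derivable F x (bv i) -> pd i F x (partial i F x).
Proof. exact: derivableP. Qed.

Lemma pd_smooth U i F x : smooth_on U F -> U x -> pd i F x (partial i F x).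
Proof. by move=> sF Ux; apply: pdE; exact: smooth_der sF Ux. Qed.

Lemma pd_dmx U p q i (A : 'rV[R]_n -> 'M[R]_(p, q)) x j k : smx U A -> U x ->
 pd i (fun z => A z j k) x (dmx i A x j k).
Proof. by move=> sA Ux; rewrite -dmx_pd; apply: pd_smooth Ux. Qed.

Lemma pdD i F G x a b : pd i F x a -> pd i G x b -> pd i (fun y => F y + G y) x (a + b).
Proof. exact: is_deriveD. Qed.

Lemma pdB i F G x a b : pd i F x a -> pd i G x b -> pd i (fun y => F y - G y) x (a - b).
Proof. exact: is_deriveB. Qed.

Lemma pdM i F G x a b : pd i F x a -> pd i G x b -> pd i (fun y => F y * G y) x (a * G x + F x * b).
Proof.
move=> [dF eF] [dG eG]; split; first exact: derivableM.
have := partialM dF dG; rewrite /partial eF eG; exact.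
Qed.

Lemma pdZ i F x (c a : R) : pd i F x a -> pd i (fun y => c * F y) x (c * a).
Proof. by move=> [dF eF]; split; [exact: derivableZ|rewrite -eF; exact: deriveZ]. Qed.

Lemma pd_sum i (I : Type) (r : seq I) (f : I -> 'rV[R]_n -> R) x (v : I -> R) :
 (forall j, pd i (f j) x (v j)) ->
 pd i (fun y => \sum_(j <- r) f j y) x (\sum_(j <- r) v j).
Proof.
move=> fv; have df j : derivable (f j) x (bv i) by case: (fv j).
have [d e] := derivable_sumr r (P := xpredT) (fun j _ => df j).
by split=> //; rewrite e; sumr j; case: (fv j).
Qed.

Lemma pd_eq U i F G x v : open U -> (forall y, U y -> F y = G y) -> U x -> pd i G x v -> partial i F x = v.
Proof. by move=> oU FG Ux /pd_val <-; exact: pd_eq_on Ux. Qed.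

End PartialDerivation.

(** * Scalar curvature and its gradient *)

Section ScalarCurvature.
Context {R : realType} {n : nat}.
Variables (U : set 'rV[R]_n) (g : 'rV[R]_n -> 'M[R]_n) (F : 'rV[R]_n -> R).
Hypothesis ls : local_soliton U g F.
Let lm := ls_metric ls.
Let oU := lm_open lm.
Let sg := lm_smooth lm.

Definition scal (x : 'rV[R]_n) := gtrace (g x) (fun a b => ricm g x a b).

Lemma smooth_gtrace (T : 'I_n -> 'I_n -> 'rV[R]_n -> R) : (forall i j, smooth_on U (T i j)) ->
 smooth_on U (fun x => gtrace (g x) (fun i j => T i j x)).
Proof.
move=> sT k; apply: Ck_sum => // i _; apply: Ck_sum => // j _; apply: CkM => //; last exact: sT.
exact: smooth_ginv.
Qed.

Lemma smooth_scal : smooth_on U scal.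
Proof. by apply: smooth_gtrace => i j; exact: (smooth_ricm lm). Qed.

Lemma gtrace_tr (G T : 'M[R]_n) : gtrace G (fun a b => T a b) = \tr (invmx G *m T^T).
Proof. by rewrite gtraceE; congr (\tr (_ *m _^T)); apply/matrixP => i j; rewrite mxE. Qed.

(** The derivative of the inverse metric is expressed by the connection, and cyclicity of the trace
    turns these terms into the connection terms of $\nabla Ric$. *)
Lemma grad_scalE x i : U x -> grad scal x i 0 = gtrace (g x) (fun a b => dric g i x a b).
Proof.
move=> Ux; have si := smooth_ginv lm; have sS := smooth_ricm lm.
pose A x := invmx (g x) *m (ricm g x)^T.
have sA : smx U A := smxM oU si (smxT oU sS).
have -> : grad scal x i 0 = \tr (dmx i A x).
 rewrite mxE /mxtrace -(pd_val (pd_sum (index_enum _) (fun j => pd_dmx i j j sA Ux))).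
 by congr (partial i _ x); fext z; rewrite /scal gtrace_tr.
rewrite gtrace_tr /A (dmxM Ux i si (smxT oU sS)) dmxT.
have dI : dmx i (fun x => invmx (g x)) x = - (invmx (g x) *m dmx i g x *m invmx (g x)).
 have E : dmx i (fun x => invmx (g x) *m g x) x = 0.
  rewrite (dmx_eq (B := fun=> 1%:M) i oU) ?dmx_cst// => y Uy.
  by rewrite mulVmx// (lm_unit lm).
 move: E; rewrite (dmxM Ux i si sg) => /eqP; rewrite addr_eq0 => /eqP E.
 by rewrite -[LHS](mulmxK (lm_unit lm Ux)) E mulNmx.
rewrite dI (conn_compat lm i Ux) /dric cov2E.
have gu := lm_unit lm Ux.
have alg (G S dS K : 'M[R]_n) : G \in unitmx -> S^T = S ->
 \tr (- (invmx G *m (K *m G + G *m K^T) *m invmx G) *m S^T + invmx G *m dS^T) =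
 \tr (invmx G *m (dS - K *m S - S *m K^T)^T).
 move=> Gu sS'.
 have -> : (dS - K *m S - S *m K^T)^T = dS^T - S *m K^T - K *m S.
  by rewrite !linearB /= !trmx_mul trmxK sS'.
 rewrite !mulmxBr mulmxDr mulmxDl !mulNmx mulmxDl.
 have -> : invmx G *m (K *m G) *m invmx G = invmx G *m K by rewrite -!mulmxA mulmxV// mulmx1.
 have -> : invmx G *m (G *m K^T) *m invmx G = K^T *m invmx G by rewrite mulmxA mulVmx// mul1mx.
 have trD (A' B' : 'M[R]_n) : \tr (A' + B') = \tr A' + \tr B' by exact: raddfD.
 have trN (A' : 'M[R]_n) : \tr (- A') = - \tr A' by exact: raddfN.
 rewrite !trD !trN !trD sS' -[K^T *m invmx G *m S]mulmxA.
 rewrite [\tr (K^T *m _)]mxtrace_mulC -!mulmxA.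
 by move: (\tr _) (\tr _) (\tr _) => *; ring.
exact: alg gu (ricm_sym ls Ux).
Qed.

End ScalarCurvature.

(** * Identities at the origin of normal coordinates *)

Section Origin.
Context {R : realType} {n : nat}.
Variables (U : set 'rV[R]_n) (g : 'rV[R]_n -> 'M[R]_n) (F : 'rV[R]_n -> R).
Hypothesis ls : local_soliton U g F.
Hypothesis U0 : U 0.
Hypothesis g0 : g 0 = 1%:M.
Hypothesis K0 : forall a, conn g a 0 = 0.
Let lm := ls_metric ls.
Let oU := lm_open lm.
Let sg := lm_smooth lm.
Let sc := smooth_conn lm.

Lemma dmx_metric0 a : dmx a g 0 = 0.
Proof. by rewrite (conn_compat lm a U0) K0 trmx0 mul0mx mulmx0 addr0. Qed.

Lemma dmx_ginv0 a : dmx a (fun x => invmx (g x)) 0 = 0.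
Proof.
have si := smooth_ginv lm.
have E : dmx a (fun x => invmx (g x) *m g x) 0 = 0.
 rewrite (dmx_eq (B := fun=> 1%:M) a oU) ?dmx_cst// => y Uy.
 by rewrite mulVmx// (lm_unit lm).
by move: E; rewrite (dmxM U0 a si sg) dmx_metric0 mulmx0 addr0 g0 mulmx1.
Qed.

Lemma pd_gtrace0 a (T : 'I_n -> 'I_n -> 'rV[R]_n -> R) :
 (forall i j, smooth_on U (T i j)) ->
 partial a (fun x => gtrace (g x) (fun i j => T i j x)) 0 = \sum_i partial a (T i i) 0.
Proof.
move=> sT; have si := smooth_ginv lm.
have dT i j : derivable (T i j) 0 (bv a) by exact: smooth_der (sT i j) U0.
have dI i j : derivable (fun x => invmx (g x) i j) 0 (bv a) by exact: smooth_der (si i j) U0.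
rewrite /gtrace partial_sum => [|i _]; last first.
 by have [] := derivable_sumr (index_enum _) (P := xpredT) (fun j _ => derivableM (dI i j) (dT i j)).
sumr i; rewrite partial_sum => [|j _]; last exact: derivableM.
transitivity (\sum_j (i == j)%:R * partial a (T i j) 0); last by rewrite mul_delta_sum.
sumr j; rewrite partialM//.
have -> : partial a (fun x => invmx (g x) i j) 0 = 0.
 by have /matrixP/(_ i j) := dmx_ginv0 a; rewrite -dmx_pd mxE.
by rewrite mul0r add0r g0 invmx1 mxE.
Qed.

Lemma riem0 a b : riem g a b 0 = curv g a b 0.
Proof. by rewrite riemdE g0 mulmx1. Qed.

Lemma dmx_riem0 m a b : dmx m (riem g a b) 0 = dmx m (curv g a b) 0.
Proof.
have -> : dmx m (riem g a b) 0 = dmx m (fun x => curv g a b x *m g x) 0.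
 by apply: (dmx_eq _ oU _ U0) => y _; rewrite riemdE.
by rewrite (dmxM U0 m (smooth_curv lm a b) sg) dmx_metric0 mulmx0 addr0 g0 mulmx1.
Qed.

Lemma nriem0 m a b : nriem g m a b 0 = dmx m (curv g a b) 0.
Proof.
have zs (f : 'I_n -> 'M[R]_n) i : \sum_p (0 : 'M[R]_n) i p *: f p = 0.
 by rewrite big1// => p _; rewrite mxE scale0r.
rewrite nriemdE cov2E K0 trmx0 mul0mx mulmx0 !subr0 dmx_riem0.
have alg (A S T : 'M[R]_n) : S = 0 -> T = 0 -> A - S - T = A by move=> -> ->; rewrite !subr0.
by apply: alg; exact: zs.
Qed.

Lemma dmx_curv0 m a b : dmx m (curv g a b) 0 = dmx m (dmx a (conn g b)) 0 - dmx m (dmx b (conn g a)) 0.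
Proof.
have sd p q := smooth_dmx oU p (sc q).
have sm p q := smxM oU (sc p) (sc q).
have d0 p q : dmx m (fun x => conn g p x *m conn g q x) 0 = 0.
 by rewrite (dmxM U0 m (sc p) (sc q)) !K0 mulmx0 mul0mx addr0.
have -> : dmx m (curv g a b) 0 = dmx m (fun x => dmx a (conn g b) x - dmx b (conn g a) x
  - conn g a x *m conn g b x + conn g b x *m conn g a x) 0.
 by apply: (dmx_eq _ oU _ U0) => y _; rewrite curvdE.
rewrite (dmxD U0 m (smxB oU (smxB oU (sd a b) (sd b a)) (sm a b)) (sm b a)).
rewrite (dmxB oU U0 m (smxB oU (sd a b) (sd b a)) (sm a b)).
by rewrite (dmxB oU U0 m (sd a b) (sd b a)) !d0 subr0 addr0.
Qed.

(** At the origin the products of connection matrices have zero derivative, and the second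
    derivatives that remain commute and cancel in pairs. *)
Lemma second_bianchi0 m a b :
 dmx m (curv g a b) 0 + dmx a (curv g b m) 0 + dmx b (curv g m a) 0 = 0.
Proof.
have alg (c1 c2 c3 A B C A' B' C' : 'M[R]_n) : c1 = A - B -> c2 = C - A' -> c3 = B' - C' ->
  A = A' -> B = B' -> C = C' -> c1 + c2 + c3 = 0.
 by move=> -> -> -> -> -> ->; apply/matrixP => i j; rewrite !mxE; ring.
exact: alg (dmx_curv0 m a b) (dmx_curv0 a b m) (dmx_curv0 b m a)
 (dmxC oU U0 m a (sc b)) (dmxC oU U0 m b (sc a)) (dmxC oU U0 a b (sc m)).
Qed.

Let r a b k l := curv g a b 0 k l.
Let dr m a b k l := dmx m (curv g a b) 0 k l.
Let s j k := ricm g 0 j k.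
Let d a j k := dric g a 0 j k.
Let dd l a j k := dmx l (dric g a) 0 j k.
Let w l := grad F 0 l 0.
Let nn i l := dmx i (grad F) 0 l 0.

Lemma dmx_entry_eq m (A B : 'rV[R]_n -> 'M[R]_n) c i j k l :
 (forall x, U x -> A x i j = c * B x k l) -> smx U B ->
 dmx m A 0 i j = c * dmx m B 0 k l.
Proof.
move=> e sB; rewrite -!dmx_pd (pd_eq_on m oU e U0).
have dB : derivable (fun z => B z k l) 0 (bv m) by exact: smooth_der (sB k l) U0.
by rewrite partialM// ?partial_cst ?mul0r ?add0r//; exact: derivable_cst.
Qed.

Let r_sk1 a b k l : r a b k l = - r b a k l.
Proof. by rewrite /r (curv_skew g b a) mxoppE. Qed.

Let r_sk2 a b k l : r a b k l = - r a b l k.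
Proof. by rewrite /r -!riem0; exact: riem_skew2 lm _ _ _ _ _ U0. Qed.

Let r_pair a b k l : r a b k l = r k l a b.
Proof. by rewrite /r -!riem0; exact: riem_pair lm _ _ _ _ _ U0. Qed.

Let dr_sk2 m a b k l : dr m a b k l = - dr m a b l k.
Proof.
rewrite /dr -!dmx_riem0 -mulN1r; apply: dmx_entry_eq; last exact: smooth_riem.
by move=> x Ux; rewrite mulN1r; exact: (riem_skew2 lm).
Qed.

Let dr_pair m a b k l : dr m a b k l = dr m k l a b.
Proof.
rewrite /dr -!dmx_riem0 -[RHS]mul1r; apply: dmx_entry_eq; last exact: smooth_riem.
by move=> x Ux; rewrite mul1r; exact: (riem_pair lm).
Qed.

Let dr_bianchi m a b k l : dr m a b k l + dr a b m k l + dr b m a k l = 0.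
Proof. by rewrite /dr -!mxaddE second_bianchi0 mxE. Qed.

Let s_r j k : s j k = \sum_i r i j k i.
Proof. exact: ricmE. Qed.

Let dE m : dric g m 0 = dmx m (ricm g) 0.
Proof. by rewrite /dric cov2E K0 trmx0 mul0mx mulmx0 !subr0. Qed.

Let d_dr m j k : d m j k = \sum_i dr m i j k i.
Proof.
rewrite /d dE -dmx_pd.
have -> : (fun z => ricm g z j k) = (fun z => \sum_i curv g i j z k i) by fext z; rewrite ricmE.
rewrite partial_sum => [|i _]; last exact: smooth_der (smooth_curv lm i j k i) U0.
by sumr i; exact: dmx_pd.
Qed.

Let s_sym j k : s j k = s k j.
Proof. by rewrite /s -[in LHS](ricm_sym ls U0) mxtrE. Qed.

Let d_sym m j k : d m j k = d m k j.
Proof. by rewrite /d -[in LHS](dric_sym ls m U0) mxtrE. Qed.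

Let ricci a b k : d a b k - d b a k = \sum_l r a b k l * w l.
Proof. exact: (ricci_identity ls). Qed.

Let nn_s i l : nn i l = 2^-1 * (i == l)%:R - s i l.
Proof.
have e : hessm g F 0 i l = nn i l by rewrite hessmE cov1E K0 mul0mx subr0.
by rewrite /s (ls_eq ls U0) mxsubE mxscaleE g0 e mxE; ring.
Qed.

Lemma contracted_bianchi0 j k l : div_Rm g j k l 0 = d l k j - d k l j.
Proof.
rewrite /div_Rm g0 gtrace1 -(bianchi2c dr_sk2 dr_pair dr_bianchi d_dr d_sym).
by sumr m; rewrite (nabla_RmE lm)// nriem0.
Qed.

Lemma div_ric0 k : \sum_j d j j k = \sum_l s k l * w l.
Proof. exact: (div_ric r_pair dr_sk2 dr_pair dr_bianchi s_r d_dr s_sym d_sym ricci). Qed.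

(** [div_ric0] holds at the origin only, but [ddiv] is its derivative. The identity at nearby points
    is assumed here and supplied later by normal coordinates centred at each of them. *)
Hypothesis div_ric_on : forall x k, U x ->
 gtrace (g x) (fun i q => dric g i x q k) = gtrace (g x) (fun l m => ricm g x k l * grad F x m 0).

Let dricci l a b k : dd l a b k - dd l b a k = \sum_q (dr l a b k q * w q + r a b k q * nn l q).
Proof.
have sw := smooth_grad lm (ls_smooth ls).
have sd c : smx U (dric g c) := smooth_dric ls c.
have L := pdB (pd_dmx l b k (sd a) U0) (pd_dmx l a k (sd b) U0).
have RR := pd_sum (index_enum _)
 (fun q => pdM (pd_dmx l k q (smooth_curv lm a b) U0) (pd_dmx l q 0 sw U0)).
by rewrite /dd -(pd_val L) (pd_eq oU _ U0 RR)// => y Uy; exact: (ricci_identity ls).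
Qed.

(** Since $\Gamma = 0$ at the origin, commuting the derivatives leaves only derivatives of $\Gamma$,
    that is, the curvature acting on each slot of Ricci. *)
Let dd_comm l a j k : dd l a j k - dd a l j k = - (\sum_p r l a j p * s p k) - \sum_p s j p * r l a k p.
Proof.
have sS := smooth_ricm lm.
have ddE p q : dmx p (dric g q) 0 = dmx p (dmx q (ricm g)) 0 - dmx p (conn g q) 0 *m ricm g 0
  - ricm g 0 *m (dmx p (conn g q) 0)^T.
 have -> : dmx p (dric g q) 0 = dmx p (fun x => dmx q (ricm g) x - conn g q x *m ricm g x - ricm g x *m (conn g q x)^T) 0.
  by apply: (dmx_eq _ oU _ U0) => y _; rewrite /dric cov2E.
 have s1 := smxM oU (sc q) sS; have s2 := smxM oU sS (smxT oU (sc q)).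
 rewrite (dmxB oU U0 p (smxB oU (smooth_dmx oU q sS) s1) s2) (dmxB oU U0 p (smooth_dmx oU q sS) s1).
 rewrite (dmxM U0 p (sc q) sS) (dmxM U0 p sS (smxT oU (sc q))) dmxT K0.
 by rewrite trmx0 mul0mx mulmx0 addr0 add0r.
have key : dmx l (dric g a) 0 - dmx a (dric g l) 0 = - (curv g l a 0 *m ricm g 0) - ricm g 0 *m (curv g l a 0)^T.
 rewrite !ddE (dmxC oU U0 a l sS) curvdE !K0 mulmx0 subr0 addr0.
 have alg (A P Q S : 'M[R]_n) : A - P *m S - S *m P^T - (A - Q *m S - S *m Q^T) = - ((P - Q) *m S) - S *m (P - Q)^T.
  have -> : (P - Q)^T = P^T - Q^T by apply/matrixP => i i'; rewrite !mxE.
  rewrite mulmxBl mulmxBr; move: (P *m S) (Q *m S) (S *m P^T) (S *m Q^T) => *.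
  by apply/matrixP => i i'; rewrite !mxE; ring.
 exact: alg.
rewrite /dd -mxsubE key mxsubE mxoppE !mxmulE; congr (_ - _).
by sumr p; rewrite mxtrE.
Qed.

Let ddiv j k : \sum_i dd j i i k = \sum_l (d j k l * w l + s k l * nn j l).
Proof.
have sw := smooth_grad lm (ls_smooth ls); have sS := smooth_ricm lm.
have := pd_eq_on j oU (fun x => @div_ric_on x k) U0.
rewrite (pd_gtrace0 j (T := fun i q x => dric g i x q k)); last by move=> i q; exact: (smooth_dric ls).
rewrite (pd_gtrace0 j (T := fun l m x => ricm g x k l * grad F x m 0)); last first.
 by move=> l m q; apply: CkM => //; [exact: sS|exact: sw].
move=> e; transitivity (\sum_i partial j (fun x => dric g i x i k) 0).
 by sumr i; exact: (esym (dmx_pd _ _ _ _ _)).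
rewrite e; sumr l; rewrite /d dE.
exact: pd_val (pdM (pd_dmx j k l sS U0) (pd_dmx j l 0 sw U0)).
Qed.

Lemma div_W0 (W := fun x => \col_i tinner (g x) (tens2 (ricm g x)) (tmix (fun a => dric g a x) i)) :
 gtrace (g 0) (fun a b => cov1 g a W 0 b 0) - \sum_i grad F 0 i 0 * W 0 i 0 =
 tnorm2 (g 0) (tens3 (fun a => dric g a 0)) - tnorm2 (g 0) (tskew (fun a => dric g a 0)).
Proof.
have sS := smooth_ricm lm; have sd c : smx U (dric g c) := smooth_dric ls c.
rewrite g0 gtrace1 /tnorm2 !tinner1_3 -sumrB.
have H := div_W_algebra r_sk1 r_sk2 r_pair dr_sk2 dr_pair dr_bianchi s_r d_dr s_sym d_sym ricci nn_s dricci dd_comm ddiv.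
rewrite -[RHS]H; sumr i; congr (_ - _ * _); last first.
 by rewrite mxE g0 tinner1_2.
rewrite cov1E K0 mul0mx subr0 -dmx_pd.
have sm a b c e : smooth_on U (fun x => ricm g x a b * tmix (fun a => dric g a x) i c e).
 move=> q; apply: CkM => //; first exact: sS.
 by apply: CkB => //; [apply: CkM => //; [exact: Ck_cst|exact: sd]|exact: sd].
transitivity (partial i (fun x => gtrace (g x) (fun a b => gtrace (g x)
  (fun c e => ricm g x a c * tmix (fun a => dric g a x) i b e))) 0).
 by congr (partial i _ 0); fext z; rewrite mxE.
rewrite (pd_gtrace0 i (T := fun a b x => gtrace (g x) (fun c e => ricm g x a c * tmix (fun a => dric g a x) i b e))); last first.
 move=> a b q; apply: Ck_sum => // c _; apply: Ck_sum => // e _; apply: CkM => //.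
  exact: (smooth_ginv lm).
 exact: sm.
sumr j.
rewrite (pd_gtrace0 i (T := fun c e x => ricm g x j c * tmix (fun a => dric g a x) i j e)); last by move=> c e; exact: sm.
sumr k; rewrite /tmix.
have P1 := pdM (pd_dmx i j k sS U0) (pdB (pdZ 2 (pd_dmx i i k (sd j) U0)) (pd_dmx i j k (sd i) U0)).
by apply: etrans (pd_val P1) _; rewrite -dE.
Qed.

Let scal := scal g.

Lemma div_grad_scal0 :
 gtrace (g 0) (fun a b => cov1 g a (grad scal) 0 b 0) - \sum_i grad F 0 i 0 * grad scal 0 i 0 =
 scal 0 - 2 * tnorm2 (g 0) (tens2 (ricm g 0)).
Proof.
have sS := smooth_ricm lm; have sd c : smx U (dric g c) := smooth_dric ls c.
have H := lap_scal_algebra r_sk1 r_sk2 r_pair dr_sk2 dr_pair dr_bianchi s_r d_dr s_sym d_sym ricci nn_s dricci dd_comm ddiv.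
have gs x i : U x -> grad scal x i 0 = gtrace (g x) (fun a b => dric g i x a b).
 exact: (grad_scalE ls).
have -> : scal 0 = \sum_j s j j by rewrite -[scal 0]/(gtrace (g 0) (fun a b => ricm g 0 a b)) g0 gtrace1.
rewrite g0 gtrace1 /tnorm2 tinner1_2 -[RHS]H -sumrB.
sumr i; congr (_ - _ * _); last by rewrite gs// g0 gtrace1.
rewrite cov1E K0 mul0mx subr0 -dmx_pd.
rewrite (pd_eq_on (G := fun x => gtrace (g x) (fun a b => dric g i x a b)) i oU _ U0); last first.
 by move=> y Uy; exact: gs.
rewrite (pd_gtrace0 i (T := fun a b x => dric g i x a b)) => [|a b]; last exact: sd.
by sumr j; exact: dmx_pd.
Qed.

Lemma grad_constant0 a :
 partial a (fun x => gtrace (g x) (fun i j => grad F x i 0 * grad F x j 0) + scal x - F x) 0 = 0.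
Proof.
have sw := smooth_grad lm (ls_smooth ls); have sS := smooth_ricm lm.
have sww i j : smooth_on U (fun x => grad F x i 0 * grad F x j 0).
 by move=> q; apply: CkM => //; exact: sw.
have s1 := smooth_gtrace ls sww.
have P1 := pdB (pdD (pd_smooth a s1 U0) (pd_smooth a (smooth_scal ls) U0)) (pd_smooth a (ls_smooth ls) U0).
rewrite (pd_val P1) (pd_gtrace0 a (T := fun i j x => grad F x i 0 * grad F x j 0))//.
rewrite (pd_gtrace0 a (T := fun i j x => ricm g x i j)) => [|i j]; last exact: sS.
have -> : \sum_i partial a (fun x => grad F x i 0 * grad F x i 0) 0 = 2 * \sum_l w l * nn a l.
 rewrite mulr_sumr; sumr l.
 by rewrite (pd_val (pdM (pd_dmx a l 0 sw U0) (pd_dmx a l 0 sw U0))) -/(w l) -/(nn a l); ring.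
have -> : \sum_i partial a (fun x => ricm g x i i) 0 = \sum_j d a j j.
 by sumr l; rewrite /d dE; exact: dmx_pd.
have -> : partial a F 0 = w a by rewrite /w mxE.
exact: (grad_constant_algebra r_pair dr_sk2 dr_pair dr_bianchi s_r d_dr s_sym d_sym ricci nn_s).
Qed.

End Origin.

Lemma tinner_frame (R : realType) n (G E : 'M[R]_n) k (S T : tensor R n k) : E *m G *m E^T = 1%:M ->
 tinner G S T = tinner 1%:M (tpull E S) (tpull E T).
Proof.
move=> EGE; have /mulmx1_unit[] := EGE; rewrite unitmx_mul => /andP[Eu Gu] _.
by rewrite -EGE tinner_pull.
Qed.

Definition driftW (R : realType) n (g : 'rV[R]_n -> 'M[R]_n) x : 'cV[R]_n :=
 \col_i tinner (g x) (tens2 (ricm g x)) (tmix (fun a => dric g a x) i).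

Definition divc (R : realType) n (g : 'rV[R]_n -> 'M[R]_n) (w : 'rV[R]_n -> 'cV[R]_n) x : R :=
 gtrace (g x) (fun a b => cov1 g a w x b 0).

Definition vdot (R : realType) n (G : 'M[R]_n) (u v : 'cV[R]_n) : R := tinner G (tvec u) (tvec v).

Lemma vdotE (R : realType) n (G : 'M[R]_n) (u v : 'cV[R]_n) : vdot G u v = gtrace G (fun a b => u a 0 * v b 0).
Proof. by []. Qed.

Lemma vdot1 (R : realType) n (u v : 'cV[R]_n) : vdot 1%:M u v = \sum_i u i 0 * v i 0.
Proof. exact: tinner1_1. Qed.

Definition dric_tens (R : realType) n (g : 'rV[R]_n -> 'M[R]_n) x : tensor R n 3 := tens3 (fun a => dric g a x).
Definition skew_tens (R : realType) n (g : 'rV[R]_n -> 'M[R]_n) x : tensor R n 3 := tskew (fun a => dric g a x).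
Definition div_tens (R : realType) n (g : 'rV[R]_n -> 'M[R]_n) x : tensor R n 3 := fun j k l => div_Rm g j k l x.
Definition riem_tens (R : realType) n (g : 'rV[R]_n -> 'M[R]_n) x : tensor R n 4 := tens4 (fun a b => riem g a b x).

(** * Invariance under coordinate changes *)

Section Transport.
Context {R : realType} {n : nat}.
Variables (U V : set 'rV[R]_n) (g gt : 'rV[R]_n -> 'M[R]_n) (tau : 'rV[R]_n -> 'rV[R]_n).
Hypothesis lm : local_metric U g.
Hypothesis cc : coord_change U V g gt tau.
Let J := jac tau.

Lemma metric_unit_tr y : V y -> g (tau y) \in unitmx.
Proof. by move=> Vy; exact: lm_unit lm _ (cc_map cc Vy). Qed.

Lemma dric_tr a y : V y -> dric gt a y = J y *m (\sum_d J y a d *: dric g d (tau y)) *m (J y)^T.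
Proof. by move=> Vy; exact: (cov2_tr lm cc a (smooth_ricm lm) (fun z Vz => ricm_tr lm cc Vz) Vy). Qed.

Lemma tinner_tr k (S T : tensor R n k) y : V y ->
 tinner (gt y) (tpull (J y) S) (tpull (J y) T) = tinner (g (tau y)) S T.
Proof.
by move=> Vy; rewrite (cc_metric cc Vy) tinner_pull// ?(cc_jac cc Vy)// metric_unit_tr.
Qed.

Lemma gtrace_tr' (T : 'I_n -> 'I_n -> R) y : V y ->
 gtrace (gt y) (fun a b => \sum_c J y a c * \sum_d J y b d * T c d) = gtrace (g (tau y)) T.
Proof. by move=> Vy; rewrite (cc_metric cc Vy) gtrace_pull ?(cc_jac cc Vy)// metric_unit_tr. Qed.

Lemma dric_tens_tr y : V y -> dric_tens gt y = tpull (J y) (dric_tens g (tau y)).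
Proof. by move=> Vy; apply: tens3_pull => a; exact: dric_tr. Qed.

Lemma skew_tens_tr y : V y -> skew_tens gt y = tpull (J y) (skew_tens g (tau y)).
Proof. by move=> Vy; apply: tskew_pull => a; exact: dric_tr. Qed.

Lemma riem_tens_tr y : V y -> riem_tens gt y = tpull (J y) (riem_tens g (tau y)).
Proof. by move=> Vy; apply: tens4_pull => a b; exact: (riem_tr lm cc a b Vy). Qed.

Lemma ric_tens_tr y : V y -> tens2 (ricm gt y) = tpull (J y) (tens2 (ricm g (tau y))).
Proof. by move=> Vy; rewrite (ricm_tr lm cc Vy) tens2_pull. Qed.

Lemma driftW_tr y : V y -> driftW gt y = J y *m driftW g (tau y).
Proof.
move=> Vy; apply/matrixP => i j; rewrite ord1 mxE mxmulE ric_tens_tr//.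
rewrite (tmix_pull (J := J y) (A := fun a => dric g a (tau y)) (A' := fun a => dric gt a y)); last first.
 by move=> a; exact: dric_tr.
transitivity (tinner (gt y) (tpull (J y) (tens2 (ricm g (tau y))))
 (@tcomb R n 2 (J y i) (fun a => @tpull R n (J y) 2 (tmix (fun a => dric g a (tau y)) a)))); first by [].
rewrite tinner_combr; sumr d; congr (_ * _).
by rewrite tinner_tr// [RHS]mxE.
Qed.

Lemma vdot_tr u v y : V y -> vdot (gt y) (J y *m u) (J y *m v) = vdot (g (tau y)) u v.
Proof. by move=> Vy; rewrite /vdot !tvec_pull tinner_tr. Qed.

Lemma divc_tr (w wt : 'rV[R]_n -> 'cV[R]_n) y : smx U w ->
 (forall z, V z -> wt z = J z *m w (tau z)) -> V y -> divc gt wt y = divc g w (tau y).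
Proof.
move=> sw wE Vy; rewrite /divc -(gtrace_tr' (fun c d => cov1 g c w (tau y) d 0) Vy).
apply: eq_gtrace => a b; rewrite (cov1_tr lm cc a sw wE Vy) mxsumZr summxE.
by sumr c; rewrite mxscaleE mxmulE.
Qed.

Lemma scal_tr y : V y -> scal gt y = scal g (tau y).
Proof.
move=> Vy; rewrite /scal -(gtrace_tr' (fun c d => ricm g (tau y) c d) Vy).
by apply: eq_gtrace => a b; rewrite (ricm_tr lm cc Vy) conj_entry.
Qed.

Lemma div_tens_tr y : V y -> div_tens gt y = tpull (J y) (div_tens g (tau y)).
Proof.
move=> Vy; fext j; fext k; fext l.
have lmt := new_metric lm cc.
pose N c d e p q := nriem g c d e (tau y) p q.
transitivity (gtrace (gt y) (fun m i => \sum_c J y m c * \sum_d J y i d *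
 (\sum_e J y j e * (\sum_p J y k p * (\sum_q J y l q * N c d e p q))))).
 apply: eq_gtrace => m i; rewrite (nabla_RmE lmt)// (nriem_tr lm cc m i j Vy).
 rewrite mulmx_sumr mulmx_suml summxE; sumr c.
 rewrite mulmx_sumr mulmx_suml summxE mulr_sumr; sumr d.
 rewrite mxsumZr mxsumZl summxE mulrA mulr_sumr; sumr e.
 by rewrite mxscaleE conj_entry !mulrA.
rewrite gtrace_tr'// gtrace_sum /=; sumr e; congr (_ * _).
rewrite gtrace_sum /=; sumr p; congr (_ * _).
rewrite gtrace_sum /=; sumr q; congr (_ * _).
by apply: eq_gtrace => a b; rewrite (nabla_RmE lm)//; exact: cc_map cc _ Vy.
Qed.

End Transport.

Section NormalFrame.
Context {R : realType} {n : nat}.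
Variables (U : set 'rV[R]_n) (g : 'rV[R]_n -> 'M[R]_n).
Hypothesis lm : local_metric U g.
Hypothesis gpos : forall x, U x -> posdef (g x).

Lemma normal_coordinates x : U x -> exists V gt tau,
 [/\ coord_change U V g gt tau, V 0, tau 0 = x, gt 0 = 1%:M & forall a, conn gt a 0 = 0].
Proof.
move=> Ux; have [E EgE] := orthoframe (lm_sym lm Ux) (gpos Ux).
exists (normal_dom U g x E), (normal_metric g x E), (nmap g x E); split.
- exact: normal_change lm _ _.
- by apply: normal_dom0; eauto.
- exact: normal_map0.
- by apply: normal_metric0; eauto.
- by apply: conn_normal0; eauto.
Qed.

End NormalFrame.

Lemma posdef_change (R : realType) n (U V : set 'rV[R]_n) g gt tau : coord_change U V g gt tau ->
 (forall x, U x -> posdef (g x)) -> forall y, V y -> posdef (gt y).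
Proof.
move=> cc gp y Vy v v0; rewrite (cc_metric cc Vy) !mulmxA -[_ *m _^T *m _^T]mulmxA -trmx_mul.
apply: (gp _ (cc_map cc Vy)).
by apply: contra_neq v0 => e; rewrite -[v](mulmxK (cc_jac cc Vy)) e mul0mx.
Qed.

(** * Pointwise inequalities *)

Section CauchySchwarz.
Context {R : realFieldType}.

Lemma sum_CS (I : finType) (a b : I -> R) :
 (\sum_i a i * b i) ^+ 2 <= (\sum_i a i * a i) * \sum_i b i * b i.
Proof.
set A := \sum_i a i * a i; set B := \sum_i b i * b i; set C := \sum_i _.
have A0 : 0 <= A by apply: sumr_ge0 => i _; rewrite -expr2 sqr_ge0.
have key t : 0 <= A * t ^+ 2 - 2 * C * t + B.
 have -> : A * t ^+ 2 - 2 * C * t + B = \sum_i (t * a i - b i) ^+ 2.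
  rewrite /A /B /C mulr_suml mulr_sumr mulr_suml -sumrB -big_split; sumr i => /=; ring.
 by apply: sumr_ge0 => i _; rewrite sqr_ge0.
have [A_gt|] := ltrP 0 A.
 have := mulr_ge0 A0 (key (C / A)).
 have -> : A * (A * (C / A) ^+ 2 - 2 * C * (C / A) + B) = A * B - C ^+ 2 by field; rewrite gt_eqF.
 by rewrite subr_ge0.
rewrite le_eqVlt ltNge A0 orbF => /eqP A00.
have a0 i : a i = 0.
 apply/eqP; rewrite -sqrf_eq0 expr2; move/eqP: A00.
 by rewrite psumr_eq0 => [|j _]; [move/allP/(_ i); rewrite mem_index_enum => /(_ isT)|rewrite -expr2 sqr_ge0].
by rewrite /C big1 ?expr0n ?A00 ?mul0r// => i _; rewrite a0 mul0r.
Qed.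

Lemma sum_sqr_le (I : finType) (a : I -> R) : (\sum_i a i) ^+ 2 <= #|I|%:R * \sum_i a i * a i.
Proof.
have := sum_CS (fun=> 1) a; rewrite (eq_bigr a) => [|i _]; last by rewrite mul1r.
by under [X in X * _]eq_bigr do rewrite mulr1; rewrite sumr_const.
Qed.

Lemma ler_sum1 (I : finType) (f : I -> R) i : (forall j, 0 <= f j) -> f i <= \sum_j f j.
Proof. by move=> f0; rewrite (bigD1 i)//= lerDl sumr_ge0. Qed.

End CauchySchwarz.

Section Pointwise.
Context {R : realType} {n : nat}.

Lemma tnorm2_ge0 k (G : 'M[R]_n) (T : tensor R n k) : G^T = G -> posdef G -> 0 <= tnorm2 G T.
Proof.
move=> sG pG; have [E EGE] := orthoframe sG pG; rewrite /tnorm2 (tinner_frame _ _ EGE).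
move: (tpull E T) => {EGE}; elim: k T => [|k IH] _ S; first by rewrite /= -expr2 sqr_ge0.
by rewrite /= gtrace1 sumr_ge0// => i _; exact: (IH (S i)).
Qed.

Lemma vdot_CS (G : 'M[R]_n) (u v : 'cV[R]_n) : G^T = G -> posdef G ->
 vdot G u v ^+ 2 <= vdot G u u * vdot G v v.
Proof.
move=> sG pG; have [E EGE] := orthoframe sG pG; rewrite /vdot !(tinner_frame _ _ EGE) !tinner1_1.
exact: sum_CS.
Qed.

(* At the origin of normal coordinates all tensor inequalities reduce to finite sums. *)
Lemma tnorm2_trace4 (r : tensor R n 4) (s : tensor R n 2) :
 (forall j k, s j k = \sum_i r i j k i) -> tnorm2 1%:M s <= n%:R * tnorm2 1%:M r.
Proof.
move=> sr; rewrite /tnorm2 tinner1_2 tinner1_4 mulr_sumr.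
under [leRHS]eq_bigr do rewrite mulr_sumr.
rewrite [leRHS]exchange_big /=; apply: ler_sum => j _.
under [leRHS]eq_bigr do rewrite mulr_sumr.
rewrite [leRHS]exchange_big /=; apply: ler_sum => k _.
rewrite -mulr_sumr sr -expr2; apply: (le_trans (sum_sqr_le _)); rewrite card_ord.
apply: ler_wpM2l => //; apply: ler_sum => i _.
by apply: (ler_sum1 (f := fun l => r i j k l * r i j k l)) => l; rewrite -expr2 sqr_ge0.
Qed.

Lemma trace_sqr_le (s : tensor R n 2) : (\sum_i s i i) ^+ 2 <= n%:R * tnorm2 1%:M s.
Proof.
rewrite /tnorm2 tinner1_2; apply: (le_trans (sum_sqr_le _)); rewrite card_ord ler_wpM2l//.
apply: ler_sum => i _.
by apply: (ler_sum1 (f := fun j => s i j * s i j)) => l; rewrite -expr2 sqr_ge0.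
Qed.

Lemma tnorm2_contr (r : tensor R n 4) (t : tensor R n 3) (w : 'cV[R]_n) :
 (forall a b k, t a b k = \sum_l r a b k l * w l 0) -> tnorm2 1%:M t <= tnorm2 1%:M r * vdot 1%:M w w.
Proof.
move=> tE; rewrite /tnorm2 tinner1_3 tinner1_4 vdot1 mulr_suml; apply: ler_sum => a _.
rewrite mulr_suml; apply: ler_sum => b _; rewrite mulr_suml; apply: ler_sum => k _.
by rewrite tE -expr2; exact: (sum_CS (fun l => r a b k l) (fun l => w l 0)).
Qed.

(** $(2x-y)^2 \le 8x^2 + 2y^2$, and both sums of squares equal $|\nabla Ric|^2$ after renaming
    indices; $10 = 8 + 2$. *)
Lemma mix_norm (d : 'I_n -> 'M[R]_n) : tnorm2 1%:M (tmix d) <= 10 * tnorm2 1%:M (tens3 d).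
Proof.
rewrite /tnorm2 !tinner1_3.
have -> : 10 * (\sum_i \sum_j \sum_k tens3 d i j k * tens3 d i j k) =
 \sum_i \sum_j \sum_k (8 * (d j i k * d j i k) + 2 * (d i j k * d i j k)).
 have sw : \sum_i \sum_j \sum_k d j i k * d j i k = \sum_i \sum_j \sum_k tens3 d i j k * tens3 d i j k by rewrite exchange_big.
 have -> : (10 : R) = 8 + 2 by ring.
 rewrite mulrDl -{1}sw !mulr_sumr -big_split; sumr i => /=.
 by rewrite !mulr_sumr -big_split; sumr j => /=; rewrite !mulr_sumr -big_split.
apply: ler_sum => i _; apply: ler_sum => j _; apply: ler_sum => k _; rewrite /tmix.
rewrite -subr_ge0; set x := d j i k; set y := d i j k.
have -> : 8 * (x * x) + 2 * (y * y) - (2 * x - y) * (2 * x - y) = (2 * x + y) ^+ 2 by ring.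
exact: sqr_ge0.
Qed.

Lemma contr_mix_norm (s : tensor R n 2) (t : tensor R n 3) (w : 'cV[R]_n) :
 (forall i, w i 0 = tinner 1%:M s (t i)) -> vdot 1%:M w w <= tnorm2 1%:M s * tnorm2 1%:M t.
Proof.
move=> wE; rewrite vdot1 /tnorm2 tinner1_3 mulr_sumr; apply: ler_sum => i _.
rewrite wE !tinner1_2 !pair_big /= -expr2.
exact: (sum_CS (fun p : 'I_n * 'I_n => s p.1 p.2) (fun p => t i p.1 p.2)).
Qed.

Variables (U : set 'rV[R]_n) (g : 'rV[R]_n -> 'M[R]_n) (F : 'rV[R]_n -> R).
Hypothesis ls : local_soliton U g F.
Hypothesis gpos : forall x, U x -> posdef (g x).
Let lm := ls_metric ls.

Lemma normal_at x : U x -> exists V gt tau,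
 [/\ coord_change U V g gt tau, local_soliton V gt (fun z => F (tau z)) & [/\ V 0, tau 0 = x, gt 0 = 1%:M & forall a, conn gt a 0 = 0]].
Proof.
move=> Ux; have [V [gt [tau [cc V0 t0 g0 K0]]]] := normal_coordinates lm gpos Ux.
by exists V, gt, tau; split=> //; exact: soliton_change cc ls.
Qed.

(** The identity at the origin of normal coordinates centred at [x] becomes an equality of covectors
    multiplied by the Jacobian, which is invertible. *)
Lemma div_ric_at x k : U x ->
 gtrace (g x) (fun i q => dric g i x q k) = gtrace (g x) (fun l m => ricm g x k l * grad F x m 0).
Proof.
move=> Ux; have [V [gt [tau [cc ls' [V0 t0 g0 K0]]]]] := normal_at Ux.
pose L k := gtrace (g x) (fun i q => dric g i x q k).
pose P k := gtrace (g x) (fun l m => ricm g x k l * grad F x m 0).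
pose J := jac tau 0.
have LE j : gtrace (gt 0) (fun i q => dric gt i 0 q j) = \sum_k J j k * L k.
 rewrite -gtrace_sum -[in RHS]t0 -(gtrace_tr' lm cc _ V0); apply: eq_gtrace => a b.
 rewrite (dric_tr lm cc a V0) conj_sum_entry; sumr c; congr (_ * _).
have PE j : gtrace (gt 0) (fun l m => ricm gt 0 j l * grad (fun z => F (tau z)) 0 m 0) = \sum_k J j k * P k.
 rewrite -gtrace_sum -[in RHS]t0 -(gtrace_tr' lm cc _ V0); apply: eq_gtrace => a b.
 rewrite (ricm_tr lm cc V0) conj_entry (grad_tr lm cc (ls_smooth ls) V0) mxmulE.
 rewrite mulr_suml.
 transitivity (\sum_e \sum_c \sum_d J j e * (J a c * (J b d * (ricm g (tau 0) e c * grad F (tau 0) d 0)))).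
  sumr e; rewrite mulrAC mulr_sumr; sumr c.
  rewrite !(mulr_suml, mulr_sumr); sumr d; rewrite -/J; ring.
 sumx c => /=; rewrite exchange_big mulr_sumr; sumr d => /=.
 by rewrite !mulr_sumr; sumr e; rewrite t0; ring.
have E j : \sum_k J j k * L k = \sum_k J j k * P k.
 rewrite -LE -PE g0 !gtrace1; exact: (div_ric0 ls' V0 g0 K0 j).
have JE : J *m (\col_k L k) = J *m (\col_k P k).
 have alg (A : 'M[R]_n) (l p : 'I_n -> R) : (forall j, \sum_k A j k * l k = \sum_k A j k * p k) ->
   A *m (\col_k l k) = A *m (\col_k p k).
  move=> e; apply/colP => j; rewrite !mxE; under eq_bigr do rewrite mxE.
  by under [RHS]eq_bigr do rewrite mxE.
 exact: alg.
have := congr1 (fun M => (invmx J *m M) k 0) JE.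
by rewrite !mulKmx ?(cc_jac cc V0)// !mxE.
Qed.

(** In an orthonormal frame $div(Rm)$ is the skew part of $\nabla Ric$ with its indices reversed,
    and the norm ignores the order of the indices. *)
Lemma div_tens_norm x : U x -> tnorm2 (g x) (div_tens g x) = tnorm2 (g x) (skew_tens g x).
Proof.
move=> Ux; have [V [gt [tau [cc ls' [V0 t0 g0 K0]]]]] := normal_at Ux.
rewrite /tnorm2 -t0 -!(tinner_tr lm cc _ _ V0) -(div_tens_tr lm cc V0) -(skew_tens_tr lm cc V0).
rewrite g0 !tinner1_3.
transitivity (\sum_j \sum_k \sum_l skew_tens gt 0 l k j * skew_tens gt 0 l k j).
 sumr j k; sumr l.
 by rewrite /div_tens (contracted_bianchi0 ls' V0 g0 K0).
under eq_bigr do rewrite exchange_big /=.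
sumx l.
by rewrite exchange_big.
Qed.

End Pointwise.

(** * Identities and estimates at every point of a chart *)

Section SolitonIdentities.
Context {R : realType} {n : nat}.
Variables (U : set 'rV[R]_n) (g : 'rV[R]_n -> 'M[R]_n) (F : 'rV[R]_n -> R).
Hypothesis ls : local_soliton U g F.
Hypothesis gpos : forall x, U x -> posdef (g x).
Let lm := ls_metric ls.

Lemma smooth_driftW : smx U (driftW g).
Proof.
move=> i j; apply: smooth_eq (_ : smooth_on U (fun x => tinner (g x) (tens2 (ricm g x)) (tmix (fun a => dric g a x) i))).
- exact: lm_open lm.
- by move=> y _; rewrite mxE.
apply: (smooth_gtrace ls) => a b; apply: (smooth_gtrace ls) => c d k.
have oU := lm_open lm; have sd e : smx U (dric g e) := smooth_dric ls e.
apply: CkM => //; first exact: (smooth_ricm lm).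
by apply: CkB => //; [apply: CkM => //; [exact: Ck_cst|exact: sd]|exact: sd].
Qed.

Lemma div_driftW x : U x ->
 divc g (driftW g) x - vdot (g x) (grad F x) (driftW g x) =
 tnorm2 (g x) (dric_tens g x) - tnorm2 (g x) (skew_tens g x).
Proof.
move=> Ux; have [V [gt [tau [cc ls' [V0 t0 g0 K0]]]]] := normal_at ls gpos Ux.
have dr' z k Vz := div_ric_at ls' (posdef_change cc gpos) k (x := z) Vz.
rewrite /tnorm2 -t0 -!(tinner_tr lm cc _ _ V0) -(dric_tens_tr lm cc V0) -(skew_tens_tr lm cc V0).
rewrite -(vdot_tr lm cc _ _ V0) -(driftW_tr lm cc V0) -(grad_tr lm cc (ls_smooth ls) V0).
rewrite -(divc_tr lm cc smooth_driftW (fun z Vz => driftW_tr lm cc Vz) V0).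
rewrite [vdot _ _ _](_ : _ = \sum_i grad (fun z => F (tau z)) 0 i 0 * driftW gt 0 i 0); last by rewrite g0 vdot1.
exact: (div_W0 ls' V0 g0 K0 dr').
Qed.

Lemma grad_scal_tr V gt tau y : coord_change U V g gt tau -> V y ->
 grad (scal gt) y = jac tau y *m grad (scal g) (tau y).
Proof.
move=> cc Vy; rewrite -(grad_tr lm cc (smooth_scal ls) Vy); apply/colP => i.
have gE (G : 'rV[R]_n -> R) z : grad G z i 0 = partial i G z by exact: mxE.
apply: (etrans (gE (scal gt) y)); apply: (etrans _ (esym (gE _ y))).
by apply: (pd_eq_on i (cc_open cc) _ Vy) => z Vz; exact: (scal_tr lm cc).
Qed.

Lemma div_grad_scal x : U x ->
 divc g (grad (scal g)) x - vdot (g x) (grad F x) (grad (scal g) x) =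
 scal g x - 2 * tnorm2 (g x) (tens2 (ricm g x)).
Proof.
move=> Ux; have [V [gt [tau [cc ls' [V0 t0 g0 K0]]]]] := normal_at ls gpos Ux.
have dr' z k Vz := div_ric_at ls' (posdef_change cc gpos) k (x := z) Vz.
rewrite /tnorm2 -t0 -!(tinner_tr lm cc _ _ V0) -(ric_tens_tr lm cc V0) -(scal_tr lm cc V0).
rewrite -(vdot_tr lm cc _ _ V0) -(grad_scal_tr cc V0) -(grad_tr lm cc (ls_smooth ls) V0).
rewrite -(divc_tr lm cc (smooth_grad lm (smooth_scal ls)) (fun z Vz => grad_scal_tr cc Vz) V0).
rewrite [vdot _ _ _](_ : _ = \sum_i grad (fun z => F (tau z)) 0 i 0 * grad (scal gt) 0 i 0); last by rewrite g0 vdot1.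
exact: (div_grad_scal0 ls' V0 g0 K0 dr').
Qed.

Definition sconst (g : 'rV[R]_n -> 'M[R]_n) (F : 'rV[R]_n -> R) x := vdot (g x) (grad F x) (grad F x) + scal g x - F x.

Lemma smooth_sconst : smooth_on U (sconst g F).
Proof.
have oU := lm_open lm; have sw := smooth_grad lm (ls_smooth ls).
move=> k; apply: CkB => //; last exact: ls_smooth ls k.
apply: CkD => //; last exact: (smooth_scal ls).
by apply: (smooth_gtrace ls (T := fun i j x => grad F x i 0 * grad F x j 0)) => i j q; apply: CkM => //; exact: sw.
Qed.

Lemma grad_sconst x : U x -> grad (sconst g F) x = 0.
Proof.
move=> Ux; have [V [gt [tau [cc ls' [V0 t0 g0 K0]]]]] := normal_at ls gpos Ux.
have gE : jac tau 0 *m grad (sconst g F) (tau 0) = 0.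
 rewrite -(grad_tr lm cc smooth_sconst V0); apply/colP => i.
 rewrite [LHS]mxE [RHS]mxE -[RHS](grad_constant0 ls' V0 g0 K0 i).
 apply: (pd_eq_on i (cc_open cc) _ V0) => z Vz; rewrite /sconst.
 by rewrite -(vdot_tr lm cc _ _ Vz) -(grad_tr lm cc (ls_smooth ls) Vz) -(scal_tr lm cc Vz).
by rewrite -t0 -[LHS](mulKmx (cc_jac cc V0)) gE mulmx0.
Qed.

Lemma tnorm2_tr V gt tau k (S : tensor R n k) y : coord_change U V g gt tau -> V y ->
 tnorm2 (gt y) (tpull (jac tau y) S) = tnorm2 (g (tau y)) S.
Proof. by move=> cc Vy; exact: (tinner_tr lm cc). Qed.

Lemma skew_norm_le x : U x ->
 tnorm2 (g x) (skew_tens g x) <= tnorm2 (g x) (riem_tens g x) * vdot (g x) (grad F x) (grad F x).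
Proof.
move=> Ux; have [V [gt [tau [cc ls' [V0 t0 g0 K0]]]]] := normal_at ls gpos Ux.
rewrite -t0 -!(tnorm2_tr _ cc V0) -(vdot_tr lm cc _ _ V0) -(grad_tr lm cc (ls_smooth ls) V0).
rewrite -(skew_tens_tr lm cc V0) -(riem_tens_tr lm cc V0) g0.
apply: tnorm2_contr => a b k; rewrite [LHS](ricci_identity ls')//; sumr l.
by rewrite /riem_tens /tens4 riemdE g0 mulmx1.
Qed.

Lemma ric_norm_le x : U x -> tnorm2 (g x) (tens2 (ricm g x)) <= n%:R * tnorm2 (g x) (riem_tens g x).
Proof.
move=> Ux; have [V [gt [tau [cc ls' [V0 t0 g0 K0]]]]] := normal_at ls gpos Ux.
rewrite -t0 -!(tnorm2_tr _ cc V0) -(riem_tens_tr lm cc V0) -(ric_tens_tr lm cc V0) g0.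
apply: tnorm2_trace4 => j k; rewrite /tens2 ricmE; sumr i.
by rewrite /riem_tens /tens4 riemdE g0 mulmx1.
Qed.

Lemma scal_sqr_le x : U x -> scal g x ^+ 2 <= n%:R * tnorm2 (g x) (tens2 (ricm g x)).
Proof.
move=> Ux; have [V [gt [tau [cc ls' [V0 t0 g0 K0]]]]] := normal_at ls gpos Ux.
rewrite -t0 -!(tnorm2_tr _ cc V0) -(ric_tens_tr lm cc V0) -(scal_tr lm cc V0) /scal g0 gtrace1.
exact: trace_sqr_le.
Qed.

Lemma driftW_norm_le x : U x -> vdot (g x) (driftW g x) (driftW g x) <=
 10 * tnorm2 (g x) (tens2 (ricm g x)) * tnorm2 (g x) (dric_tens g x).
Proof.
move=> Ux; have [V [gt [tau [cc ls' [V0 t0 g0 K0]]]]] := normal_at ls gpos Ux.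
rewrite -t0 -!(tnorm2_tr _ cc V0) -(ric_tens_tr lm cc V0) -(dric_tens_tr lm cc V0).
rewrite -(vdot_tr lm cc _ _ V0) -(driftW_tr lm cc V0) g0.
apply: le_trans (contr_mix_norm (s := tens2 (ricm gt 0)) (t := tmix (fun a => dric gt a 0)) _) _ => [i|].
 by rewrite mxE g0.
rewrite [10 * _]mulrC -mulrA ler_wpM2l ?mix_norm//.
have p0 := posdef_change cc gpos V0; rewrite g0 in p0.
by rewrite tnorm2_ge0 ?trmx1.
Qed.

End SolitonIdentities.

Lemma grad_tr_C1 (R : realType) n (U V : set 'rV[R]_n) g gt tau F y : local_metric U g ->
 coord_change U V g gt tau -> Ck_on 1 U F -> V y ->
 grad (fun z => F (tau z)) y = jac tau y *m grad F (tau y).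
Proof.
move=> lm cc CF Vy; apply/matrixP => i j; rewrite !mxE.
have [_ ->] := derive_comp_row i (cc_open cc) (lm_open lm) (fun c => cc_smooth cc c 1) CF Vy (cc_map cc Vy).
by sumr c; rewrite !mxE.
Qed.

(** * Tensor fields on the manifold *)
Section Atlas.
Context {R : realType} {n : nat} {M : topologicalType} {A : smooth_atlas R n M}.
Local Notation rV := 'rV[R]_n.
Implicit Types (i j : chart_idx A) (x : M).

Lemma open_img i : open (chart_img i).
Proof. exact: chart_img_open. Qed.
Arguments open_img : clear implicits.

Lemma imgP i x : chart_dom i x -> chart_img i (chart i x).
Proof. by move=> dx; exists x. Qed.

Lemma inv_dom i y : chart_img i y -> chart_dom i (chart_inv i y).
Proof. by move=> [x dx <-]; rewrite chartK. Qed.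

Lemma chart_invK i y : chart_img i y -> chart i (chart_inv i y) = y.
Proof. by move=> [x dx <-]; rewrite chartK. Qed.

Definition overlap i j : set rV := chart i @` (chart_dom i `&` chart_dom j).

Definition trans i j (y : rV) : rV := chart j (chart_inv i y).

Lemma open_chart_inv i (B : set M) : open B -> open [set y | chart_img i y /\ B (chart_inv i y)].
Proof.
move=> oB; rewrite openE => y [iy By]; rewrite /interior.
have oU : open (chart_img i) := open_img i.
have h1 : \forall z \near y, chart_img i z by exact: near_open.
have h2 : \forall z \near y, B (chart_inv i z).
 apply: (chart_inv_continuous iy); exact: open_nbhs_nbhs.
by apply: filterS2 h1 h2 => z.
Qed.

Lemma overlapE i j : overlap i j = [set y | chart_img i y /\ chart_dom j (chart_inv i y)].
Proof.
apply/seteqP; split => y [] => [x [dx dx'] <-|]; first by split; [exact: imgP|rewrite chartK].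
by move=> [x dx <-]; rewrite chartK// => dx'; exists x.
Qed.

Lemma overlap_open i j : open (overlap i j).
Proof. by rewrite overlapE; apply: open_chart_inv; exact: chart_dom_open. Qed.

Definition compatible (Q : chart_idx A -> rV -> R) :=
 forall i j x, chart_dom i x -> chart_dom j x -> Q i (chart i x) = Q j (chart j x).

Definition glue (Q : chart_idx A -> rV -> R) x := Q (chart_at A x) (chart (chart_at A x) x).

Lemma glueE Q i x : compatible Q -> chart_dom i x -> glue Q x = Q i (chart i x).
Proof. by move=> cQ dx; apply: cQ => //; exact: chart_atP. Qed.

Lemma glue_inv Q i y : compatible Q -> chart_img i y -> glue Q (chart_inv i y) = Q i y.
Proof. by move=> cQ iy; rewrite (glueE cQ (inv_dom iy)) chart_invK. Qed.

Definition Ck_fun k (h : M -> R) := forall i, Ck_on k (chart_img i) (fun y => h (chart_inv i y)).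

Lemma glue_Ck k Q : compatible Q -> (forall i, Ck_on k (chart_img i) (Q i)) -> Ck_fun k (glue Q).
Proof.
move=> cQ sQ i; apply: Ck_on_eq (sQ i) => [|y iy]; first exact: open_img.
by rewrite glue_inv.
Qed.

Lemma Ck_fun_cts k (h : M -> R) : Ck_fun k h -> continuous h.
Proof.
move=> Ch x; have dx := chart_atP A x; set i := chart_at A x in dx.
have c1 : {for x, continuous (fun z => h (chart_inv i (chart i z)))}.
 apply: (ct_comp (h := chart i) (F := fun y => h (chart_inv i y))); first exact: chart_continuous.
 exact: Ck_cts (Ch i) (imgP dx).
apply: ct_near c1.
have : \forall z \near x, chart_dom i z by apply: open_nbhs_nbhs; split=> //; exact: chart_dom_open.
by apply: filterS => z dz; rewrite chartK.
Qed.

Variable g : riemannian_metric A.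

Lemma g_posdef i y : chart_img i y -> posdef (g i y).
Proof. by move=> iy v v0; exact: metric_pos. Qed.
Arguments g_posdef {i y} _ _ _.

Lemma metric_at i : local_metric (chart_img i) (g i).
Proof.
split; first exact: open_img.
- by move=> a b; exact: metric_smooth.
- by move=> y iy; exact: (Defs.metric_sym g iy).
- by move=> y iy; apply: posdef_unit; exact: g_posdef.
Qed.

Lemma chart_change i j : coord_change (chart_img j) (overlap i j) (g j) (g i) (trans i j).
Proof.
have comp y : overlap i j y -> g i y = jac (trans i j) y *m g j (trans i j y) *m (jac (trans i j) y)^T.
 by move=> [x [di dj] <-]; rewrite /trans chartK//; exact: metric_compat.
split=> //; first exact: overlap_open.
- by move=> c; exact: chart_smooth.
- by move=> y [x [di dj] <-]; rewrite /trans chartK//; exact: imgP.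
- move=> y Vy; have iy : chart_img i y by move: Vy; rewrite overlapE => -[].
 by have := lm_unit (metric_at i) iy; rewrite comp// !unitmx_mul => /andP[/andP[]].
Qed.

Lemma overlapP i j x : chart_dom i x -> chart_dom j x -> overlap i j (chart i x).
Proof. by move=> di dj; exists x. Qed.

Lemma transitionE i j x : chart_dom i x -> trans i j (chart i x) = chart j x.
Proof. by move=> di; rewrite /trans chartK. Qed.

Lemma scalar_compat_tr (Q : chart_idx A -> rV -> R) :
 (forall i j y, coord_change (chart_img j) (overlap i j) (g j) (g i) (trans i j) ->
  overlap i j y -> Q i y = Q j (trans i j y)) -> compatible Q.
Proof.
by move=> tr i j x di dj; rewrite (tr i j _ (chart_change i j) (overlapP di dj)) transitionE.
Qed.

Definition covector (w : chart_idx A -> rV -> 'cV[R]_n) :=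
 forall i j y, overlap i j y -> w i y = jac (trans i j) y *m w j (trans i j y).

Definition smooth_cov (w : chart_idx A -> rV -> 'cV[R]_n) := forall i, smx (chart_img i) (w i).

Definition dotM (u v : chart_idx A -> rV -> 'cV[R]_n) := glue (fun i y => vdot (g i y) (u i y) (v i y)).

Definition divM (w : chart_idx A -> rV -> 'cV[R]_n) := glue (fun i y => divc (g i) (w i) y).

Definition gradM (h : M -> R) : chart_idx A -> rV -> 'cV[R]_n := fun i => grad (fun y => h (chart_inv i y)).

Definition cts_cov (w : chart_idx A -> rV -> 'cV[R]_n) :=
 forall i a, Ck_on 0 (chart_img i) (fun y => w i y a 0).

Lemma cov_gradM h : Ck_fun 1 h -> covector (gradM h).
Proof.
move=> Ch i j y Vy; have cc := chart_change i j.
rewrite -(grad_tr_C1 (metric_at j) cc (Ch j) Vy); apply/colP => a; rewrite !mxE.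
apply: (pd_eq_on a (cc_open cc) _ Vy) => z [x [di dj] <-].
by rewrite transitionE// !chartK.
Qed.

Lemma cts_gradM h : Ck_fun 1 h -> cts_cov (gradM h).
Proof.
move=> Ch i a; have := Ck_partial a (Ch i); apply: Ck_on_eq => [|y _]; first exact: open_img.
by rewrite mxE.
Qed.

Lemma smooth_cts_cov w : smooth_cov w -> cts_cov w.
Proof. by move=> sw i a; exact: sw. Qed.

Lemma dot_compat u v : covector u -> covector v -> compatible (fun i y => vdot (g i y) (u i y) (v i y)).
Proof.
move=> cu cv; apply: scalar_compat_tr => i j y cc Vy.
by rewrite (cu i j y Vy) (cv i j y Vy) (vdot_tr (metric_at j) cc).
Qed.

Lemma div_compat w : smooth_cov w -> covector w -> compatible (fun i y => divc (g i) (w i) y).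
Proof.
move=> sw cw; apply: scalar_compat_tr => i j y cc Vy.
by apply: (divc_tr (metric_at j) cc (sw j)) => // z Vz; exact: cw.
Qed.

Lemma tnorm_compat k (T : (rV -> 'M[R]_n) -> rV -> tensor R n k) :
 (forall i j y, overlap i j y -> T (g i) y = tpull (jac (trans i j) y) (T (g j) (trans i j y))) ->
 compatible (fun i y => tnorm2 (g i y) (T (g i) y)).
Proof.
move=> tT; apply: scalar_compat_tr => i j y cc Vy.
by rewrite (tT i j y Vy); exact: (tinner_tr (metric_at j) cc).
Qed.

Lemma dotE u v i x : covector u -> covector v -> chart_dom i x ->
 dotM u v x = vdot (g i (chart i x)) (u i (chart i x)) (v i (chart i x)).
Proof. by move=> cu cv dx; exact: glueE (dot_compat cu cv) dx. Qed.

Lemma divE w i x : smooth_cov w -> covector w -> chart_dom i x -> divM w x = divc (g i) (w i) (chart i x).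
Proof. by move=> sw cw dx; exact: glueE (div_compat sw cw) dx. Qed.

Lemma Ck_gtrace k i (T : 'I_n -> 'I_n -> rV -> R) : (forall a b, Ck_on k (chart_img i) (T a b)) ->
 Ck_on k (chart_img i) (fun y => gtrace (g i y) (fun a b => T a b y)).
Proof.
have oU : open (chart_img i) := open_img i.
move=> sT; apply: Ck_sum => // a _; apply: Ck_sum => // b _; apply: CkM => //.
exact: (smooth_ginv (metric_at i)).
Qed.

Lemma cts_dotM u v : covector u -> covector v -> cts_cov u -> cts_cov v -> continuous (dotM u v).
Proof.
move=> cu cv su sv; apply: (@Ck_fun_cts 0); apply: glue_Ck; first exact: dot_compat.
move=> i; apply: Ck_gtrace => a b; apply: CkM; [exact: open_img|exact: su|exact: sv].
Qed.

Lemma cts_dot_grad h w : Ck_fun 1 h -> smooth_cov w -> covector w -> continuous (dotM (gradM h) w).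
Proof. by move=> Ch sw cw; apply: cts_dotM => //; [exact: cov_gradM|exact: cts_gradM|exact: smooth_cts_cov]. Qed.

Lemma cts_divM w : smooth_cov w -> covector w -> continuous (divM w).
Proof.
move=> sw cw; apply: (@Ck_fun_cts 0); apply: glue_Ck; first exact: div_compat.
by move=> i; apply: Ck_gtrace => a b; exact: (smooth_cov1 (metric_at i) a (sw i)).
Qed.

Lemma dot_ge0 w x : 0 <= dotM w w x.
Proof.
have iy := imgP (chart_atP A x); exact: (tnorm2_ge0 (k := 1) _ (Defs.metric_sym g iy) (g_posdef iy)).
Qed.

Lemma dot_CS u v x : dotM u v x ^+ 2 <= dotM u u x * dotM v v x.
Proof.
have iy := imgP (chart_atP A x); exact: vdot_CS (Defs.metric_sym g iy) (g_posdef iy).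
Qed.

(** Level sets are closed by continuity and open by the mean value theorem on segments in a chart,
    so connectedness applies. *)
Lemma gradM0_const h : connected [set: M] -> Ck_fun 1 h ->
 (forall i y, chart_img i y -> gradM h i y = 0) -> forall x y, h x = h y.
Proof.
move=> cM Ch g0 p q.
have ch := Ck_fun_cts Ch.
suff E : [set x | h x = h p] = [set: M].
 by have : [set x | h x = h p] q by rewrite E.
apply: cM; first by exists p.
- exists [set x | h x = h p]; last by rewrite setTI.
 rewrite openE => x /= hx; rewrite /interior.
 have dx := chart_atP A x; set i := chart_at A x in dx.
 have oU : open (chart_img i) := open_img i.
 have [r r0 rU] := open_ball_sub oU (imgP dx).
 have N1 : \forall z \near x, chart_dom i z by apply: open_nbhs_nbhs; split=> //; exact: chart_dom_open.
 have N2 : \forall z \near x, `|chart i z - chart i x| <= r.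
  have /cvgrPdist_le/(_ _ r0) := chart_continuous dx.
  by apply: filterS => z; rewrite distrC.
 apply: filterS2 N1 N2 => z dz zr /=; rewrite -hx -(chartK dz) -(chartK dx).
 pose v := chart i z - chart i x.
 have Ut t : `|t| <= `|1 : R| -> chart_img i (chart i x + t *: v).
  by move=> t1; apply: rU; rewrite normrZ; apply: le_trans zr; rewrite -/v -[leRHS]mul1r ler_wpM2r// -[leRHS]normr1.
 have [t t1|t /Ut Ct] := @MVT_line R n (fun y => h (chart_inv i y)) (chart i x) v 1.
  by apply: diff_derivable; exact: Ck_diff oU (Ch i) (Ut _ t1).
 rewrite scale1r mul1r [chart i x + v]addrC subrK => /eqP; rewrite subr_eq => /eqP ->.
 rewrite (C1_derive v oU (Ch i) Ct) big1 ?add0r// => k _.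
 by have /matrixP/(_ k 0) := g0 i _ Ct; rewrite !mxE => ->; exact: mulr0.
- exists [set x | h x = h p]; last by rewrite setTI.
 by apply: (preimage_closed (D := [set y | y = h p])) => [x _|]; [exact: ch|exact: closed_eq].
Qed.

End Atlas.
Arguments Ck_fun {R n M} A k h.

(** * Measures with density and Borel sets *)

Section Density.
Local Open Scope ereal_scope.
Context d (T : measurableType d) (R : realType).
Variables (mu nu : {measure set T -> \bar R}) (g : T -> R).
Hypothesis mg : measurable_fun [set: T] g.
Hypothesis g0 : forall x, (0 <= g x)%R.
Hypothesis nuE : forall B, measurable B -> nu B = \int[mu]_(x in B) (g x)%:E.

Import HBNNSimple.

(** [nu] is known only through its values on measurable sets; the identity passes from indicators to
    simple functions and, by monotone convergence, to all nonnegative functions. *)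
Lemma integral_density (f : T -> \bar R) : (forall x, 0 <= f x) -> measurable_fun [set: T] f ->
 \int[mu]_x (f x * (g x)%:E) = \int[nu]_x f x.
Proof.
move=> f0 mf; pose h := nnsfun_approx measurableT mf.
have mgE : measurable_fun [set: T] (fun x => (g x)%:E) by exact/measurable_EFinP.
have -> : \int[nu]_x f x = lim (\int[nu]_x (EFin \o h n) x @[n --> \oo]).
 have fE x : f x = lim ((EFin \o h n) x @[n --> \oo]).
  by apply/esym/cvg_lim => //; exact: cvg_nnsfun_approx.
 under eq_integral do rewrite fE.
 apply: monotone_convergence => //.
 - by move=> n; exact/measurable_EFinP.
 - by move=> n x _ //=; rewrite lee_fin.
 - by move=> x _ a b ab; rewrite lee_fin; exact/lefP/nd_nnsfun_approx.
have -> : \int[mu]_x (f x * (g x)%:E) = lim (\int[mu]_x ((EFin \o h n) x * (g x)%:E) @[n --> \oo]).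
 have fg x : f x * (g x)%:E = lim (((EFin \o h n) x * (g x)%:E) @[n --> \oo]).
  by apply/esym/cvg_lim => //; apply: cvgeZr => //; exact: cvg_nnsfun_approx.
 under eq_integral do rewrite fg.
 apply: monotone_convergence => [//| | |].
 - by move=> n; apply/emeasurable_funM => //; exact/measurable_EFinP.
 - by move=> n x _ /=; rewrite mule_ge0 ?lee_fin.
 - by move=> x _ a b ab/=; rewrite lee_wpmul2r ?lee_fin//; exact/lefP/nd_nnsfun_approx.
suff suf n : \int[mu]_x ((EFin \o h n) x * (g x)%:E) = \int[nu]_x (EFin \o h n) x.
 by under eq_fun do rewrite suf.
transitivity (\int[nu]_x (\sum_(y \in range (h n)) (y * \1_(h n @^-1` [set y]) x)%:E)); last first.
 by apply: eq_integral => t _; rewrite /= fimfunE -fsumEFin.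
have indich m r : measurable_fun [set: T] (fun x => (r * \1_(h m @^-1` [set r]) x)%:E).
 by apply/measurable_EFinP; exact: measurable_funM.
rewrite ge0_integral_fsum//; last by move=> m y _; exact: nnfun_muleindic_ge0.
transitivity (\int[mu]_x (\sum_(y \in range (h n)) (y * \1_(h n @^-1` [set y]) x)%:E * (g x)%:E)).
 under [RHS]eq_integral => x _.
  rewrite -ge0_mule_fsuml => [|y]; last exact: nnfun_muleindic_ge0.
  rewrite fsumEFin // -(fimfunE _ x); over.
 by [].
rewrite ge0_integral_fsum//; last 2 first.
 - by move=> y; apply: emeasurable_funM.
 - by move=> m y _; apply: mule_ge0; [exact: nnfun_muleindic_ge0|rewrite lee_fin].
apply: eq_fsbigr => r rhn.
under [RHS]eq_integral do rewrite EFinM.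
rewrite integralZl_indic_nnsfun => //.
under eq_integral do rewrite EFinM -muleA.
rewrite ge0_integralZl//.
- under eq_integral do rewrite muleC.
 rewrite (eq_integral ((fun x => (g x)%:E) \_ (h n @^-1` [set r]))); last first.
  by move=> x xE; rewrite epatch_indic.
 by rewrite -integral_mkcond -nuE// integral_indic// setIT.
- by apply: emeasurable_funM => //; exact/measurable_EFinP.
- by move=> t _; rewrite mule_ge0 ?lee_fin.
- by move: rhn; rewrite inE => -[t _ <-]; rewrite lee_fin.
Qed.

End Density.

Section Borel.
Context {R : realType} {M : ptopologicalType}.

Lemma open_borel (B : set M) : open B -> measurable (B : set (borel M)).
Proof. by move=> oB; apply: sub_sigma_algebra. Qed.

Lemma closed_borel (B : set M) : closed B -> measurable (B : set (borel M)).
Proof. by move=> cB; rewrite -(setCK B); apply: measurableC; apply: open_borel; exact: closed_openC. Qed.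

Lemma preimage_open_on {N : topologicalType} (D : set M) (f : M -> N) (B : set N) : open D ->
 (forall x, D x -> {for x, continuous f}) -> open B -> open (D `&` f @^-1` B).
Proof.
move=> oD cf oB; rewrite openE => x [Dx Bfx]; rewrite /interior.
have h1 : \forall z \near x, D z by apply: open_nbhs_nbhs.
have h2 : \forall z \near x, B (f z) by apply: (cf x Dx); exact: open_nbhs_nbhs.
by apply: filterS2 h1 h2 => z.
Qed.

Lemma ct_borel_map {N : ptopologicalType} (D : set M) (f : M -> N) : open D ->
 (forall x, D x -> {for x, continuous f}) -> measurable_fun (D : set (borel M)) (f : borel M -> borel N).
Proof.
move=> oD cf; apply: (@measurability _ _ (borel M) (borel N) D f (@open N)) => // _ [B oB <-].
by apply: open_borel; exact: preimage_open_on.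
Qed.

Lemma ct_borel (D : set M) (f : M -> R) : open D ->
 (forall x, D x -> {for x, continuous f}) -> measurable_fun (D : set (borel M)) (f : borel M -> R).
Proof.
move=> oD cf; apply: (@measurability _ _ _ _ _ _ (@RGenOpens.G R)); first exact: RGenOpens.measurableE.
move=> _ [_ [x [y ->]] <-]; apply: open_borel; exact: preimage_open_on.
Qed.

End Borel.

(** * Lebesgue measure on $R^n$ *)
Section RationalBoxes.
Context {R : realType}.

Lemma continuous_dist n (c : 'rV[R]_n) : continuous (fun y : 'rV[R]_n => `|y - c|).
Proof.
move=> y; apply: (@continuous_comp _ _ _ (fun z : 'rV[R]_n => z - c) Num.norm y); last exact: norm_continuous.
apply: ct_row => k; rewrite (_ : (fun z : 'rV[R]_n => (z - c) 0 k) = (fun z => z 0 k - c 0 k)); last first.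
 by fext z; rewrite mxsubE.
by apply: ctB; [exact: Ck_cts (Ck_coord 0 k openT) I|exact: ct_cst].
Qed.

Lemma rational_box n (O : set 'rV[R]_n) z : open O -> O z ->
 exists (q : 'rV[rat]_n) (k : nat), `|z - map_mx ratr q| < k.+1%:R^-1 /\
  (forall y, `|y - map_mx ratr q| < k.+1%:R^-1 -> O y).
Proof.
move=> oO Oz; have [r r0 rO] := open_ball_sub oO Oz.
pose k := Num.truncn (2 / r).
have kr : k.+1%:R^-1 <= r / 2.
 rewrite -[leRHS]invrK lef_pV2 ?posrE ?ltr0n ?invr_gt0 ?divr_gt0// invf_div ltW//.
 exact: truncnS_gt.
have e0 : 0 < k.+1%:R^-1 :> R by rewrite invr_gt0 ltr0n.
have ex i : exists q : rat, `|z 0 i - ratr q| < k.+1%:R^-1 / 2.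
 have [|q] := @rat_in_itvoo R (z 0 i - k.+1%:R^-1 / 2) (z 0 i + k.+1%:R^-1 / 2).
  by move: (z 0 i) (k.+1%:R^-1) e0 => a e e0; lra.
 by rewrite in_itv /= => /andP[a b]; exists q; rewrite distrC ltr_distl a b.
have [q qP] := choice ex.
have zq : `|z - map_mx ratr (\row_i q i)| <= k.+1%:R^-1 / 2.
 by apply: row_normP => [|i j]; [rewrite divr_ge0// ltW|rewrite ord1 !mxE ltW].
exists (\row_i q i), k; split=> [|y yq]; first by apply: le_lt_trans zq _; rewrite ltr_pdivrMr// ltr_pMr// ltr1n.
have -> : y = z + (y - z) by rewrite addrC subrK.
apply: rO; have -> : y - z = (y - map_mx ratr (\row_i q i)) - (z - map_mx ratr (\row_i q i)).
 by rewrite opprB addrA subrK.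
apply: (le_trans (ler_normB _ _)); apply: (le_trans (lerD (ltW yq) zq)).
by move: kr e0; move: (k.+1%:R^-1) => e; lra.
Qed.

Lemma open_bigcup_boxes n (O : set 'rV[R]_n) : open O ->
 O = \bigcup_(p : 'rV[rat]_n * nat) (if `[< forall y, `|y - map_mx ratr p.1| < p.2.+1%:R^-1 -> O y >]
   then [set y | `|y - map_mx ratr p.1| < p.2.+1%:R^-1] else set0).
Proof.
move=> oO; apply/seteqP; split => z.
 by move=> /(rational_box oO)[q [k [zq qO]]]; exists (q, k) => //=; case: asboolP.
by move=> [[q k] _] /=; case: asboolP => // H; exact: H.
Qed.

Lemma normr_row_ltP n (x : 'rV[R]_n) (r : R) : 0 < r -> (`|x| < r) = [forall i, `|x 0 i| < r].
Proof.
move=> r0; apply/idP/forallP => [h i|h]; first exact: le_lt_trans (coord_le x 0 i) h.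
case: n x h => [|n] x h; first by rewrite [x]thinmx0 normr0.
have [j jP] : exists j, forall i, `|x 0 i| <= `|x 0 j|.
 have [j _ jP] := @arg_maxP _ _ _ ord0 xpredT (fun i => `|x 0 i|) isT.
 by exists j => i; exact: jP.
apply: le_lt_trans (h j); apply: row_normP => // i i'; rewrite ord1; exact: jP.
Qed.

Definition consrow n (p : R * 'rV[R]_n) : 'rV[R]_n.+1 := row_mx (p.1%:M : 'rV[R]_1) p.2.

Lemma consrow0 n (p : R * 'rV[R]_n) : consrow p 0 ord0 = p.1.
Proof.
have -> : ord0 = lshift n (0 : 'I_1) by apply/val_inj.
by apply: (etrans (row_mxEl (p.1%:M : 'rV[R]_1) p.2 0 0)); rewrite mxE.
Qed.

Lemma consrowS n (p : R * 'rV[R]_n) i : consrow p 0 (lift ord0 i) = p.2 0 i.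
Proof.
have -> : lift ord0 i = rshift 1 i by apply/val_inj.
exact: row_mxEr.
Qed.

Lemma consrow_norm_le n (p : R * 'rV[R]_n) (r : R) : 0 <= r ->
 (`|consrow p| <= r) = (`|p.1| <= r) && (`|p.2| <= r).
Proof.
move=> r0; apply/idP/andP => [h|[h1 h2]].
 split; first by rewrite -consrow0; exact: le_trans (coord_le _ 0 ord0) h.
 by apply: row_normP => // i j; rewrite ord1 -consrowS; exact: le_trans (coord_le _ 0 _) h.
apply: row_normP => // i j; rewrite ord1.
have [l ->|->] := unliftP ord0 j; last by rewrite consrow0.
by rewrite consrowS; exact: le_trans (coord_le _ 0 l) h2.
Qed.

(** Open sets are countable unions of rational cubes of the sup norm, and the preimage of such a
    cube is the product of an interval and a cube, hence measurable for the product
    sigma-algebra. *)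
Lemma consrow_meas n :
 measurable_fun [set: R * borel 'rV[R]_n] (@consrow n : R * borel 'rV[R]_n -> borel 'rV[R]_n.+1).
Proof.
apply: (@measurability _ _ _ (borel 'rV[R]_n.+1) _ _ (@open 'rV[R]_n.+1)) => // _ [B oB <-].
rewrite setTI (open_bigcup_boxes oB) preimage_bigcup.
apply: countable_bigcupT_measurable; first exact: countableP.
move=> [q k]; case: asboolP => _; last by rewrite preimage_set0.
rewrite (_ : _ @^-1` _ = ball (ratr (q 0 ord0) : R) k.+1%:R^-1 `*`
 [set y : 'rV[R]_n | `|y - map_mx ratr (\row_i q 0 (lift ord0 i))| < k.+1%:R^-1]).
 apply: measurableX; first exact: measurable_ball.
 apply: open_borel; rewrite -[X in open X]/((fun y => `|y - map_mx ratr (\row_i q 0 (lift ord0 i))|) @^-1` [set r : R | r < k.+1%:R^-1]).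
 apply: open_comp; last exact: open_lt.
 by move=> y _; exact: continuous_dist.
have e0 : 0 < k.+1%:R^-1 :> R by rewrite invr_gt0 ltr0n.
apply/seteqP; split => -[t y] /=; rewrite /ball /= !normr_row_ltP//.
 move=> /forallP h; split.
  by have := h ord0; rewrite mxsubE consrow0 mxE distrC.
 by apply/forallP => i; have := h (lift ord0 i); rewrite !mxsubE consrowS !mxE.
move=> [h1 /forallP h2]; apply/forallP => i; rewrite mxsubE.
have [j ->|->] := unliftP ord0 i.
 by have := h2 j; rewrite mxsubE consrowS !mxE.
by rewrite consrow0 mxE distrC.
Qed.

End RationalBoxes.

Section SigmaFinitePack.
Context d (T : measurableType d) (R : realType) (mu : {measure set T -> \bar R}).
Hypothesis smu : sigma_finite [set: T] mu.
Let H1 := isSFinite.Build _ _ _ _ (sfinite_measure_sigma_finite smu).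
Let H2 := isSigmaFinite.Build _ _ _ _ smu.
Definition sigma_finite_pack : {sigma_finite_measure set T -> \bar R} :=
 HB.pack_for (SigmaFiniteMeasure.type T R) (Measure.sort mu) H1 H2.
End SigmaFinitePack.

Definition pushfwd d d' (T1 : measurableType d) (T2 : measurableType d') (R : realType)
 (m : {measure set T1 -> \bar R}) (f : T1 -> T2) (mf : measurable_fun [set: T1] f) :
 {measure set T2 -> \bar R} := measure_function_pushforward__canonical__measure_function_Measure m mf.

Lemma integral_pushforward_on d d' (T1 : measurableType d) (T2 : measurableType d') (R : realType)
 (m : {measure set T1 -> \bar R}) (f : T1 -> T2) (mf : measurable_fun [set: T1] f) (F : T2 -> \bar R) :
 measurable_fun [set: T2] F -> (forall y, 0 <= F y)%E ->
 (\int[pushfwd m mf]_y F y = \int[m]_x F (f x))%E.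
Proof.
move=> mF F0.
have := ge0_integral_pushforward mf m measurableT mF (fun y _ => F0 y).
by rewrite preimage_setT.
Qed.

(* The Fixpoint [int_Rn] is integration against a measure, which makes the
 convergence theorems available for it. *)
Section LebesgueMeasure.
Context {R : realType}.
Local Open Scope ereal_scope.

Definition cube n (r : R) : set 'rV[R]_n := [set y | (`|y| <= r)%R].

Lemma cube_borel n r : measurable (@cube n r : set (borel 'rV[R]_n)).
Proof.
apply: closed_borel; apply: (@preimage_closed _ _ _ [set t : R | (t <= r)%R]); last exact: closed_le.
by move=> y _; exact: norm_continuous.
Qed.

Lemma bounded_box_cover n : [set: 'rV[R]_n] = \bigcup_k @cube n k%:R.
Proof.
apply/seteqP; split => // y _; exists (Num.truncn `|y|).+1 => //.
by rewrite /cube /= ltW// truncnS_gt.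
Qed.

(** The volume of cubes is included so that the measure is sigma-finite, which the product
    construction of the next dimension requires. *)
Definition represents_int_Rn n (mu : {measure set (borel 'rV[R]_n) -> \bar R}) :=
 (forall F, measurable_fun [set: borel 'rV[R]_n] F -> (forall y, 0 <= F y) ->
  int_Rn F = \int[mu]_y F y) /\
 (forall r, (0 <= r)%R -> mu (@cube n r) = ((r *+ 2) ^+ n)%:E).

Lemma sigma_finite_boxes n (mu : {measure set (borel 'rV[R]_n) -> \bar R}) :
 represents_int_Rn mu -> sigma_finite [set: borel 'rV[R]_n] mu.
Proof.
move=> [_ muk]; exists (fun k => @cube n k%:R); first exact: bounded_box_cover.
by move=> k; split; [exact: cube_borel|rewrite muk// ltry].
Qed.

Lemma measurable_section n (F : 'rV[R]_n.+1 -> \bar R) :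
 measurable_fun [set: borel 'rV[R]_n.+1] F -> measurable_fun [set: R * borel 'rV[R]_n] (fun p => F (consrow p)).
Proof. by move=> mF; exact: (measurableT_comp mF (@consrow_meas R n)). Qed.

(** The measure in the next dimension is the product with Lebesgue measure on the line, carried over
    by [consrow]; Tonelli's theorem identifies its integral with the iterated one. *)
Lemma int_Rn_measure n : exists mu : {measure set (borel 'rV[R]_n) -> \bar R}, represents_int_Rn mu.
Proof.
elim: n => [|n [mu muP]].
 exists (@dirac _ (borel 'rV[R]_0) (0%R : 'rV[R]_0) R); split=> [F mF F0|r r0] /=.
  by rewrite integral_dirac// diracT mul1e.
 by rewrite diracE mem_set ?expr0// /cube /= normr0.
have [muE muk] := muP; pose smu' := sigma_finite_pack (sigma_finite_boxes muP).
have mc := @consrow_meas R n.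
pose nu := pushfwd (@lebesgue_measure R \x smu')%E mc.
exists nu; split=> [F mF F0|r r0].
 rewrite /nu integral_pushforward_on//; have mFc := measurable_section mF.
 rewrite (fubini_tonelli1 (m1 := @lebesgue_measure R) (m2 := smu') (fun p => F (consrow p)) mFc (fun p => F0 _)).
 apply: eq_integral => t _; rewrite /fubini_F.
 exact: (muE (fun y => F (consrow (t, y))) (measurableT_comp mFc (measurable_pair1 t)) (fun y => F0 _)).
have -> : nu (@cube n.+1 r) = (@lebesgue_measure R \x smu')%E ([set t : R | (`|t| <= r)%R] `*` @cube n r).
 congr ((_ \x _)%E _); apply/seteqP; split => -[t y] /=; rewrite /cube /=.
  by rewrite consrow_norm_le// => /andP.
 by rewrite consrow_norm_le// => /andP.
have -> : [set t : R | (`|t| <= r)%R] = `[(- r)%R, r]%classic.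
 by apply/seteqP; split => t /=; rewrite in_itv /= ler_norml.
rewrite product_measure1E//=; last exact: cube_borel.
rewrite lebesgue_measure_itv /= lte_fin muk//; case: ifPn => h.
 by rewrite -EFinD opprK -mulr2n -EFinM exprS.
suff -> : r = 0%R by rewrite mul0rn exprS mul0r mul0e.
by apply/eqP; rewrite eq_le r0 andbT; move: h; rewrite -leNgt; lra.
Qed.

Lemma measurable_int_Rn n (F : 'rV[R]_n.+1 -> \bar R) : measurable_fun [set: borel 'rV[R]_n.+1] F ->
 (forall y, 0 <= F y) -> measurable_fun [set: R] (fun t => int_Rn (fun y => F (consrow (t, y)))).
Proof.
move=> mF F0; have [mu muP] := int_Rn_measure n; have [muE _] := muP.
have mFc := measurable_section mF.
have := measurable_fun_fubini_tonelli_F (m2 := sigma_finite_pack (sigma_finite_boxes muP)) (fun p => F (consrow p)) mFc (fun p => F0 _).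
apply: eq_measurable_fun => t _; rewrite /fubini_F.
by apply/esym; exact: (muE (fun y => F (consrow (t, y))) (measurableT_comp mFc (measurable_pair1 t)) (fun y => F0 _)).
Qed.

(** A translate of Lebesgue measure has the same values on half-open intervals, and these determine
    the measure. *)
Lemma integral_shift (a : R) (F : R -> \bar R) : measurable_fun [set: R] F -> (forall t, 0 <= F t) ->
 \int[@lebesgue_measure R]_t F (t + a)%R = \int[@lebesgue_measure R]_t F t.
Proof.
move=> mF F0; have ms : @measurable_fun _ _ (measurableTypeR R) (measurableTypeR R) setT (fun t : R => (t + a)%R) by exact: measurable_funD.
rewrite -[LHS](@integral_pushforward_on _ _ (measurableTypeR R) (measurableTypeR R) R (@lebesgue_measure R) _ ms F mF F0).
apply: (@eq_measure_integral _ _ _ setT (@lebesgue_measure R) (pushfwd (@lebesgue_measure R) ms) F) => B mB _.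
apply/esym; apply: (lebesgue_measure_unique (mu := pushfwd (@lebesgue_measure R) ms)) mB => _ [[x y]] _ <-.
rewrite /=.
rewrite /pushforward (_ : _ @^-1` _ = `](x - a)%R, (y - a)%R]%classic); last first.
 by apply/seteqP; split => t /=; rewrite !in_itv /= ltrBlDr lerBrDr.
rewrite !lebesgue_measure_itv /= !lte_fin ltrD2r; case: ifP => // _.
by congr (_%:E); rewrite opprB addrA subrK.
Qed.

Lemma consrowD n (p q : R * 'rV[R]_n) : consrow (p.1 + q.1, p.2 + q.2)%R = (consrow p + consrow q)%R.
Proof. by rewrite /consrow /= raddfD /= -add_row_mx. Qed.

Lemma consrow_surj n (w : 'rV[R]_n.+1) : exists p : R * 'rV[R]_n, w = consrow p.
Proof.
exists (w 0%R ord0, \row_i w 0%R (lift ord0 i)); apply/rowP => i.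
by have [j ->|->] := unliftP ord0 i; rewrite ?consrowS ?consrow0 ?mxE.
Qed.

Lemma int_Rn_shift n (w : 'rV[R]_n) (F : 'rV[R]_n -> \bar R) :
 measurable_fun [set: borel 'rV[R]_n] F -> (forall y, 0 <= F y) ->
 int_Rn (fun y => F (y + w)%R) = int_Rn F.
Proof.
elim: n w F => [|n IH] w F mF F0 /=.
 by congr (F _); apply/rowP => -[].
have [p ->] := consrow_surj w.
transitivity (\int[@lebesgue_measure R]_t (fun t => int_Rn (fun y => F (consrow (t, y)))) (t + p.1)%R).
 apply: eq_integral => t _ /=.
 have mFt : measurable_fun [set: borel 'rV[R]_n] (fun y => F (consrow ((t + p.1)%R, y))).
  exact: (measurableT_comp (measurable_section mF) (measurable_pair1 (t + p.1)%R)).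
 rewrite -(IH p.2 _ mFt)//; congr int_Rn; fext y.
 by rewrite (consrowD (t, y) p).
apply: (integral_shift p.1 (F := fun t => int_Rn (fun y => F (consrow (t, y))))); first exact: measurable_int_Rn.
by move=> t; have [mu [muE _]] := int_Rn_measure n; rewrite muE// ?integral_ge0//; exact: (measurableT_comp (measurable_section mF) (measurable_pair1 t)).
Qed.

Definition leb_Rn n : {measure set (borel 'rV[R]_n) -> \bar R} := projT1 (cid (int_Rn_measure n)).

Lemma int_RnE n (F : 'rV[R]_n -> \bar R) : measurable_fun [set: borel 'rV[R]_n] F -> (forall y, 0 <= F y) ->
 int_Rn F = \int[leb_Rn n]_y F y.
Proof. by have [h _] := projT2 (cid (int_Rn_measure n)); exact: h. Qed.

Lemma leb_Rn_box n r : (0 <= r)%R -> leb_Rn n (@cube n r) = ((r *+ 2) ^+ n)%:E.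
Proof. by have [_ h] := projT2 (cid (int_Rn_measure n)); exact: h. Qed.

Lemma measurable_shift n (w : 'rV[R]_n) :
 measurable_fun [set: borel 'rV[R]_n] (fun y : 'rV[R]_n => (y + w)%R : borel 'rV[R]_n).
Proof.
apply: ct_borel_map => [|y _]; first exact: openT.
apply: ct_row => k; rewrite (_ : (fun z : 'rV[R]_n => _) = (fun z => z 0%R k + w 0%R k)%R); last first.
 by fext z; rewrite mxaddE.
by apply: ctD; [exact: Ck_cts (Ck_coord 0 k openT) I|exact: ct_cst].
Qed.

Lemma leb_Rn_shift n (w : 'rV[R]_n) (F : 'rV[R]_n -> \bar R) : measurable_fun [set: borel 'rV[R]_n] F ->
 (forall y, 0 <= F y) -> \int[leb_Rn n]_y F (y + w)%R = \int[leb_Rn n]_y F y.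
Proof.
move=> mF F0; rewrite -!int_RnE//; first exact: int_Rn_shift.
exact: measurableT_comp mF (measurable_shift w).
Qed.

End LebesgueMeasure.

Arguments open_img {R n M A} i.
Arguments chart_dom_open {R n M} s i.

(** * The Riemannian volume *)
(** An orthonormal frame [E] gives $(\det E)^2 \det G = 1$. *)
Lemma posdef_det (R : realType) n (G : 'M[R]_n) : G^T = G -> posdef G -> 0 < \det G.
Proof.
move=> sG pG; have [E EGE] := orthoframe sG pG.
have := congr1 determinant EGE; rewrite !det_mulmx det_tr det1 => e.
have E0 : \det E != 0 by apply: contra_eq_neq e => ->; rewrite !mul0r eq_sym oner_neq0.
have -> : \det G = ((\det E)^-1) ^+ 2 by rewrite expr2; apply: (mulfI E0); apply: (mulIf E0); rewrite e; field.
by rewrite lt_def sqrf_eq0 invr_neq0//= sqr_ge0.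
Qed.

Lemma integral_mrestr d (T : measurableType d) (R : realType) (mu : {measure set T -> \bar R}) (D : set T)
 (mD : measurable D) (F : T -> \bar R) : measurable_fun [set: T] F -> (forall x, 0 <= F x)%E ->
 (\int[mrestr mu mD]_x F x = \int[mu]_(x in D) F x)%E.
Proof.
move=> mF F0; have m1 : measurable_fun [set: T] (\1_D : T -> R) by exact: measurable_indic.
rewrite -(integral_density (mu := mu) (g := \1_D) m1)//.
 rewrite [RHS]integral_mkcond; apply: eq_integral => x _ /=.
 by rewrite patchE indicE; case: ifP => _; rewrite ?mule1 ?mule0.
by move=> B mB; rewrite integral_indic//= setIC.
Qed.

Lemma closed_cball (R : realType) n (c : 'rV[R]_n) (r : R) : closed [set y | `|y - c| <= r].
Proof.
apply: (@preimage_closed _ _ (fun y : 'rV[R]_n => `|y - c|) [set t : R | t <= r]); last exact: closed_le.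
by move=> y _; exact: continuous_dist.
Qed.

Lemma leb_Rn_dist_ball (R : realType) n (c : 'rV[R]_n) (r : R) : 0 <= r ->
 leb_Rn n [set y | `|y - c| <= r] = ((r *+ 2) ^+ n)%:E.
Proof.
move=> r0; have mB : measurable ([set y | `|y - c| <= r] : set (borel 'rV[R]_n)).
 by apply: closed_borel; exact: closed_cball.
have mb : measurable (@cube R n r : set (borel 'rV[R]_n)) by exact: cube_borel.
have -> : leb_Rn n [set y | `|y - c| <= r] = (\int[leb_Rn n]_y (\1_([set y : borel 'rV[R]_n | `|y - c| <= r]) y)%:E)%E.
 by rewrite integral_indic// setIT.
have -> : (\int[leb_Rn n]_y (\1_([set y : borel 'rV[R]_n | `|y - c| <= r]) y)%:E =
  \int[leb_Rn n]_y (\1_(@cube R n r) (y - c))%:E)%E by [].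
rewrite (leb_Rn_shift (- c) (F := fun y => (\1_(@cube R n r) y)%:E))//.
 by rewrite integral_indic// setIT leb_Rn_box.
by apply/measurable_EFinP; exact: measurable_indic.
Qed.

Section Volume.
Context {R : realType} {n : nat} {M : ptopologicalType} {A : smooth_atlas R n M}.
Local Notation rV := 'rV[R]_n.
Variable g : riemannian_metric A.
Implicit Types (i : chart_idx A).

Definition vdens i (y : rV) : R := Num.sqrt (\det (g i y)).

Lemma det_metric_gt0 i y : chart_img i y -> 0 < \det (g i y).
Proof. by move=> iy; apply: posdef_det; [exact: Defs.metric_sym iy|exact: g_posdef]. Qed.

Lemma vdens_gt0 i y : chart_img i y -> 0 < vdens i y.
Proof. by move=> iy; rewrite sqrtr_gt0 det_metric_gt0. Qed.

Lemma ct_vdens i y : chart_img i y -> {for y, continuous (vdens i)}.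
Proof.
move=> iy; apply: (ct_rcomp (h := @Num.sqrt R)); last exact: sqrt_continuous.
have sd := smooth_det (open_img i) (lm_smooth (metric_at g i)) 0.
exact: Ck_cts sd iy.
Qed.

Lemma measurable_chart_inv i :
 measurable_fun [set: borel rV] (((chart_inv i : borel rV -> borel M) \_ (chart_img i))).
Proof.
have mI : measurable (chart_img i : set (borel rV)) by apply: open_borel; exact: open_img.
apply: (measurable_restrictT _ mI).1.
by apply: (@ct_borel_map rV M (chart_img i) (chart_inv i)) => [|y iy]; [exact: open_img i|exact: chart_inv_continuous].
Qed.

Lemma measurable_vdens i : measurable_fun (chart_img i : set (borel rV)) (vdens i : borel rV -> R).
Proof. by apply: ct_borel => [|y iy]; [exact: open_img|exact: ct_vdens]. Qed.

Variable vol : {measure set (borel M) -> \bar R}.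
Hypothesis volP : riemannian_volume g vol.

Local Open Scope ereal_scope.

Lemma dom_borel i : measurable (chart_dom i : set (borel M)).
Proof. by apply: open_borel; exact: chart_dom_open. Qed.

Lemma img_borel i : measurable (chart_img i : set (borel rV)).
Proof. by apply: open_borel; exact: open_img. Qed.

(** The hypothesis on the volume speaks of sets only. It says that on the chart domain [vol] has
    density [dens] with respect to the image of Lebesgue measure under the chart inverse;
    [integral_density] then reaches functions. [phi] extends the chart inverse by a default point,
    so that it is measurable everywhere. *)
Lemma ge0_int_chart i (F : borel M -> \bar R) : measurable_fun [set: borel M] F -> (forall x, 0 <= F x) ->
 \int[vol]_(x in chart_dom i) F x = \int[leb_Rn n]_(y in chart_img i) (F (chart_inv i y) * (vdens i y)%:E).
Proof.
move=> mF F0.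
pose phi := (chart_inv i : borel rV -> borel M) \_ (chart_img i).
have phiE y : chart_img i y -> phi y = chart_inv i y by move=> iy; rewrite /phi patchE mem_set.
have mphi := measurable_chart_inv i; have mD := dom_borel i; have mI := img_borel i.
pose mu := pushfwd (mrestr (leb_Rn n) mI) mphi.
pose dens := ((fun x => vdens i (chart i x)) : borel M -> R) \_ (chart_dom i).
have md : measurable_fun [set: borel M] dens.
 apply: (measurable_restrictT _ mD).1; apply: (@ct_borel R M (chart_dom i) (fun x => vdens i (chart i x))) => [|x dx]; first exact: chart_dom_open.
 by apply: ct_comp; [exact: chart_continuous|apply: ct_vdens; exact: imgP].
have d0 x : (0 <= dens x)%R by rewrite /dens patchE; case: ifP => // _; exact: sqrtr_ge0.
have denE x : chart_dom i x -> dens x = vdens i (chart i x) by move=> dx; rewrite /dens patchE mem_set.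
have intmu G : measurable_fun [set: borel M] G -> (forall x, 0 <= G x) ->
  \int[mu]_x G x = \int[leb_Rn n]_(y in chart_img i) G (chart_inv i y).
 move=> mG G0; rewrite integral_pushforward_on// integral_mrestr//; last exact: measurableT_comp.
 by apply: eq_integral => y; rewrite inE => iy; congr (G _); exact: phiE.
have mFd : measurable_fun [set: borel M] (fun x => F x * (dens x)%:E).
 by apply: emeasurable_funM => //; exact/measurable_EFinP.
rewrite -(integral_mrestr vol mD)// -(integral_density (mu := mu) md)//.
 rewrite intmu// => [|x]; last by rewrite mule_ge0 ?lee_fin.
 apply: eq_integral => y; rewrite inE => iy.
 by rewrite denE ?chart_invK//; exact: inv_dom.
move=> B mB; rewrite [LHS]/(vol (B `&` chart_dom i)).
have mBD : measurable (B `&` chart_dom i) by exact: measurableI.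
apply: (etrans (volP mBD (@subIsetr _ _ _))).
rewrite [RHS]integral_mkcond.
have -> : (fun x => (dens x)%:E) \_ B = (fun x => (dens x * \1_B x)%:E).
 by fext x; rewrite patchE indicE; case: ifP => _; rewrite ?mulr1 ?mulr0.
have m1 : measurable_fun [set: borel M] (fun x => dens x * \1_B x)%R.
 by apply: measurable_funM => //; exact: measurable_indic.
rewrite intmu => [||x]; [|exact/measurable_EFinP|by rewrite lee_fin mulr_ge0].
have E1 : (fun y : rV => (\1_(chart i @` (B `&` chart_dom i)) y * Num.sqrt (\det (g i y)))%:E) =
  (fun y : rV => (dens (chart_inv i y) * \1_B (chart_inv i y))%:E) \_ (chart_img i).
 fext y; rewrite patchE; case: ifPn => [|/negP]; rewrite inE => iy.
  rewrite denE ?chart_invK//; last exact: inv_dom.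
  rewrite mulrC; congr ((_ * _)%:E); rewrite !indicE; congr (_%:R : R).
  congr nat_of_bool; apply/idP/idP; rewrite !inE.
   by move=> [x [Bx dx] <-]; rewrite chartK.
  move=> By; exists (chart_inv i y); last exact: chart_invK.
  by split=> //; exact: inv_dom.
 rewrite indicE memNset ?mul0r// => -[x [Bx dx] e].
 by apply: iy; rewrite -e; exact: imgP.
rewrite E1 integral_mkcond int_RnE// => [|y]; last first.
 by rewrite patchE; case: ifP => // _; rewrite lee_fin mulr_ge0.
apply: (measurable_restrictT _ mI).1; apply/measurable_EFinP.
have mi : measurable_fun (chart_img i : set (borel rV)) (chart_inv i : borel rV -> borel M).
 exact/(measurable_restrictT _ _).2.
exact: (measurableT_comp m1 mi).
Qed.

Lemma measurable_inv_on i :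
 measurable_fun (chart_img i : set (borel rV)) (chart_inv i : borel rV -> borel M).
Proof. by apply: (@ct_borel_map rV M) => [|y iy]; [exact: open_img|exact: chart_inv_continuous]. Qed.

Lemma integral_chart i (F : borel M -> R) : measurable_fun [set: borel M] F ->
 \int[vol]_(x in chart_dom i) (F x)%:E =
 \int[leb_Rn n]_(y in chart_img i) (F (chart_inv i y) * vdens i y)%:E.
Proof.
move=> mF; have mE : measurable_fun [set: borel M] (EFin \o F) by exact/measurable_EFinP.
have v0 y : 0 <= (vdens i y)%:E by rewrite lee_fin sqrtr_ge0.
rewrite integralE [RHS]integralE; congr (_ - _).
 rewrite ge0_int_chart//; last exact: measurable_funepos.
 by apply: eq_integral => y _; rewrite !funeposE /= EFinM maxe_pMl// mul0e.
rewrite ge0_int_chart//; last exact: measurable_funeneg.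
by apply: eq_integral => y _; rewrite !funenegE /= -mulNr EFinM maxe_pMl// mul0e.
Qed.

Lemma chart_ball_nbhd i x (r : R) : chart_dom i x -> (0 < r)%R ->
 exists N : set M, [/\ open N, N x, N `<=` chart_dom i & forall z, N z <-> chart_dom i z /\ (`|chart i z - chart i x| < r)%R].
Proof.
move=> dx r0; exists [set z | chart_dom i z /\ (`|chart i z - chart i x| < r)%R]; split=> //.
- apply: (preimage_open_on (f := fun z => `|chart i z - chart i x|%R) (B := [set t : R | (t < r)%R])).
 + exact: chart_dom_open.
 + move=> z dz; apply: (ct_comp (h := chart i) (F := fun y => `|y - chart i x|%R)).
   exact: chart_continuous.
  exact: continuous_dist.
 + exact: open_lt.
- by split=> //; rewrite subrr normr0.
- by move=> z [].
Qed.

(** On a small coordinate ball the density is at most its value at the centre plus 1. *)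
Lemma locally_finite_vol x : exists N : set M, [/\ open N, N x & vol N < +oo].
Proof.
have dx := chart_atP A x; set i := chart_at A x in dx; pose y0 := chart i x.
have iy0 : chart_img i y0 by exact: imgP.
have [r1 r10 r1P] := open_ball_sub (open_img i) iy0.
have /cvgrPdist_le/(_ 1%R ltr01)/near_normP[r2 r20 r2P] := ct_vdens iy0.
pose r := Num.min r1 r2; have r0 : (0 < r)%R by rewrite lt_min r10 r20.
have [N [oN Nx ND NP]] := chart_ball_nbhd dx r0.
exists N; split=> //.
have mN : measurable (N : set (borel M)) by exact: open_borel.
have -> : vol N = \int[vol]_(z in chart_dom i) (\1_N z)%:E.
 by rewrite integral_indic ?setIidl//; exact: dom_borel.
rewrite ge0_int_chart//; last exact/measurable_EFinP/measurable_indic.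
pose B := [set y : rV | (`|y - y0| <= r)%R].
have mB : measurable (B : set (borel rV)).
 by apply: closed_borel; exact: closed_cball.
have LB : leb_Rn n B < +oo by rewrite leb_Rn_dist_ball ?ltry// ltW.
apply: (@le_lt_trans _ _ (\int[leb_Rn n]_y ((vdens i y0 + 1)%:E * (\1_B y)%:E))); last first.
 have c0 : (0 <= vdens i y0 + 1)%R by rewrite addr_ge0 ?sqrtr_ge0.
 rewrite ge0_integralZl_EFin//; last exact/measurable_EFinP/measurable_indic.
 by rewrite integral_indic// setIT lte_mul_pinfty.
rewrite integral_mkcond; apply: ge0_le_integral => //.
- by move=> y _; rewrite patchE; case: ifP => // _; rewrite mule_ge0 ?lee_fin ?sqrtr_ge0.
- have mI := img_borel i; apply: (measurable_restrictT _ mI).1; apply: emeasurable_funM.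
  apply/measurable_EFinP; apply: (measurableT_comp (f := \1_N : borel M -> R)); first exact: measurable_indic.
  exact: measurable_inv_on.
 by apply/measurable_EFinP; exact: measurable_vdens.
- by apply: emeasurable_funM => //; exact/measurable_EFinP/measurable_indic.
move=> y _; rewrite patchE; case: ifPn => [|_]; last by rewrite mule_ge0 ?lee_fin// addr_ge0 ?sqrtr_ge0.
rewrite inE => iy; rewrite !indicE.
have [Ny|] := boolP (chart_inv i y \in N); last by rewrite mul0e mule_ge0 ?lee_fin// addr_ge0 ?sqrtr_ge0.
move: Ny; rewrite inE => /NP[_]; rewrite chart_invK// => yr.
have yB : B y by rewrite /B /= ltW.
rewrite (mem_set yB) mul1e mule1 lee_fin.
have : (`|vdens i y0 - vdens i (y0 + (y - y0))| <= 1)%R.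
 by apply: r2P; apply: (lt_le_trans yr); rewrite ge_min lexx orbT.
by rewrite addrCA subrr addr0 ler_norml => /andP[h _]; move: h; lra.
Qed.

Lemma compact_finite_vol (K : set M) : compact K -> measurable (K : set (borel M)) -> vol K < +oo.
Proof.
move=> cK mK; have [N NP] := choice locally_finite_vol.
have := cK; rewrite compact_cover => /(_ M setT N)[x _|x Kx|D _ KD].
- by have [] := NP x.
- by exists x => //; have [] := NP x.
have mN x : measurable (N x : set (borel M)) by apply: open_borel; have [] := NP x.
apply: (@le_lt_trans _ _ (vol (\big[setU/set0]_(x <- finmap.enum_fset D) N x))).
 apply: le_measure; rewrite ?inE//; first exact: bigsetU_measurable.
 by move=> y /KD[x /= xD Ny]; rewrite -bigcup_seq; exists x.
apply: (@le_lt_trans _ _ (\sum_(x <- finmap.enum_fset D) vol (N x))).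
 elim: (finmap.enum_fset D) => [|x s IH]; first by rewrite !big_nil measure0.
 have mU : measurable (\big[setU/set0]_(x <- s) N x : set (borel M)) by exact: bigsetU_measurable.
 have h := @measureU2 _ _ _ vol _ _ (mN x) mU.
 by rewrite !big_cons; apply: (le_trans h); exact: leeD2l.
by elim: (finmap.enum_fset D) => [|x s IH]; rewrite ?big_nil ?ltry// big_cons lte_add_pinfty//; have [] := NP x.
Qed.

Lemma integrable_compact (K : set M) (h : M -> R) : hausdorff_space M -> compact K -> continuous h ->
 vol.-integrable (K : set (borel M)) (EFin \o (h : borel M -> R)).
Proof.
move=> hM cK ch; have mK : measurable (K : set (borel M)).
 by apply: closed_borel; exact: compact_closed.
apply: measurable_bounded_integrable => //; first exact: compact_finite_vol.
 apply: (measurable_funS (E := setT)) => //.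
 by apply: (@ct_borel R M setT) => [|x _]; [exact: openT|exact: ch].
have : bounded_set (h @` K).
 by apply: compact_bounded; apply: continuous_compact cK; apply: continuous_subspaceT.
move=> [B [Br BP]]; exists B; split=> // b Bb x Kx; exact: (BP b Bb _ (imageP _ Kx)).
Qed.

(** Near a point where [h] is positive, both [h] and the density stay above half their values there,
    on a coordinate ball of positive Lebesgue measure. *)
Lemma integral0_continuous (h : M -> R) : continuous h -> (forall x, 0 <= h x)%R ->
 \int[vol]_x (h x)%:E = 0 -> forall x, h x = 0%R.
Proof.
move=> ch h0 int0 x; apply/eqP; rewrite eq_le h0 andbT leNgt; apply/negP => hx.
have dx := chart_atP A x; set i := chart_at A x in dx; pose y0 := chart i x.
have iy0 : chart_img i y0 by exact: imgP.
have [r1 r10 r1P] := open_ball_sub (open_img i) iy0.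
have v0 := vdens_gt0 iy0.
have hv : (0 < vdens i y0 / 2)%R by rewrite divr_gt0.
have /cvgrPdist_le/(_ _ hv)/near_normP[r2 r20 r2P] := ct_vdens iy0.
have hh : (0 < h x / 2)%R by rewrite divr_gt0.
have chi : {for y0, continuous (fun y => h (chart_inv i y))}.
 by apply: ct_comp; [exact: chart_inv_continuous|exact: ch].
have /cvgrPdist_le/(_ _ hh)/near_normP[r3 r30 r3P] := chi.
pose r := (Num.min r1 (Num.min r2 r3) / 2)%R.
have r0 : (0 < r)%R by rewrite divr_gt0// !lt_min r10 r20 r30.
have rr : (r < Num.min r1 (Num.min r2 r3))%R by rewrite /r ltr_pdivrMr// ltr_pMr ?ltr1n// !lt_min r10 r20 r30.
pose B := [set y : rV | (`|y - y0| <= r)%R].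
have mB : measurable (B : set (borel rV)) by apply: closed_borel; exact: closed_cball.
have mh : measurable_fun [set: borel M] (h : borel M -> R).
 by apply: (@ct_borel R M setT) => [|z _]; [exact: openT|exact: ch].
have mD := dom_borel i; have mI := img_borel i.
pose c := ((h x / 2) * (vdens i y0 / 2))%R.
have c0 : (0 < c)%R by rewrite mulr_gt0.
have BP y : B y -> chart_img i y /\ (c <= h (chart_inv i y) * vdens i y)%R.
 move=> By; have yE : y = (y0 + (y - y0))%R by rewrite addrC subrK.
 have lr : (`|y - y0| < Num.min r1 (Num.min r2 r3))%R by apply: le_lt_trans rr.
 move: lr; rewrite !lt_min => /and3P[l1 l2 l3]; split; first by rewrite yE; apply: r1P; exact: ltW.
 have := r2P _ l2; have := r3P _ l3; rewrite -!yE /y0 chartK// -/y0 !ler_norml => /andP[_ b3] /andP[_ b2].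
 by apply: ler_pM; [exact: ltW|exact: ltW|move: b3; lra|move: b2; lra].
have : \int[leb_Rn n]_y (c%:E * (\1_B y)%:E) <= 0.
 rewrite -int0.
 apply: (@le_trans _ _ (\int[vol]_(z in chart_dom i) (h z)%:E)); last first.
  apply: ge0_subset_integral => //; last by move=> z _; rewrite lee_fin.
  exact/measurable_EFinP.
 rewrite integral_chart// [leRHS]integral_mkcond; apply: ge0_le_integral => //.
 - by move=> y _; rewrite mule_ge0 ?lee_fin// ltW.
 - by apply: emeasurable_funM => //; exact/measurable_EFinP/measurable_indic.
 - apply: (measurable_restrictT _ mI).1; apply/measurable_EFinP; apply: measurable_funM.
   apply: (measurableT_comp mh); exact: measurable_inv_on.
  exact: measurable_vdens.
 move=> y _; rewrite patchE indicE; have [|_] := boolP (y \in B).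
  by rewrite inE => /BP[iy cy]; rewrite mem_set// mule1 lee_fin.
 by rewrite mule0; case: ifP => // _; rewrite lee_fin mulr_ge0 ?sqrtr_ge0.
rewrite ge0_integralZl_EFin//; [|exact/measurable_EFinP/measurable_indic|exact: ltW].
have LB := leb_Rn_dist_ball y0 (ltW r0); rewrite -/B in LB.
rewrite integral_indic// setIT LB -EFinM lee_fin leNgt mulr_gt0//.
by rewrite exprn_gt0// mulrn_wgt0.
Qed.

End Volume.

(** * The divergence of a covector field *)
Section C1Composition.
Context {R : realType} {n : nat}.
Implicit Types (F : 'rV[R]_n -> R).

Lemma C1_comp (U : set 'rV[R]_n) F (v v' : R -> R) : open U -> Ck_on 1 U F ->
 (forall t : R, is_der t v (v' t)) -> continuous v' ->
 Ck_on 1 U (fun x => v (F x)) /\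
 (forall i x, U x -> pd i (fun x => v (F x)) x (v' (F x) * partial i F x)).
Proof.
move=> oU CF dv cv.
have P i x : U x -> pd i (fun x => v (F x)) x (v' (F x) * partial i F x).
 move=> Ux; have dF := Ck_diff oU CF Ux.
 have dv1 : differentiable v (F x) by apply/derivable1_diffP; case: (dv (F x)).
 have dvF : differentiable (v \o F) x by exact: differentiable_comp.
 split; first exact: diff_derivable.
 rewrite deriveE// -[fun z => v (F z)]/(v \o F) diff_comp//=.
 rewrite /partial deriveE//.
 have -> : 'd F x (bv i) = 'd F x (bv i) *: (1 : R) by rewrite /GRing.scale/= mulr1.
 rewrite linearZ /=.
 have -> : 'd v (F x) 1 = v' (F x) by rewrite -deriveE//; have [_ ->] := dv (F x).
 by rewrite /GRing.scale /= mulr1 mulrC.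
split=> //; apply: Ck_onSI.
- move=> x Ux; apply: ct_rcomp; first exact: Ck_cts CF Ux.
 by apply: differentiable_continuous; apply/derivable1_diffP; case: (dv (F x)).
- by move=> i x Ux; have [] := P i x Ux.
- move=> i; apply: (@Ck_on_eq _ _ 0 U (fun x => v' (F x) * partial i F x)) => //.
  by move=> x Ux; rewrite (pd_val (P i x Ux)).
 apply: Ck_on0 => x Ux; apply: ctM; last exact: Ck_cts (Ck_partial i CF) Ux.
 by apply: ct_rcomp; [exact: Ck_cts CF Ux|exact: cv].
Qed.

Lemma Ck_onU k (U V : set 'rV[R]_n) F : Ck_on k U F -> Ck_on k V F -> Ck_on k (U `|` V) F.
Proof.
elim: k F => [|k IH] F CU CV.
 by apply: Ck_on0 => x [Ux|Vx]; [exact: Ck_cts CU Ux|exact: Ck_cts CV Vx].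
apply: Ck_onSI.
- by move=> x [Ux|Vx]; [exact: Ck_cts CU Ux|exact: Ck_cts CV Vx].
- by move=> i x [Ux|Vx]; [exact: (Ck_der i CU)|exact: (Ck_der i CV)].
- by move=> i; apply: IH; exact: Ck_partial.
Qed.

End C1Composition.

Section PositivePart.
Context {R : realType}.

Definition pospow (p : nat) (t : R) : R := Num.max t 0 ^+ p.

Lemma pospow_ge0 p t : 0 <= pospow p t.
Proof. by rewrite exprn_ge0// le_max lexx orbT. Qed.

Lemma cts_pospow p : continuous (pospow p).
Proof.
move=> t; apply: (ct_rcomp (F := fun t : R => Num.max t 0) (h := fun s : R => s ^+ p)); last exact: exprn_continuous.
have -> : (fun t : R => Num.max t 0) = (fun t => (t + `|t|) * 2^-1).
 by fext s; rewrite maxr_absE addr0 subr0.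
apply: ctM; last exact: ct_cst.
by apply: ctD; [exact: cvg_id|exact: norm_continuous].
Qed.
Arguments cts_pospow : clear implicits.

Lemma der_pospow p (t : R) : is_der t (pospow p.+2) (p.+2%:R * pospow p.+1 t).
Proof.
have [t0|t0|->] := ltgtP t 0.
- apply: (@near_eq_is_derive _ _ _ (fun=> 0)).
  apply: filterS (open_nbhs_nbhs (conj (@open_lt R 0) t0)) => s /= s0.
  by rewrite /pospow max_r ?ltW// expr0n.
 by apply: is_derive_eq; rewrite /pospow max_r ?ltW// expr0n mulr0.
- apply: (@near_eq_is_derive _ _ _ (fun s : R => s ^+ p.+2)).
  apply: filterS (open_nbhs_nbhs (conj (@open_gt R 0) t0)) => s /= s0.
  by rewrite /pospow max_l ?ltW.
 have -> : (fun s : R => s ^+ p.+2) = (@idfun R) ^+ p.+2 by fext s; rewrite exprfctE.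
 have := is_deriveX p.+2 (is_derive_id t (1 : R)); rewrite /pospow max_l ?ltW// /GRing.scale /= mulr1; exact.
have -> : p.+2%:R * pospow p.+1 0 = 0 by rewrite /pospow maxxx expr0n mulr0.
(* At 0 the difference quotient of [pospow p.+2] is [pospow p.+1], which is continuous and vanishes
   there. *)
have h : (fun h : R => h^-1 *: (pospow p.+2 (h *: 1 + 0) - pospow p.+2 0)) @ 0^' --> (0 : R).
 have c : pospow p.+1 @ (0 : R)^' --> (0 : R).
  have := cts_pospow p.+1 (0 : R); rewrite /continuous_at [X in _ --> X](_ : _ = 0); last by rewrite /pospow maxxx expr0n.
  by apply: cvg_trans; apply: cvg_app; exact: cvg_within.
 apply: cvg_trans c; apply: near_eq_cvg; near=> h.
 have h0 : h != 0 by near: h; exact: nbhs_dnbhs_neq.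
 have p0 : pospow p.+2 0 = 0 by rewrite /pospow maxxx expr0n.
 rewrite p0 subr0 addr0 /GRing.scale /= mulr1 /pospow [in RHS]exprS mulrA.
 by have [hp|hn] := leP 0 h; [rewrite mulVf ?mul1r|rewrite expr0n !mulr0].
by split; [apply/cvg_ex; exists 0|exact: cvg_lim h].
Unshelve. all: by end_near. Qed.

End PositivePart.

Section Jacobi.
Context {R : realType} {n : nat}.
Variables (U : set 'rV[R]_n) (oU : open U) (x : 'rV[R]_n) (Ux : U x) (a : 'I_n).

Lemma pd_prod (I : eqType) (r : seq I) (f : I -> 'rV[R]_n -> R) (v : I -> R) : uniq r ->
 (forall j, pd a (f j) x (v j)) ->
 pd a (fun y => \prod_(j <- r) f j y) x (\sum_(j <- r) v j * \prod_(k <- r | k != j) f k x).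
Proof.
elim: r => [_ _|i r IH /= /andP[ir ur] fv].
 rewrite big_nil (_ : (fun y => _) = fun=> 1); last by fext y; rewrite big_nil.
 exact: is_derive_cst.
rewrite (_ : (fun y => _) = (fun y => f i y * \prod_(j <- r) f j y)); last by fext y; rewrite big_cons.
have := pdM (fv i) (IH ur fv); congr pd.
rewrite big_cons big_cons eqxx /=; congr (_ * _ + _).
 rewrite big_seq_cond [RHS]big_seq_cond; apply: eq_bigl => k; case: (k \in r) / boolP => // kr.
 by rewrite /= (_ : k != i)//; apply: contraNneq ir => <-.
rewrite mulr_sumr; apply: eq_big_seq => k kr.
have ik : i != k by apply: contraNneq ir => ->.
by rewrite [in RHS]big_cons ik; exact: mulrCA.
Qed.

(** Jacobi's formula: differentiating row [i] alone gives again a determinant, which is expanded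
    along that row into cofactors. *)
Lemma pd_det (A : 'rV[R]_n -> 'M[R]_n) : smx U A ->
 pd a (fun y => \det (A y)) x (\tr (dmx a A x *m \adj (A x))).
Proof.
move=> sA; rewrite /determinant.
have P (s : {perm 'I_n}) : pd a (fun y => (-1) ^+ s * \prod_i A y i (s i)) x
 ((-1) ^+ s * \sum_i dmx a A x i (s i) * \prod_(k | k != i) A x k (s k)).
 by apply: pdZ; apply: pd_prod => [|j]; [exact: index_enum_uniq|exact: pd_dmx Ux].
have := pd_sum (index_enum _) P; congr pd.
under eq_bigr do rewrite mulr_sumr.
rewrite exchange_big /mxtrace; sumr i => /=.
pose B : 'M[R]_n := \matrix_(k, l) if k == i then dmx a A x k l else A x k l.
transitivity (\det B).
 sumr s; rewrite [X in _ = _ * X](bigD1 i)//= [B i _]mxE eqxx; congr (_ * (_ * _)).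
 by apply: eq_bigr => k /negbTE ki; rewrite mxE ki.
rewrite (expand_det_row B i) mxmulE; sumr j; rewrite mxE eqxx mxE; congr (_ * _).
rewrite [(\adj _) _ _]mxE /cofactor; congr (_ * \det _); apply/matrixP => k l; rewrite !mxE.
by rewrite eq_sym (negbTE (neq_lift _ _)).
Qed.

End Jacobi.

Section DivergenceForm.
Context {R : realType} {n : nat}.
Variables (U : set 'rV[R]_n) (g : 'rV[R]_n -> 'M[R]_n).
Hypothesis lm : local_metric U g.
Hypothesis gpos : forall x, U x -> posdef (g x).
Let oU := lm_open lm.

(** By Jacobi's formula and metric compatibility, $\partial_a \det g = 2 \det g \, tr\,\Gamma_a$. *)
Lemma pd_sqrt_det x a : U x ->
 pd a (fun y => Num.sqrt (\det (g y))) x (Num.sqrt (\det (g x)) * \tr (conn g a x)).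
Proof.
move=> Ux; have d0 : 0 < \det (g x) := posdef_det (lm_sym lm Ux) (gpos Ux).
have [dF eF] := pd_det Ux a (lm_smooth lm).
have CF : Ck_on 1 U (fun y => \det (g y)) by exact: (smooth_det oU (lm_smooth lm)).
have ddF := Ck_diff oU CF Ux.
have dv := is_derive1_sqrt d0.
have dv1 : differentiable (@Num.sqrt R) (\det (g x)) by apply/derivable1_diffP; case: dv.
have dvF : differentiable (@Num.sqrt R \o (fun y => \det (g y))) x by exact: differentiable_comp.
split; first exact: diff_derivable.
rewrite deriveE// diff_comp//=.
have -> : 'd (fun y => \det (g y)) x (bv a) = 'd (fun y => \det (g y)) x (bv a) *: (1 : R).
 by rewrite /GRing.scale/= mulr1.
rewrite linearZ /=.
have -> : 'd (@Num.sqrt R) (\det (g x)) 1 = (2 * Num.sqrt (\det (g x)))^-1 by rewrite -deriveE//; case: dv.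
rewrite -deriveE// eF (conn_compat lm a Ux) /GRing.scale /=.
have alg (G K : 'M[R]_n) : \tr ((K *m G + G *m K^T) *m \adj G) = 2 * \det G * \tr K.
 rewrite mulmxDl -mulmxA mul_mx_adj mxtraceD mul_mx_scalar mxtraceZ.
 by rewrite mxtrace_mulC mulmxA mul_adj_mx mul_scalar_mx mxtraceZ mxtrace_tr; ring.
rewrite alg; set s := Num.sqrt _; have ss : \det (g x) = s * s by rewrite -expr2 sqr_sqrtr// ltW.
have s0 : s != 0 by rewrite gt_eqF// sqrtr_gt0.
by rewrite [in X in X * _](_ : 2 * \det (g x) = 2 * (s * s)) ?ss//; field.
Qed.

Lemma dmx_ginv a x : U x -> dmx a (fun y => invmx (g y)) x =
 - (invmx (g x) *m conn g a x) - (conn g a x)^T *m invmx (g x).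
Proof.
move=> Ux; have si := smooth_ginv lm; have sg := lm_smooth lm; have gu := lm_unit lm Ux.
have E : dmx a (fun x => invmx (g x) *m g x) x = 0.
 rewrite (dmx_eq (B := fun=> 1%:M) a oU) ?dmx_cst// => y Uy.
 by rewrite mulVmx// (lm_unit lm).
move: E; rewrite (dmxM Ux a si sg) (conn_compat lm a Ux) => /eqP; rewrite addr_eq0 => /eqP E.
rewrite -[LHS](mulmxK gu) E mulNmx mulmxDr mulmxDl opprD; congr (- _ - _).
 by rewrite -!mulmxA mulmxV// mulmx1.
by rewrite mulmxA mulVmx// mul1mx.
Qed.

(* The flux density whose Euclidean divergence is the weighted covariant one. *)
Definition flux (phi : 'rV[R]_n -> R) (w : 'rV[R]_n -> 'cV[R]_n) (y : 'rV[R]_n) (a : 'I_n) : R :=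
 phi y * (Num.sqrt (\det (g y)) * (invmx (g y) *m w y) a 0).

Lemma smooth_sqrt_det : Ck_on 1 U (fun y => Num.sqrt (\det (g y))).
Proof.
apply: Ck_onSI.
- move=> x Ux; apply: (ct_rcomp (h := @Num.sqrt R)); last exact: sqrt_continuous.
 by have sd := smooth_det oU (lm_smooth lm) 0; exact: Ck_cts sd Ux.
- by move=> i x Ux; case: (pd_sqrt_det i Ux).
move=> i; apply: (@Ck_on_eq _ _ 0 U (fun x => Num.sqrt (\det (g x)) * \tr (conn g i x))) => //.
 by move=> x Ux; rewrite (pd_val (pd_sqrt_det i Ux)).
apply: Ck_on0 => x Ux; apply: ctM.
 apply: (ct_rcomp (h := @Num.sqrt R)); last exact: sqrt_continuous.
 by have sd := smooth_det oU (lm_smooth lm) 0; exact: Ck_cts sd Ux.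
by apply: ct_sum => j _; exact: Ck_cts (smooth_conn lm i j j 0) Ux.
Qed.

Lemma C1_flux phi w a : Ck_on 1 U phi -> smx U w -> Ck_on 1 U (fun y => flux phi w y a).
Proof.
move=> Cp sw; apply: (CkM oU Cp); apply: (CkM oU smooth_sqrt_det).
exact: (smxM oU (smooth_ginv lm) sw a 0 1).
Qed.

Lemma div_flux phi w x : Ck_on 1 U phi -> smx U w -> U x ->
 \sum_a partial a (fun y => flux phi w y a) x =
 Num.sqrt (\det (g x)) * (phi x * divc g w x + vdot (g x) (grad phi x) (w x)).
Proof.
move=> Cp sw Ux; have si := smooth_ginv lm.
pose D := Num.sqrt (\det (g x)); pose V := invmx (g x) *m w x.
have P a : partial a (fun y => flux phi w y a) x =
 partial a phi x * (D * V a 0) + phi x * (D * \tr (conn g a x) * V a 0 +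
  D * (dmx a (fun y => invmx (g y)) x *m w x + invmx (g x) *m dmx a w x) a 0).
 rewrite -(dmxM Ux a si sw).
 exact: (pd_val (pdM (pdE (Ck_der a Cp Ux)) (pdM (pd_sqrt_det a Ux) (pd_dmx a a 0 (smxM oU si sw) Ux)))).
rewrite (eq_bigr _ (fun a _ => P a)) big_split /= -mulr_sumr mulrDr addrC; congr (_ + _); last first.
 rewrite vdotE /gtrace mulr_sumr; sumr a.
 rewrite -/D mulrCA; congr (D * _); rewrite /V mxmulE mulr_sumr; sumr b.
 by rewrite [grad phi x a 0]mxE mulrCA.
rewrite mulrCA; congr (_ * _); rewrite /divc /gtrace mulr_sumr.
have Q a : D * \tr (conn g a x) * V a 0 + D * (dmx a (fun y => invmx (g y)) x *m w x + invmx (g x) *m dmx a w x) a 0 =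
 D * (\sum_b invmx (g x) a b * cov1 g a w x b 0) + D * (\tr (conn g a x) * V a 0 - ((conn g a x)^T *m V) a 0).
 have -> : \sum_b invmx (g x) a b * cov1 g a w x b 0 = (invmx (g x) *m (dmx a w x - conn g a x *m w x)) a 0.
  by rewrite mxmulE; sumr b; rewrite cov1E.
 rewrite (dmx_ginv a Ux) /V.
 have alg (gi K : 'M[R]_n) (w0 dw : 'cV[R]_n) (c t : R) : c * t * (gi *m w0) a 0 + c * ((- (gi *m K) - K^T *m gi) *m w0 + gi *m dw) a 0 =
  c * (gi *m (dw - K *m w0)) a 0 + c * (t * (gi *m w0) a 0 - (K^T *m (gi *m w0)) a 0).
  rewrite mulmxBl mulNmx mulmxBr !mulmxA.
  have e1 (A B C E : 'cV[R]_n) : (- A - B + C) a 0 = - A a 0 - B a 0 + C a 0 by rewrite !mxE.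
  have e2 (A B : 'cV[R]_n) : (A - B) a 0 = A a 0 - B a 0 by rewrite !mxE.
  by rewrite e1// e2; ring.
 exact: alg.
(* The remaining terms, with the trace of $\Gamma_a$ and with its transpose applied to the raised
   vector, cancel after summation by the symmetry of the Christoffel symbols. *)
rewrite (eq_bigr _ (fun a _ => Q a)) big_split /= [X in _ + X](_ : _ = 0) ?addr0; last first.
 rewrite -mulr_sumr sumrB (_ : \sum_a \tr (conn g a x) * V a 0 = \sum_a ((conn g a x)^T *m V) a 0) ?subrr ?mulr0//.
 transitivity (\sum_a \sum_b conn g a x b b * V a 0).
  by sumr a; rewrite /mxtrace mulr_suml.
 sumx b => /=; rewrite mxmulE; sumr a.
 by rewrite mxtrE (conn_sym lm a b b Ux).
by sumr a.
Qed.

End DivergenceForm.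

(** * Integration by parts against Lipschitz cutoffs *)
Section RealIntegrals.
Context d (T : measurableType d) (R : realType) (mu : {measure set T -> \bar R}).

Lemma Rintegral_cvg (f_ : nat -> T -> R) (f h : T -> R) :
 (forall k, measurable_fun [set: T] (f_ k)) -> (forall x, f_ ^~ x @ \oo --> f x) ->
 mu.-integrable [set: T] (EFin \o h) -> (forall k x, `|f_ k x| <= h x) ->
 mu.-integrable [set: T] (EFin \o f) /\
 (fun k => \int[mu]_x f_ k x)%R @ \oo --> (\int[mu]_x f x)%R.
Proof.
move=> mf cf ih fh.
have mlim : measurable_fun [set: T] f.
 by apply: (@measurable_fun_cvg _ _ _ _ f_) => // x _; exact: cf.
have [|||||intf _ cv] := @dominated_convergence _ _ _ mu setT measurableT (fun k => EFin \o f_ k) (EFin \o f) (EFin \o h).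
- by move=> k; exact/measurable_EFinP.
- exact/measurable_EFinP.
- by apply: aeW => x _; apply: cvg_EFin; [near=> k|exact: cf].
- by [].
- by apply: aeW => x k _; rewrite /= lee_fin; exact: fh.
split=> //; apply: fine_cvg; rewrite fineK//; exact: integrable_fin_num.
Unshelve. all: by end_near. Qed.

Lemma Rintegrable_le (f h : T -> R) : measurable_fun [set: T] f -> (forall x, `|f x| <= h x) ->
 mu.-integrable [set: T] (EFin \o h) -> mu.-integrable [set: T] (EFin \o f).
Proof.
move=> mf fh ih; apply: le_integrable ih => //; first exact/measurable_EFinP.
by move=> x _; rewrite /= lee_fin (le_trans (fh x))// ler_norm.
Qed.

End RealIntegrals.

Section Translation.
Context {R : realType} {n : nat}.
Local Notation rV := 'rV[R]_n.
Let mu := @leb_Rn R n.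

Lemma Rintegral_shift (w : rV) (F : rV -> R) : measurable_fun [set: borel rV] F ->
 (\int[mu]_y F (y + w) = \int[mu]_y F y)%R.
Proof.
move=> mF; congr fine; have mE : measurable_fun [set: borel rV] (EFin \o F) by exact/measurable_EFinP.
rewrite integralE [RHS]integralE; congr (_ - _)%E.
 rewrite -(leb_Rn_shift w (measurable_funepos mE))//.
 by apply: eq_integral => y _; rewrite !funeposE.
rewrite -(leb_Rn_shift w (measurable_funeneg mE))//.
by apply: eq_integral => y _; rewrite !funenegE.
Qed.

Lemma integrable_shift (w : rV) (F : rV -> R) : mu.-integrable setT (EFin \o F) ->
 mu.-integrable setT (fun y => (F (y + w))%:E).
Proof.
move=> /integrableP[mF iF]; apply/integrableP; split; first exact: measurableT_comp mF (measurable_shift w).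
have := @leb_Rn_shift R n w (fun y => `|(F y)%:E|%E) _ (fun y => abse_ge0 _).
by move=> ->//; exact: measurableT_comp.
Qed.

Lemma continuous_shiftr (w : rV) : continuous (fun y : rV => y + w).
Proof.
move=> y; apply: ct_row => k; rewrite (_ : (fun z : rV => _) = (fun z => z 0 k + w 0 k)); last first.
 by fext z; rewrite mxaddE.
by apply: ctD; [exact: Ck_cts (Ck_coord 0 k openT) I|exact: ct_cst].
Qed.

Lemma supp_bounded (F : rV -> R) (y0 : rV) (r : R) : continuous F ->
 (forall y, r < `|y - y0| -> F y = 0) -> exists2 C, 0 <= C & forall y, `|F y| <= C.
Proof.
move=> cF F0.
have cB : compact [set y : rV | `|y - y0| <= r].
 apply: bounded_closed_compact; last exact: closed_cball.
 exists (`|y0| + r); split; first exact: num_real.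
 move=> b bb y /= yr; apply: ltW; apply: le_lt_trans bb.
 by rewrite -[y](subrK y0) addrC (le_trans (ler_normD _ _))// lerD2l.
have : bounded_set (F @` [set y : rV | `|y - y0| <= r]).
 by apply: compact_bounded; apply: continuous_compact cB; apply: continuous_subspaceT.
move=> [B [Br BP]]; exists (Num.max B 0 + 1) => [|y]; first by rewrite addr_ge0// le_max lexx orbT.
have [yr|/F0 ->] := leP `|y - y0| r; last by rewrite normr0 addr_ge0// le_max lexx orbT.
by apply: (BP (Num.max B 0 + 1)); [rewrite ltr_pwDr// le_max lexx|exists y].
Qed.

Lemma cts_borel (F : rV -> R) : continuous F -> measurable_fun [set: borel rV] F.
Proof. by move=> cF; apply: (@ct_borel R rV setT) => [|x _]; [exact: openT|exact: cF]. Qed.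

Lemma integrable_ball (y0 : rV) (r C : R) : 0 <= r ->
 mu.-integrable setT (EFin \o (fun y => C * \1_([set y : rV | `|y - y0| <= r]) y)).
Proof.
move=> r0; have mB : measurable ([set y | `|y - y0| <= r] : set (borel rV)).
 by apply: closed_borel; exact: closed_cball.
apply/integrableP; split.
 by apply/measurable_EFinP; apply: measurable_funM => //; exact: measurable_indic.
rewrite (eq_integral (fun y : borel rV => (`|C|%:E * (\1_([set y : rV | `|y - y0| <= r]) y)%:E)%E)); last first.
 by move=> y _; rewrite /= normrM EFinM; congr (_ * _)%E; rewrite indicE; case: (_ \in _); rewrite ?normr1 ?normr0.
rewrite ge0_integralZl//; last by apply/measurable_EFinP; exact: measurable_indic.
by rewrite integral_indic// setIT leb_Rn_dist_ball// -EFinM ltry.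
Qed.

Lemma supp_integrable (F : rV -> R) (y0 : rV) (r : R) : 0 <= r -> continuous F ->
 (forall y, r < `|y - y0| -> F y = 0) -> mu.-integrable setT (EFin \o F).
Proof.
move=> r0 cF F0; have [C C0 FC] := supp_bounded cF F0.
apply: Rintegrable_le (integrable_ball y0 C r0); first exact: cts_borel.
move=> y; rewrite indicE; have [yr|yr] := leP `|y - y0| r; first by rewrite mem_set// mulr1.
by rewrite F0// normr0 mulr_ge0.
Qed.

Lemma pow_diff_le (a b : R) m : 0 <= a -> 0 <= b ->
 `|a ^+ m.+1 - b ^+ m.+1| <= m.+1%:R * `|a - b| * (Num.max a b) ^+ m.
Proof.
move=> a0 b0; set c := Num.max a b.
have ac : a <= c by rewrite le_max lexx.
have bc : b <= c by rewrite le_max lexx orbT.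
have c0 : 0 <= c := le_trans a0 ac.
elim: m => [|m IH]; first by rewrite !expr1 expr0 mul1r mulr1.
have -> : a ^+ m.+2 - b ^+ m.+2 = a * (a ^+ m.+1 - b ^+ m.+1) + (a - b) * b ^+ m.+1.
 by rewrite [in LHS](exprS a) [in LHS](exprS b); ring.
apply: (le_trans (ler_normD _ _)); rewrite !normrM (ger0_norm a0) [`|b ^+ _|]ger0_norm ?exprn_ge0//.
have h1 : a * `|a ^+ m.+1 - b ^+ m.+1| <= c * (m.+1%:R * `|a - b| * c ^+ m) by apply: ler_pM.
have h2 : `|a - b| * b ^+ m.+1 <= `|a - b| * c ^+ m.+1 by rewrite ler_wpM2l// lerXn2r.
apply: (le_trans (lerD h1 h2)); rewrite exprS [m.+2%:R]mulrS.
by rewrite le_eqVlt; apply/orP; left; apply/eqP; ring.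
Qed.

(* The difference quotients of [c] are moved onto [psi] by translation
 invariance; this needs no differentiability of [psi]. *)
Lemma lipschitz_by_parts (c psi : rV -> R) (e y0 : rV) (r s l : R) (m : nat) :
 0 <= r -> 0 < s -> 0 <= l -> Ck_on 1 setT c -> (forall y, r < `|y - y0| -> c y = 0) ->
 measurable_fun [set: borel rV] psi -> (forall y, 0 <= psi y <= 1) ->
 (forall y t, `|y - y0| <= r -> `|t| <= s -> `|psi (y + t *: e) - psi y| <= l * `|t|) ->
 [/\ mu.-integrable setT (fun y => (psi y ^+ m.+1 * 'D_e c y)%:E),
   mu.-integrable setT (fun y => (psi y ^+ m * `|c y|)%:E) &
   `|\int[mu]_y (psi y ^+ m.+1 * 'D_e c y)| <= m.+1%:R * l * \int[mu]_y (psi y ^+ m * `|c y|)]%R.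
Proof.
move=> r0 s0 l0 Cc c0 mpsi psi01 psil.
have ctc : continuous c by move=> y; exact: Ck_cts Cc I.
have De y : 'D_e c y = \sum_i e 0 i * partial i c y by exact: (C1_derive e openT Cc I).
have dc y : derivable c y e by apply: diff_derivable; exact: Ck_diff openT Cc I.
have ctD' : continuous (fun y => 'D_e c y).
 move=> y; under eq_fun do rewrite De.
 by apply: ct_sum => i _; apply: ctM; [exact: ct_cst|exact: Ck_cts (Ck_partial i Cc) I].
have D0 y : r < `|y - y0| -> 'D_e c y = 0.
 move=> yr; rewrite -[RHS](derive_cst (0 : R) y e); apply: near_eq_derive.
 have : \forall z \near y, r < `|z - y0|.
  have oB : open [set z : rV | r < `|z - y0|].
   rewrite (_ : [set z | _] = ~` [set z : rV | `|z - y0| <= r]).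
    by rewrite openC; exact: closed_cball.
   by apply/seteqP; split => z /=; rewrite ltNge => /negP.
  exact: (open_nbhs_nbhs (conj oB yr)).
 by apply: filterS => z /c0.
have [C C0 DC] := supp_bounded ctD' D0.
have psip k y : 0 <= psi y ^+ k <= 1.
 by have /andP[p0 p1] := psi01 y; rewrite exprn_ge0// exprn_ile1.
have mp k : measurable_fun [set: borel rV] (fun y => psi y ^+ k) by exact: measurable_funX.
have mc := cts_borel ctc.
pose h k : R := s / k.+1%:R.
have hp k : 0 < h k by rewrite divr_gt0// ltr0n.
have hs k : h k <= s by rewrite ler_pdivrMr ?ltr0n// ler_peMr ?ler1n// ltW.
have h_cvg : h @ \oo --> (0 : R).
 have -> : h = (fun k => s * k.+1%:R^-1) by [].
 by rewrite -[X in _ --> X](mulr0 s); apply: cvgMr; exact: cvg_harmonic.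
have hD0 : h @ \oo --> 0^'.
 move=> P nP; have H : \forall k \near \oo, (h k != 0 -> P (h k)) := h_cvg _ nP.
 by move: H; apply: filterS => k; apply; rewrite gt_eqF// hp.
clearbody h.
pose q k y := (h k)^-1 * (c (y + h k *: e) - c y).
have shift_cts k : continuous (fun y : rV => c (y + h k *: e)).
 move=> y; have := @continuous_comp rV rV R (fun y => y + h k *: e) c y; apply; last exact: ctc.
 exact: continuous_shiftr.
have qD y : q ^~ y @ \oo --> 'D_e c y.
 have := dc y; rewrite /derivable => /cvg_ex[L HL].
 have DL : 'D_e c y = L by rewrite /derive; apply/cvg_lim.
 rewrite DL; apply: cvg_trans (cvg_comp _ _ hD0 HL).
 by apply: near_eq_cvg; near=> k; rewrite /q /= [y + _]addrC.
pose rr := r + s * `|e|.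
have rr0 : 0 <= rr by rewrite addr_ge0// mulr_ge0// ltW.
pose B := [set y : rV | `|y - y0| <= rr].
have qB k y : `|q k y| <= C * \1_B y.
 rewrite indicE; have [yB|yB] := pselect (B y).
  rewrite mem_set// mulr1 /q.
  have [t _ ->] := @MVT_line R n c y e (h k) (fun t _ => dc _).
  by rewrite mulrA mulVf ?gt_eqF// mul1r.
 rewrite memNset// mulr0 /q.
 have yr : rr < `|y - y0| by rewrite ltNge; apply/negP.
 rewrite !c0 ?subrr ?mulr0 ?normr0//.
  by apply: le_lt_trans yr; rewrite lerDl mulr_ge0// ltW.
 have : `|y - y0| <= `|y + h k *: e - y0| + s * `|e|.
  rewrite (_ : y - y0 = (y + h k *: e - y0) - h k *: e); last by rewrite addrAC addrK.
  rewrite (le_trans (ler_normB _ _))// lerD2l normrZ gtr0_norm//.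
  by rewrite ler_wpM2r.
 by move: yr; rewrite /rr => a1 a2; rewrite -(ltrD2r (s * `|e|)) (lt_le_trans a1 a2).
have mq k : measurable_fun [set: borel rV] (q k).
 apply: measurable_funM => //; apply: measurable_funB => //.
 exact: cts_borel (shift_cts k).
have iB : mu.-integrable setT (EFin \o (fun y => C * \1_B y)) by exact: integrable_ball.
have ic : mu.-integrable setT (EFin \o c) by exact: supp_integrable c0.
have iac : mu.-integrable setT (EFin \o (fun y => `|c y|)).
 by apply: (Rintegrable_le _ _ (integrable_abse ic)) => [|y /=]; [exact: measurableT_comp|rewrite normr_id].
have [|||iI cvI] := @Rintegral_cvg _ _ R mu (fun k y => psi y ^+ m.+1 * q k y) (fun y => psi y ^+ m.+1 * 'D_e c y) (fun y => C * \1_B y) _ _ iB.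
- by move=> k; exact: measurable_funM.
- by move=> y; apply: cvgMr; exact: qD.
- move=> k y; have /andP[p0 p1] := psip m.+1 y.
 by rewrite normrM ger0_norm// (le_trans _ (qB k y))// ler_piMl.
(* Moving by [h k] along [e] raises the cutoff to at most [psi y + l * h k]. With this majorant the
   bound on the differences of [psi ^+ m.+1] has a limit as [h k] tends to 0. *)
have pJ k y : 0 <= psi y + l * h k by have /andP[p0 _] := psi01 y; rewrite addr_ge0// mulr_ge0// ltW.
have mJ k : measurable_fun [set: borel rV] (fun y => (psi y + l * h k) ^+ m * `|c y|).
 by apply: measurable_funM; [apply: measurable_funX; apply: measurable_funD|exact: measurableT_comp].
have Jle k y : `|(psi y + l * h k) ^+ m * `|c y| | <= (1 + l * s) ^+ m * `|c y|.
 rewrite normrM normr_id ler_wpM2r// ger0_norm ?exprn_ge0//.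
 rewrite lerXn2r// ?nnegrE//; first by rewrite addr_ge0// mulr_ge0// ltW.
 by have /andP[_ p1] := psi01 y; rewrite lerD// ler_wpM2l.
have iJs := integrableZl measurableT ((1 + l * s) ^+ m) iac.
have [||||iJ cvJ] := @Rintegral_cvg _ _ R mu (fun k y => (psi y + l * h k) ^+ m * `|c y|) (fun y => psi y ^+ m * `|c y|) (fun y => (1 + l * s) ^+ m * `|c y|) => //.
move=> y; apply: cvgMl; have cp : (fun k => psi y + l * h k) @ \oo --> psi y.
  rewrite -[X in _ --> X](addr0 (psi y)) -(mulr0 l).
  by apply: cvgD; [exact: cvg_cst|exact: cvgMr].
 by have := cvg_comp _ _ cp (@exprn_continuous R m (psi y)).
split=> //.
have cvJ' : (fun k => m.+1%:R * l * \int[mu]_y ((psi y + l * h k) ^+ m * `|c y|))%R @ \oo --> (m.+1%:R * l * \int[mu]_y (psi y ^+ m * `|c y|))%R.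
 exact: cvgMr.
apply: (ler_cvg_to (cvg_norm cvI) cvJ'); near=> k.
have mps w : measurable_fun [set: borel rV] (fun y => psi (y + w)).
 exact: measurableT_comp mpsi (measurable_shift w).
have imul (p d : rV -> R) : measurable_fun [set: borel rV] p -> (forall y, 0 <= p y <= 1) ->
  measurable_fun [set: borel rV] d -> mu.-integrable setT (EFin \o d) ->
  mu.-integrable setT (EFin \o (fun y => p y * d y)).
 move=> mp' p01 md id; apply: (Rintegrable_le _ _ (integrable_abse id)); first exact: measurable_funM.
 by move=> y /=; have /andP[p0 p1] := p01 y; rewrite normrM ger0_norm// ler_piMl.
have iq : mu.-integrable setT (EFin \o (fun y => psi y ^+ m.+1 * c (y + h k *: e))).
 exact: imul (mp m.+1) (psip m.+1) (cts_borel (shift_cts k)) (integrable_shift (h k *: e) ic).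
have iq0 : mu.-integrable setT (EFin \o (fun y => psi y ^+ m.+1 * c y)).
 exact: imul (mp m.+1) (psip m.+1) mc ic.
pose ps y := psi (y - h k *: e) ^+ m.+1.
have mps' : measurable_fun [set: borel rV] ps by apply: measurable_funX; exact: mps.
have ips : mu.-integrable setT (EFin \o (fun y => ps y * c y)).
 exact: imul mps' (fun y => psip m.+1 _) mc ic.
have E1 : (\int[mu]_y (psi y ^+ m.+1 * q k y) = (h k)^-1 * \int[mu]_y (ps y * c y - psi y ^+ m.+1 * c y))%R.
 rewrite RintegralB//.
 rewrite -(@Rintegral_shift (h k *: e) (fun y => ps y * c y)); last first.
  exact: measurable_funM.
 rewrite (_ : (fun y : rV => ps (y + _) * _) = (fun y => psi y ^+ m.+1 * c (y + h k *: e))); last first.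
  by fext y; rewrite /ps addrK.
 rewrite -RintegralB// -RintegralZl//; last by have := integrableB measurableT iq iq0.
 by congr (fine (integral _ _ _)); fext y; rewrite /= /q; congr (_%:E); ring.
rewrite E1 normrM ger0_norm ?invr_ge0 ?(ltW (hp k))// ler_pdivrMl//.
have idf : mu.-integrable setT (EFin \o (fun y => ps y * c y - psi y ^+ m.+1 * c y)).
 by have := integrableB measurableT ips iq0.
apply: (le_trans (le_normr_Rintegral measurableT idf)).
have iJk : mu.-integrable setT (EFin \o (fun y => (psi y + l * h k) ^+ m * `|c y|)).
 exact: Rintegrable_le (mJ k) (Jle k) iJs.
rewrite (_ : h k * _ = m.+1%:R * l * h k * \int[mu]_y ((psi y + l * h k) ^+ m * `|c y|))%R; last by ring.
rewrite -RintegralZl//; apply: le_Rintegral => //.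
- exact: (integrable_abse idf).
- by have := integrableZl measurableT (m.+1%:R * l * h k) iJk.
move=> y _; rewrite -mulrBl normrM mulrA; have [yr|/c0 ->] := leP `|y - y0| r; last by rewrite normr0 !mulr0.
rewrite ler_wpM2r// /ps; have /andP[p0 _] := psi01 y; have /andP[p0' _] := psi01 (y - h k *: e).
have dl : `|psi (y - h k *: e) - psi y| <= l * h k.
 have hk := psil y (- h k) yr; rewrite normrN (gtr0_norm (hp k)) scaleNr in hk.
 exact: hk (hs k).
apply: (le_trans (pow_diff_le m p0' p0)); apply: ler_pM.
- exact: mulr_ge0.
- by rewrite exprn_ge0// le_max p0 orbT.
- by rewrite -mulrA ler_wpM2l.
have dl2 := le_trans (ler_norm _) dl.
rewrite lerXn2r// ?nnegrE ?le_max ?p0 ?orbT//.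
by rewrite ge_max lerDl mulr_ge0 ?(ltW (hp k))// andbT -lerBlDl.
Unshelve. all: by end_near. Qed.

End Translation.

Section GlobalContinuity.
Context {T : topologicalType} {R : realType}.
Implicit Types F G : T -> R.

Lemma ctsM F G : continuous F -> continuous G -> continuous (fun x => F x * G x).
Proof. by move=> cF cG x; exact: (ctM (cF x) (cG x)). Qed.

Lemma ctsD F G : continuous F -> continuous G -> continuous (fun x => F x + G x).
Proof. by move=> cF cG x; exact: (ctD (cF x) (cG x)). Qed.

Lemma ctsX F m : continuous F -> continuous (fun x => F x ^+ m).
Proof. by move=> cF x; exact: (ct_rcomp (h := fun t : R => t ^+ m) (cF x) (@exprn_continuous R m (F x))). Qed.

Lemma cts_rcomp F (h : R -> R) : continuous F -> continuous h -> continuous (fun x => h (F x)).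
Proof. by move=> cF ch x; exact: (ct_rcomp (cF x) (ch (F x))). Qed.

Lemma cts_norm F : continuous F -> continuous (fun x => `|F x|).
Proof. by move=> cF; apply: (cts_rcomp (h := fun t : R => `|t|) cF); exact: norm_continuous. Qed.

End GlobalContinuity.
Arguments ctsM {T R F G} _ _.
Arguments ctsD {T R F G} _ _.
Arguments ctsX {T R F} m _.
Arguments cts_norm {T R F} _.

(** * Quadratic forms compared with the sup norm and with each other *)

Section QuadraticForm.
Context {R : realType} {n : nat}.
Implicit Types (G E : 'M[R]_n) (u v : 'rV[R]_n).

Definition bf G u v : R := (u *m G *m v^T) 0 0.
Definition qf G v : R := bf G v v.

Lemma bfE G u v : bf G u v = \sum_i \sum_j u 0 i * G i j * v 0 j.
Proof.
rewrite /bf mxmulE exchange_big /=; sumr j.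
by rewrite mxmulE mulr_suml; sumr i; rewrite mxtrE.
Qed.

Lemma qf_ge0 G v : posdef G -> 0 <= qf G v.
Proof.
move=> pG; have [->|v0] := eqVneq v 0; last exact: ltW (pG v v0).
by rewrite /qf /bf mul0mx mul0mx mxE.
Qed.

Lemma qf_frame G E v : E *m G *m E^T = 1%:M -> E \in unitmx ->
 qf G v = \sum_i ((v *m invmx E) 0 i) ^+ 2.
Proof.
move=> EGE uE; have {1}-> : v = (v *m invmx E) *m E by rewrite mulmxKV.
set u := v *m invmx E; rewrite /qf /bf trmx_mul.
have -> : u *m E *m G *m (E^T *m u^T) = u *m u^T by rewrite -!mulmxA (mulmxA G) (mulmxA E) (mulmxA E) EGE mul1mx.
by rewrite mxmulE; sumr i; rewrite mxtrE expr2.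
Qed.

Lemma frame_unitmx G E : E *m G *m E^T = 1%:M -> E \in unitmx.
Proof. by rewrite -mulmxA => /mulmx1_unit[]. Qed.

Lemma sqr_le_sum (u : 'rV[R]_n) i : u 0 i ^+ 2 <= \sum_j u 0 j ^+ 2.
Proof. by rewrite (bigD1 i)//= lerDl sumr_ge0// => j _; exact: sqr_ge0. Qed.

Lemma qf_perturb (D : 'M[R]_n) u : `|bf D u u| <= (\sum_i \sum_j `|D i j|) * \sum_j u 0 j ^+ 2.
Proof.
rewrite bfE (le_trans (ler_norm_sum _ _ _))// mulr_suml; apply: ler_sum => i _.
rewrite (le_trans (ler_norm_sum _ _ _))// mulr_suml; apply: ler_sum => j _.
rewrite !normrM mulrAC mulrC ler_wpM2l//.
have := sqr_le_sum u i; have := sqr_le_sum u j; set S := \sum_ _ _ => sj si.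
rewrite -(@ler_pM2l _ 2)// mulrA.
have : 0 <= (`|u 0 i| - `|u 0 j|) ^+ 2 by exact: sqr_ge0.
by move: si sj; rewrite -(real_normK (num_real (u 0 i))) -(real_normK (num_real (u 0 j))); nra.
Qed.

Lemma qf_norm_le G : exists2 c, 0 < c & forall v, qf G v <= c * `|v| ^+ 2.
Proof.
exists (1 + \sum_i \sum_j `|G i j|) => [|v]; first by rewrite ltr_wpDr// sumr_ge0// => i _; rewrite sumr_ge0.
rewrite mulrDl mul1r ler_wpDl ?sqr_ge0// /qf bfE mulr_suml; apply: ler_sum => i _; rewrite mulr_suml; apply: ler_sum => j _.
rewrite (le_trans (ler_norm _))// !normrM mulrAC mulrC ler_wpM2l// expr2.
by apply: ler_pM => //; exact: coord_le.
Qed.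

Lemma norm_qf_le G : G^T = G -> posdef G -> exists2 c, 0 < c & forall v, `|v| <= c * Num.sqrt (qf G v).
Proof.
move=> sG pG; have [E EGE] := orthoframe sG pG; have uE := frame_unitmx EGE.
have s0 : 0 <= \sum_i \sum_j `|E i j| by rewrite sumr_ge0// => i _; rewrite sumr_ge0.
exists (1 + \sum_i \sum_j `|E i j|) => [|v]; first by rewrite ltr_wpDr.
apply: row_normP => [|i k]; first by rewrite mulr_ge0 ?sqrtr_ge0// addr_ge0.
rewrite ord1; have -> : v 0 k = (v *m invmx E *m E) 0 k by rewrite mulmxKV.
rewrite mxmulE; set u := v *m invmx E.
rewrite (le_trans (ler_norm_sum _ _ _))//.
rewrite mulrDl mul1r ler_wpDl ?sqrtr_ge0// mulr_suml; apply: ler_sum => j _.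
rewrite normrM mulrC; apply: ler_pM => //; first by rewrite (bigD1 k)//= lerDl sumr_ge0.
by rewrite -(sqrtr_sqr (u 0 j)) (qf_frame _ EGE uE) ler_wsqrtr// sqr_le_sum.
Qed.

Lemma qfZ G (t : R) v : qf G (t *: v) = t ^+ 2 * qf G v.
Proof. by rewrite /qf /bf linearZ /= -scalemxAl -scalemxAl -scalemxAr !mxscaleE mulrA expr2. Qed.

Lemma qf_row G E j : E *m G *m E^T = 1%:M -> qf G (row j E) = 1.
Proof.
move=> EGE; rewrite /qf /bf -row_mul tr_row mxmulE.
have := congr1 (fun A : 'M[R]_n => A j j) EGE; rewrite /= mxmulE [X in _ = X]mxE eqxx mulr1n => <-.
by sumr k; rewrite [row _ _ _ _]mxE [col _ _ _ _]mxE.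
Qed.

(** In a frame orthonormal at [y0] the Gram matrix is continuous and equals the identity at [y0], so
    its deviation is small relative to [qf (g y0)]. *)
Lemma qf_near (U : set 'rV[R]_n) (g : 'rV[R]_n -> 'M[R]_n) y0 (d : R) : local_metric U g ->
 posdef (g y0) -> U y0 -> 0 < d ->
 exists2 r, 0 < r & (forall y, `|y - y0| <= r -> U y) /\
  forall y, `|y - y0| <= r -> forall v, `|qf (g y) v - qf (g y0) v| <= d * qf (g y0) v.
Proof.
move=> lm pG Uy0 d0; have [E EGE] := orthoframe (lm_sym lm Uy0) pG.
have uE := frame_unitmx EGE.
pose H y := E *m g y *m E^T; pose S y := \sum_i \sum_j `|(H y - 1%:M) i j|.
have S0 : S y0 = 0.
 by rewrite /S /H EGE subrr big1// => i _; rewrite big1// => j _; rewrite mxE normr0.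
have cS : {for y0, continuous S}.
 apply: ct_sum => i _; apply: ct_sum => j _; apply: (ct_rcomp (h := fun t : R => `|t|)); last exact: norm_continuous.
 rewrite (_ : (fun y => _) = (fun y => (\sum_k (\sum_l E i l * g y l k) * E j k) - (1%:M : 'M[R]_n) i j)); last first.
  fext y; rewrite mxsubE /H mxmulE; congr (_ - _); sumr k.
  by rewrite mxmulE mxtrE.
 apply: ctB; last exact: ct_cst.
 apply: ct_sum => k _; apply: ctM; last exact: ct_cst.
 apply: ct_sum => l _; apply: ctM; first exact: ct_cst.
 by have sg := lm_smooth lm l k 0; exact: Ck_cts sg Uy0.
have nS : \forall y \near y0, U y /\ S y <= d.
 have N1 := near_open (lm_open lm) Uy0.
 have N2 : \forall y \near y0, S y <= d.
  have /cvgrPdist_le/(_ _ d0) := cS; apply: filterS => y; rewrite S0 sub0r normrN.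
  exact: le_trans (ler_norm _).
 by apply: filterS2 N1 N2.
have [r r0 rP] := near_normP nS.
have rr y : `|y - y0| <= r / 2 -> U y /\ S y <= d.
 move=> yr; rewrite -(subrK y0 y) addrC; apply: rP; apply: le_lt_trans yr _.
 by rewrite ltr_pdivrMr// ltr_pMr// ltr1n.
exists (r / 2); first by rewrite divr_gt0.
split=> y /rr[Uy Sy]// v.
have E1 : qf (g y) v = bf (H y) (v *m invmx E) (v *m invmx E).
 rewrite /qf /bf /H trmx_mul -!mulmxA; congr (fun_of_matrix _ 0 0); congr (_ *m _).
 by rewrite (mulmxA (E^T)) -trmx_mul mulVmx// trmx1 mul1mx (mulmxA (invmx E)) mulVmx// mul1mx.
have -> : qf (g y) v - qf (g y0) v = bf (H y - 1%:M) (v *m invmx E) (v *m invmx E).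
 rewrite E1 (qf_frame _ EGE uE) /bf mulmxBr mulmxBl mxsubE; congr (_ - _).
 by rewrite mulmx1 mxmulE; sumr i; rewrite mxtrE expr2.
rewrite (le_trans (qf_perturb _ _))// (qf_frame _ EGE uE) ler_wpM2r//.
by rewrite sumr_ge0// => i _; exact: sqr_ge0.
Qed.

Lemma vdot_qf G (w : 'cV[R]_n) : G^T = G -> G \in unitmx -> vdot G w w = qf G (invmx G *m w)^T.
Proof.
move=> sG uG; rewrite vdotE /gtrace /qf bfE.
have -> : \sum_i \sum_j (invmx G *m w)^T 0 i * G i j * (invmx G *m w)^T 0 j = \sum_i w i 0 * (invmx G *m w) i 0.
 transitivity (\sum_i (invmx G *m w) i 0 * (G *m (invmx G *m w)) i 0).
  sumr i; rewrite [(G *m _) i 0]mxmulE mulr_sumr; sumr j.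
  by rewrite !mxtrE mulrA.
 by rewrite mulKVmx//; sumr i; rewrite mulrC.
by sumr a; rewrite mxmulE mulr_sumr; sumr b; ring.
Qed.

End QuadraticForm.

Lemma Rintegral_sum d (T : measurableType d) (R : realType) (mu : {measure set T -> \bar R}) (I : Type) (r : seq I)
 (f : I -> T -> R) : (forall i, mu.-integrable [set: T] (EFin \o f i)) ->
 mu.-integrable [set: T] (EFin \o (fun x => \sum_(i <- r) f i x)) /\
 (\int[mu]_x (\sum_(i <- r) f i x) = \sum_(i <- r) \int[mu]_x f i x)%R.
Proof.
move=> fi; elim: r => [|i r [IH1 IH2]].
 split; last by rewrite big_nil; under eq_Rintegral do rewrite big_nil; rewrite Rintegral_cst// mul0r.
 rewrite (_ : EFin \o _ = cst 0%E); first exact: integrable0.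
 by fext x; rewrite /= big_nil.
have E : (fun x => \sum_(j <- i :: r) f j x) = (fun x => f i x + \sum_(j <- r) f j x).
 by fext x; rewrite big_cons.
rewrite E big_cons RintegralD// IH2; split=> //.
by have := integrableD measurableT (fi i) IH1.
Qed.

(** * The divergence estimate in one chart *)

Section LocalEstimate.
Context {R : realType} {n : nat} {M : ptopologicalType} {A : smooth_atlas R n M}.
Variable g : riemannian_metric A.
Hypothesis hausM : hausdorff_space M.
Variable vol : {measure set (borel M) -> \bar R}.
Hypothesis volP : riemannian_volume g vol.

Lemma normM_continuous (w : chart_idx A -> 'rV[R]_n -> 'cV[R]_n) : covector w -> cts_cov w ->
 continuous (fun x => Num.sqrt (dotM g w w x)).
Proof.
by move=> cw ctw x; apply: (ct_rcomp (h := @Num.sqrt R)); [exact: cts_dotM|exact: sqrt_continuous].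
Qed.

Lemma closed_inv_ball i y0 r : (forall y, `|y - y0| <= r -> chart_img i y) ->
 compact (@chart_inv _ _ _ A i @` [set y | `|y - y0| <= r]).
Proof.
move=> rU; apply: continuous_compact.
 apply: continuous_in_subspaceT => y; rewrite inE => yr; exact: (chart_inv_continuous (rU y yr)).
apply: bounded_closed_compact; last exact: closed_cball.
exists (`|y0| + r); split; first exact: num_real.
move=> b bb y /= yr; apply: ltW; apply: le_lt_trans bb.
by rewrite -[y](subrK y0) addrC (le_trans (ler_normD _ _))// lerD2l.
Qed.

Lemma gradM_near0 (phi : M -> R) i x : (\forall z \near x, phi z = 0) -> chart_dom i x ->
 gradM (A := A) phi i (chart i x) = 0.
Proof.
move=> p0 dx; apply/colP => a; rewrite !mxE -[RHS](partial_cst a 0 (chart i x)); apply: near_partial.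
have cx : chart_inv i z @[z --> chart i x] --> x.
 have cx : chart_inv i z @[z --> chart i x] --> chart_inv i (chart i x) := chart_inv_continuous (imgP dx).
 by rewrite chartK in cx.
exact: cx _ p0.
Qed.

Lemma dot_near0 (phi : M -> R) w x : Ck_fun A 1 phi -> covector w ->
 (\forall z \near x, phi z = 0) -> dotM g (gradM phi) w x = 0.
Proof.
move=> Cphi cw p0; have dx := chart_atP A x.
rewrite (@dotE _ _ _ _ g _ _ _ _ (cov_gradM g Cphi) cw dx) gradM_near0// vdotE.
by rewrite /gtrace big1// => a _; rewrite big1// => b _; rewrite mxE mul0r mulr0.
Qed.

Lemma near_far i y0 r x : (forall y, `|y - y0| <= r -> chart_img (A := A) i y) ->
 ~ (@chart_inv _ _ _ A i @` [set y | `|y - y0| <= r]) x ->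
 forall phi : M -> R, (forall z, phi z != 0 -> chart_dom i z /\ `|chart i z - y0| <= r) ->
 \forall z \near x, phi z = 0.
Proof.
move=> rU nx phi pP; have cK := compact_closed hausM (closed_inv_ball rU).
have : open_nbhs x (~` (@chart_inv _ _ _ A i @` [set y | `|y - y0| <= r])) by split=> //; exact: closed_openC.
move=> /open_nbhs_nbhs; apply: filterS => z nz; apply/eqP; apply: contra_notT nz => /pP[dz zr].
by exists (chart i z) => //; rewrite chartK.
Qed.

Lemma integral_supp (D : set M) (F : M -> R) : open D -> (forall x, ~ D x -> F x = 0) ->
 (\int[vol]_x (F x)%:E = \int[vol]_(x in (D : set (borel M))) (F x)%:E)%E.
Proof.
move=> oD F0; rewrite [RHS]integral_mkcond; apply: eq_integral => x _.
by rewrite patchE; case: ifPn => // /negP xD; rewrite F0// => Dx; apply: xD; rewrite inE.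
Qed.

Lemma local_estimate i y0 r (psi phi : M -> R) w L m :
 0 < r -> (forall y, `|y - y0| <= 2 * r -> chart_img i y) -> 0 <= L ->
 continuous psi -> (forall x, 0 <= psi x <= 1) ->
 (forall y z, `|y - y0| <= 2 * r -> `|z - y0| <= 2 * r ->
  `|psi (chart_inv i y) - psi (chart_inv i z)| <= L * Num.sqrt (qf (g i y0) (y - z))) ->
 (forall y v, `|y - y0| <= r -> qf (g i y0) v <= 4 * qf (g i y) v) ->
 Ck_fun A 1 phi -> smooth_cov w -> covector w ->
 (forall x, phi x != 0 -> chart_dom i x /\ `|chart i x - y0| <= r) ->
 `|\int[vol]_x (psi x ^+ m.+1 * (phi x * divM g w x + dotM g (gradM phi) w x))| <=
 n%:R * (m.+1%:R * L * (2 * \int[vol]_x (psi x ^+ m * (`|phi x| * Num.sqrt (dotM g w w x)))))%R.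
Proof.
move=> r0 rU2 L0 cpsi psi01 psiL gle Cphi sw cw phiS.
have rU y : `|y - y0| <= r -> chart_img i y.
 by move=> yr; apply: rU2; apply: le_trans yr _; rewrite ler_peMl ?ler1n// ltW.
have Uy0 : chart_img i y0 by apply: rU; rewrite subrr normr0 ltW.
have lm := metric_at g i; have gpos y (Uy : chart_img i y) := g_posdef g Uy.
have oU := lm_open lm.
set T := fun x => psi x ^+ m.+1 * _; set N := fun x => psi x ^+ m * _.
have cphi := Ck_fun_cts Cphi.
have cdot := cts_dot_grad (g := g) Cphi sw cw.
have cT : continuous (T : M -> R).
 exact: (ctsM (ctsX m.+1 cpsi) (ctsD (ctsM cphi (cts_divM (g := g) sw cw)) cdot)).
have cN : continuous N.
 exact: (ctsM (ctsX m cpsi) (ctsM (cts_norm cphi) (normM_continuous cw (smooth_cts_cov sw)))).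
have far x : ~ chart_dom i x -> \forall z \near x, phi z = 0.
 move=> nd; apply: (near_far rU _ phiS) => -[y yr yx]; apply: nd; rewrite -yx.
 exact: inv_dom (rU y yr).
have T0 x : ~ chart_dom i x -> T x = 0.
 move=> /far p0; rewrite /T (dot_near0 Cphi cw p0) (nbhs_singleton p0); ring.
have N0 x : ~ chart_dom i x -> N x = 0.
 by move=> /far p0; rewrite /N (nbhs_singleton p0) normr0; ring.
have [E EGE] := orthoframe (lm_sym lm Uy0) (gpos _ Uy0).
have uE := frame_unitmx EGE.
pose h y := phi (chart_inv i y).
(* The flux extended by 0; it stays $C^1$ because it already vanishes outside the ball of radius
   [r]. *)
pose X a y := if `[< chart_img i y >] then flux (g i) h (w i) y a else 0.
have h0 y : chart_img i y -> r < `|y - y0| -> h y = 0.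
 move=> Uy yr; apply/eqP; apply: contraT => /phiS[_]; rewrite chart_invK//.
 by rewrite leNgt yr.
have X0 a y : r < `|y - y0| -> X a y = 0.
 by move=> yr; rewrite /X; case: asboolP => // Uy; rewrite /flux h0// mul0r.
have oF : open [set y : 'rV[R]_n | r < `|y - y0|].
 rewrite (_ : [set y | _] = ~` [set y | `|y - y0| <= r]).
  by rewrite openC; exact: closed_cball.
 by apply/seteqP; split => z /=; rewrite ltNge => /negP.
have CX a : Ck_on 1 setT (X a).
 apply: (@Ck_on_sub _ _ 1 (chart_img i `|` [set y | r < `|y - y0|])).
  by move=> y _; case: (leP `|y - y0| r) => yr; [left; exact: rU|right].
 apply: Ck_onU.
  apply: (Ck_on_eq oU) (C1_flux lm gpos a (Cphi i) (sw i)) => y Uy.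
  by rewrite /X; case: asboolP.
 by apply: (Ck_on_eq oF) (Ck_cst 1 0 oF) => y yr; rewrite X0.
pose c j y := \sum_a X a y * invmx E a j.
have Cc j : Ck_on 1 setT (c j).
 by apply: Ck_sum => [|a _]; [exact: openT|apply: CkM; [exact: openT|exact: CX|exact: (Ck_cst 1 _ openT)]].
have c0 j y : r < `|y - y0| -> c j y = 0.
 by move=> yr; rewrite /c big1// => a _; rewrite X0// mul0r.
pose ps y := if `[< chart_img i y >] then psi (chart_inv i y) else 0.
have ps01 y : 0 <= ps y <= 1.
 by rewrite /ps; case: asboolP => _; rewrite ?psi01// lexx ler01.
have mps : measurable_fun setT (ps : borel 'rV[R]_n -> R).
 rewrite (_ : ps = (fun y => psi (chart_inv i y)) \_ (chart_img i)); last first.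
  fext y; rewrite /ps patchE; case: asboolP => [Uy|Uy]; first by rewrite mem_set.
  by rewrite memNset.
 apply: (measurable_restrictT _ (img_borel i)).1.
 by apply: ct_borel => // y Uy; apply: ct_comp; [exact: chart_inv_continuous|exact: cpsi].
(* The Euclidean divergence can be computed in any linear frame. *)
have divE1 y : \sum_j 'D_(row j E) (c j) y = \sum_a partial a (X a) y.
 transitivity (\sum_j \sum_k E j k * \sum_a partial k (X a) y * invmx E a j).
  sumr j; rewrite (C1_derive _ openT (Cc j) I); sumr k; rewrite mxE; congr (_ * _).
  have dX a : derivable (X a) y (bv k) by exact: Ck_der k (CX a) I.
  rewrite /c partial_sum => [|a _]; last by apply: derivableM => //; exact: derivable_cst.
  by sumr a; rewrite partialM// partial_cst mulr0 addr0.
 transitivity (\sum_a \sum_k (invmx E *m E) a k * partial k (X a) y).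
  under eq_bigr do under eq_bigr do rewrite mulr_sumr.
  under eq_bigr do rewrite exchange_big.
  sumx a; sumx k.
  by rewrite mxmulE mulr_suml; sumr j; ring.
 sumr a; rewrite mulVmx// (bigD1 a)//= mxE eqxx mul1r big1 ?addr0// => k ka.
 by rewrite mxE eq_sym (negPf ka) mul0r.
have ET : (\int[vol]_x T x = \int[leb_Rn n]_y \sum_j (ps y ^+ m.+1 * 'D_(row j E) (c j) y))%R.
 congr fine; rewrite (integral_supp (chart_dom_open A i) T0) (integral_chart volP i (F := T)); last first.
  by apply: ct_borel => [|x _]; [exact: openT|exact: cT].
 rewrite [LHS]integral_mkcond; apply: eq_integral => y _; rewrite patchE -mulr_sumr divE1.
 case: ifPn => [/set_mem Uy|/negP yU].
  rewrite /ps; case: asboolP => // _; congr (_%:E).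
  have dy := inv_dom Uy.
  rewrite /T (divE g sw cw dy) (@dotE _ _ _ _ g _ _ _ _ (cov_gradM g Cphi) cw dy) chart_invK//.
  rewrite -mulrA; congr (_ * _); rewrite mulrC -(div_flux lm gpos (Cphi i) (sw i) Uy).
  sumr a; apply: (pd_eq_on a oU) => // z Uz.
  by rewrite /X; case: asboolP.
 have nU : ~ chart_img i y by move=> Uy; apply: yU; rewrite inE.
 rewrite big1 ?mulr0// => a _; rewrite -(partial_cst a 0 y); apply: (pd_eq_on a oF) => [z zr|].
  by rewrite X0.
 by rewrite /= ltNge; apply/negP => /rU.
pose Nh y := if `[< chart_img i y >] then N (chart_inv i y) * vdens g i y else 0.
have Nh0 y : r < `|y - y0| -> Nh y = 0.
 by move=> yr; rewrite /Nh; case: asboolP => // Uy; rewrite /N -/(h y) h0// normr0; ring.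
have cNh : continuous Nh.
 move=> y; have [yr|yr] := leP `|y - y0| r.
  have Uy := rU _ yr; apply: (ct_near (F := fun y => N (chart_inv i y) * vdens g i y)).
   by apply: filterS (near_open oU Uy) => z Uz; rewrite /Nh; case: asboolP.
  apply: ctM; last exact: ct_vdens.
  by apply: ct_comp; [exact: chart_inv_continuous|exact: cN].
 apply: (ct_near (F := fun=> 0)); last exact: ct_cst.
 by apply: filterS (near_open oF yr) => z zr; rewrite Nh0.
have iNh : (leb_Rn n).-integrable setT (EFin \o (Nh : borel 'rV[R]_n -> R)).
 exact: (supp_integrable (ltW r0) cNh Nh0).
have EN : (\int[vol]_x N x = \int[leb_Rn n]_y Nh y)%R.
 congr fine; rewrite (integral_supp (chart_dom_open A i) N0) (integral_chart volP i (F := N)); last first.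
  by apply: ct_borel => [|x _]; [exact: openT|exact: cN].
 rewrite [LHS]integral_mkcond; apply: eq_integral => y _; rewrite patchE /Nh.
 case: ifPn => [/set_mem Uy|/negP yU]; case: asboolP => // Uy'.
 by case: yU; rewrite inE.
have cle j y : ps y ^+ m * `|c j y| <= 2 * Nh y.
 have [yr|yr] := leP `|y - y0| r; last by rewrite c0// normr0 mulr0 Nh0// mulr0.
 have Uy := rU _ yr; rewrite /Nh /ps; case: asboolP => // _.
 rewrite /N (@dotE _ _ _ _ g _ _ _ _ cw cw (inv_dom Uy)) chart_invK// -/(h y).
 rewrite mulrCA -!mulrA ler_wpM2l//.
  by have /andP[p0 _] := psi01 (chart_inv i y); rewrite exprn_ge0.
 pose Xv : 'rV[R]_n := \row_a X a y.
 have cX : c j y = (Xv *m invmx E) 0 j by rewrite mxmulE; sumr a; rewrite mxE.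
 have XvE : Xv = (h y * vdens g i y) *: (invmx (g i y) *m w i y)^T.
  apply/rowP => a; rewrite mxE mxscaleE mxtrE /X; case: asboolP => // _.
  by rewrite /flux mulrA.
 have c2 : c j y ^+ 2 <= 4 * qf (g i y) Xv.
  by rewrite (le_trans _ (gle y Xv yr))// (qf_frame _ EGE uE) cX sqr_le_sum.
 rewrite -(sqrtr_sqr (c j y)) (le_trans (ler_wsqrtr c2))// XvE qfZ -vdot_qf//.
 - rewrite sqrtrM// sqrtrM ?sqr_ge0// sqrtr_sqr normrM (ger0_norm (ltW (vdens_gt0 g Uy))).
  rewrite (_ : 4 = 2 ^+ 2 :> R); last by ring.
  by rewrite sqrtr_sqr (ger0_norm (ler0n R 2)) le_eqVlt; apply/orP; left; apply/eqP; ring.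
 - exact: (lm_sym lm Uy).
 - exact: (lm_unit lm Uy).
have LB j : [/\ (leb_Rn n).-integrable setT (fun y => (ps y ^+ m.+1 * 'D_(row j E) (c j) y)%:E),
   (leb_Rn n).-integrable setT (fun y => (ps y ^+ m * `|c j y|)%:E) &
   `|\int[leb_Rn n]_y (ps y ^+ m.+1 * 'D_(row j E) (c j) y)| <= m.+1%:R * L * \int[leb_Rn n]_y (ps y ^+ m * `|c j y|)]%R.
 (* This bound on the displacement keeps the moved points within [2 * r] of [y0]; the added 1 keeps
    the divisor positive. *)
 apply: (@lipschitz_by_parts _ _ _ _ _ y0 r (r / (`|row j E| + 1))) => //.
 - exact: ltW.
 - exact: divr_gt0.
 - exact: c0.
 - move=> y t yr tr; have y2 : `|y - y0| <= 2 * r by apply: le_trans yr _; rewrite ler_peMl ?ler1n// ltW.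
  have t2 : `|y + t *: row j E - y0| <= 2 * r.
   rewrite addrAC (le_trans (ler_normD _ _))// mulr_natl mulr2n lerD// normrZ.
   rewrite (le_trans (ler_wpM2r _ tr))// mulrAC ler_pdivrMr// ler_wpM2l ?(ltW r0)//.
   by rewrite lerDl.
  rewrite /ps; case: asboolP => [_|/(_ (rU2 _ t2))//]; case: asboolP => [_|/(_ (rU2 _ y2))//].
  have := psiL _ _ t2 y2; rewrite (_ : y + _ - y = t *: row j E); last by rewrite addrAC subrr add0r.
  by rewrite qfZ qf_row// mulr1 sqrtr_sqr.
rewrite ET; have [|_ ->] := @Rintegral_sum _ _ _ (leb_Rn n) _ (index_enum 'I_n) (fun j y => ps y ^+ m.+1 * 'D_(row j E) (c j) y).
 by move=> j; have [] := LB j.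
rewrite (le_trans (ler_norm_sum _ _ _))//.
rewrite -[n in n%:R](card_ord n) -sum1_card natr_sum mulr_suml; apply: ler_sum => j _; rewrite mul1r.
have [_ ic le1] := LB j; apply: (le_trans le1); rewrite ler_wpM2l ?mulr_ge0//.
rewrite EN -RintegralZl//; apply: le_Rintegral => //.
by have := integrableZl measurableT 2 iNh.
Qed.

End LocalEstimate.

(** * The divergence estimate on the manifold *)

Section GlobalEstimate.
Context {R : realType} {n : nat} {M : ptopologicalType} {A : smooth_atlas R n M}.
Variable g : riemannian_metric A.
Hypothesis hausM : hausdorff_space M.
Variable vol : {measure set (borel M) -> \bar R}.
Hypothesis volP : riemannian_volume g vol.

(** Lipschitz continuity for the Riemannian metric, expressed in charts: near each point, increments
    are compared with the metric frozen there. *)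
Definition loc_lipschitz (L : R) (psi : M -> R) := forall i y0, chart_img i y0 ->
 exists2 r, 0 < r & forall y z, `|y - y0| <= r -> `|z - y0| <= r ->
  `|psi (chart_inv i y) - psi (chart_inv i z)| <= L * Num.sqrt (qf (g i y0) (y - z)).

(** A $C^1$ profile in the squared radius [t]: 1 up to $r^2/2$ and 0 from $r^2$ on. The factor
    $4/r^4$ makes the inner expression reach 1 exactly at $t = r^2/2$. *)
Definition plateau (r t : R) : R := 1 - pospow 2 (1 - 4 / r ^+ 4 * pospow 2 (r ^+ 2 - t)).

Lemma pospow2_le1 (t : R) : t <= 1 -> pospow 2 t <= 1.
Proof.
move=> t1; rewrite /pospow expr_le1 ?le_max ?lexx ?orbT//.
by rewrite ge_max t1 ler01.
Qed.

Lemma pospow2_0 (t : R) : t <= 0 -> pospow 2 t = 0.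
Proof. by move=> t0; rewrite /pospow (max_idPr t0) expr0n. Qed.

Lemma plateau01 r t : 0 <= plateau r t <= 1.
Proof.
rewrite /plateau subr_ge0 gerBl pospow_ge0 andbT pospow2_le1//.
by rewrite gerBl mulr_ge0 ?pospow_ge0// divr_ge0// exprn_even_ge0.
Qed.

Lemma plateau0 r t : r ^+ 2 <= t -> plateau r t = 0.
Proof.
move=> rt; rewrite /plateau (pospow2_0 (t := r ^+ 2 - t)) ?subr_le0// mulr0 subr0.
by rewrite /pospow (max_idPl ler01) expr1n subrr.
Qed.

Lemma plateau1 r t : 0 < r -> t <= r ^+ 2 / 2 -> plateau r t = 1.
Proof.
move=> r0 tr; rewrite /plateau (pospow2_0 (t := 1 - _)) ?subr0//.
have r2 : 0 < r ^+ 2 by rewrite exprn_gt0.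
have h1 : r ^+ 2 / 2 <= r ^+ 2 - t by rewrite lerBrDr; move: tr; set x := r ^+ 2 => tr; lra.
have h2 : (r ^+ 2 / 2) ^+ 2 <= pospow 2 (r ^+ 2 - t).
 rewrite /pospow lerXn2r ?nnegrE ?le_max ?h1 ?lexx ?orbT//.
 by rewrite divr_ge0// ltW.
have a0 : 0 < r ^+ 4 by rewrite exprn_gt0.
have e4 : 4 / r ^+ 4 * (r ^+ 2 / 2) ^+ 2 = 1 by field; rewrite gt_eqF.
by rewrite subr_le0 -{1}e4 ler_wpM2l// divr_ge0// ltW.
Qed.

Lemma C1_plateau r (U : set 'rV[R]_n) F : open U -> Ck_on 1 U F -> Ck_on 1 U (fun y => plateau r (F y)).
Proof.
move=> oU CF; have P H : Ck_on 1 U H -> Ck_on 1 U (fun y => pospow 2 (H y)).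
 move=> CH; have [] := C1_comp oU CH (@der_pospow R 0) => // t.
 by apply: cvgMr; exact: cts_pospow.
have C c : Ck_on 1 U (fun=> c : R) by exact: Ck_cst.
exact: (CkB oU (C 1) (P _ (CkB oU (C 1) (CkM oU (C _) (P _ (CkB oU (C _) CF)))))).
Qed.

Lemma bump_exists (i : chart_idx A) y0 r : 0 < r -> (forall y, `|y - y0| <= r -> chart_img i y) ->
 exists b : M -> R, [/\ Ck_fun A 1 b, forall x, 0 <= b x <= 1,
  forall x, b x != 0 -> chart_dom i x /\ `|chart i x - y0| <= r &
  \forall z \near chart_inv i y0, b z = 1].
Proof.
(* The squared Euclidean distance is smooth, unlike the sup norm in which balls are taken; outside
   the sup-norm ball it is at least $r^2$. *)
move=> r0 rU; pose q (y : 'rV[R]_n) := \sum_a (y 0 a - y0 0 a) ^+ 2.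
pose b x := if `[< chart_dom i x >] then plateau r (q (chart i x)) else 0.
have q_out y : ~ `|y - y0| <= r -> r ^+ 2 <= q y.
 move=> /negP; rewrite -ltNge => yr; rewrite leNgt; apply/negP => qr.
 suff : `|y - y0| <= r by rewrite leNgt yr.
 apply: row_normP => [|k a]; first exact: ltW.
 rewrite -(@ler_pXn2r _ 2) ?nnegrE ?(ltW r0)// real_normK ?num_real// ord1 mxsubE.
 by apply: le_trans (ltW qr); rewrite /q (bigD1 a)//= lerDl sumr_ge0// => c _; exact: sqr_ge0.
have bS x : b x != 0 -> chart_dom i x /\ `|chart i x - y0| <= r.
 rewrite /b; case: asboolP => [dx|]; last by rewrite eqxx.
 move=> bx; split=> //; apply: contra_neqT bx => /negP /q_out; exact: plateau0.
have Uy0 : chart_img i y0 by apply: rU; rewrite subrr normr0 ltW.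
have Cq (U : set 'rV[R]_n) (tau : 'rV[R]_n -> 'rV[R]_n) : open U -> (forall c, smooth_on U (fun z => tau z 0 c)) ->
  Ck_on 1 U (fun z => q (tau z)).
 move=> oU st; apply: Ck_sum => // a _; under eq_fun do rewrite expr2.
 have C : Ck_on 1 U (fun z => tau z 0 a - y0 0 a) by apply: CkB => //; [exact: st|exact: Ck_cst].
 exact: CkM.
have cK := compact_closed hausM (closed_inv_ball rU).
exists b; split=> //.
(* Two open sets cover the image of chart [j]: the overlap with chart [i], and the part that avoids
   the compact image of the ball under the chart inverse, where [b] is 0. Compact sets are closed
   because [M] is Hausdorff. *)
- move=> j; pose U1 := overlap (A := A) j i.
 pose U2 := [set y | chart_img j y /\ (~` (@chart_inv _ _ _ A i @` [set y | `|y - y0| <= r])) (chart_inv j y)].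
 have oU2 : open U2 by apply: open_chart_inv; exact: closed_openC.
 apply: (@Ck_on_sub _ _ 1 (U1 `|` U2)) => [y Uy|].
  have [dy|ndy] := pselect (chart_dom i (chart_inv j y)); first by left; rewrite /U1 overlapE.
  right; split=> // -[z zr zy]; apply: ndy; rewrite -zy.
  exact: inv_dom (rU z zr).
 apply: Ck_onU.
  have oU1 : open U1 by exact: overlap_open.
  have cc := chart_change g j i.
  apply: (Ck_on_eq oU1) (C1_plateau r oU1 (Cq _ _ oU1 (cc_smooth cc))) => y; rewrite /U1 overlapE => -[Uy dy].
  by rewrite /b; case: asboolP.
 apply: (Ck_on_eq oU2) (Ck_cst 1 0 oU2) => y [Uy nK]; apply/esym/eqP; apply: contra_notT nK => /bS[dz zr].
 by exists (chart i (chart_inv j y)) => //; rewrite chartK.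
- by move=> x; rewrite /b; case: asboolP => _; rewrite ?plateau01// lexx ler01.
- have dx := inv_dom Uy0.
 have N1 : \forall z \near chart_inv i y0, chart_dom i z.
  by apply: open_nbhs_nbhs; split => //; exact: chart_dom_open.
 have cq : {for chart_inv i y0, continuous (fun z => q (chart i z))}.
  apply: ct_comp; first exact: chart_continuous.
  by have C := Cq _ id openT (fun c k => Ck_coord k c openT); exact: (Ck_cts C I).
 have q0 : q (chart i (chart_inv i y0)) = 0.
  by rewrite chart_invK// /q big1// => a _; rewrite subrr expr0n.
 have e0 : 0 < r ^+ 2 / 2 by rewrite divr_gt0// exprn_gt0.
 have N2 : \forall z \near chart_inv i y0, q (chart i z) <= r ^+ 2 / 2.
  have /cvgrPdist_le/(_ _ e0) := cq; apply: filterS => z; rewrite q0 sub0r normrN.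
  exact: le_trans (ler_norm _).
 apply: filterS2 N1 N2 => z dz zr; rewrite /b; case: asboolP => // _; exact: plateau1.
Qed.

Lemma integrable_supp (K : set M) (h : M -> R) : compact K -> continuous h -> (forall x, ~ K x -> h x = 0) ->
 vol.-integrable setT (EFin \o (h : borel M -> R)).
Proof.
move=> cK ch h0; have mK : measurable (K : set (borel M)) by apply: closed_borel; exact: compact_closed.
have := integrable_compact volP hausM cK ch; rewrite (integrable_mkcond _ mK).
congr (_.-integrable _ _); fext x; rewrite patchE; case: ifPn => // /negP xK.
by rewrite /= h0// => Kx; apply: xK; rewrite inE.
Qed.

Lemma vdotDl (G : 'M[R]_n) u v w : vdot G (u + v) w = vdot G u w + vdot G v w.
Proof.
rewrite !vdotE /gtrace -big_split; sumr a => /=.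
by rewrite -big_split; sumr b => /=; rewrite mxaddE; ring.
Qed.

Lemma gradMD (f1 f2 : M -> R) i y : Ck_fun A 1 f1 -> Ck_fun A 1 f2 -> chart_img i y ->
 gradM (fun x => f1 x + f2 x) i y = gradM (A := A) f1 i y + gradM (A := A) f2 i y.
Proof.
move=> C1 C2 Uy; apply/colP => a; rewrite mxaddE !mxE partialD//.
 exact: (Ck_der a (C1 i) Uy).
exact: (Ck_der a (C2 i) Uy).
Qed.

Lemma Ck_funD k (f1 f2 : M -> R) : Ck_fun A k f1 -> Ck_fun A k f2 -> Ck_fun A k (fun x => f1 x + f2 x).
Proof. by move=> C1 C2 i; apply: CkD => //; exact: open_img. Qed.

Lemma Ck_funM k (f1 f2 : M -> R) : Ck_fun A k f1 -> Ck_fun A k f2 -> Ck_fun A k (fun x => f1 x * f2 x).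
Proof. by move=> C1 C2 i; apply: CkM => //; exact: open_img. Qed.

Lemma Ck_fun_cst k (a : R) : Ck_fun A k (fun=> a).
Proof. by move=> i; apply: Ck_cst; exact: open_img. Qed.

Lemma dotM_gradD (f1 f2 : M -> R) w x : Ck_fun A 1 f1 -> Ck_fun A 1 f2 -> covector w ->
 dotM g (gradM (fun x => f1 x + f2 x)) w x = dotM g (gradM f1) w x + dotM g (gradM f2) w x.
Proof.
move=> C1 C2 cw; have dx := chart_atP A x.
have C12 := Ck_funD C1 C2.
rewrite (@dotE _ _ _ _ g _ _ _ _ (cov_gradM g C12) cw dx).
rewrite (@dotE _ _ _ _ g _ _ _ _ (cov_gradM g C1) cw dx).
rewrite (@dotE _ _ _ _ g _ _ _ _ (cov_gradM g C2) cw dx).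
by rewrite gradMD ?vdotDl//; exact: imgP.
Qed.

Section Estimate.
Variables (psi : M -> R) (w : chart_idx A -> 'rV[R]_n -> 'cV[R]_n) (L : R) (m : nat) (K : set M).
Hypotheses (cK : compact K) (psiK : forall x, psi x != 0 -> K x) (cpsi : continuous psi)
 (psi01 : forall x, 0 <= psi x <= 1) (L0 : 0 <= L) (psiL : loc_lipschitz L psi)
 (sw : smooth_cov w) (cw : covector w).

(** The bracket is $div(\varphi w)$. The exponents start at 2 here and at 1 in [cut_norm], so that
    both integrands vanish where [psi] does. *)
Definition cut_div (phi : M -> R) (x : M) : R :=
 psi x ^+ m.+2 * (phi x * divM g w x + dotM g (gradM phi) w x).
Definition cut_norm (phi : M -> R) (x : M) : R :=
 psi x ^+ m.+1 * (`|phi x| * Num.sqrt (dotM g w w x)).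
Definition cut_bound (phi : M -> R) :=
 `|\int[vol]_x cut_div phi x| <=
 n%:R * (m.+2%:R * L * (2 * \int[vol]_x cut_norm phi x)).

Lemma psi_out x : ~ K x -> psi x = 0.
Proof. by move=> nK; apply/eqP; apply: contra_notT nK; exact: psiK. Qed.

Lemma cut_div_int phi : Ck_fun A 1 phi -> vol.-integrable setT (EFin \o (cut_div phi : borel M -> R)).
Proof.
move=> Cphi; have cphi := Ck_fun_cts Cphi.
have cdot := cts_dot_grad (g := g) Cphi sw cw.
apply: (integrable_supp cK); last by move=> x nK; rewrite /cut_div psi_out// expr0n mul0r.
exact: (ctsM (ctsX m.+2 cpsi) (ctsD (ctsM cphi (cts_divM (g := g) sw cw)) cdot)).
Qed.

Lemma cut_norm_int phi : continuous phi -> vol.-integrable setT (EFin \o (cut_norm phi : borel M -> R)).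
Proof.
move=> cphi; apply: (integrable_supp cK); last by move=> x nK; rewrite /cut_norm psi_out// expr0n mul0r.
exact: (ctsM (ctsX m.+1 cpsi) (ctsM (cts_norm cphi) (normM_continuous cw (smooth_cts_cov sw)))).
Qed.

Lemma cut_norm_ge0 phi x : 0 <= cut_norm phi x.
Proof. by have /andP[p0 _] := psi01 x; rewrite !mulr_ge0// ?exprn_ge0// sqrtr_ge0. Qed.

Lemma cut_bound0 phi : Ck_fun A 1 phi -> (forall x, psi x != 0 -> phi x = 0) -> cut_bound phi.
Proof.
move=> Cphi p0; rewrite /cut_bound.
have -> : (\int[vol]_x cut_div phi x = 0)%R.
 rewrite (_ : (fun x : borel M => cut_div phi x) = cst 0); first by rewrite Rintegral_cst// mul0r.
 apply/funext => x /=; rewrite /cut_div; have [->|px] := eqVneq (psi x) 0; first by rewrite expr0n mul0r.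
 rewrite (dot_near0 g Cphi cw); first by rewrite p0// mul0r addr0 mulr0.
 have oP : open [set z | psi z != 0].
  rewrite (_ : [set z | _] = psi @^-1` [set t | t != 0])//.
  by apply: open_comp => [z _|]; [exact: cpsi|exact: open_neq].
 by have := open_nbhs_nbhs (conj oP px); apply: filterS => z; exact: p0.
rewrite normr0 !mulr_ge0// Rintegral_ge0// => x _; exact: cut_norm_ge0.
Qed.

(** The absence of cancellation in [f1 + f2] is what makes the right-hand side of the bound
    additive. *)
Lemma cut_boundD f1 f2 : Ck_fun A 1 f1 -> Ck_fun A 1 f2 -> (forall x, `|f1 x + f2 x| = `|f1 x| + `|f2 x|) ->
 cut_bound f1 -> cut_bound f2 -> cut_bound (fun x => f1 x + f2 x).
Proof.
move=> C1 C2 Ef b1 b2; rewrite /cut_bound.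
have -> : (\int[vol]_x cut_div (fun x => f1 x + f2 x)%R x =
 \int[vol]_x cut_div f1 x + \int[vol]_x cut_div f2 x)%R.
 rewrite -RintegralD//; [|exact: cut_div_int..].
 congr (Rintegral _ _ _); fext x; rewrite /cut_div dotM_gradD//; ring.
have -> : (\int[vol]_x cut_norm (fun x => f1 x + f2 x)%R x =
 \int[vol]_x cut_norm f1 x + \int[vol]_x cut_norm f2 x)%R.
 rewrite -RintegralD//; [|apply: cut_norm_int; exact: Ck_fun_cts C1|apply: cut_norm_int; exact: Ck_fun_cts C2].
 congr (Rintegral _ _ _); fext x; rewrite /cut_norm Ef; ring.
by rewrite (le_trans (ler_normD _ _))// !mulrDr lerD.
Qed.

Lemma local_bump (x : M) : exists b : M -> R, [/\ Ck_fun A 1 b, forall x, 0 <= b x <= 1,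
 \forall z \near x, b z = 1 & forall phi, Ck_fun A 1 phi -> cut_bound (fun x => b x * phi x)].
Proof.
have dx := chart_atP A x; set i := chart_at A x in dx; have Uy := imgP dx.
set y0 := chart i x in Uy.
have h34 : (0 : R) < 3 / 4 by lra.
have [r1 r10 [r1U gn]] := qf_near (metric_at g i) (g_posdef g Uy) Uy h34.
have [r2 r20 pl] := psiL Uy.
pose r := Num.min r1 r2 / 2.
have r0 : 0 < r by rewrite divr_gt0// lt_min r10.
have r2r : 2 * r = Num.min r1 r2 by rewrite /r; field.
have le1 : 2 * r <= r1 by rewrite r2r ge_min lexx.
have le2 : 2 * r <= r2 by rewrite r2r ge_min lexx orbT.
have rr : r <= 2 * r by rewrite ler_peMl ?ler1n// ltW.
have rU y : `|y - y0| <= r -> chart_img i y by move=> yr; apply: r1U; rewrite (le_trans yr)// (le_trans rr).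
have [b [Cb b01 bS b1]] := bump_exists r0 rU.
exists b; split=> //; first by rewrite /y0 chartK in b1.
move=> phi Cphi; apply: (@local_estimate _ _ _ _ g hausM vol volP i y0 r) => //.
- by move=> y yr; apply: r1U; rewrite (le_trans yr).
- by move=> y z yr zr; apply: pl; [exact: le_trans yr le2|exact: le_trans zr le2].
- move=> y v yr; have /gn/(_ v) : `|y - y0| <= r1 by rewrite (le_trans yr)// (le_trans rr).
 rewrite ler_norml => /andP[+ _]; move: (qf _ v) (qf (g i y0) v) => a c; lra.
- exact: Ck_funM.
- by move=> z; rewrite mulf_eq0 negb_or => /andP[/bS].
Qed.

(** In place of a partition of unity, bumps are peeled off one at a time by
    [phi = b * phi + (1 - b) * phi]. As $0 \le b \le 1$ there is no cancellation, and once the bumps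
    cover the support of [psi] the remainder vanishes there. *)
Lemma divergence_estimate phi : Ck_fun A 1 phi -> cut_bound phi.
Proof.
have [b bP] := choice local_bump.
have [D DK] : exists D : seq M, forall x, K x -> exists2 z, z \in D & b z x = 1.
 have := cK; rewrite compact_cover => /(_ M K (fun z => interior [set x | b z x = 1])).
 case=> [z _|x Kx|D _ DK]; first exact: open_interior.
  by exists x => //; have [_ _ + _] := bP x; exact.
 exists (finmap.enum_fset D) => x /DK[z zD zx]; exists z; first exact: zD.
 exact: interior_subset zx.
have ind : forall s : seq M, forall phi, Ck_fun A 1 phi ->
  (forall x, psi x != 0 -> phi x * \prod_(z <- s) (1 - b z x) = 0) -> cut_bound phi.
 elim=> [|z s IH] {}phi Cphi p0.
  by apply: cut_bound0 => // x /p0; rewrite big_nil mulr1.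
 have [Cb b01 _ est] := bP z.
 have C1b : Ck_fun A 1 (fun x => 1 - b z x).
  by move=> i; apply: CkB; [exact: open_img|exact: Ck_fun_cst|exact: Cb].
 have -> : phi = (fun x => b z x * phi x + (1 - b z x) * phi x) by fext x; ring.
 apply: cut_boundD; [exact: Ck_funM|exact: Ck_funM| |exact: est|].
  move=> x; have /andP[b0 b1] := b01 x; rewrite -mulrDl addrC subrK mul1r !normrM.
  by rewrite (ger0_norm b0) (ger0_norm (_ : 0 <= 1 - b z x)) ?subr_ge0//; ring.
 apply: IH => [|x px]; first exact: Ck_funM.
 by have := p0 x px; rewrite big_cons => <-; ring.
move=> Cphi; apply: (ind D) => // x /psiK /DK[z zD bz].
by rewrite (big_rem z zD)/= bz subrr mul0r mulr0.
Qed.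

End Estimate.
End GlobalEstimate.

(** * Geodesics in a coordinate ball *)
Lemma ex2_and (T : Type) (P Q : T -> Prop) : (exists2 x, P x & Q x) -> exists x, P x /\ Q x.
Proof. by case=> x; exists x. Qed.

Section RealLine.
Context {R : realType}.
Implicit Types f df : R -> R.

Lemma real_induction (P : R -> Prop) (b : R) : 0 <= b -> P 0 ->
 (forall t : R, 0 <= t < b -> (forall s : R, 0 <= s <= t -> P s) ->
  exists2 e : R, 0 < e & forall s : R, t <= s < t + e -> P s) ->
 (forall t : R, 0 < t <= b -> (forall s : R, 0 <= s < t -> P s) -> P t) ->
 forall t : R, 0 <= t <= b -> P t.
Proof.
move=> b0 P0 Po Pc; pose S := [set t : R | 0 <= t <= b /\ forall s : R, 0 <= s <= t -> P s].
have S0 : S 0 by split=> [|s s0]; [rewrite lexx b0|rewrite -(le_anti s0)].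
have hS : has_sup S by split; [exists 0|exists b => t [/andP[]]].
have T0 : 0 <= sup S by apply: ub_le_sup => //; case: hS.
have Tb : sup S <= b by apply: ge_sup; [exists 0|move=> t [/andP[]]].
have lt s : 0 <= s < sup S -> P s.
 move=> /andP[s0 sT]; have [|t St /ltW] := @sup_adherent _ S (sup S - s) _ hS; first by rewrite subr_gt0.
 by rewrite subKr => st; case: St => _; apply; rewrite s0.
have PT : P (sup S).
 have [->//|Tn0] := eqVneq (sup S) 0.
 by apply: Pc => //; rewrite lt_neqAle eq_sym Tn0 T0.
have ST s : 0 <= s <= sup S -> P s.
 by move=> /andP[s0]; rewrite le_eqVlt => /orP[/eqP->//|sT]; apply: lt; rewrite s0.
suff -> : b = sup S by [].
apply/eqP; rewrite eq_le Tb andbT leNgt; apply/negP => Tlt.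
have [|e e0 Pe] := Po (sup S) _ ST; first by rewrite T0.
pose t := Num.min b (sup S + e / 2).
have tT : sup S < t by rewrite lt_min Tlt ltrDl divr_gt0.
suff : t <= sup S by rewrite leNgt tT.
apply: ub_le_sup; first by case: hS.
split=> [|s /andP[s0 st]]; first by rewrite ge_min lexx/= andbT (le_trans T0)// ltW.
have [sT|Ts] := leP s (sup S); first by apply: ST; rewrite s0.
apply: Pe; rewrite (ltW Ts)/=; apply: le_lt_trans st _.
by rewrite gt_min ltrD2l ltr_pdivrMr// ltr_pMr// ltr1n orbT.
Qed.

Lemma is_derive_ct f (df t : R) : is_der t f df -> {for t, continuous f}.
Proof. by move=> H; apply: differentiable_continuous; apply/derivable1_diffP; case: H. Qed.

Lemma mvt f df (a b : R) : a <= b -> (forall t : R, a <= t <= b -> is_der t f (df t)) ->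
 exists2 c : R, a <= c <= b & f b - f a = df c * (b - a).
Proof.
move=> ab D; have [||c cab ->] := @MVT_segment R f df a b ab.
- by move=> x; rewrite in_itv /= => /andP[/ltW ax /ltW xb]; apply: D; rewrite ax.
- apply: continuous_in_subspaceT => x; rewrite inE /= in_itv /= => xab.
 exact: is_derive_ct (D x xab).
- by exists c => //; move: cab; rewrite in_itv.
Qed.

Lemma mvt_le f df (a b K : R) : a <= b -> (forall t : R, a <= t <= b -> is_der t f (df t)) ->
 (forall t : R, a <= t <= b -> `|df t| <= K) -> `|f b - f a| <= K * (b - a).
Proof.
move=> ab D Kb; have [c cab ->] := mvt ab D.
by rewrite normrM (ger0_norm (_ : 0 <= b - a)) ?subr_ge0// ler_wpM2r ?subr_ge0// Kb.
Qed.

Lemma mvt0_le f df (t K : R) : 0 <= t -> (forall s : R, 0 <= s <= t -> is_der s f (df s)) ->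
 (forall s : R, 0 <= s <= t -> `|df s| <= K) -> `|f t - f 0| <= K * t.
Proof. by move=> t0 D Kb; have := mvt_le t0 D Kb; rewrite subr0. Qed.

Lemma mvt_nondecr f df (a b : R) : a <= b -> (forall t : R, a <= t <= b -> is_der t f (df t)) ->
 (forall t : R, a <= t <= b -> 0 <= df t) -> f a <= f b.
Proof.
move=> ab D K0; have [c cab E] := mvt ab D.
by rewrite -subr_ge0 E mulr_ge0 ?subr_ge0// K0.
Qed.

Lemma derD f1 f2 (d1 d2 t : R) : is_der t f1 d1 -> is_der t f2 d2 ->
 is_der t (fun s => f1 s + f2 s) (d1 + d2).
Proof. by move=> h1 h2; exact: is_deriveD. Qed.

Lemma derB f1 f2 (d1 d2 t : R) : is_der t f1 d1 -> is_der t f2 d2 ->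
 is_der t (fun s => f1 s - f2 s) (d1 - d2).
Proof. by move=> h1 h2; exact: is_deriveB. Qed.

Lemma derM f1 f2 (d1 d2 t : R) : is_der t f1 d1 -> is_der t f2 d2 ->
 is_der t (fun s => f1 s * f2 s) (d1 * f2 t + f1 t * d2).
Proof.
move=> h1 h2; have := @is_deriveM R R f1 f2 t 1 d1 d2 h1 h2.
by rewrite /GRing.scale /= addrC (mulrC d1).
Qed.

Lemma derC (a t : R) : is_der t (fun _ : R => a) 0.
Proof. exact: is_derive_cst. Qed.

Lemma derZ f (a d t : R) : is_der t f d -> is_der t (fun s => a * f s) (a * d).
Proof. by move=> h; have := derM (derC a t) h; rewrite mul0r add0r. Qed.

Lemma derI (t : R) : is_der t (fun s : R => s) 1.
Proof. exact: is_derive_id. Qed.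

Lemma der_sum (I : Type) (r : seq I) (f : I -> R -> R) (d : I -> R) (t : R) :
 (forall i, is_der t (f i) (d i)) ->
 is_der t (fun s => \sum_(i <- r) f i s) (\sum_(i <- r) d i).
Proof.
move=> H; elim: r => [|i r IH].
 rewrite big_nil (_ : (fun s => _) = fun=> 0); first exact: derC.
 by fext s; rewrite big_nil.
rewrite big_cons (_ : (fun s => _) = fun s => f i s + \sum_(j <- r) f j s); first exact: derD.
by fext s; rewrite big_cons.
Qed.

Lemma der_eq f (d d' t : R) : is_der t f d -> d = d' -> is_der t f d'.
Proof. by move=> h <-. Qed.

End RealLine.

Section BallBounds.
Context {R : realType} {n : nat}.
Local Notation rV := 'rV[R]_n.
Variables (U : set rV) (y0 : rV) (r : R).
Hypotheses (oU : open U) (rU : forall y, `|y - y0| <= r -> U y).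

Lemma ball_bound (F : rV -> R) : (forall y, U y -> {for y, continuous F}) ->
 exists2 C, 0 <= C & forall y, `|y - y0| <= r -> `|F y| <= C.
Proof.
move=> cF; have cB : compact [set y : rV | `|y - y0| <= r].
 apply: bounded_closed_compact; last exact: closed_cball.
 exists (`|y0| + r); split; first exact: num_real.
 move=> b bb y /= yr; apply: ltW; apply: le_lt_trans bb.
 by rewrite -[y](subrK y0) addrC (le_trans (ler_normD _ _))// lerD2l.
have : bounded_set (F @` [set y : rV | `|y - y0| <= r]).
 apply: compact_bounded; apply: continuous_compact cB; apply: continuous_in_subspaceT => y.
 by rewrite inE => yr; apply: cF; exact: rU.
move=> [B [Br BP]]; exists (Num.max B 0 + 1) => [|y yr]; first by rewrite addr_ge0// le_max lexx orbT.
by apply: (BP (Num.max B 0 + 1)); [rewrite ltr_pwDr// le_max lexx|exists y].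
Qed.

Lemma ball_bounds (I : finType) (F : I -> rV -> R) : (forall i y, U y -> {for y, continuous (F i)}) ->
 exists2 C, 0 <= C & forall i y, `|y - y0| <= r -> `|F i y| <= C.
Proof.
move=> cF; have [C CP] := choice (fun i => ex2_and (ball_bound (cF i))).
exists (\sum_i `|C i|) => [|i y yr]; first exact: sumr_ge0.
have [C0 CF] := CP i; rewrite (le_trans (CF y yr))// (bigD1 i)//= (ger0_norm C0) lerDl.
exact: sumr_ge0.
Qed.

Lemma segment_ball (y z : rV) (t : R) : `|y - y0| <= r -> `|z - y0| <= r -> 0 <= t <= 1 ->
 `|y + t *: (z - y) - y0| <= r.
Proof.
move=> yr zr /andP[t0 t1].
have -> : y + t *: (z - y) - y0 = (1 - t) *: (y - y0) + t *: (z - y0).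
 rewrite scalerBl scale1r !scalerBr; apply/rowP => k; rewrite !(mxaddE, mxoppE, mxscaleE); ring.
rewrite (le_trans (ler_normD _ _))// !normrZ (ger0_norm t0) (ger0_norm (_ : 0 <= 1 - t)) ?subr_ge0//.
have h1 : (1 - t) * `|y - y0| <= (1 - t) * r by rewrite ler_wpM2l// subr_ge0.
have h2 : t * `|z - y0| <= t * r by rewrite ler_wpM2l.
by apply: (le_trans (lerD h1 h2)); rewrite -mulrDl subrK mul1r.
Qed.

Lemma segment0 (y z : rV) : y + 0 *: (z - y) = y.
Proof. by rewrite scale0r addr0. Qed.

Lemma segment1 (y z : rV) : y + 1 *: (z - y) = z.
Proof. by rewrite scale1r addrC subrK. Qed.

Lemma is_derive_segment F (y z : rV) (t : R) : Ck_on 1 U F -> U (y + t *: (z - y)) ->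
 is_der t (fun s => F (y + s *: (z - y))) (\sum_k (z - y) 0 k * partial k F (y + t *: (z - y))).
Proof.
move=> CF Ut.
have D k : is_der t (fun s : R => (y + s *: (z - y)) 0 k) ((z - y) 0 k).
 rewrite (_ : (fun s : R => _) = (fun s => y 0 k + s * (z - y) 0 k)); last first.
  by fext s; rewrite mxaddE mxscaleE.
 by apply: der_eq (derD (derC _ t) (derM (derI t) (derC _ t))) _; rewrite mul1r mulr0 addr0 add0r.
have := @derive_curve R n U F (fun s => y + s *: (z - y)) t oU CF Ut (fun k => ex_derive (is_derive := D k)).
by congr (is_derive _ _ _ _); sumr k; have [_ ->] := D k.
Qed.

Lemma C1_lipschitz F : Ck_on 1 U F ->
 exists2 C, 0 <= C & forall y z, `|y - y0| <= r -> `|z - y0| <= r -> `|F z - F y| <= C * `|z - y|.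
Proof.
move=> CF; have [C C0 CP] := ball_bounds (fun i y Uy => Ck_cts (Ck_partial i CF) Uy).
exists (n%:R * C) => [|y z yr zr]; first exact: mulr_ge0.
have Us (t : R) : 0 <= t <= 1 -> U (y + t *: (z - y)) by move=> t01; apply: rU; exact: segment_ball.
have := @mvt_le R _ _ 0 1 (n%:R * C * `|z - y|) ler01 (fun t t01 => is_derive_segment CF (Us t t01)).
rewrite subr0 mulr1 segment0 segment1; apply => t t01.
rewrite (le_trans (ler_norm_sum _ _ _))//.
apply: (@le_trans _ _ (\sum_(k < n) `|z - y| * C)); last first.
 by rewrite sumr_const card_ord -mulr_natl le_eqVlt; apply/orP; left; apply/eqP; ring.
apply: ler_sum => k _; rewrite normrM; apply: ler_pM => //; first exact: coord_le.
by apply: CP; exact: segment_ball.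
Qed.

Lemma C2_taylor F : Ck_on 2 U F ->
 exists2 C, 0 <= C & forall y z, `|y - y0| <= r -> `|z - y0| <= r ->
  `|F z - F y - \sum_k (z - y) 0 k * partial k F y| <= C * `|z - y| ^+ 2.
Proof.
move=> CF; have CF1 := Ck_onW CF.
have [C CP] := choice (fun i => ex2_and (C1_lipschitz (Ck_partial i CF))).
exists (\sum_i C i) => [|y z yr zr]; first by apply: sumr_ge0 => i _; have [] := CP i.
have Us (t : R) : 0 <= t <= 1 -> U (y + t *: (z - y)) by move=> t01; apply: rU; exact: segment_ball.
pose D0 := \sum_k (z - y) 0 k * partial k F y.
have D (t : R) : 0 <= t <= 1 -> is_der t (fun s => F (y + s *: (z - y)) - s * D0)
  (\sum_k (z - y) 0 k * partial k F (y + t *: (z - y)) - D0).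
 move=> t01; apply: der_eq (derB (is_derive_segment CF1 (Us t t01)) (derM (derI t) (derC D0 t))) _.
 by rewrite mul1r mulr0 addr0.
have := @mvt_le R _ _ 0 1 ((\sum_i C i) * `|z - y| ^+ 2) ler01 D.
rewrite subr0 mulr1 segment0 segment1 mul0r subr0 mul1r addrAC; apply => t t01.
rewrite /D0 -sumrB (le_trans (ler_norm_sum _ _ _))// mulr_suml; apply: ler_sum => k _.
rewrite -mulrBr normrM expr2 mulrCA; apply: ler_pM => //; first exact: coord_le.
have [C0 CL] := CP k; apply: le_trans (CL _ _ yr (segment_ball yr zr t01)) _.
rewrite addrC addKr normrZ ler_wpM2l//; have /andP[t0 t1] := t01.
by rewrite ger0_norm// ler_piMl.
Qed.

End BallBounds.

(** * Momentum and energy of geodesics *)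

Section GeodesicEquation.
Context {R : realType} {n : nat}.
Implicit Types (c : R -> 'rV[R]_n) (t : R).

Definition vel c t : 'rV[R]_n := \row_k derive1 (fun s => c s 0 k) t.

Definition curve_at c t := forall k, is_der t (fun s => c s 0 k) (vel c t 0 k).

Variable g : 'rV[R]_n -> 'M[R]_n.

Definition gam_form (y v : 'rV[R]_n) : 'rV[R]_n :=
 \row_k \sum_a \sum_b christoffel g k a b y * v 0 a * v 0 b.

Definition geo_at c t := curve_at c t /\
 forall k, is_der t (fun s => vel c s 0 k) (- gam_form (c t) (vel c t) 0 k).

(** The derivative in direction [l] of [qf (g y) v] for fixed [v]; together with [momentum] it gives
    the Euler-Lagrange form of the geodesic equation. *)
Definition dgq (l : 'I_n) (y v : 'rV[R]_n) : R := \sum_a \sum_b v 0 a * v 0 b * partial l (gcomp g a b) y.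

Definition momentum c (l : 'I_n) t : R := \sum_i g (c t) i l * vel c t 0 i.

Variables (U : set 'rV[R]_n).
Hypothesis lm : local_metric U g.

Lemma derive_gcomp_curve c t i j : curve_at c t -> U (c t) ->
 is_der t (fun s => g (c s) i j) (\sum_k vel c t 0 k * partial k (gcomp g i j) (c t)).
Proof.
move=> cc Ut; have dk k : derivable (fun s => c s 0 k) t 1 by case: (cc k).
have := @derive_curve R n U (gcomp g i j) c t (lm_open lm) (smooth_gcomp lm i j 1) Ut dk.
by congr (is_derive _ _ _ _); sumr k; rewrite mxE derive1E.
Qed.

Lemma christoffel_lower y v l : U y -> \sum_i g y i l * gam_form y v 0 i =
 \sum_a \sum_b v 0 a * v 0 b * partial a (gcomp g b l) y - 2^-1 * dgq l y v.
Proof.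
move=> Uy; transitivity (\sum_a \sum_b v 0 a * v 0 b * (conn g a y *m g y) b l).
 under eq_bigr do rewrite mxE mulr_sumr.
 sumx a.
 under eq_bigr do rewrite mulr_sumr.
 sumx b.
 rewrite mxmulE mulr_sumr; sumr i; rewrite connE; ring.
have -> : \sum_a \sum_b v 0 a * v 0 b * (conn g a y *m g y) b l =
 2^-1 * (\sum_a \sum_b v 0 a * v 0 b * partial a (gcomp g b l) y
 + \sum_a \sum_b v 0 a * v 0 b * partial b (gcomp g a l) y - dgq l y v).
 rewrite -big_split -sumrB mulr_sumr; sumr a.
 rewrite -big_split -sumrB mulr_sumr; sumr b => /=.
 rewrite (conn_lower lm a b l Uy); ring.
have -> : \sum_a \sum_b v 0 a * v 0 b * partial b (gcomp g a l) y = \sum_a \sum_b v 0 a * v 0 b * partial a (gcomp g b l) y.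
 by sumx a; sumr b; rewrite (mulrC (v 0 b)).
by field.
Qed.

(** After lowering the index, the terms with $\Gamma$ combine with the derivative of the metric
    along the curve and leave half of [dgq]. *)
Lemma derive_momentum c t l : geo_at c t -> U (c t) ->
 is_der t (momentum c l) (2^-1 * dgq l (c t) (vel c t)).
Proof.
move=> [cc gc] Ut.
have D i := derM (derive_gcomp_curve i l cc Ut) (gc i).
apply: der_eq (der_sum (index_enum 'I_n) D) _.
rewrite big_split /=.
have -> : \sum_i g (c t) i l * - gam_form (c t) (vel c t) 0 i = - \sum_i g (c t) i l * gam_form (c t) (vel c t) 0 i.
 by rewrite -sumrN; sumr i; rewrite mulrN.
rewrite (christoffel_lower _ _ Ut).
have -> : \sum_i (\sum_k vel c t 0 k * partial k (gcomp g i l) (c t)) * vel c t 0 i =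
 \sum_a \sum_b vel c t 0 a * vel c t 0 b * partial a (gcomp g b l) (c t).
 rewrite [RHS]exchange_big; sumr b; rewrite mulr_suml; sumr a => /=; ring.
by rewrite opprB addrC subrK.
Qed.

Lemma qf_momentum c t : qf (g (c t)) (vel c t) = \sum_l momentum c l t * vel c t 0 l.
Proof.
rewrite /qf bfE exchange_big; sumr l; rewrite mulr_suml; sumr i => /=; ring.
Qed.

Lemma derive_energy c t : geo_at c t -> U (c t) ->
 is_der t (fun s => qf (g (c s)) (vel c s)) 0.
Proof.
move=> gct Ut; have [cc gc] := gct.
have -> : (fun s => qf (g (c s)) (vel c s)) = (fun s => \sum_l momentum c l s * vel c s 0 l).
 by fext s; rewrite qf_momentum.
have D l := derM (derive_momentum l gct Ut) (gc l).
apply: der_eq (der_sum (index_enum 'I_n) D) _.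
rewrite big_split /=.
have -> : \sum_l momentum c l t * - gam_form (c t) (vel c t) 0 l =
 - \sum_l vel c t 0 l * \sum_i g (c t) i l * gam_form (c t) (vel c t) 0 i.
 rewrite -sumrN.
 under eq_bigr do rewrite mulrN /momentum mulr_suml -sumrN.
 under [RHS]eq_bigr do rewrite mulr_sumr -sumrN.
 sumx i; sumr l => /=.
 have := congr1 (fun A : 'M[R]_n => A i l) (lm_sym lm Ut); rewrite mxtrE => ->; ring.
have -> : \sum_l vel c t 0 l * \sum_i g (c t) i l * gam_form (c t) (vel c t) 0 i =
  \sum_l 2^-1 * dgq l (c t) (vel c t) * vel c t 0 l; last by rewrite subrr.
under eq_bigr do rewrite (christoffel_lower _ _ Ut) mulrBr.
rewrite sumrB.
have -> : \sum_l vel c t 0 l * (\sum_a \sum_b vel c t 0 a * vel c t 0 b * partial a (gcomp g b l) (c t)) =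
 \sum_l vel c t 0 l * dgq l (c t) (vel c t).
 rewrite /dgq; under eq_bigr do rewrite mulr_sumr.
 sumx a; under eq_bigr do rewrite mulr_sumr.
 rewrite exchange_big mulr_sumr; sumr b => /=; rewrite mulr_sumr; sumr l; ring.
by rewrite -sumrB; sumr l; field.
Qed.

End GeodesicEquation.

(** * Comparison of arcs in a controlled ball *)

Section BallControl.
Context {R : realType} {n : nat}.
Local Notation rV := 'rV[R]_n.
Variable g : rV -> 'M[R]_n.
Implicit Types (c : R -> rV) (y z v w : rV).

Definition ball_ctl y0 (r C : R) := forall y z, `|y - y0| <= r -> `|z - y0| <= r ->
 [/\ forall k a b, `|christoffel g k a b y| <= C,
   forall k a b, `|christoffel g k a b z - christoffel g k a b y| <= C * `|z - y|,
   forall i j, `|g z i j - g y i j| <= C * `|z - y| &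
   forall i j, `|g z i j - g y i j - \sum_l (z - y) 0 l * partial l (gcomp g i j) y| <= C * `|z - y| ^+ 2].

Lemma unif_bound (I : finType) (P : I -> R -> Prop) :
 (forall i (C C' : R), C <= C' -> P i C -> P i C') -> (forall i, exists2 C, 0 <= C & P i C) ->
 exists2 C, 0 <= C & forall i, P i C.
Proof.
move=> mon ex; have [C CP] := choice (fun i => ex2_and (ex i)).
exists (\sum_i C i) => [|i]; first by apply: sumr_ge0 => i _; have [] := CP i.
have [C0 PC] := CP i; apply: mon PC; rewrite (bigD1 i)//= lerDl.
by apply: sumr_ge0 => j _; have [] := CP j.
Qed.

Lemma ball_ctl_exists (U : set rV) y0 (r : R) : local_metric U g -> (forall y, `|y - y0| <= r -> U y) ->
 exists2 C, 0 <= C & ball_ctl y0 r C.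
Proof.
move=> lm rU; have oU := lm_open lm.
pose I := ('I_n * 'I_n * 'I_n)%type.
have cC (i : I) : smooth_on U (christoffel g i.1.1 i.1.2 i.2).
 apply: smooth_eq oU _ (smooth_conn lm i.1.2 i.2 i.1.1) => y Uy; exact: connE.
have [C1 C10 P1] := ball_bounds rU (fun (i : I) y Uy => Ck_cts (cC i 0) Uy).
have [|i|C2 C20 P2] := @unif_bound I (fun i C => forall y z, `|y - y0| <= r -> `|z - y0| <= r ->
  `|christoffel g i.1.1 i.1.2 i.2 z - christoffel g i.1.1 i.1.2 i.2 y| <= C * `|z - y|).
- by move=> i C C' CC' H y z yr zr; rewrite (le_trans (H y z yr zr))// ler_wpM2r.
- exact: (C1_lipschitz oU rU (cC i 1)).
have [|i|C3 C30 P3] := @unif_bound ('I_n * 'I_n)%type (fun i C => forall y z, `|y - y0| <= r -> `|z - y0| <= r ->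
  `|gcomp g i.1 i.2 z - gcomp g i.1 i.2 y| <= C * `|z - y|).
- by move=> i C C' CC' H y z yr zr; rewrite (le_trans (H y z yr zr))// ler_wpM2r.
- exact: (C1_lipschitz oU rU (smooth_gcomp lm i.1 i.2 1)).
have [|i|C4 C40 P4] := @unif_bound ('I_n * 'I_n)%type (fun i C => forall y z, `|y - y0| <= r -> `|z - y0| <= r ->
  `|gcomp g i.1 i.2 z - gcomp g i.1 i.2 y - \sum_l (z - y) 0 l * partial l (gcomp g i.1 i.2) y| <= C * `|z - y| ^+ 2).
- by move=> i C C' CC' H y z yr zr; rewrite (le_trans (H y z yr zr))// ler_wpM2r// exprn_ge0.
- exact: (C2_taylor oU rU (smooth_gcomp lm i.1 i.2 2)).
exists (C1 + C2 + C3 + C4) => [|y z yr zr]; first by rewrite !addr_ge0.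
have d0 : 0 <= `|z - y| by [].
split=> [k a b|k a b|i j|i j].
- by rewrite (le_trans (P1 (k, a, b) y yr))//; lra.
- by rewrite (le_trans (P2 (k, a, b) y z yr zr))// ler_wpM2r//; lra.
- by rewrite (le_trans (P3 (i, j) y z yr zr))// ler_wpM2r//; lra.
- by rewrite (le_trans (P4 (i, j) y z yr zr))// ler_wpM2r ?exprn_ge0//; lra.
Qed.

Lemma sum2_le (X : 'I_n -> 'I_n -> R) (K : R) : (forall a b, `|X a b| <= K) -> `|\sum_a \sum_b X a b| <= (n ^ 2)%:R * K.
Proof.
move=> XK; rewrite (le_trans (ler_norm_sum _ _ _))//.
apply: (@le_trans _ _ (\sum_(a < n) \sum_(b < n) K)).
 by apply: ler_sum => a _; rewrite (le_trans (ler_norm_sum _ _ _))// ler_sum.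
by rewrite !sumr_const card_ord -mulrnA mulr_natl mulnn.
Qed.

Variables (y0 : rV) (r C : R).
Hypotheses (C0 : 0 <= C) (ctl : ball_ctl y0 r C).
Let n2 : R := (n ^ 2)%:R.

Lemma gam_form_lip y z v w : `|y - y0| <= r -> `|z - y0| <= r ->
 `|gam_form g z w - gam_form g y v| <= n2 * (C * (`|z - y| * `|w| ^+ 2 + `|w - v| * (`|w| + `|v|))).
Proof.
move=> yr zr; have [B L _ _] := ctl yr zr; have n20 : 0 <= n2 by exact: ler0n.
apply: row_normP => [|i k]; first by rewrite !mulr_ge0// addr_ge0// mulr_ge0// addr_ge0.
rewrite ord1 mxsubE !mxE -sumrB; under eq_bigr do rewrite -sumrB.
apply: sum2_le => a b.
set Gz := christoffel g k a b z; set Gy := christoffel g k a b y.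
have -> : Gz * w 0 a * w 0 b - Gy * v 0 a * v 0 b = (Gz - Gy) * (w 0 a * w 0 b) + Gy * (w 0 a * (w - v) 0 b + (w - v) 0 a * v 0 b).
 rewrite !mxsubE; ring.
have nc (u : rV) j : `|u 0 j| <= `|u| by exact: coord_le.
have h1 : `|(Gz - Gy) * (w 0 a * w 0 b)| <= C * `|z - y| * (`|w| * `|w|).
 by rewrite !normrM; apply: ler_pM => //; [exact: L|apply: ler_pM].
have h2 : `|Gy * (w 0 a * (w - v) 0 b + (w - v) 0 a * v 0 b)| <= C * (`|w| * `|w - v| + `|w - v| * `|v|).
 rewrite normrM; apply: ler_pM => //; first exact: B.
 by rewrite (le_trans (ler_normD _ _))// !normrM lerD// ler_pM.
rewrite (le_trans (ler_normD _ _))// (le_trans (lerD h1 h2))// le_eqVlt; apply/orP; left; apply/eqP; ring.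
Qed.

Variable e : R.
Hypothesis e0 : 0 <= e.

Definition good_arc c := forall t, 0 <= t <= 1 -> [/\ geo_at g c t, `|c t - y0| <= r & `|vel c t| <= e].

(** A Gronwall argument in closed form: the supremum [N] of the velocity difference enters the bound
    on the difference of accelerations with the factor [eta], and small [eta] lets it be absorbed.
    Positions are then affine in the difference of the initial data, up to a small relative
    error. *)
Lemma geo_diff c1 c2 (eta : R) : good_arc c1 -> good_arc c2 -> n2 * C * (e ^+ 2 + 2 * e) <= eta -> eta <= 1 / 4 ->
 let d := `|c1 0 - c2 0| + `|vel c1 0 - vel c2 0| in
 forall t, 0 <= t <= 1 ->
  `|vel c1 t - vel c2 t| <= 2 * d /\
  `|c1 t - c2 t - (c1 0 - c2 0) - t *: (vel c1 0 - vel c2 0)| <= 5 * eta * t * d.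
Proof.
move=> G1 G2 etaP eta4 d.
have n20 : 0 <= n2 by exact: ler0n.
have eta0 : 0 <= eta by apply: le_trans etaP; rewrite !mulr_ge0// addr_ge0 ?exprn_ge0// mulr_ge0.
pose u t := vel c1 t - vel c2 t.
(* The supremum of this set is finite because both velocities are bounded by [e]. *)
pose S := [set x | exists2 t, 0 <= t <= 1 & x = `|u t|].
have u2e t : 0 <= t <= 1 -> `|u t| <= 2 * e.
 by move=> t01; have [_ _ a1] := G1 t t01; have [_ _ a2] := G2 t t01; rewrite (le_trans (ler_normB _ _))// mulr_natl mulr2n lerD.
have hS : has_sup S.
 split; first by exists `|u 0|, 0; rewrite // lexx ler01.
 by exists (2 * e) => x [t /u2e tu ->].
set N := sup S.
have uN t : 0 <= t <= 1 -> `|u t| <= N by move=> t01; apply: ub_le_sup; [case: hS|exists t].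
have N0 : 0 <= N by apply: le_trans (uN 0 _); rewrite ?lexx ?ler01.
have dN t : 0 <= t <= 1 -> `|c1 t - c2 t| <= `|c1 0 - c2 0| + N.
 move=> t01; have /andP[t0 t1] := t01.
 have -> : c1 t - c2 t = (c1 0 - c2 0) + ((c1 t - c2 t) - (c1 0 - c2 0)) by rewrite [RHS]addrC subrK.
 rewrite (le_trans (ler_normD _ _))// lerD2l.
 apply: (@le_trans _ _ (N * t)); last by rewrite ler_piMr.
 apply: row_normP => [|i k]; first exact: mulr_ge0.
 rewrite ord1 !mxsubE.
 apply: (@mvt0_le R (fun s => c1 s 0 k - c2 s 0 k) (fun s => u s 0 k) t N) => // s /andP[s0 st].
  have s01 : 0 <= s <= 1 by rewrite s0 (le_trans st).
  have [[h1 _] _ _] := G1 s s01; have [[h2 _] _ _] := G2 s s01.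
  by apply: der_eq (derB (h1 k) (h2 k)) _; rewrite mxsubE.
 by apply: le_trans (uN s _); [exact: coord_le|rewrite s0 (le_trans st)].
have acc t : 0 <= t <= 1 -> `|u t - u 0| <= eta * (`|c1 0 - c2 0| + 2 * N) * t.
 move=> t01; have /andP[t0 t1] := t01.
 apply: row_normP => [|i k]; first by rewrite !mulr_ge0// addr_ge0// mulr_ge0.
 rewrite ord1 mxsubE.
 apply: (@mvt0_le R (fun s => u s 0 k) (fun s => - (gam_form g (c1 s) (vel c1 s) - gam_form g (c2 s) (vel c2 s)) 0 k) t) => // s /andP[s0 st].
  have s01 : 0 <= s <= 1 by rewrite s0 (le_trans st).
  have [[_ h1] _ _] := G1 s s01; have [[_ h2] _ _] := G2 s s01.
  rewrite (_ : (fun s => u s 0 k) = (fun s => vel c1 s 0 k - vel c2 s 0 k)); last first.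
   by apply/funext => s'; rewrite mxsubE.
  by apply: der_eq (derB (h1 k) (h2 k)) _; rewrite mxsubE; ring.
 have s01 : 0 <= s <= 1 by rewrite s0 (le_trans st).
 have [_ b1 v1] := G1 s s01; have [_ b2 v2] := G2 s s01.
 rewrite normrN (le_trans (coord_le _ _ _))// (le_trans (gam_form_lip _ _ b2 b1))//.
 have dd := dN s s01; have un := uN s s01.
 apply: (@le_trans _ _ (n2 * (C * ((`|c1 0 - c2 0| + N) * e ^+ 2 + N * (e + e))))).
  rewrite ler_wpM2l// ler_wpM2l// lerD//; last by apply: ler_pM => //; rewrite ?addr_ge0// lerD.
  by apply: ler_pM => //; rewrite ?exprn_ge0// lerXn2r ?nnegrE.
 set D := `|c1 0 - c2 0| in dd *; have D0 : 0 <= D by exact: normr_ge0.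
 apply: (@le_trans _ _ (n2 * C * (e ^+ 2 + 2 * e) * (D + 2 * N))); last by rewrite ler_wpM2r// addr_ge0// mulr_ge0.
 rewrite (mulrA n2 C) -[leRHS]mulrA ler_wpM2l ?mulr_ge0//.
 have e20 : 0 <= e ^+ 2 by rewrite exprn_ge0.
 by have := mulr_ge0 e0 D0; have := mulr_ge0 e20 N0; have := mulr_ge0 e0 N0; nra.
have Nle : N <= `|u 0| + eta * (`|c1 0 - c2 0| + 2 * N).
 apply: ge_sup; first by case: hS.
 move=> x [t t01 ->]; have -> : u t = u 0 + (u t - u 0) by rewrite [RHS]addrC subrK.
 rewrite (le_trans (ler_normD _ _))// lerD2l (le_trans (acc t t01))//.
 have /andP[t0 t1] := t01.
 by rewrite ler_piMr// mulr_ge0// addr_ge0// mulr_ge0.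
have N2 : N <= 2 * d.
 rewrite /d -/(u 0); move: Nle (normr_ge0 (c1 0 - c2 0)) (normr_ge0 (u 0)) N0 eta0 eta4.
 set x := `|c1 0 - _|; set y := `|u 0|; nra.
have acc2 t : 0 <= t <= 1 -> `|u t - u 0| <= 5 * eta * d.
 move=> t01; rewrite (le_trans (acc t t01))//; have /andP[t0 t1] := t01.
 apply: (@le_trans _ _ (eta * (`|c1 0 - c2 0| + 2 * N))).
  by rewrite ler_piMr// mulr_ge0// addr_ge0// mulr_ge0.
 have h : `|c1 0 - c2 0| <= d by rewrite /d lerDl.
 have : `|c1 0 - c2 0| + 2 * N <= 5 * d by lra.
 by rewrite mulrAC [5 * d * eta]mulrC => ?; rewrite ler_wpM2l.
move=> t t01; have /andP[t0 t1] := t01; split; first by rewrite (le_trans (uN t t01)).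
apply: row_normP => [|i k]; first by rewrite !mulr_ge0// /d addr_ge0.
rewrite ord1; have -> : (c1 t - c2 t - (c1 0 - c2 0) - t *: (vel c1 0 - vel c2 0)) 0 k =
  (c1 t 0 k - c2 t 0 k - t * u 0 0 k) - (c1 0 0 k - c2 0 0 k - 0 * u 0 0 k).
 rewrite /u !mxsubE mxscaleE !mxsubE; ring.
rewrite mulrAC.
apply: (@mvt0_le R (fun s => c1 s 0 k - c2 s 0 k - s * u 0 0 k) (fun s => (u s - u 0) 0 k) t) => // s /andP[s0 st].
 have s01 : 0 <= s <= 1 by rewrite s0 (le_trans st).
 have [[h1 _] _ _] := G1 s s01; have [[h2 _] _ _] := G2 s s01.
 apply: der_eq (derB (derB (h1 k) (h2 k)) (derM (derI s) (derC (u 0 0 k) s))) _.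
 rewrite /u !mxsubE; ring.
by apply: le_trans (acc2 s _); [exact: coord_le|rewrite s0 (le_trans st)].
Qed.

Definition sqn (v : rV) : R := \sum_k v 0 k ^+ 2.

Lemma sqn_ge0 v : 0 <= sqn v.
Proof. by apply: sumr_ge0 => k _; exact: sqr_ge0. Qed.

Lemma normr_sqn v : `|v| ^+ 2 <= sqn v.
Proof.
rewrite -[leRHS]sqr_sqrtr ?sqn_ge0// lerXn2r ?nnegrE ?sqrtr_ge0//.
apply: row_normP => [|i k]; first exact: sqrtr_ge0.
by rewrite ord1 -(sqrtr_sqr (v 0 k)) ler_wsqrtr// sqr_le_sum.
Qed.

Lemma sqn_eq0 v : sqn v <= 0 -> v = 0.
Proof.
move=> v0; apply/rowP => k; rewrite mxE; apply/eqP; rewrite -sqrf_eq0 eq_le sqr_ge0 andbT.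
exact: le_trans (sqr_le_sum v k) v0.
Qed.

Variable U : set 'rV[R]_n.
Hypotheses (lm : local_metric U g) (rU : forall y, `|y - y0| <= r -> U y).
Variable c0 : R.
Hypothesis c0P : forall y v, `|y - y0| <= r -> c0 * sqn v <= qf (g y) v.
Let mu : R := n2 * C * (e ^+ 2 + e).

(** Taylor expansion of the energy density at [y], [v] with its first-order terms subtracted.
    Positivity of the metric controls the square of [h]; the variation of the metric in the ball
    costs only [mu], which is small together with [e]. *)
Lemma energy_expand y z v h : `|y - y0| <= r -> `|z - y0| <= r -> `|v| <= e ->
 c0 * sqn h - mu * (sqn (z - y) + sqn h) <=
 qf (g z) (v + h) - qf (g y) v - \sum_l (z - y) 0 l * dgq g l y v - 2 * \sum_l (\sum_i g y i l * v 0 i) * h 0 l.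
Proof.
move=> yr zr ve; have [_ _ Lg Tg] := ctl yr zr; have n20 : 0 <= n2 by exact: ler0n.
have sz := lm_sym lm (rU zr).
pose S1 := \sum_i \sum_j v 0 i * v 0 j * (g z i j - g y i j - \sum_l (z - y) 0 l * partial l (gcomp g i j) y).
pose S2 := \sum_i \sum_j (g z i j - g y i j) * (v 0 i * h 0 j).
have E : qf (g z) (v + h) - qf (g y) v - \sum_l (z - y) 0 l * dgq g l y v - 2 * \sum_l (\sum_i g y i l * v 0 i) * h 0 l =
 qf (g z) h + S1 + 2 * S2.
 have -> : qf (g z) (v + h) = qf (g z) v + 2 * (\sum_i \sum_j g z i j * (v 0 i * h 0 j)) + qf (g z) h.
  rewrite /qf !bfE.
  have -> : 2 * (\sum_i \sum_j g z i j * (v 0 i * h 0 j)) =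
   \sum_i \sum_j (v 0 i * g z i j * h 0 j + h 0 i * g z i j * v 0 j).
   under [RHS]eq_bigr do rewrite big_split.
   rewrite big_split /= [X in _ + X]exchange_big /= mulr_natl mulr2n; congr (_ + _).
    by sumr i j; ring.
   sumr i j.
   by have := congr1 (fun A : 'M[R]_n => A i j) sz; rewrite mxtrE => ->; ring.
  rewrite -big_split -big_split; sumr i => /=; rewrite -big_split -big_split; sumr j => /=.
  rewrite !mxaddE; ring.
 have -> : \sum_l (z - y) 0 l * dgq g l y v = \sum_i \sum_j v 0 i * v 0 j * (\sum_l (z - y) 0 l * partial l (gcomp g i j) y).
  under eq_bigr do rewrite /dgq mulr_sumr; sumx i.
  under eq_bigr do rewrite mulr_sumr; sumx j.
  by rewrite mulr_sumr; sumr l => /=; ring.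
 have -> : \sum_l (\sum_i g y i l * v 0 i) * h 0 l = \sum_i \sum_j g y i j * (v 0 i * h 0 j).
  by sumx l; rewrite mulr_suml; sumr i => /=; ring.
 have -> : S1 = qf (g z) v - qf (g y) v - \sum_i \sum_j v 0 i * v 0 j * (\sum_l (z - y) 0 l * partial l (gcomp g i j) y).
  rewrite /qf !bfE -!sumrB; sumr i; rewrite -!sumrB; sumr j; ring.
 have -> : S2 = \sum_i \sum_j g z i j * (v 0 i * h 0 j) - \sum_i \sum_j g y i j * (v 0 i * h 0 j).
  rewrite /S2 -!sumrB; sumr i; rewrite -!sumrB; sumr j; ring.
 ring.
have nc (u : rV) j : `|u 0 j| <= `|u| by exact: coord_le.
have b1 : `|S1| <= n2 * (e ^+ 2 * (C * sqn (z - y))).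
 apply: sum2_le => i j; rewrite normrM; apply: ler_pM => //.
  by rewrite normrM expr2; apply: ler_pM => //; apply: le_trans ve.
 by rewrite (le_trans (Tg i j))// ler_wpM2l// normr_sqn.
have b2 : `|S2| <= n2 * (C * `|z - y| * (e * `|h|)).
 apply: sum2_le => i j; rewrite normrM; apply: ler_pM => //.
 by rewrite normrM; apply: ler_pM => //; apply: le_trans ve.
have b3 : 2 * (`|z - y| * `|h|) <= sqn (z - y) + sqn h.
 have := normr_sqn (z - y); have := normr_sqn h; have : 0 <= (`|z - y| - `|h|) ^+ 2 by exact: sqr_ge0.
 nra.
rewrite E; have := c0P h zr; move: b1 b2; rewrite !ler_norml => /andP[b1 _] /andP[b2 _] b4.
have b5 : n2 * (C * e) * (2 * (`|z - y| * `|h|)) <= n2 * (C * e) * (sqn (z - y) + sqn h).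
 by rewrite ler_wpM2l// !mulr_ge0.
have b6 : 0 <= n2 * (e ^+ 2 * (C * sqn h)) by rewrite !mulr_ge0 ?exprn_ge0 ?sqn_ge0.
rewrite /mu; move: b1 b2 b4 b5 b6; set Q := qf _ _; set A1 := `|z - y|; set A2 := `|h|.
set N1 := sqn (z - y); set N2 := sqn h; move: (n2) (C) (e ^+ 2) => nn CC ee; nra.
Qed.

Let kap : R := c0 - mu.

(* [b] is the constant part of the weight; it jumps from -1/8 to 1/8 at the
 vertex of the broken curve, which is what makes the inequality of
 [broken_energy] strict. *)
Definition phi_fun c sg (l2 L2 b t : R) : R :=
 (l2 - L2) * t - 2 * \sum_l momentum g c l t * (sg t - c t) 0 l + kap * ((t / 4 + b) * sqn (sg t - c t)).

(** Subtracting the first variation leaves a derivative that is bounded below by a quadratic form in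
    the deviation from the geodesic and its velocity; the weight [t / 4 + b] completes the
    square. *)
Lemma phi_mono c sg (l2 b t1 t2 : R) : good_arc c -> mu <= kap * (7 / 64) -> 0 <= kap ->
 0 <= t1 -> t1 <= t2 -> t2 <= 1 ->
 (forall t, t1 <= t <= t2 -> [/\ curve_at sg t, `|sg t - y0| <= r, qf (g (sg t)) (vel sg t) = l2 & `|t / 4 + b| <= 3 / 8]) ->
 phi_fun c sg l2 (qf (g (c 0)) (vel c 0)) b t1 <= phi_fun c sg l2 (qf (g (c 0)) (vel c 0)) b t2.
Proof.
move=> Gc muk k0 t10 t12 t21 H; set L2 := qf _ _.
have In t : t1 <= t <= t2 -> 0 <= t <= 1 by move=> /andP[a1 a2]; rewrite (le_trans t10 a1) (le_trans a2 t21).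
have EL t : 0 <= t <= 1 -> qf (g (c t)) (vel c t) = L2.
 move=> /andP[t0 t1']; have [s _ ] := @mvt R (fun s => qf (g (c s)) (vel c s)) (fun=> 0) 0 t t0 (fun s st =>
  derive_energy lm (let: And3 a _ _ := Gc s (introT andP (conj (proj1 (andP st)) (le_trans (proj2 (andP st)) t1'))) in a)
   (rU (let: And3 _ a _ := Gc s (introT andP (conj (proj1 (andP st)) (le_trans (proj2 (andP st)) t1'))) in a))).
 by rewrite mul0r => /eqP; rewrite subr_eq0 => /eqP.
pose h t := vel sg t - vel c t.
pose dphi t := (l2 - L2) - 2 * \sum_l (2^-1 * dgq g l (c t) (vel c t) * (sg t - c t) 0 l + momentum g c l t * h t 0 l)
 + kap * (4^-1 * sqn (sg t - c t) + (t / 4 + b) * (2 * \sum_k (sg t - c t) 0 k * h t 0 k)).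
apply: (@mvt_nondecr R (phi_fun c sg l2 L2 b) dphi t1 t2 t12) => t tt.
 have [Gt ct _] := Gc t (In t tt); have [sgt st _ _] := H t tt; have [cct _] := Gt.
 have De k : is_der t (fun s => (sg s - c s) 0 k) (h t 0 k).
  rewrite (_ : (fun s => _) = (fun s => sg s 0 k - c s 0 k)); last by fext s; rewrite mxsubE.
  by apply: der_eq (derB (sgt k) (cct k)) _; rewrite mxsubE.
 have Dl := derZ (l2 - L2) (derI t).
 have Dp := derZ 2 (der_sum (index_enum 'I_n) (fun l => derM (derive_momentum lm l Gt (rU ct)) (De l))).
 have Dw : is_der t (fun s => s / 4 + b) 4^-1.
  by apply: der_eq (derD (derM (derI t) (derC 4^-1 t)) (derC b t)) _; rewrite mul1r mulr0 !addr0.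
 have DN : is_der t (fun s => sqn (sg s - c s)) (2 * \sum_k (sg t - c t) 0 k * h t 0 k).
  have D2 k := derM (De k) (De k).
  rewrite (_ : (fun s => _) = (fun s => \sum_k (sg s - c s) 0 k * (sg s - c s) 0 k)); last first.
   by fext s; sumr k; rewrite expr2.
  apply: der_eq (der_sum (index_enum 'I_n) D2) _; rewrite mulr_sumr; sumr k; ring.
 by apply: der_eq (derD (derB Dl Dp) (derZ kap (derM Dw DN))) _; rewrite mulr1.
have [Gt ct vt] := Gc t (In t tt); have [sgt st el tb] := H t tt.
have := energy_expand (h t) ct st vt.
rewrite (EL t (In t tt)) /h [vel c t + _]addrC subrK -/(h t) el.
have -> : \sum_l (\sum_i g (c t) i l * vel c t 0 i) * h t 0 l = \sum_l momentum g c l t * h t 0 l by [].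
rewrite /dphi big_split /=.
have -> : \sum_l 2^-1 * dgq g l (c t) (vel c t) * (sg t - c t) 0 l = 2^-1 * \sum_l (sg t - c t) 0 l * dgq g l (c t) (vel c t).
 by rewrite mulr_sumr; sumr l; ring.
set W := t / 4 + b; set X := \sum_l _ * dgq _ _ _ _; set Y := \sum_l _ * _; set Z := \sum_k _ * _.
have sq : 0 <= sqn (h t) + W * (2 * Z) + W ^+ 2 * sqn (sg t - c t).
 have -> : sqn (h t) + W * (2 * Z) + W ^+ 2 * sqn (sg t - c t) = sqn (h t + W *: (sg t - c t)).
  rewrite /sqn /Z !mulr_sumr -!big_split; sumr k => /=; rewrite !(mxaddE, mxscaleE); ring.
 exact: sqn_ge0.
(* The derivative 1/4 of the weight minus $W^2 \le 9/64$ leaves the margin 7/64 that absorbs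
   [mu]. *)
have W2 : W ^+ 2 <= 9 / 64.
 have -> : (9 / 64 : R) = (3 / 8) ^+ 2 by field.
 by rewrite -(real_normK (num_real W)) lerXn2r ?nnegrE.
have N0 := sqn_ge0 (sg t - c t).
move: N0 sq W2; rewrite (_ : c0 = kap + mu); last by rewrite /kap subrK.
set N := sqn (sg t - c t); set H1 := sqn (h t); set LL := l2 - L2; move=> N0 sq W2 EX.
have m1 : 0 <= kap * (H1 + W * (2 * Z) + W ^+ 2 * N) by exact: mulr_ge0.
have m2 : kap * (W ^+ 2 * N) <= kap * (9 / 64 * N) by rewrite ler_wpM2l// ler_wpM2r.
have m3 : mu * N <= kap * (7 / 64) * N by rewrite ler_wpM2r.
lra.
Qed.

(** [phi_fun] is 0 at time 0, is the energy difference at time 1, does not decrease on either piece,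
    and jumps up at the vertex by [kap / 4] times the squared deviation. So a broken path has no
    less energy than the geodesic, and equality puts its vertex on the geodesic when [kap] is
    positive. *)
Lemma broken_energy c s1 s2 (l2 tau : R) : good_arc c -> mu <= kap * (7 / 64) -> 0 <= kap -> 0 <= tau <= 1 ->
 (forall t, 0 <= t <= tau -> [/\ curve_at s1 t, `|s1 t - y0| <= r & qf (g (s1 t)) (vel s1 t) = l2]) ->
 (forall t, tau <= t <= 1 -> [/\ curve_at s2 t, `|s2 t - y0| <= r & qf (g (s2 t)) (vel s2 t) = l2]) ->
 s1 0 = c 0 -> s1 tau = s2 tau -> s2 1 = c 1 ->
 kap / 4 * sqn (s1 tau - c tau) <= l2 - qf (g (c 0)) (vel c 0).
Proof.
move=> Gc muk k0 /andP[tau0 tau1] H1 H2 e1 e2 e3.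
have s00 : sqn 0 = 0 by rewrite /sqn big1// => k _; rewrite mxE expr0n.
have P1 := @phi_mono c s1 l2 (- (tau / 4) - 1 / 8) 0 tau Gc muk k0 (lexx 0) tau0 tau1.
have P2 := @phi_mono c s2 l2 (- (tau / 4) + 1 / 8) tau 1 Gc muk k0 tau0 tau1 (lexx 1).
have Q1 : forall t : R, 0 <= t <= tau -> `|t / 4 + (- (tau / 4) - 1 / 8)| <= 3 / 8.
 by move=> t /andP[a1 a2]; rewrite ler_norml; apply/andP; split; lra.
have Q2 : forall t : R, tau <= t <= 1 -> `|t / 4 + (- (tau / 4) + 1 / 8)| <= 3 / 8.
 by move=> t /andP[a1 a2]; rewrite ler_norml; apply/andP; split; lra.
move: (P1 (fun t tt => let: And3 a b d := H1 t tt in And4 a b d (Q1 t tt))) (P2 (fun t tt => let: And3 a b d := H2 t tt in And4 a b d (Q2 t tt))); rewrite /phi_fun e1 -e2 e3 !subrr s00.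
have z0 t : \sum_l momentum g c l t * (0 : rV) 0 l = 0 by rewrite big1// => l _; rewrite mxE mulr0.
rewrite !z0; set Y := \sum_l _ * _; set N := sqn _; set LL := l2 - _ => i1 i2; lra.
Qed.

End BallControl.

Lemma addr_decomp (V : zmodType) (y x w : V) : y = (y - x - w) + (x + w).
Proof. by rewrite -(addrA y) -opprD subrK. Qed.

Lemma subr_decomp (V : zmodType) (w y x : V) : w = (y - x) - (y - x - w).
Proof. by rewrite opprB addrC subrK. Qed.

Lemma qf_add_le (R : realType) n (G : 'M[R]_n) (u w : 'rV[R]_n) : posdef G -> qf G (u + w) <= 2 * qf G u + 2 * qf G w.
Proof.
move=> pG; have := qf_ge0 (u - w) pG; rewrite /qf !bfE => p0.
have : \sum_i \sum_j (u + w) 0 i * G i j * (u + w) 0 j + \sum_i \sum_j (u - w) 0 i * G i j * (u - w) 0 j =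
 2 * (\sum_i \sum_j u 0 i * G i j * u 0 j) + 2 * (\sum_i \sum_j w 0 i * G i j * w 0 j).
 rewrite !mulr_sumr -!big_split; sumr a; rewrite !mulr_sumr -!big_split; sumr b => /=.
 rewrite !(mxaddE, mxoppE); ring.
by move: p0; set P := \sum_i _; set Q := \sum_i _; set X := \sum_i _; set Y := \sum_i _; lra.
Qed.

(** * Geodesics on the manifold and good balls *)

Section Geodesics.
Context {R : realType} {n : nat} {M : ptopologicalType} {A : smooth_atlas R n M}.
Variable g : riemannian_metric A.
Hypothesis hausM : hausdorff_space M.
Implicit Types (gam : R -> M) (i j : chart_idx A) (t l : R).

Definition crd i gam : R -> 'rV[R]_n := fun s => chart i (gam s).

Lemma geod_at gam i t : geodesic g gam -> chart_dom i (gam t) -> geo_at (g i) (crd i gam) t.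
Proof.
move=> [_ G] dt; split=> k; have [d1 d2 E] := G i t dt k.
 by split=> //; rewrite mxE derive1E.
have -> : (fun s => vel (crd i gam) s 0 k) = derive1 (fun s => crd i gam s 0 k) by fext s; rewrite mxE.
split=> //; rewrite -derive1E E mxE; congr (- _); sumr a b.
by rewrite !mxE.
Qed.

Lemma near_dom gam i t : continuous gam -> chart_dom i (gam t) -> \forall s \near t, chart_dom i (gam s).
Proof.
move=> cg dt; have N : nbhs (gam t) (chart_dom i) by apply: open_nbhs_nbhs; split=> //; exact: chart_dom_open.
exact: (cg t _ N).
Qed.

Lemma crd_continuous gam i t : continuous gam -> chart_dom i (gam t) -> {for t, continuous (crd i gam)}.
Proof. by move=> cg dt; exact: (@continuous_comp R M 'rV[R]_n gam (chart i) t (cg t) (chart_continuous dt)). Qed.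

Lemma is_derive_near (f h : R -> R) (d t : R) : (\forall s \near t, f s = h s) ->
 is_der t f d -> is_der t h d.
Proof.
move=> fh [df vf]; split; first exact: (near_eq_derivable fh df).
by rewrite -(near_eq_derive (1 : R) fh).
Qed.

Lemma vel_change gam i j t : continuous gam -> chart_dom i (gam t) -> chart_dom j (gam t) -> curve_at (crd i gam) t ->
 vel (crd j gam) t = vel (crd i gam) t *m jac (trans i j) (crd i gam t).
Proof.
move=> cg di dj ci; apply/rowP => c; rewrite mxE derive1E.
have cc := chart_change g i j.
have Ot : overlap i j (crd i gam t) by exact: overlapP.
have D := @derive_curve R n _ (fun z => trans i j z 0 c) (crd i gam) t (cc_open cc) (cc_smooth cc c 1) Ot
 (fun k => let: DeriveDef a _ := ci k in a).
have N : \forall s \near t, trans i j (crd i gam s) 0 c = crd j gam s 0 c.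
 by have := near_dom cg di; apply: filterS => s ds; rewrite transitionE.
have [_ ->] := is_derive_near N D; rewrite mxmulE; sumr k.
by rewrite [jac _ _ _ _]mxE; congr (_ * _); rewrite mxE derive1E.
Qed.

Definition spd i gam t : R := qf (g i (crd i gam t)) (vel (crd i gam) t).

Lemma spd_change gam i j t : geodesic g gam -> chart_dom i (gam t) -> chart_dom j (gam t) -> spd i gam t = spd j gam t.
Proof.
move=> G di dj; have [cg _] := G; have [ci _] := geod_at G di.
have cc := chart_change g i j; have Ot : overlap i j (crd i gam t) by exact: overlapP.
rewrite /spd (vel_change cg di dj ci) (cc_metric cc Ot) /crd transitionE//.
by rewrite /qf /bf trmx_mul !mulmxA.
Qed.

Definition has_speed gam l := [/\ geodesic g gam, 0 <= l & forall i t, chart_dom i (gam t) -> spd i gam t = l ^+ 2].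

(** The energy has zero derivative in every chart and does not depend on the chart, so it is
    constant along the whole curve. *)
Lemma geodesic_speed gam i : geodesic g gam -> chart_dom i (gam 0) -> has_speed gam (Num.sqrt (spd i gam 0)).
Proof.
move=> G d0; have [cg _] := G.
pose E t := spd (chart_at A (gam t)) gam t.
have DE (t : R) : is_der t E 0.
 have dt := chart_atP A (gam t); set j := chart_at A (gam t) in dt.
 have Ut := imgP dt.
 apply: is_derive_near (derive_energy (metric_at g j) (geod_at G dt) Ut).
 have := near_dom cg dt; apply: filterS => s ds.
 exact: spd_change G ds (chart_atP A (gam s)).
have Ec t : E t = E 0.
 have [t0|t0] := leP 0 t.
  have [s _] := mvt t0 (fun s _ => DE s); rewrite mul0r => /eqP; rewrite subr_eq0 => /eqP; exact.
 have [s _] := mvt (ltW t0) (fun s _ => DE s); rewrite mul0r => /eqP; rewrite subr_eq0 => /eqP; exact.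
split=> // k t dt; rewrite sqr_sqrtr; last by apply: qf_ge0; apply: g_posdef; exact: imgP.
rewrite (spd_change G dt (chart_atP A (gam t))) -/(E t) Ec.
exact: spd_change G (chart_atP A (gam 0)) d0.
Qed.

Lemma affine_continuous (a b : R) : continuous (fun s : R => a * s + b).
Proof. by move=> s; apply: ctD; [apply: ctM; [exact: ct_cst|exact: cvg_id]|exact: ct_cst]. Qed.

Lemma affine_derive (f : R -> R) (a b t : R) : derivable f (a * t + b) 1 ->
 is_der t (fun s => f (a * s + b)) (a * derive1 f (a * t + b)).
Proof.
move=> df; have D0 : is_derive (a * t + b) (1 : R) f (derive1 f (a * t + b)) by split; rewrite ?derive1E.
have Da : is_der t (fun s : R => a * s + b) a.
 by apply: der_eq (derD (derZ a (derI t)) (derC b t)) _; rewrite mulr1 addr0.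
by have := @is_derive1_comp _ f (fun s : R => a * s + b) t _ _ D0 Da; rewrite mulrC.
Qed.

Lemma affine_derive2 (f : R -> R) (a b t : R) : (\forall s \near t, derivable f (a * s + b) 1) ->
 derivable (derive1 f) (a * t + b) 1 ->
 is_der t (derive1 (fun s => f (a * s + b))) (a * (a * derive1 (derive1 f) (a * t + b))).
Proof.
move=> nf d2; apply: is_derive_near (derZ a (affine_derive d2)).
by apply: filterS nf => s ds; rewrite [RHS]derive1E; have [_ ->] := affine_derive ds.
Qed.

Lemma geodesic_affine gam (a b : R) : geodesic g gam -> geodesic g (fun s => gam (a * s + b)).
Proof.
move=> [cg G].
have cg' : continuous (fun s => gam (a * s + b)).
 by move=> s; have := @continuous_comp R R M (fun s => a * s + b) gam s; apply; [exact: affine_continuous|exact: cg].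
split; first exact: cg'.
move=> i t dt c k; rewrite /c; pose c0 k := fun s => chart i (gam s) 0 k.
have df m s : chart_dom i (gam (a * s + b)) -> derivable (c0 m) (a * s + b) 1.
 by move=> ds; case: (G i _ ds m).
have [d1 d2 E] := G i _ dt k.
have D1 m : is_der t (fun s => chart i (gam (a * s + b)) 0 m) (a * derive1 (c0 m) (a * t + b)).
 exact: (affine_derive (df m t dt)).
have D2 : is_der t (derive1 (fun s => chart i (gam (a * s + b)) 0 k)) (a * (a * derive1 (derive1 (c0 k)) (a * t + b))).
 apply: (affine_derive2 (f := c0 k)); last exact: d2.
 by have := near_dom cg' dt; apply: filterS => s; exact: df.
have E1 m : derive1 (fun s => chart i (gam (a * s + b)) 0 m) t = a * derive1 (c0 m) (a * t + b).
 by rewrite derive1E; case: (D1 m).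
split; [by case: (D1 k)|by case: D2|].
rewrite derive1E; have [_ ->] := D2; rewrite E.
have pull (S : 'I_n -> 'I_n -> R) : a * (a * - \sum_p \sum_q S p q) = - \sum_p \sum_q a * (a * S p q).
 by rewrite !mulrN !mulr_sumr; congr (- _); sumr p; rewrite !mulr_sumr.
rewrite pull; congr (- _); sumr p q.
rewrite !E1; move: (derive1 (c0 p) _) (derive1 (c0 q) _) (christoffel _ _ _ _ _) => u v w; ring.
Qed.

Lemma speed_affine gam l (a b : R) : has_speed gam l -> has_speed (fun s => gam (a * s + b)) (`|a| * l).
Proof.
move=> [G l0 Gl]; have Ga := geodesic_affine a b G; split=> //; first exact: mulr_ge0.
move=> i t dt; rewrite exprMn real_normK ?num_real// -(Gl i _ dt) /spd -qfZ; congr (qf _ _).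
apply/rowP => k; rewrite mxscaleE; have [h _] := geod_at G dt.
have [D0 _] := h k; have [_ E] := @affine_derive (fun s => crd i gam s 0 k) a b t D0.
by rewrite [LHS]mxE [LHS]derive1E E [in RHS]mxE.
Qed.

Hypothesis complg : complete_metric g.

Lemma geodesic_exists i x v : chart_dom i x -> exists gam, [/\ has_speed gam (Num.sqrt (qf (g i (chart i x)) v)),
 gam 0 = x & vel (crd i gam) 0 = v].
Proof.
move=> dx; have [gam [G g0 gv]] := complg v dx.
have E : vel (crd i gam) 0 = v by apply/rowP => k; rewrite mxE gv.
exists gam; split=> //.
have -> : qf (g i (chart i x)) v = spd i gam 0 by rewrite /spd E /crd g0.
by apply: geodesic_speed => //; rewrite g0.
Qed.

Section GoodBall.
Variables (i : chart_idx A) (y0 : 'rV[R]_n).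

Definition in_ball (rho : R) (x : M) := chart_dom i x /\ `|chart i x - y0| <= rho.

(* [rho] bounds the starting points, [r] the whole arc and [l0] the speed. *)
Definition two_positions (rho l0 : R) : Prop := forall gam1 gam2 l1 l2 b, has_speed gam1 l1 -> has_speed gam2 l2 -> l1 <= l0 -> l2 <= l0 ->
  in_ball rho (gam1 0) -> in_ball rho (gam2 0) -> 0 < b <= 1 -> forall t, 0 <= t <= 1 ->
  `|crd i gam1 t - crd i gam2 t| <= 10 / b * (`|crd i gam1 0 - crd i gam2 0| + `|crd i gam1 b - crd i gam2 b|).

Definition one_velocity (rho l0 : R) : Prop := forall gam1 gam2 l1 l2, has_speed gam1 l1 -> has_speed gam2 l2 -> l1 <= l0 -> l2 <= l0 ->
  in_ball rho (gam1 0) -> in_ball rho (gam2 0) -> forall t, 0 <= t <= 1 ->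
  `|crd i gam1 t - crd i gam2 t| <= 3 * (`|crd i gam1 0 - crd i gam2 0| + `|vel (crd i gam1) 0 - vel (crd i gam2) 0|).

(** Takes the place of the Gauss lemma: short geodesics minimise locally, and a broken path that is
    equally short has no corner. *)
Definition short_triangles (rho l0 : R) : Prop := forall al be ga l1 l2 L, has_speed al l1 -> has_speed be l2 -> has_speed ga L ->
  l1 + l2 <= l0 -> L <= l0 -> in_ball rho (al 0) -> in_ball rho (be 0) -> al 1 = be 0 -> ga 0 = al 0 -> ga 1 = be 1 ->
  L <= l1 + l2 /\ (0 < l1 + l2 -> L = l1 + l2 -> ga (l1 / (l1 + l2)) = be 0).

Definition short_arcs (rho l0 : R) : Prop := forall x y, in_ball rho x -> in_ball rho y -> exists gam l,
  [/\ has_speed gam l, gam 0 = x, gam 1 = y, l <= l0 & l <= 4 * Num.sqrt (qf (g i y0) (chart i y - chart i x))].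

(** A working substitute for a convex normal neighbourhood. *)
Record good_ball (r rho l0 : R) : Prop := GoodBall {
 gb_rho : 0 < rho;
 gb_l0 : 0 < l0;
 gb_rU : forall y, `|y - y0| <= r -> chart_img i y;
 gb_rho_r : rho <= r;
 gb_stay : forall gam l, has_speed gam l -> l <= l0 -> in_ball rho (gam 0) ->
  forall t, 0 <= t <= 1 -> in_ball r (gam t);
 gb_conn : short_arcs rho l0;
 gb_drift : exists2 Lam, 0 < Lam & forall gam l s, has_speed gam l -> l <= l0 -> s <= rho -> in_ball s (gam 0) ->
  forall t, 0 <= t <= 1 -> in_ball (s + Lam * l) (gam t);
 gb_two : two_positions rho l0;
 gb_vel : one_velocity rho l0;
 gb_tri : short_triangles rho l0
}.

Section Construction.
Variables (r C Lam c0 e : R).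
Hypotheses (r0 : 0 < r) (e0 : 0 < e) (C0 : 0 <= C) (Lam1 : 1 <= Lam) (c00 : 0 < c0).
Hypothesis rU : forall y, `|y - y0| <= r -> chart_img i y.
Hypothesis ctl : ball_ctl (g i) y0 r C.
Hypothesis lowN : forall y v, `|y - y0| <= r -> c0 * sqn v <= qf (g i y) v.
Hypothesis lowLam : forall y v, `|y - y0| <= r -> `|v| <= Lam * Num.sqrt (qf (g i y) v).
Hypothesis upLam : forall y v, `|y - y0| <= r -> Num.sqrt (qf (g i y) v) <= Lam * `|v|.
Hypothesis cmp : forall y v, `|y - y0| <= r -> qf (g i y) v <= 4 * qf (g i y0) v.
Let n2 : R := (n ^ 2)%:R.
Let eta := n2 * C * (e ^+ 2 + 2 * e).
Hypothesis eta_small : 20 * Lam ^+ 2 * eta <= 1.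
Hypothesis mu_small : n2 * C * (e ^+ 2 + e) <= (c0 - n2 * C * (e ^+ 2 + e)) * (7 / 64).
Hypothesis e_r : e <= r / 4.
(** Speed at most [l0] means coordinate velocity at most [e]. The radius [rho] below keeps arcs that
    start within it inside the ball of radius [r], and makes initial velocities of norm up to
    [4 * rho] admissible. *)
Let l0 := e / Lam.
Let rho := Num.min (r / 2) (e / (4 * Lam ^+ 2)).

Let Lam0 : 0 < Lam. Proof. exact: lt_le_trans Lam1. Qed.
Let l00 : 0 < l0. Proof. exact: divr_gt0. Qed.
Let rho0 : 0 < rho. Proof. by rewrite lt_min !divr_gt0// mulr_gt0// exprn_gt0. Qed.
Let rho_r2 : rho <= r / 2. Proof. by rewrite ge_min lexx. Qed.
Let rho_e : 4 * Lam ^+ 2 * rho <= e.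
Proof. by rewrite mulrC -ler_pdivlMr ?mulr_gt0 ?exprn_gt0// ge_min lexx orbT. Qed.
Let eta_ge0 : 0 <= eta.
Proof. by rewrite !mulr_ge0 ?ler0n// addr_ge0 ?exprn_ge0 ?mulr_ge0// ltW. Qed.
Let eta20 : 20 * eta <= 1.
Proof.
apply: le_trans eta_small; rewrite -mulrA ler_wpM2l// ler_peMl//.
by rewrite -(expr1n _ 2) lerXn2r ?nnegrE ?ler01// ltW.
Qed.

Lemma speed_vel gam l t : has_speed gam l -> in_ball r (gam t) -> `|vel (crd i gam) t| <= Lam * l.
Proof.
move=> [_ l0' Gl] [dt tr]; apply: (le_trans (lowLam _ tr)).
by rewrite -/(spd i gam t) (Gl i t dt) sqrtr_sqr ger0_norm.
Qed.

Lemma arc_bound gam l rh (T : R) : has_speed gam l -> 0 <= T <= 1 -> in_ball rh (gam 0) ->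
 (forall s, 0 <= s <= T -> in_ball r (gam s)) -> `|crd i gam T - crd i gam 0| <= Lam * l.
Proof.
move=> G T01 b0 H; have [Gg l0' _] := G; have /andP[T0 T1] := T01.
apply: (@le_trans _ _ (Lam * l * T)); last by rewrite ler_piMr// mulr_ge0// ltW.
apply: row_normP => [|k a]; first by rewrite !mulr_ge0// ltW.
rewrite ord1 mxsubE; apply: (@mvt0_le R (fun s => crd i gam s 0 a) (fun s => vel (crd i gam) s 0 a) T) => // s sT.
 by have [ds _] := H s sT; have [+ _] := geod_at Gg ds.
by apply: le_trans (speed_vel G (H s sT)); exact: coord_le.
Qed.

(** While the arc is in the ball of radius [r], its coordinates obey a strictly sharper bound, so it
    continues inside. It cannot leave the chart at a limit time, because the image of the closed
    ball under the chart inverse is compact, hence closed. *)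
Lemma stay_small gam l rh : has_speed gam l -> l <= l0 -> in_ball rh (gam 0) -> rh + Lam * l < r ->
 forall t, 0 <= t <= 1 -> in_ball (rh + Lam * l) (gam t).
Proof.
move=> G ll b0 rhl; have [Gg l0' _] := G; have [cg _] := Gg; have [d0 y0r] := b0.
have key T : 0 <= T <= 1 -> (forall s, 0 <= s <= T -> in_ball r (gam s)) -> in_ball (rh + Lam * l) (gam T).
 move=> T01 H; have /andP[T0 _] := T01.
 have [dT _] : in_ball r (gam T) by apply: H; rewrite T0 lexx.
 split=> //; rewrite -(subrK (crd i gam 0) (chart i (gam T))) -addrA addrC (le_trans (ler_normD _ _))// lerD//.
 exact: (arc_bound G T01 b0 H).
have cK := compact_closed hausM (closed_inv_ball rU).
suff H t : 0 <= t <= 1 -> in_ball r (gam t).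
 by move=> t /andP[t0 t1]; apply: key => [|s /andP[s0 st]]; [rewrite t0|apply: H; rewrite s0 (le_trans st)].
move: t; apply: real_induction => [|||].
- exact: ler01.
- by split=> //; apply: le_trans (ltW rhl); rewrite (le_trans y0r)// lerDl mulr_ge0// ltW.
- move=> t /andP[t0 t1] H; have [dt tr] : in_ball (rh + Lam * l) (gam t) by apply: key => //; rewrite t0 ltW.
 have N1 := near_dom cg dt.
 have e1 : 0 < r - (rh + Lam * l) by rewrite subr_gt0.
 have N2 : \forall s \near t, `|crd i gam t - crd i gam s| <= r - (rh + Lam * l).
  by have /cvgrPdist_le/(_ _ e1) := crd_continuous cg dt.
 have [d dP Nd] : exists2 d : R, 0 < d & forall s, `|t - s| < d -> chart_dom i (gam s) /\ `|crd i gam t - crd i gam s| <= r - (rh + Lam * l).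
  have N : \forall s \near t, chart_dom i (gam s) /\ `|crd i gam t - crd i gam s| <= r - (rh + Lam * l).
   by apply: filterS2 N1 N2.
  by have /nbhs_ballP[d dP Nd] := N; exists d => // s; exact: Nd.
 exists d => // s /andP[ts sd]; have [ds1 ds2] : chart_dom i (gam s) /\ `|crd i gam t - crd i gam s| <= r - (rh + Lam * l).
  by apply: Nd; rewrite distrC ger0_norm ?subr_ge0// ltrBlDl.
 split=> //; rewrite -(subrK (crd i gam t) (chart i (gam s))) -addrA (le_trans (ler_normD _ _))// distrC.
 by rewrite -[leRHS](subrK (rh + Lam * l)) lerD.
- move=> t /andP[t0 t1] H.
 have Kt : (@chart_inv _ _ _ A i @` [set y | `|y - y0| <= r]) (gam t).
  apply: contrapT => nK; have N : \forall s \near t, (~` (@chart_inv _ _ _ A i @` [set y | `|y - y0| <= r])) (gam s).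
   by apply: (cg t); apply: open_nbhs_nbhs; split=> //; exact: closed_openC.
  have /nbhs_ballP[d d0' Nd] := N.
  pose s := Num.max 0 (t - d / 2).
  have st : s < t by rewrite gt_max t0 ltrBlDr ltrDl divr_gt0.
  have s0 : 0 <= s by rewrite le_max lexx.
  have sd : `|t - s| < d.
   rewrite ger0_norm ?subr_ge0 ?(ltW st)// ltrBlDr -ltrBlDl lt_max; apply/orP; right.
   by rewrite ltrD2l ltrN2 ltr_pdivrMr// ltr_pMr// ltr1n.
  have [ds sr] : in_ball r (gam s) by apply: H; rewrite s0.
  by apply: (Nd s sd); exists (chart i (gam s)) => //; rewrite chartK.
 have [z zr zt] := Kt; rewrite -zt; split; first exact: inv_dom (rU zr).
 by rewrite chart_invK//; exact: rU.
Qed.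

Lemma ball_arc gam l : has_speed gam l -> l <= l0 -> in_ball rho (gam 0) ->
 (forall t, 0 <= t <= 1 -> in_ball r (gam t)) /\ good_arc (g i) y0 r e (crd i gam).
Proof.
move=> G ll b0; have [Gg l0' _] := G.
have Le : Lam * l <= e by move: ll; rewrite /l0 ler_pdivlMr// mulrC.
have lt : rho + Lam * l < r.
 by move: rho_r2 e_r Le r0; move: (rho) (Lam * l) (e) (r) => a1 a2 a3 a4; lra.
have H t : 0 <= t <= 1 -> in_ball r (gam t).
 by move=> t01; have [dt tr] := stay_small G ll b0 lt t01; split=> //; apply: le_trans tr (ltW lt).
split=> // t t01; have [dt tr] := H t t01; split=> //; first exact: geod_at.
exact: le_trans (speed_vel G (H t t01)) Le.
Qed.

Lemma two_arcs gam1 gam2 l1 l2 : has_speed gam1 l1 -> has_speed gam2 l2 -> l1 <= l0 -> l2 <= l0 ->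
 in_ball rho (gam1 0) -> in_ball rho (gam2 0) ->
 let d := `|crd i gam1 0 - crd i gam2 0| + `|vel (crd i gam1) 0 - vel (crd i gam2) 0| in
 forall t, 0 <= t <= 1 -> `|crd i gam1 t - crd i gam2 t - (crd i gam1 0 - crd i gam2 0) - t *: (vel (crd i gam1) 0 - vel (crd i gam2) 0)| <= 5 * eta * t * d.
Proof.
move=> G1 G2 h1 h2 b1 b2 d t t01; have [_ A1] := ball_arc G1 h1 b1; have [_ A2] := ball_arc G2 h2 b2.
have e4 : eta <= 1 / 4 by have := eta20; lra.
by have [_] := geo_diff C0 ctl (ltW e0) A1 A2 (lexx _) e4 t01.
Qed.

Lemma arc_vel : one_velocity rho l0.
Proof.
move=> gam1 gam2 l1 l2 G1 G2 h1 h2 b1 b2 t t01; have := two_arcs G1 G2 h1 h2 b1 b2 t01; have /andP[t0 t1] := t01.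
set X := crd i gam1 0 - _; set V := vel _ _ - _; set Y := crd i gam1 t - _ => H.
rewrite [Y](addr_decomp _ X (t *: V)) (le_trans (ler_normD _ _))//.
have h3 : `|X + t *: V| <= `|X| + `|V|.
 by rewrite (le_trans (ler_normD _ _))// lerD2l normrZ ger0_norm// ler_piMl.
have d0 : 0 <= `|X| + `|V| by rewrite addr_ge0.
have h5 : 5 * eta * t * (`|X| + `|V|) <= `|X| + `|V|.
 rewrite ler_piMl//; have := eta20; have := eta_ge0; have : eta * t <= eta by rewrite ler_piMr.
 lra.
lra.
Qed.

Lemma arc_two : two_positions rho l0.
Proof.
move=> gam1 gam2 l1 l2 b G1 G2 h1 h2 b1 b2 /andP[b0 b1'] t t01.
have := arc_vel G1 G2 h1 h2 b1 b2 t01.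
have := two_arcs G1 G2 h1 h2 b1 b2 (introT andP (conj (ltW b0) b1')).
set X := crd i gam1 0 - _; set V := vel _ _ - _; set Y := crd i gam1 b - _; set Z := crd i gam1 t - _ => H HZ.
have hV : b * `|V| <= `|Y| + `|X| + 5 * eta * b * (`|X| + `|V|).
 rewrite -(ger0_norm (ltW b0)) -normrZ.
 rewrite [b *: V](subr_decomp _ Y X).
 by rewrite (le_trans (ler_normB _ _))// (ger0_norm (ltW b0)) lerD// ler_normB.
have x0 : 0 <= `|X| by []. have v0 : 0 <= `|V| by []. have yy0 : 0 <= `|Y| by [].
have hV2 : b * `|V| <= 2 * (`|X| + `|Y|).
 have q1 : 5 * eta * b * (`|X| + `|V|) <= 4^-1 * (b * (`|X| + `|V|)).
  rewrite -mulrA ler_wpM2r ?mulr_ge0 ?addr_ge0 ?(ltW b0)//; have := eta20; lra.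
 have q2 : b * `|X| <= `|X| by rewrite ler_piMl.
 move: hV q1; rewrite !mulrDr; lra.
rewrite mulrAC ler_pdivlMr//; move: HZ => /(ler_wpM2r (ltW b0)) /le_trans; apply.
have q2 : b * `|X| <= `|X| by rewrite ler_piMl.
rewrite mulrAC [3 * b]mulrC -mulrA; lra.
Qed.

(** The initial velocity is found by shooting, as a fixed point of [F], which adds to [v] the defect
    of the endpoint. Endpoints depend on [v] like [v] itself up to the relative error [5 * eta], so
    [F] is a contraction. *)
Lemma arc_conn : short_arcs rho l0.
Proof.
move=> x y bx By; have [dx xr] := bx; have [dy yr] := By.
have [S SP] := choice (fun v => geodesic_exists v dx).
set u := chart i y - chart i x.
have ur : `|u| <= 2 * rho.
 rewrite (_ : u = (chart i y - y0) - (chart i x - y0)); last by rewrite opprB addrA subrK.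
 by rewrite (le_trans (ler_normB _ _))// mulr_natl mulr2n lerD.
have xr' : `|chart i x - y0| <= r by apply: (le_trans xr); move: rho_r2 r0; move: (rho) (r) => a1 a2; lra.
have spv v : `|v| <= 2 * `|u| -> Num.sqrt (qf (g i (chart i x)) v) <= l0.
 move=> vu; rewrite (le_trans (upLam _ xr'))// /l0 ler_pdivlMr//.
 have v4 : `|v| <= 4 * rho by move: vu ur; move: (rho) => a1; lra.
 apply: le_trans rho_e; rewrite (_ : Lam * `|v| * Lam = Lam ^+ 2 * `|v|); last by ring.
 by rewrite (_ : 4 * Lam ^+ 2 * rho = Lam ^+ 2 * (4 * rho)) ?ler_wpM2l ?exprn_ge0 ?(ltW Lam0)//; ring.
have G v := let: And3 a _ _ := SP v in a.
have S0 v : in_ball rho (S v 0) by have [_ -> _] := SP v.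
have cS v : crd i (S v) 0 = chart i x by rewrite /crd; have [_ -> _] := SP v.
pose F v := v + (chart i y - crd i (S v) 1).
have Fd v w : `|v| <= 2 * `|u| -> `|w| <= 2 * `|u| -> `|F v - F w| <= 5 * eta * `|v - w|.
 move=> vu wu; have := two_arcs (G v) (G w) (spv v vu) (spv w wu) (S0 v) (S0 w) (t := 1).
 rewrite lexx ler01 => /(_ isT); have [_ _ ->] := SP v; have [_ _ ->] := SP w.
 rewrite !cS subrr normr0 add0r subr0 scale1r mulr1.
 have -> : F v - F w = - (crd i (S v) 1 - crd i (S w) 1 - (v - w)).
  by apply/rowP => k; rewrite /F !(mxaddE, mxoppE); ring.
 by rewrite normrN.
have F0 : F 0 = u.
 have [_ e1 v1] := SP 0; rewrite /F add0r; congr (_ - _).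
 have z0 : Num.sqrt (qf (g i (chart i x)) 0) = 0 by rewrite /qf /bf mul0mx mul0mx mxE sqrtr0.
 have := G 0; rewrite z0 => G0; have [H _] := ball_arc G0 (ltW l00) (S0 0).
 have := arc_bound G0 (introT andP (conj ler01 (lexx 1))) (S0 0) H.
 by rewrite mulr0 normr_le0 subr_eq0 => /eqP ->; rewrite /crd e1.
have FD v : `|v| <= 2 * `|u| -> `|F v| <= 2 * `|u|.
 move=> vu; have := Fd v 0 vu; rewrite normr0 mulr_ge0// => /(_ isT); rewrite F0 subr0 => h.
 rewrite -(subrK u (F v)) (le_trans (ler_normD _ _))//.
 have : 5 * eta * `|v| <= 4^-1 * (2 * `|u|).
  by apply: ler_pM => //; [rewrite mulr_ge0|have := eta20; lra].
 by have := normr_ge0 u; lra.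
(* A minimiser of $|F(v) - v|$ on this compact ball is a fixed point, since one more application of
   [F] divides the quantity by at least 4. *)
pose D := [set v : 'rV[R]_n | `|v| <= 2 * `|u|].
have [v Dv Fv] : exists2 v, D v & v = F v.
 have cD : compact D.
  apply: bounded_closed_compact.
   exists (2 * `|u|); split; first exact: num_real.
   by move=> b bb v vD; apply: ltW; exact: le_lt_trans vD bb.
  by have := @closed_cball R n 0 (2 * `|u|); congr closed; apply/seteqP; split => v /=; rewrite subr0.
 have ne : D !=set0 by exists 0; rewrite /D /= normr0 mulr_ge0.
 have cF : {within D, continuous (fun v => `|F v - v|)}.
  apply/subspace_continuousP => x0 Dx; apply/cvgrPdist_le => ep ep0.
  have N : \forall v \near x0, `|x0 - v| < ep / 2.
   by apply/nbhs_ballP; exists (ep / 2); [exact: divr_gt0|move=> v; rewrite -ball_normE].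
  apply: filterS N => v xv Dv; rewrite (le_trans (ler_dist_dist _ _))//.
  have -> : F x0 - x0 - (F v - v) = (F x0 - F v) - (x0 - v).
   by apply/rowP => k; rewrite !(mxaddE, mxoppE); ring.
  have h1 := Fd _ _ Dx Dv; rewrite (le_trans (ler_normB _ _))//.
  have h2 : 5 * eta * `|x0 - v| <= `|x0 - v| by rewrite ler_piMl//; have := eta20; lra.
  lra.
 have [v Dv vmin] := EVT_min_rV ne cD cF.
 move/set_mem: Dv => Dv; exists v => //; apply/eqP; rewrite eq_sym -subr_eq0 -normr_eq0 -normr_le0 normr_id.
 have := vmin (F v) (mem_set (FD v Dv)); have := Fd _ _ (FD v Dv) Dv.
 have : 5 * eta * `|F v - v| <= 4^-1 * `|F v - v| by rewrite ler_wpM2r//; have := eta20; lra.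
 have := normr_ge0 (F v - v); lra.
have [Gv e1 _] := SP v.
have yE : S v 1 = y.
 have [H _] := ball_arc Gv (spv v Dv) (S0 v).
 have [d1 _] := H 1 (introT andP (conj ler01 (lexx 1))).
 have Ecrd : crd i (S v) 1 = chart i y.
  apply/eqP; rewrite eq_sym -subr_eq0; apply/eqP.
  by apply: (addrI v); rewrite -/(F v) -Fv addr0.
 by rewrite -(chartK d1) -(chartK dy); congr (chart_inv i _).
exists (S v), (Num.sqrt (qf (g i (chart i x)) v)); split=> //; first exact: spv.
have y0r : `|y0 - y0| <= r by rewrite subrr normr0 ltW.
have vu : `|v - u| <= 10 * eta * `|u|.
 have := Fd v 0 Dv; rewrite normr0 mulr_ge0// => /(_ isT); rewrite F0 subr0 -Fv => /le_trans; apply.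
 by rewrite (_ : 10 * eta * `|u| = 5 * eta * (2 * `|u|)); [rewrite ler_wpM2l// mulr_ge0|ring].
have q1 : Num.sqrt (qf (g i y0) (v - u)) <= Num.sqrt (qf (g i y0) u).
 apply: (le_trans (upLam _ y0r)).
 apply: (@le_trans _ _ (Lam * (10 * eta * (Lam * Num.sqrt (qf (g i y0) u))))).
  have e10 : 0 <= 10 * eta by exact: mulr_ge0.
  exact: (ler_wpM2l (ltW Lam0) (le_trans vu (ler_wpM2l e10 (lowLam u y0r)))).
 rewrite (_ : _ * _ = (10 * Lam ^+ 2 * eta) * Num.sqrt (qf (g i y0) u)); last by ring.
 rewrite ler_piMl ?sqrtr_ge0//; have := eta_small.
 have : 0 <= Lam ^+ 2 * eta by rewrite mulr_ge0 ?exprn_ge0// ltW.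
 rewrite -!mulrA; lra.
have pg : posdef (g i y0) by apply: g_posdef; exact: rU.
have q2 : qf (g i y0) (v - u) <= qf (g i y0) u by rewrite -ler_sqrt// qf_ge0.
have q3 : qf (g i y0) v <= 2 * qf (g i y0) u + 2 * qf (g i y0) (v - u).
 by have := qf_add_le u (v - u) pg; rewrite [u + _]addrC subrK.
(* 16 is the factor 4 from comparing the metric at [x] with the one at [y0], times 2 + 2 from the
   parallelogram inequality. *)
rewrite (_ : 4 * _ = Num.sqrt (16 * qf (g i y0) u)); last first.
 rewrite (_ : 16 = 4 ^+ 2 :> R); last by ring.
 by rewrite sqrtrM ?exprn_ge0// sqrtr_sqr ger0_norm.
rewrite ler_wsqrtr//; have := cmp v xr'; lra.
Qed.

Lemma arc_tri : short_triangles rho l0.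
Proof.
move=> al be ga l1 l2 L Ga Gb Gc l12 Ll ba bb ab ca cb.
have [_ l10 _] := Ga; have [_ l20 _] := Gb; have [_ L0 Lc] := Gc.
have l1l : l1 <= l0 by apply: le_trans l12; rewrite lerDl.
have l2l : l2 <= l0 by apply: le_trans l12; rewrite lerDr.
have [Ha _] := ball_arc Ga l1l ba; have [Hb _] := ball_arc Gb l2l bb.
have bc : in_ball rho (ga 0) by rewrite ca.
have [Hc Ac] := ball_arc Gc Ll bc.
set l := l1 + l2; have l_ge0 : 0 <= l by rewrite addr_ge0.
have k0 : 0 < c0 - n2 * C * (e ^+ 2 + e).
 have : 0 <= n2 * C * (e ^+ 2 + e) by rewrite !mulr_ge0 ?ler0n// addr_ge0 ?exprn_ge0// ltW.
 by move: mu_small c00; move: (n2 * C * (e ^+ 2 + e)) => m; lra.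
(* Both sides are reparametrised to the common speed [l], with the vertex at time [l1 / l]. When one
   side is degenerate its reparametrisation would divide by zero, and the other side alone serves
   for both pieces. *)
have [tau [sg1 [sg2 [tau01 tauE [H1 H2] [e1 e2 e3]]]]] : exists tau (sg1 sg2 : R -> M), [/\ 0 <= tau <= 1,
 0 < l -> tau = l1 / l,
 (forall t, 0 <= t <= tau -> in_ball r (sg1 t)) /\ (forall t, tau <= t <= 1 -> in_ball r (sg2 t)) &
 [/\ has_speed sg1 l /\ has_speed sg2 l, sg1 0 = ga 0 /\ sg2 1 = ga 1 & sg1 tau = be 0 /\ sg2 tau = be 0]].
 have [l1z|l1p] := eqVneq l1 0.
  have lE : l = l2 by rewrite /l l1z add0r.
  have x0 : al 0 = be 0.
   have [d0 _] := ba; have [d1 _] := Ha 1 (introT andP (conj ler01 (lexx 1))).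
   have := arc_bound Ga (introT andP (conj ler01 (lexx 1))) ba Ha.
   by rewrite l1z mulr0 normr_le0 subr_eq0 => /eqP E; rewrite -ab -(chartK d0) -(chartK d1) -/(crd i al 0) -E.
  exists 0, be, be; split.
  - by rewrite lexx ler01.
  - by rewrite l1z mul0r.
  - by split=> // t /andP[t0 t1]; apply: Hb; rewrite t0 (le_trans t1).
  - by rewrite lE ca cb x0.
 have [l2z|l2p] := eqVneq l2 0.
  have lE : l = l1 by rewrite /l l2z addr0.
  have x1 : be 1 = be 0.
   have [d0 _] := bb; have [d1 _] := Hb 1 (introT andP (conj ler01 (lexx 1))).
   have := arc_bound Gb (introT andP (conj ler01 (lexx 1))) bb Hb.
   by rewrite l2z mulr0 normr_le0 subr_eq0 => /eqP E; rewrite -(chartK d0) -(chartK d1) -/(crd i be 1) E.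
  exists 1, al, al; split.
  - by rewrite lexx ler01.
  - by rewrite lE => _; rewrite divff.
  - by split=> // t /andP[t0 t1]; apply: Ha; rewrite (le_trans ler01).
  - by rewrite lE ca cb x1 ab.
 have {l1p}l1p : 0 < l1 by rewrite lt_neqAle eq_sym l1p.
 have {l2p}l2p : 0 < l2 by rewrite lt_neqAle eq_sym l2p.
 have lp : 0 < l by rewrite addr_gt0.
 have tE : 1 - l1 / l = l2 / l.
  rewrite -[1](divff (lt0r_neq0 lp)) -mulrBl; congr (_ / _); rewrite /l; ring.
 exists (l1 / l), (fun s => al (l / l1 * s + 0)), (fun s => be (l / l2 * s + (- (l1 / l2)))); split.
 - by rewrite divr_ge0//= ler_pdivrMr// mul1r lerDl.
 - by [].
 - split=> t /andP[t0 t1].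
   apply: Ha; rewrite addr0 mulr_ge0 ?divr_ge0//=.
   apply: (@le_trans _ _ (l / l1 * (l1 / l))); first by rewrite ler_wpM2l// divr_ge0.
   by rewrite mulrA mulfVK ?gt_eqF// divff ?gt_eqF.
  apply: Hb; apply/andP; split.
   rewrite subr_ge0; apply: (@le_trans _ _ (l / l2 * (l1 / l))); last by rewrite ler_wpM2l// divr_ge0.
   by rewrite [leRHS]mulrC mulrA divfK ?gt_eqF.
  rewrite lerBlDr; apply: (@le_trans _ _ (l / l2 * 1)); first by rewrite ler_wpM2l// divr_ge0.
  by rewrite mulr1 /l mulrDl divff ?gt_eqF// addrC.
 - split.
  + have := speed_affine (l / l1) 0 Ga; have := speed_affine (l / l2) (- (l1 / l2)) Gb.
   by rewrite !ger0_norm ?divr_ge0// !mulfVK ?gt_eqF.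
  + rewrite mulr0 addr0 ca cb; split=> //; congr be; rewrite /l; field; exact: lt0r_neq0.
  + rewrite -ab; split; [congr al|rewrite ab; congr be]; field; rewrite ?gt_eqF//.
have [G1 G2] := e1; have [a1 a2] := e2; have [a3 a4] := e3.
have S1 t : 0 <= t <= tau -> [/\ curve_at (crd i sg1) t, `|crd i sg1 t - y0| <= r & qf (g i (crd i sg1 t)) (vel (crd i sg1) t) = l ^+ 2].
 move=> tt; have [dt tr] := H1 t tt; have [Gg _ Gl] := G1; split=> //; first by have [] := geod_at Gg dt.
 exact: Gl.
have S2 t : tau <= t <= 1 -> [/\ curve_at (crd i sg2) t, `|crd i sg2 t - y0| <= r & qf (g i (crd i sg2 t)) (vel (crd i sg2) t) = l ^+ 2].
 move=> tt; have [dt tr] := H2 t tt; have [Gg _ Gl] := G2; split=> //; first by have [] := geod_at Gg dt.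
 exact: Gl.
have := @broken_energy R n (g i) y0 r C C0 ctl e (ltW e0) (chart_img i) (metric_at g i) rU c0 lowN (crd i ga) (crd i sg1) (crd i sg2)
 (l ^+ 2) tau Ac mu_small (ltW k0) tau01 S1 S2.
rewrite /crd a1 a2 a3 a4 => /(_ erefl erefl erefl); rewrite -/(crd i ga) -/(crd i ga tau).
rewrite -[qf _ _]/(spd i ga 0) Lc; last by case: bc.
set k := _ / 4 => BE; have kp : 0 < k by rewrite divr_gt0.
have Lle : L <= l.
 rewrite -(@ler_pXn2r _ 2) ?nnegrE// -subr_ge0; apply: le_trans BE.
 by rewrite mulr_ge0 ?sqn_ge0// ltW.
split=> // lp LE; rewrite -(tauE lp).
have [dt _] := Hc tau tau01; have [db _] := bb.
move: BE; rewrite LE subrr pmulr_rle0// => /sqn_eq0 /eqP; rewrite subr_eq0 => /eqP E.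
by rewrite -(chartK dt) -(chartK db) E.
Qed.

Lemma good_ball_build : good_ball r rho l0.
Proof.
split=> //.
- by apply: (le_trans rho_r2); rewrite ler_pdivrMr// ler_peMr ?ler1n// ltW.
- by move=> gam l G ll b0; have [H _] := ball_arc G ll b0.
- exact: arc_conn.
- exists Lam => // gam l s G ll sr b0; apply: (stay_small G ll b0).
 have Le : Lam * l <= e by move: ll; rewrite /l0 ler_pdivlMr// mulrC.
 by move: sr rho_r2 e_r Le r0; move: (rho) (Lam * l) (e) (r) => a1 a2 a3 a4; lra.
- exact: arc_two.
- exact: arc_vel.
- exact: arc_tri.
Qed.

End Construction.

Lemma good_ball_exists : chart_img i y0 -> exists r rho l0, good_ball r rho l0.
Proof.
move=> Uy0; have lm := metric_at g i; have pg := g_posdef g Uy0.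
have h34 : (0 : R) < 3 / 4 by lra.
have [r r0 [rU gn]] := qf_near lm pg Uy0 h34.
have [c1 c10 low1] := norm_qf_le (lm_sym lm Uy0) pg.
have [c2 c20 up2] := qf_norm_le (g i y0).
have [C C0 ctl] := ball_ctl_exists lm rU.
pose Lam := 1 + 2 * c1 + 2 * (1 + c2).
have Lam1 : 1 <= Lam by rewrite /Lam; lra.
have Lam0 : 0 < Lam by apply: lt_le_trans Lam1.
have L20 : 0 < Lam ^+ 2 by rewrite exprn_gt0.
have gl y v : `|y - y0| <= r -> qf (g i y0) v <= 4 * qf (g i y) v.
 by move=> yr; have := gn y yr v; rewrite ler_norml => /andP[+ _]; move: (qf _ v) (qf (g i y0) v) => a b; lra.
have gu y v : `|y - y0| <= r -> qf (g i y) v <= 4 * qf (g i y0) v.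
 move=> yr; have := gn y yr v; rewrite ler_norml => /andP[_]; have := qf_ge0 v pg.
 by move: (qf _ v) (qf (g i y0) v) => a b; lra.
have s4 (x : R) : Num.sqrt (4 * x) = 2 * Num.sqrt x.
 have e4 : 4 = 2 ^+ 2 :> R by ring.
 by rewrite e4 sqrtrM ?exprn_ge0// sqrtr_sqr ger0_norm.
have lowLam y v : `|y - y0| <= r -> `|v| <= Lam * Num.sqrt (qf (g i y) v).
 move=> yr; have h1 := low1 v; have h2 := ler_wsqrtr (gl y v yr); rewrite s4 in h2.
 have h3 : c1 * Num.sqrt (qf (g i y0) v) <= c1 * (2 * Num.sqrt (qf (g i y) v)) by rewrite ler_wpM2l// ltW.
 apply: (le_trans h1); apply: (le_trans h3); rewrite mulrA ler_wpM2r ?sqrtr_ge0//.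
 by rewrite /Lam; lra.
have upLam y v : `|y - y0| <= r -> Num.sqrt (qf (g i y) v) <= Lam * `|v|.
 move=> yr; apply: (@le_trans _ _ (Num.sqrt (4 * ((1 + c2) ^+ 2 * `|v| ^+ 2)))).
  rewrite ler_wsqrtr//; apply: (le_trans (gu y v yr)); rewrite ler_wpM2l//; apply: (le_trans (up2 v)).
  by rewrite ler_wpM2r ?exprn_ge0//; nra.
 rewrite s4 -exprMn sqrtr_sqr ger0_norm ?mulr_ge0//; last by lra.
 by rewrite mulrA ler_wpM2r//; rewrite /Lam; lra.
pose c0 := (n.+1%:R * Lam ^+ 2)^-1.
have c00 : 0 < c0 by rewrite invr_gt0 mulr_gt0.
have lowN y v : `|y - y0| <= r -> c0 * sqn v <= qf (g i y) v.
 move=> yr; have [Uy q0] : chart_img i y /\ 0 <= qf (g i y) v.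
  by have Uy := rU y yr; split=> //; apply: qf_ge0; exact: g_posdef.
 rewrite /c0 mulrC ler_pdivrMr ?mulr_gt0//.
 have h1 : sqn v <= n%:R * `|v| ^+ 2.
  rewrite -[n in n%:R](card_ord n) -sum1_card natr_sum mulr_suml; apply: ler_sum => k _.
  rewrite mul1r -(real_normK (num_real (v 0 k))) lerXn2r ?nnegrE//; exact: coord_le.
 have h2 : `|v| ^+ 2 <= Lam ^+ 2 * qf (g i y) v.
  rewrite -[X in _ * X](sqr_sqrtr q0) -exprMn lerXn2r ?nnegrE ?mulr_ge0 ?sqrtr_ge0 ?(ltW Lam0)//; exact: lowLam.
 apply: (le_trans h1); apply: (le_trans (ler_wpM2l (ler0n R n) h2)); rewrite mulrA mulrC ler_wpM2l//.
 by rewrite ler_wpM2r ?(ltW L20)// ler_nat.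
pose K : R := (n ^ 2)%:R * C; have K0 : 0 <= K by rewrite mulr_ge0 ?ler0n.
(* The four bounds give $e^2 \le e$, the bound [e_r], then [eta_small] because $20(e^2 + 2e) \le
   60e$, and [mu_small] because $2Ke \le c_0/11$ and $1/11 < 7/71$. *)
pose e := Num.min 1 (Num.min (r / 4) (Num.min (60 * Lam ^+ 2 * K + 1)^-1 (c0 / (22 * K + 1)))).
have d1 : 0 < 60 * Lam ^+ 2 * K + 1 by rewrite ltr_wpDl// !mulr_ge0// ltW.
have d2 : 0 < 22 * K + 1 by rewrite ltr_wpDl// mulr_ge0.
have e0 : 0 < e by rewrite !lt_min ltr01 divr_gt0// invr_gt0 d1 divr_gt0.
have e1 : e <= 1 by rewrite ge_min lexx.
have er : e <= r / 4 by rewrite !ge_min lexx !orbT.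
have eL : e * (60 * Lam ^+ 2 * K + 1) <= 1 by rewrite -ler_pdivlMr// div1r !ge_min lexx !orbT.
have eC : e * (22 * K + 1) <= c0 by rewrite -ler_pdivlMr// !ge_min lexx !orbT.
clearbody e c0 Lam.
have e2 : e ^+ 2 <= e by rewrite expr2 ler_piMr// ltW.
have Ke : K * e ^+ 2 <= K * e by rewrite ler_wpM2l.
have LKe : Lam ^+ 2 * (K * e ^+ 2) <= Lam ^+ 2 * (K * e) by rewrite ler_wpM2l// ltW.
exists r, (Num.min (r / 2) (e / (4 * Lam ^+ 2))), (e / Lam).
apply: (@good_ball_build r C Lam c0 e) => //.
- rewrite -/K; have -> : 20 * Lam ^+ 2 * (K * (e ^+ 2 + 2 * e)) = 20 * (Lam ^+ 2 * (K * e ^+ 2)) + 40 * (Lam ^+ 2 * (K * e)) by ring.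
 have : 60 * (Lam ^+ 2 * (K * e)) <= 1.
  apply: le_trans eL; rewrite (_ : e * _ = 60 * (Lam ^+ 2 * (K * e)) + e); last by ring.
  by rewrite lerDl ltW.
 by move: LKe; move: (Lam ^+ 2 * (K * e ^+ 2)) (Lam ^+ 2 * (K * e)) => a b; lra.
- rewrite -/K mulrDr; have : 22 * (K * e) <= c0.
  by apply: le_trans eC; rewrite (_ : e * _ = 22 * (K * e) + e) ?lerDl ?(ltW e0)//; ring.
 have Ke0 : 0 <= K * e by rewrite mulr_ge0// ltW.
 by move: Ke Ke0; move: (K * e ^+ 2) (K * e) => a b; lra.
Qed.

End GoodBall.
End Geodesics.

(** * The Hopf-Rinow theorem and cutoff functions *)
Section Distance.
Context {R : realType} {n : nat} {M : ptopologicalType} {A : smooth_atlas R n M}.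
Variable g : riemannian_metric A.
Local Notation near_pt q := (in_ball (chart_at A q) (chart (chart_at A q) q)).
Hypothesis hausM : hausdorff_space M.
Hypothesis connM : connected [set: M].
Hypothesis complg : complete_metric g.
Implicit Types (x y z p q : M) (l s t : R) (gam : R -> M).

(** A geodesic parametrised by the interval from 0 to 1, so its speed [l] is its length; chains are
    broken geodesics with total length recorded. *)
Definition step x y l := exists gam, [/\ has_speed g gam l, gam 0 = x & gam 1 = y].

Inductive chain x : M -> R -> Prop :=
| chain0 : chain x x 0
| chainS y z l l' : chain x y l -> step y z l' -> chain x z (l + l').

Lemma step_ge0 x y l : step x y l -> 0 <= l.
Proof. by case=> gam [[]]. Qed.

Lemma step_arc gam l (a b : R) : has_speed g gam l -> a <= b -> step (gam a) (gam b) ((b - a) * l).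
Proof.
move=> G ab; exists (fun s => gam ((b - a) * s + a)); split.
- by have := speed_affine (b - a) a G; rewrite ger0_norm// subr_ge0.
- by rewrite mulr0 add0r.
- by rewrite mulr1 subrK.
Qed.

Lemma step_sym x y l : step x y l -> step y x l.
Proof.
move=> [gam [G g0 g1]]; exists (fun s => gam (-1 * s + 1)); split.
- by have := speed_affine (-1) 1 G; rewrite normrN1 mul1r.
- by rewrite mulr0 add0r.
- by rewrite mulr1 addNr.
Qed.

Lemma chain_ge0 x y l : chain x y l -> 0 <= l.
Proof. by elim=> [|y' z l1 l2 _ IH /step_ge0]; [|exact: addr_ge0]. Qed.

Lemma step_chain x y l : step x y l -> chain x y l.
Proof. by move=> H; rewrite -(add0r l); apply: chainS H; exact: chain0. Qed.

Lemma chain_cat x y z l l' : chain x y l -> chain y z l' -> chain x z (l + l').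
Proof. by move=> H; elim=> [|y' z' l1 l2 _ IH S]; [rewrite addr0|rewrite addrA; exact: chainS S]. Qed.

Lemma chain_sym x y l : chain x y l -> chain y x l.
Proof.
elim=> [|y' z l1 l2 _ IH S]; first exact: chain0.
by rewrite addrC; apply: chain_cat IH; apply: step_chain; exact: step_sym.
Qed.

(** The infimum over broken geodesics rather than all curves, so that only the lengths recorded by
    [has_speed] occur. *)
Definition dist x y : R := inf [set l | chain x y l].

Lemma near_ball i x (s : R) : chart_dom (s := A) i x -> 0 < s -> \forall z \near x, in_ball i (chart i x) s z.
Proof.
move=> dx s0; have N1 : \forall z \near x, chart_dom i z.
 by apply: open_nbhs_nbhs; split=> //; exact: chart_dom_open.
have N2 : \forall z \near x, `|chart i x - chart i z| <= s.
 by have /cvgrPdist_le/(_ _ s0) := chart_continuous dx.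
by apply: filterS2 N1 N2 => z dz zs; split=> //; rewrite distrC.
Qed.

Definition is_ball q (r rho l0 : R) := good_ball g (chart_at A q) (chart (chart_at A q) q) r rho l0.

Lemma ball_exists q : exists r rho l0, is_ball q r rho l0.
Proof. by apply: good_ball_exists => //; apply: imgP; exact: chart_atP. Qed.

Lemma center_ball q s : 0 <= s -> near_pt q s q.
Proof. by move=> s0; split; [exact: chart_atP|rewrite subrr normr0]. Qed.

Lemma step_refl q : step q q 0.
Proof.
have [r [rho [l0 gb]]] := ball_exists q.
have qb := center_ball q (ltW (gb_rho gb)).
have [gam [l [G g0 g1 _]]] := gb_conn gb qb qb; rewrite subrr.
have -> : qf (g (chart_at A q) (chart (chart_at A q) q)) 0 = 0 by rewrite /qf /bf mul0mx mul0mx mxE.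
rewrite sqrtr0 mulr0 => l_le; have [_ l_ge _] := G.
by exists gam; split=> //; rewrite (_ : 0 = l)//; apply/eqP; rewrite eq_le l_ge.
Qed.

Lemma chain_exists x y : exists l, chain x y l.
Proof.
have op (p q : M) : \forall z \near q, exists l, chain q z l.
 have [r [rho [l0 gb]]] := ball_exists q.
 have qb := center_ball q (ltW (gb_rho gb)).
 have := near_ball (chart_atP A q) (gb_rho gb); apply: filterS => z zb.
 have [gam [l [G g0 g1 _ _]]] := gb_conn gb qb zb.
 by exists l; apply: step_chain; exists gam.
suff E : [set z | exists l, chain x z l] = [set: M] by have : [set z | exists l, chain x z l] y by rewrite E.
apply: connM; first by exists x, 0; exact: chain0.
- exists [set z | exists l, chain x z l]; last by rewrite setTI.
 rewrite openE => q [l xq]; rewrite /interior; have := op x q.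
 by apply: filterS => z [l' qz]; exists (l + l'); exact: chain_cat xq qz.
- exists [set z | exists l, chain x z l]; last by rewrite setTI.
 rewrite -openC openE => q nq; rewrite /interior; have := op x q.
 apply: filterS => z [l' qz] [l xz]; apply: nq; exists (l + l').
 by apply: chain_cat xz _; exact: chain_sym.
Qed.

Let hinf x y : has_inf [set l | chain x y l].
Proof.
split; first by have [l xy] := chain_exists x y; exists l.
by exists 0 => l /chain_ge0.
Qed.

Lemma dist_le x y l : chain x y l -> dist x y <= l.
Proof. by move=> H; apply: ge_inf => //; case: (hinf x y). Qed.

Lemma dist_step x y l : step x y l -> dist x y <= l.
Proof. by move=> /step_chain; exact: dist_le. Qed.

Lemma dist_ge0 x y : 0 <= dist x y.
Proof. by apply: lb_le_inf; [case: (hinf x y)|move=> l /chain_ge0]. Qed.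

Lemma dist_lt x y e : dist x y < e -> exists2 l, chain x y l & l < e.
Proof.
move=> de; have [|l xy] := @inf_adherent _ [set l | chain x y l] (e - dist x y) _ (hinf x y); first by rewrite subr_gt0.
by rewrite -/(dist x y) addrC subrK; exists l.
Qed.

Lemma distxx x : dist x x = 0.
Proof. by apply/eqP; rewrite eq_le dist_ge0 andbT; apply: dist_le; exact: chain0. Qed.

Lemma dist_sym x y : dist x y = dist y x.
Proof. by congr inf; apply/seteqP; split => l /=; exact: chain_sym. Qed.

Lemma dist_tri x y z : dist x z <= dist x y + dist y z.
Proof.
apply/ler_addgt0Pr => e e0; have e2 : 0 < e / 2 by rewrite divr_gt0.
have [l1 c1 h1] : exists2 l, chain x y l & l < dist x y + e / 2 by apply: dist_lt; rewrite ltrDl.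
have [l2 c2 h2] : exists2 l, chain y z l & l < dist y z + e / 2 by apply: dist_lt; rewrite ltrDl.
by have := dist_le (chain_cat c1 c2); lra.
Qed.

(** A short chain from [q] collapses to one geodesic: going along the chain, the geodesic found so
    far and the next side are replaced by the third side of their triangle, which starts at [q]
    again. *)
Lemma local_chain q r rho l0 : is_ball q r rho l0 -> exists2 d, 0 < d & d <= l0 /\ forall x l, chain q x l -> l < d ->
 near_pt q rho x /\ exists2 l1, l1 <= l & step q x l1.
Proof.
move=> gb; have [Lam L0 drift] := gb_drift gb; have rho0 := gb_rho gb.
have qb := center_ball q (lexx 0).
(* Lengths below [d] are admissible speeds, and such an arc moves a point by at most [rho / 4] in
   the chart. *)
pose d := Num.min l0 (rho / (4 * Lam)).
have d0 : 0 < d by rewrite lt_min (gb_l0 gb)/= divr_gt0// mulr_gt0.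
have dl : d <= l0 by rewrite ge_min lexx.
have Ld : Lam * d <= rho / 4.
 rewrite mulrC -ler_pdivlMr//; have -> : rho / 4 / Lam = rho / (4 * Lam) by rewrite invfM mulrA.
 by rewrite ge_min lexx orbT.
have near0 x l : step q x l -> l < d -> near_pt q (rho / 4) x.
 move=> [gam [G g0 g1]] ld; have b0 : near_pt q 0 (gam 0) by rewrite g0.
 have [dx xr] := drift gam l 0 G (le_trans (ltW ld) dl) (ltW rho0) b0 1 (introT andP (conj ler01 (lexx 1))).
 rewrite g1 in dx xr; split=> //; rewrite (le_trans xr)// add0r (le_trans _ Ld)// ler_wpM2l// ltW//.
have wk s x : s <= rho -> near_pt q s x -> near_pt q rho x.
 by move=> sr [dx xs]; split=> //; exact: le_trans sr.
have r4 : rho / 4 <= rho by rewrite ler_pdivrMr// ler_peMr ?ler1n// ltW.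
exists d => //; split=> // x l; elim=> [|y z l1 l2 c1 IH S2] ld.
 by split; [exact: (wk 0 _ (ltW rho0))|exists 0 => //; exact: step_refl].
have l10 := chain_ge0 c1; have l20 := step_ge0 S2.
have [yb [l1' le1 S1]] : near_pt q rho y /\ exists2 l', l' <= l1 & step q y l'.
 by apply: IH; apply: le_lt_trans ld; rewrite lerDl.
have l1d : l1' < d by apply: (le_lt_trans le1); apply: le_lt_trans ld; rewrite lerDl.
have l2d : l2 < d by apply: le_lt_trans ld; rewrite lerDr.
have y4 := near0 _ _ S1 l1d.
have [be [Gb b0 b1]] := S2; have [al [Ga a0 a1]] := S1.
have zb : near_pt q rho z.
 have y4' : near_pt q (rho / 4) (be 0) by rewrite b0.
 have := drift be l2 (rho / 4) Gb (le_trans (ltW l2d) dl) r4 y4' 1 (introT andP (conj ler01 (lexx 1))).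
 rewrite b1; apply: wk; have : Lam * l2 <= Lam * d by rewrite ler_wpM2l// ltW.
 by move: Ld rho0; move: (Lam * d) (Lam * l2) => u v; lra.
split=> //.
have qr := wk _ _ (ltW rho0) qb.
have [ga [L [Gc c0 c1' Ll _]]] := gb_conn gb qr zb.
have [] := gb_tri gb Ga Gb Gc.
- by apply: le_trans dl; apply: ltW; apply: le_lt_trans ld; rewrite lerD2r.
- exact: Ll.
- by rewrite a0.
- by rewrite b0.
- by rewrite a1 b0.
- by rewrite c0 a0.
- by rewrite c1' b1.
move=> LE _; exists L; last by exists ga.
by apply: (le_trans LE); rewrite lerD2r.
Qed.

(** A triangle with one constant side compares the two geodesics, in either order. *)
Lemma step_length_unique q r rho l0 x l1 l2 : is_ball q r rho l0 -> near_pt q rho x ->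
 step q x l1 -> step q x l2 -> l1 <= l0 -> l2 <= l0 -> l1 = l2.
Proof.
move=> gb xb; have qb := center_ball q (ltW (gb_rho gb)).
have [be [Gb b0 b1]] := step_refl x.
suff H k1 k2 : step q x k1 -> step q x k2 -> k1 <= l0 -> k2 <= l0 -> k2 <= k1.
 by move=> S1 S2 h1 h2; apply/eqP; rewrite eq_le (H _ _ S1 S2)// (H _ _ S2 S1).
move=> [al [Ga a0 a1]] [ga [Gc c0 c1]] h1 h2.
have [] := gb_tri gb Ga Gb Gc; rewrite ?a0 ?a1 ?b0 ?b1 ?c0 ?c1 ?addr0//.
Qed.

Lemma local_step q r rho l0 : is_ball q r rho l0 -> exists2 d, 0 < d & d <= l0 /\ forall x, dist q x < d ->
 step q x (dist q x) /\ near_pt q rho x.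
Proof.
move=> gb; have [d d0 [dl H]] := local_chain gb; exists d => //; split=> // x xd.
have [l c ld] := dist_lt xd; have [xb [l1 l1l S1]] := H x l c ld.
split=> //; suff -> : dist q x = l1 by [].
apply/eqP; rewrite eq_le (dist_step S1)/=; apply: lb_le_inf; first by exists l.
move=> k ck; have [kd|dk] := ltP k d; last by rewrite (le_trans l1l)// (le_trans (ltW ld)).
have [_ [k1 k1k S2]] := H x k ck kd.
rewrite (@step_length_unique q r rho l0 x l1 k1)//.
 by rewrite (le_trans l1l)// (le_trans (ltW ld)).
by rewrite (le_trans k1k)// (le_trans (ltW kd)).
Qed.

(** The factor 4 of [short_arcs] becomes the Lipschitz constant of the distance; this is the 4 in
    the constant of the cutoffs. *)
Lemma dist_chart i (y0 : 'rV[R]_n) : chart_img (A := A) i y0 -> exists2 r : R, 0 < r & forall x y, in_ball i y0 r x -> in_ball i y0 r y ->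
 dist x y <= 4 * Num.sqrt (qf (g i y0) (chart i y - chart i x)).
Proof.
move=> Uy0; have [r [rho [l0 gb]]] := good_ball_exists hausM complg Uy0.
exists rho; first exact: gb_rho gb.
move=> x y xb yb; have [gam [l [G g0 g1 _ le]]] := gb_conn gb xb yb.
by apply: le_trans le; apply: dist_step; exists gam.
Qed.

Lemma dist_near q e : 0 < e -> \forall z \near q, dist q z < e.
Proof.
move=> e0; have dq := chart_atP A q; set i := chart_at A q in dq.
have [r r0 H] := dist_chart (imgP dq).
have N1 := near_ball dq r0.
have cN : {for q, continuous (fun z => 4 * Num.sqrt (qf (g i (chart i q)) (chart i z - chart i q)))}.
 apply: ctM; first exact: ct_cst.
 apply: (ct_rcomp (h := @Num.sqrt R)); last exact: sqrt_continuous.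
 rewrite (_ : (fun z => _) = (fun z => \sum_a \sum_b (chart i z 0 a - chart i q 0 a) * g i (chart i q) a b * (chart i z 0 b - chart i q 0 b))); last first.
  by fext z; rewrite /qf bfE; sumr a b; rewrite !mxsubE.
 have cc a : {for q, continuous (fun z => chart i z 0 a)}.
  by apply: (@ct_comp _ _ _ (chart i) (fun y : 'rV[R]_n => y 0 a) q (chart_continuous dq)); exact: Ck_cts (Ck_coord 0 a openT) I.
 apply: ct_sum => a _; apply: ct_sum => b _; apply: ctM; last by apply: ctB => //; exact: ct_cst.
 by apply: ctM; [apply: ctB => //; exact: ct_cst|exact: ct_cst].
have z0 : 4 * Num.sqrt (qf (g i (chart i q)) (chart i q - chart i q)) = 0.
 by rewrite subrr /qf /bf mul0mx mul0mx mxE sqrtr0 mulr0.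
have N2 : \forall z \near q, 4 * Num.sqrt (qf (g i (chart i q)) (chart i z - chart i q)) < e.
 have /cvgrPdist_lt/(_ _ e0) := cN; apply: filterS => z; rewrite z0 sub0r normrN.
 exact: le_lt_trans (ler_norm _).
apply: filterS2 N1 N2 => z zb; apply: le_lt_trans; apply: H => //.
by split=> //; rewrite subrr normr0 ltW.
Qed.

Lemma dist_lip p x y : `|dist p x - dist p y| <= dist x y.
Proof.
rewrite ler_norml; apply/andP; split.
 by have := dist_tri p x y; lra.
by have := dist_tri p y x; rewrite (dist_sym y x); lra.
Qed.

Lemma dist_cts p : continuous (dist p).
Proof.
move=> x; apply/cvgrPdist_le => e e0; have := dist_near x e0.
by apply: filterS => z /ltW; exact: le_trans (dist_lip _ _ _).
Qed.

Lemma dist_loc_lipschitz p : loc_lipschitz g 4 (dist p).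
Proof.
move=> i y0 Uy0; have [r1 r10 H] := dist_chart Uy0.
have [r2 r20 r2U] := open_ball_sub (open_img i) Uy0.
have rr (y : 'rV[R]_n) : `|y - y0| <= Num.min r1 r2 -> in_ball i y0 r1 (chart_inv i y) /\ chart i (chart_inv i y) = y.
 rewrite le_min => /andP[h1 h2]; have Uy : chart_img i y by rewrite -(subrK y0 y) addrC; exact: r2U.
 by split; [split; [exact: inv_dom|rewrite chart_invK]|exact: chart_invK].
exists (Num.min r1 r2); first by rewrite lt_min r10.
move=> y z /rr[yb ey] /rr[zb ez]; apply: (le_trans (dist_lip _ _ _)).
by rewrite dist_sym; have := H _ _ zb yb; rewrite ey ez.
Qed.

Lemma speed_cts gam l : has_speed g gam l -> continuous gam.
Proof. by move=> [[cg _] _ _]; exact: cg. Qed.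

Lemma dist0_eq p x : dist p x = 0 -> x = p.
Proof.
move=> d0; have [r [rho [l0 gb]]] := ball_exists p.
have [d dp [_ H]] := local_step gb; have [Lam L0 drift] := gb_drift gb.
have [S _] : step p x (dist p x) /\ near_pt p rho x by apply: H; rewrite d0.
move: S; rewrite d0 => -[gam [G g0 g1]].
have b0 : near_pt p 0 (gam 0) by rewrite g0; exact: center_ball.
have [dx xr] := drift gam 0 0 G (ltW (gb_l0 gb)) (ltW (gb_rho gb)) b0 1 (introT andP (conj ler01 (lexx 1))).
move: dx xr; rewrite g1 mulr0 addr0 => dx; rewrite normr_le0 subr_eq0 => /eqP E.
by rewrite -(chartK dx) E chartK//; exact: chart_atP.
Qed.

(** Some side of the chain passes from distance less than [s] to distance at least [s], and the
    intermediate value theorem finds the crossing on it. *)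
Lemma sphere_cross p x l s : chain p x l -> 0 < s -> s <= dist p x -> exists y, dist p y = s /\ s + dist y x <= l.
Proof.
move=> H s0; elim: H => [|y z l1 l2 c1 IH S2] sx; first by move: sx; rewrite distxx leNgt s0.
have [sy|ys] := leP s (dist p y).
 have [w [ws wl]] := IH sy; exists w; split=> //.
 by have := dist_tri w y z; have := dist_step S2; lra.
have [gam [G g0 g1]] := S2; have cg := speed_cts G.
have cf : {within `[0, 1], continuous (fun t => dist p (gam t))}.
 apply: continuous_subspaceT => t; exact: (@ct_comp M R R gam (dist p) t (cg t) (@dist_cts p (gam t))).
have [|t t01 ts] := IVT ler01 cf (v := s).
 by rewrite g0 g1 ge_min le_max (ltW ys) sx orbT.
move: t01; rewrite in_itv /= => /andP[t0 t1].
exists (gam t); split=> //.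
have h1 := dist_step (step_arc G t0); have h2 := dist_step (step_arc G t1).
rewrite subr0 g0 in h1; rewrite g1 in h2.
have := dist_tri p y (gam t); rewrite ts; have := dist_le c1.
rewrite mulrBl mul1r in h2; move: h1 h2; move: (t * l2) => u; lra.
Qed.

(** Small spheres are compact, so the sphere contains a point [y] nearest to [x]; every chain
    crosses the sphere, so none is shorter than the route through [y]. *)
Lemma sphere_split q (rho d : R) (i : chart_idx A) (y0 : 'rV[R]_n) : (forall y : 'rV[R]_n, `|y - y0| <= rho -> chart_img (A := A) i y) ->
 (forall x, dist q x < d -> in_ball i y0 rho x) ->
 forall s x, 0 < s -> s < d -> s <= dist q x -> exists y, dist q y = s /\ dist q x = s + dist y x.
Proof.
move=> rU H s x s0 sd sx.
pose S := [set y | dist q y = s].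
have cS : compact S.
 apply: (@subclosed_compact _ _ (@chart_inv _ _ _ A i @` [set y | `|y - y0| <= rho])).
 - apply: (preimage_closed (D := [set t | t = s])) => [y _|]; [exact: dist_cts|exact: closed_eq].
 - exact: closed_inv_ball.
 - by move=> y ys; have [dy yr] : in_ball i y0 rho y; [apply: H; rewrite ys|exists (chart i y) => //; rewrite chartK].
have [l0 c0] := chain_exists q x; have [w0 [w0s _]] := sphere_cross c0 s0 sx.
have [|y /set_mem ys ymin] := @compact_EVT_min M R (fun y => dist y x) S (ex_intro _ w0 w0s) cS.
 apply: continuous_subspaceT => y; under eq_fun do rewrite dist_sym; exact: dist_cts.
exists y; split=> //; apply/eqP; rewrite eq_le; apply/andP; split.
 by have := dist_tri q y x; rewrite ys.
apply: lb_le_inf; first by exists l0.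
move=> l c; have [w [ws wl]] := sphere_cross c s0 sx.
by have := ymin w (mem_set ws); lra.
Qed.

Lemma extend_minimal p x gam (T : R) : has_speed g gam 1 -> gam 0 = p -> 0 < T -> T < dist p x ->
 dist (gam T) x = dist p x - T ->
 exists2 e, 0 < e & forall t, T <= t -> t <= T + e -> dist (gam t) x = dist p x - t.
Proof.
move=> G g0 T0 TD qx; set D := dist p x; set q := gam T.
have [r [rho [l0 gb]]] := ball_exists q.
have [d d0 [dl loc]] := local_step gb; have l00 := gb_l0 gb; have rho0 := gb_rho gb.
set i := chart_at A q in gb loc; set y0 := chart i q in gb loc.
have DT : 0 < D - T by rewrite subr_gt0.
pose s1 := Num.min (d / 2) (Num.min (l0 / 2) (D - T)).
have s10 : 0 < s1 by rewrite !lt_min DT !divr_gt0.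
have s1d : s1 < d by rewrite gt_min ltr_pdivrMr// ltr_pMr// ltr1n.
have s1l : s1 <= l0 / 2 by rewrite !ge_min lexx !orbT.
have s1D : s1 <= dist q x by rewrite /q qx !ge_min lexx !orbT.
have [y [qy yx]] := sphere_split (fun (w : 'rV[R]_n) zr => gb_rU gb (le_trans zr (gb_rho_r gb))) (fun z zd => proj2 (loc z zd)) s10 s1d s1D.
rewrite /q qx -/D in yx.
have [Sb yb] : step q y (dist q y) /\ in_ball i y0 rho y by apply: loc; rewrite qy.
rewrite qy in Sb; have [be [Gb b0 b1]] := Sb.
have cg := speed_cts G.
have [dl1 dl10 nr] : exists2 dd : R, 0 < dd & forall t, `|T - t| < dd -> in_ball i y0 rho (gam t).
 have N : \forall t \near T, in_ball i y0 rho (gam t) := cg T _ (near_ball (chart_atP A q) rho0).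
 by have /nbhs_ballP[dd dd0 Nd] := N; exists dd.
pose a := Num.min (dl1 / 2) (Num.min T (l0 / 2)).
have a0 : 0 < a by rewrite !lt_min T0 !divr_gt0.
have al : a <= l0 / 2 by rewrite !ge_min lexx !orbT.
have aT : a <= T by rewrite !ge_min lexx !orbT.
have ad : a < dl1 by rewrite gt_min ltr_pdivrMr// ltr_pMr// ltr1n.
clearbody a s1.
have xb : in_ball i y0 rho (gam (T - a)) by apply: nr; rewrite subKr ger0_norm// ltW.
have asp : 0 < a + s1 by rewrite addr_gt0.
have asl : a + s1 <= l0 by lra.
have Ga : has_speed g (fun u => gam (a * u + (T - a))) a.
 by have := speed_affine a (T - a) G; rewrite mulr1 gtr0_norm.
have G2 : has_speed g (fun u => gam ((a + s1) * u + (T - a))) (a + s1).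
 by have := speed_affine (a + s1) (T - a) G; rewrite mulr1 gtr0_norm.
have [ga [L [Gc c0 c1 Ll _]]] := gb_conn gb xb yb.
have x2 : gam ((a + s1) * 0 + (T - a)) = gam (T - a) by rewrite mulr0 add0r.
have [LE Lb] : L <= a + s1 /\ (0 < a + s1 -> L = a + s1 -> ga (a / (a + s1)) = be 0).
 apply: (gb_tri gb Ga Gb Gc) => //.
 - by rewrite mulr0 add0r.
 - by rewrite b0; apply: center_ball; exact: ltW.
 - by rewrite mulr1 addrC subrK b0.
 - by rewrite mulr0 add0r.
 - by rewrite c1 b1.
have pxa : dist p (gam (T - a)) <= T - a.
 have h : 0 <= T - a by rewrite subr_ge0.
 by have := dist_step (step_arc G h); rewrite g0 subr0 mulr1.
have Lxy : dist (gam (T - a)) y <= L by apply: dist_step; exists ga.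
have Leq : L = a + s1.
 apply/eqP; rewrite eq_le LE /=; have := dist_tri p (gam (T - a)) x; have := dist_tri (gam (T - a)) y x.
 by rewrite -/D; lra.
have gaq := Lb asp Leq; rewrite b0 in gaq.
have bb : 0 < a / (a + s1) <= 1 by rewrite divr_gt0//= ler_pdivrMr// mul1r lerDl ltW.
have gb2 : in_ball i y0 rho (ga 0) by rewrite c0.
have g2b : in_ball i y0 rho (gam ((a + s1) * 0 + (T - a))) by rewrite x2.
have same u : 0 <= u <= 1 -> gam ((a + s1) * u + (T - a)) = ga u.
 move=> u01; have := gb_two gb Gc G2 Ll asl gb2 g2b bb u01.
 have e2 : gam ((a + s1) * (a / (a + s1)) + (T - a)) = q.
  by congr gam; rewrite mulrC divfK ?gt_eqF// addrC subrK.
 rewrite {3 4 5 6}/crd c0 x2 e2 gaq !subrr !normr0 addr0 mulr0 normr_le0 subr_eq0 => /eqP E.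
 have [d1 _] := gb_stay gb Gc Ll gb2 u01; have [d2 _] := gb_stay gb G2 asl g2b u01.
 by rewrite -(chartK d2) -(chartK d1); congr (chart_inv _ _); exact: (esym E).
exists s1 => // t Tt tT.
pose u := (t - (T - a)) / (a + s1).
have u0 : 0 <= u by rewrite divr_ge0 ?(ltW asp)//; lra.
have u1 : u <= 1 by rewrite ler_pdivrMr// mul1r; lra.
have tu : (a + s1) * u + (T - a) = t by rewrite /u mulrC divfK ?gt_eqF// subrK.
have gt : gam t = ga u by rewrite -same ?u0// tu.
have h1 : dist (gam t) y <= (1 - u) * L.
 by rewrite gt -c1; apply: dist_step; exact: step_arc.
have uL : (1 - u) * L = T + s1 - t.
 rewrite (_ : (1 - u) * L = L - (a + s1) * u); last by rewrite Leq; ring.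
 by rewrite Leq; move: tu; move: ((a + s1) * u) => k; lra.
have h2 : dist p (gam t) <= t.
 have h : 0 <= t by rewrite (le_trans (ltW T0)).
 by have := dist_step (step_arc G h); rewrite g0 subr0 mulr1.
have h3 := dist_tri (gam t) y x; have h4 := dist_tri p (gam t) x.
apply/eqP; rewrite eq_le; apply/andP; split; rewrite -/D in h4 *; lra.
Qed.

(** The Hopf-Rinow argument: the unit-speed geodesic towards the nearest point of a small sphere is
    followed for the time [dist p x], while the remaining distance decreases at unit rate.
    [extend_minimal] continues past each time; limit times follow from continuity. *)
Theorem minimal_step p x : step p x (dist p x).
Proof.
have [r [rho [l0 gb]]] := ball_exists p.
have [d d0 [dl loc]] := local_step gb.
have [xd|dx] := ltP (dist p x) d; first by case: (loc x xd).
set D := dist p x in dx *.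
have s0 : 0 < d / 2 by rewrite divr_gt0.
have sd : d / 2 < d by rewrite ltr_pdivrMr// ltr_pMr// ltr1n.
have sD : d / 2 <= D by apply: le_trans dx; exact: ltW.
have [y [py yx]] := sphere_split (fun (w : 'rV[R]_n) zr => gb_rU gb (le_trans zr (gb_rho_r gb))) (fun z zd => proj2 (loc z zd)) s0 sd sD.
have [[gam0 [G0 g00 g01]] _] : step p y (dist p y) /\ near_pt p rho y by apply: loc; rewrite py.
rewrite py in G0; move: s0 sd sD py yx G0; rewrite -/D; set s := d / 2 => s0 sd sD py yx G0.
pose gam t := gam0 (s^-1 * t + 0).
have G : has_speed g gam 1.
 by have := speed_affine s^-1 0 G0; rewrite gtr0_norm ?invr_gt0// mulVf// gt_eqF.
have ga0 : gam 0 = p by rewrite /gam mulr0 addr0.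
have gs : gam s = y by rewrite /gam mulVf ?gt_eqF// addr0.
have cg := speed_cts G.
have main : forall t, 0 <= t <= D - s -> dist (gam (s + t)) x = D - (s + t).
 apply: real_induction.
 - by rewrite subr_ge0.
 - by rewrite addr0 gs yx; ring.
 - move=> t /andP[t0 tD] H; have [|||e e0 He] := @extend_minimal p x gam (s + t) G ga0.
  + by rewrite ltr_pwDl.
  + by rewrite -/D; lra.
  + by apply: H; rewrite t0 lexx.
  exists e => // s' /andP[h1 h2]; apply: He; lra.
 - move=> t /andP[t0 tD] H.
  pose f t := dist (gam (s + t)) x - (D - (s + t)).
  suff : f t = 0 by rewrite /f => /eqP; rewrite subr_eq0 => /eqP.
  have cf : {for t, continuous f}.
   apply: ctB.
    apply: (@ct_comp M R R (fun t => gam (s + t)) (fun z => dist z x)).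
     have := @continuous_comp R R M (fun u => s + u) gam t; apply; last exact: cg.
     by apply: ctD; [exact: ct_cst|exact: cvg_id].
    have Ed : (fun z => dist z x) = dist x by fext z; exact: dist_sym.
    by rewrite Ed; exact: dist_cts.
   by apply: ctB; [exact: ct_cst|apply: ctD; [exact: ct_cst|exact: cvg_id]].
  apply/eqP; apply: contraT => fn0; have e0 : 0 < `|f t| by rewrite normr_gt0.
  have N : \forall u \near t, `|f t - f u| < `|f t| by have /cvgrPdist_lt/(_ _ e0) := cf.
  have /nbhs_ballP[dd dd0 Nd] := N.
  pose u := Num.max 0 (t - dd / 2).
  have ut : u < t by rewrite gt_max t0 ltrBlDr ltrDl divr_gt0.
  have u0 : 0 <= u by rewrite le_max lexx.
  have ud : `|t - u| < dd.
   rewrite ger0_norm ?subr_ge0 ?(ltW ut)// ltrBlDr -ltrBlDl lt_max; apply/orP; right.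
   by rewrite ltrD2l ltrN2 ltr_pdivrMr// ltr_pMr// ltr1n.
  have fu : f u = 0 by rewrite /f H ?u0// subrr.
  by have := Nd u ud; rewrite /= fu subr0 ltxx.
have xD : gam D = x.
 apply/esym/dist0_eq; have := main (D - s); rewrite subr_ge0 sD lexx => /(_ isT).
 by rewrite addrC subrK subrr.
have D0 : 0 <= D by exact: dist_ge0.
by have := step_arc G D0; rewrite ga0 xD subr0 mulr1.
Qed.

Section GeodesicLimits.
Context {T : Type} {G : set_system T} {PG : ProperFilter G}.
Variables (Gam : T -> R -> M) (ls : T -> R) (gam : R -> M) (l Lm : R).
Hypotheses (Gs : forall k, has_speed g (Gam k) (ls k)) (lsm : \forall k \near G, ls k <= Lm)
 (Gg : has_speed g gam l) (lm : l <= Lm) (Lm0 : 0 < Lm).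

Lemma cvg_chart i (h : T -> M) z : chart_dom (s := A) i z -> h @ G --> z -> chart i (h k) @[k --> G] --> chart i z.
Proof. by move=> dz hz; exact: (cvg_comp _ _ hz (chart_continuous dz)). Qed.

Lemma cvg_point i (h : T -> M) z : chart_dom (s := A) i z -> (\forall k \near G, chart_dom i (h k)) ->
 chart i (h k) @[k --> G] --> chart i z -> h @ G --> z.
Proof.
move=> dz dh hc.
have cz : chart_inv i y @[y --> chart i z] --> z.
 have H : chart_inv i y @[y --> chart i z] --> chart_inv i (chart i z) := chart_inv_continuous (imgP dz).
 by rewrite chartK in H.
have := cvg_comp _ _ hc cz; apply: cvg_trans; apply: near_eq_cvg.
by move: dh; apply: filterS => k dk; rewrite /= chartK.
Qed.

(** By [two_positions] a whole short arc is controlled by its positions at two times. This lets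
    convergence advance without tracking velocities at later times. *)
Lemma limit_window q r rho l0 (a h b : R) : is_ball q r rho l0 -> 0 < h -> h * Lm <= l0 ->
 near_pt q (rho / 2) (gam a) -> 0 < b <= 1 ->
 Gam k a @[k --> G] --> gam a -> Gam k (a + h * b) @[k --> G] --> gam (a + h * b) ->
 forall u, 0 <= u <= 1 -> Gam k (a + h * u) @[k --> G] --> gam (a + h * u).
Proof.
move=> gb h0 hL [da ar] bb ca cb u u01; set i := chart_at A q in gb da ar *; set y0 := chart i q in gb ar *.
have rho0 := gb_rho gb; have r2 : 0 < rho / 2 by rewrite divr_gt0.
have /andP[b0 b1] := bb.
have inb z : in_ball i (chart i (gam a)) (rho / 2) z -> in_ball i y0 rho z.
 move=> [dz zr]; split=> //; rewrite -(subrK (chart i (gam a)) (chart i z)) -addrA (le_trans (ler_normD _ _))//.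
 by have := lerD zr ar; rewrite -splitr.
have ga0 : in_ball i y0 rho (gam a) by apply: inb; split=> //; rewrite subrr normr0 ltW.
have N1 : \forall k \near G, in_ball i y0 rho (Gam k a).
 by have := ca _ (near_ball da r2); apply: filterS => k; exact: inb.
have sp k : has_speed g (fun u => Gam k (h * u + a)) (h * ls k).
 by have := speed_affine h a (Gs k); rewrite gtr0_norm.
have spg : has_speed g (fun u => gam (h * u + a)) (h * l).
 by have := speed_affine h a Gg; rewrite gtr0_norm.
have hl : h * l <= l0 by apply: le_trans hL; rewrite ler_wpM2l// ltW.
have st t : 0 <= t <= 1 -> chart_dom i (gam (h * t + a)).
 by move=> t01; have [] := gb_stay gb spg hl (_ : in_ball i y0 rho (gam (h * 0 + a))) t01; rewrite ?mulr0 ?add0r.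
have stk t : 0 <= t <= 1 -> \forall k \near G, chart_dom i (Gam k (h * t + a)).
 move=> t01; apply: filterS2 N1 lsm => k kb lk.
 have hlk : h * ls k <= l0 by apply: le_trans hL; rewrite ler_wpM2l// ltW.
 by have [] := gb_stay gb (sp k) hlk (_ : in_ball i y0 rho (Gam k (h * 0 + a))) t01; rewrite ?mulr0 ?add0r.
have b01 : 0 <= b <= 1 by rewrite ltW.
rewrite (addrC a); rewrite (addrC a) in cb.
apply: (@cvg_point i) => //; [exact: st|exact: stk|].
have cca := cvg_chart da ca.
have ccb := cvg_chart (st b b01) cb.
apply/cvgrPdist_le => e e0.
have e1 : 0 < e * b / 20 by rewrite !mulr_gt0// invr_gt0.
have /cvgrPdist_le/(_ _ e1) Na := cca; have /cvgrPdist_le/(_ _ e1) Nb := ccb.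
near=> k.
have lk : ls k <= Lm by near: k.
have kb : in_ball i y0 rho (Gam k a) by near: k.
have hlk : h * ls k <= l0 by apply: le_trans hL; rewrite ler_wpM2l// ltW.
have Ha : `|chart i (gam a) - chart i (Gam k a)| <= e * b / 20 by near: k.
have Hb : `|chart i (gam (h * b + a)) - chart i (Gam k (h * b + a))| <= e * b / 20 by near: k.
have := gb_two gb spg (sp k) hl hlk (_ : in_ball i y0 rho (gam (h * 0 + a))) (_ : in_ball i y0 rho (Gam k (h * 0 + a))) bb u01.
rewrite /crd mulr0 !add0r => /(_ ga0 kb) /le_trans; apply.
rewrite mulrAC ler_pdivrMr//; have := lerD Ha Hb; move: (`|_ - _|) (`|_ - _|) => x1 x2; lra.
Unshelve. all: by end_near. Qed.

(** Continuous dependence of geodesics on the initial velocity. The first window uses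
    [one_velocity]; every later one uses two positions at times already reached. *)
Lemma geo_limit : (forall k, Gam k 0 = gam 0) ->
 vel (crd (chart_at A (gam 0)) (Gam k)) 0 @[k --> G] --> vel (crd (chart_at A (gam 0)) gam) 0 ->
 forall t, 0 <= t <= 1 -> Gam k t @[k --> G] --> gam t.
Proof.
move=> start cv.
have cg := speed_cts Gg.
have window t : 0 <= t -> exists2 h, 0 < h & (t = 0 -> forall u, 0 <= u < h -> Gam k u @[k --> G] --> gam u) /\
 (0 < t -> (forall s, 0 <= s < t -> Gam k s @[k --> G] --> gam s) ->
  forall u, t <= u < t + h -> Gam k u @[k --> G] --> gam u).
 move=> t0; have [r [rho [l0 gb]]] := ball_exists (gam t).
 have rho0 := gb_rho gb; have l00 := gb_l0 gb; have r2 : 0 < rho / 2 by rewrite divr_gt0.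
 pose h := l0 / Lm; have h0 : 0 < h by rewrite divr_gt0.
 have hL : h * Lm = l0 by rewrite /h divfK// gt_eqF.
 exists (h / 2); first by rewrite divr_gt0.
 split=> [tz|tp conv].
  move=> u /andP[u0 uh]; rewrite tz in gb.
  set i := chart_at A (gam 0) in gb cv; set y0 := chart i (gam 0) in gb.
  have b0 : in_ball i y0 rho (gam 0) by apply: center_ball; exact: ltW.
  have sp k : has_speed g (fun u => Gam k (h * u + 0)) (h * ls k).
   by have := speed_affine h 0 (Gs k); rewrite gtr0_norm.
  have spg : has_speed g (fun u => gam (h * u + 0)) (h * l).
   by have := speed_affine h 0 Gg; rewrite gtr0_norm.
  have hl : h * l <= l0 by rewrite -hL ler_wpM2l// ltW.
  pose v := u / h; have uv : h * v + 0 = u by rewrite addr0 /v mulrC divfK// gt_eqF.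
  have v01 : 0 <= v <= 1.
   by rewrite divr_ge0 ?(ltW h0)//= ler_pdivrMr// mul1r (le_trans (ltW uh))// ler_pdivrMr// ler_peMr ?ler1n// ltW.
  have bg : in_ball i y0 rho (gam (h * 0 + 0)) by rewrite mulr0 addr0.
  have bk k : in_ball i y0 rho (Gam k (h * 0 + 0)) by rewrite mulr0 addr0 start.
  have hlk : \forall k \near G, h * ls k <= l0 by move: lsm; apply: filterS => k lk; rewrite -hL ler_wpM2l// ltW.
  have velh (c : R -> M) ll : has_speed g c ll -> c 0 = gam 0 -> vel (crd i (fun u => c (h * u + 0))) 0 = h *: vel (crd i c) 0.
   move=> [Gc _ _] c0; apply/rowP => m; rewrite mxscaleE.
   have dc : chart_dom i (c (h * 0 + 0)) by rewrite mulr0 addr0 c0; exact: chart_atP.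
   have [hc _] := geod_at Gc dc; have [D0 _] := hc m.
   have [_ E] := @affine_derive R (fun s => crd i c s 0 m) h 0 0 D0.
   by rewrite [LHS]mxE [LHS]derive1E E [in RHS]mxE mulr0 addr0.
  rewrite -uv; apply: (@cvg_point i).
  - by have [] := gb_stay gb spg hl bg v01.
  - by move: hlk; apply: filterS => k hk; have [] := gb_stay gb (sp k) hk (bk k) v01.
  apply/cvgrPdist_le => e e0; have e1 : 0 < e / (3 * h) by rewrite divr_gt0// mulr_gt0.
  have /cvgrPdist_le/(_ _ e1) Nv := cv.
  apply: filterS2 hlk Nv => k hk vk.
  have := gb_vel gb spg (sp k) hl hk bg (bk k) v01.
  rewrite (velh _ _ Gg)// (velh _ _ (Gs k))// -scalerBr normrZ gtr0_norm//.
  have E0 : crd i (fun u1 : R => gam (h * u1 + 0)) 0 = crd i (fun u1 : R => Gam k (h * u1 + 0)) 0.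
   by rewrite /crd mulr0 addr0 start.
  rewrite -/i E0 subrr normr0 add0r => /le_trans; apply.
  have h3 : 0 < 3 * h by rewrite mulr_gt0.
  rewrite mulrA; apply: (le_trans (ler_wpM2l (ltW h3) vk)).
  by rewrite mulrC divfK ?gt_eqF.
 have [dd dd0 nr] : exists2 dd : R, 0 < dd & forall s, `|t - s| < dd -> in_ball (chart_at A (gam t)) (chart (chart_at A (gam t)) (gam t)) (rho / 2) (gam s).
  have N : \forall s \near t, in_ball (chart_at A (gam t)) (chart (chart_at A (gam t)) (gam t)) (rho / 2) (gam s) := cg t _ (near_ball (chart_atP A (gam t)) r2).
  by have /nbhs_ballP[dd dd0 Nd] := N; exists dd.
 pose w := Num.min (dd / 2) (Num.min t (h / 2)).
 have w0 : 0 < w by rewrite !lt_min tp !divr_gt0.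
 have wt : w <= t by rewrite !ge_min lexx !orbT.
 have wh : w <= h / 2 by rewrite !ge_min lexx !orbT.
 have wd : w < dd by rewrite gt_min ltr_pdivrMr// ltr_pMr// ltr1n.
 clearbody w.
 have ab : in_ball (chart_at A (gam t)) (chart (chart_at A (gam t)) (gam t)) (rho / 2) (gam (t - w)).
  by apply: nr; rewrite subKr gtr0_norm.
 have bb : 0 < w / 2 / h <= 1.
  by rewrite !divr_gt0//= ler_pdivrMr// mul1r; move: wh h0; move: (h) => hh; lra.
 have W := @limit_window (gam t) r rho l0 (t - w) h (w / 2 / h) gb h0 _ ab bb _ _.
 move=> u /andP[tu ut].
 have := W _ _ _ ((u - (t - w)) / h).
 have -> : t - w + h * ((u - (t - w)) / h) = u by rewrite mulrC divfK ?gt_eqF// addrC subrK.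
 apply.
 - by rewrite hL.
 - by apply: conv; rewrite subr_ge0 wt ltrBlDr ltrDl.
 - have -> : t - w + h * (w / 2 / h) = t - w / 2 by rewrite mulrC divfK ?gt_eqF//; field.
  apply: conv; apply/andP; split; lra.
 - by rewrite divr_ge0 ?(ltW h0)//= ?ler_pdivrMr// ?mul1r; move: wh ut tu h0; move: (h) => hh; lra.
apply: real_induction.
- exact: ler01.
- by under eq_fun do rewrite start; exact: cvg_cst.
- move=> t /andP[t0 t1] H; have [h h0 [W0 W1]] := window t t0; exists h => // s /andP[ts sh].
 have [tz|tn] := eqVneq t 0; first by apply: W0 => //; rewrite tz add0r in sh; rewrite (le_trans t0 ts) sh.
 apply: W1; rewrite ?ts ?sh//; first by rewrite lt_neqAle eq_sym tn.
 by move=> s' /andP[h1 h2]; apply: H; rewrite h1 ltW.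
- move=> t /andP[t0 t1] H; have [h h0 [_ W1]] := window t (ltW t0).
 by apply: W1 => //; rewrite lexx ltrDl.
Qed.

End GeodesicLimits.

(** Each point of the ball is the endpoint of a minimising geodesic from [p], so the ball is a
    closed subset of the image of a compact set of velocities under [E], the exponential map at
    [p]. *)
Lemma compact_dist_ball p (rho : R) : compact [set x | dist p x <= rho].
Proof.
have dp := chart_atP A p; set i := chart_at A p in dp; have Up := imgP dp.
have [S SP] := choice (fun v => geodesic_exists complg v dp).
have G v := let: And3 a _ _ := SP v in a.
have S0 v : S v 0 = p by case: (SP v).
have Sv v : vel (crd i (S v)) 0 = v by case: (SP v).
have [c1 c10 low1] := norm_qf_le (lm_sym (metric_at g i) Up) (g_posdef g Up).
have [c2 c20 up2] := qf_norm_le (g i (chart i p)).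
pose E v := S v 1.
have cE : continuous E.
 move=> v0; pose Lm := Num.sqrt (c2 * (`|v0| + 1) ^+ 2) + 1.
 have Lm0 : 0 < Lm by rewrite ltr_wpDl ?sqrtr_ge0.
 have lsm v : `|v| <= `|v0| + 1 -> Num.sqrt (qf (g i (chart i p)) v) <= Lm.
  move=> vv; have h : Num.sqrt (qf (g i (chart i p)) v) <= Num.sqrt (c2 * (`|v0| + 1) ^+ 2).
   rewrite ler_wsqrtr//; apply: (le_trans (up2 v)); rewrite ler_wpM2l ?(ltW c20)//.
   by rewrite lerXn2r ?nnegrE ?addr_ge0.
  by apply: (le_trans h); rewrite /Lm lerDl.
 have N : \forall v \near v0, Num.sqrt (qf (g i (chart i p)) v) <= Lm.
  have N1 : \forall v \near v0, `|v0 - v| < 1.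
   by apply/nbhs_ballP; exists 1; [exact: ltr01|move=> v; rewrite -ball_normE].
  move: N1; apply: filterS => v vv; apply: lsm; rewrite -(subrK v0 v) addrC (le_trans (ler_normD _ _))// lerD2l distrC ltW//.
 have v0m : Num.sqrt (qf (g i (chart i p)) v0) <= Lm by apply: lsm; rewrite lerDl.
 apply: (@geo_limit _ _ _ S _ (S v0) _ Lm G N (G v0) v0m Lm0).
 - by move=> v; rewrite !S0.
 - by rewrite S0 -/i Sv; under eq_fun do rewrite Sv; exact: cvg_id.
 - by rewrite ler01 lexx.
apply: (@subclosed_compact _ _ (E @` [set v | `|v| <= c1 * rho])).
- by apply: (preimage_closed (D := [set t | t <= rho])) => [x _|]; [exact: dist_cts|exact: closed_le].
- apply: continuous_compact; first exact: continuous_subspaceT.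
 apply: bounded_closed_compact.
  exists (c1 * rho); split; first exact: num_real.
  by move=> b bb v vD; apply: ltW; exact: le_lt_trans vD bb.
 by have := @closed_cball R n 0 (c1 * rho); congr closed; apply/seteqP; split => v /=; rewrite subr0.
move=> x /= xr; have [gam [Gg g0 g1]] := minimal_step p x.
pose v := vel (crd i gam) 0.
have dg0 : chart_dom i (gam 0) by rewrite g0.
have vq : qf (g i (chart i p)) v = dist p x ^+ 2.
 by have [_ _ H] := Gg; rewrite -(H i 0 dg0) /spd /crd g0.
have vr : `|v| <= c1 * rho.
 by rewrite (le_trans (low1 v))// vq sqrtr_sqr ger0_norm ?dist_ge0// ler_wpM2l// ltW.
exists v => //; rewrite /E -g1.
have spv := G v; rewrite vq sqrtr_sqr ger0_norm ?dist_ge0// in spv.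
have d1 : dist p x <= dist p x + 1 by rewrite lerDl.
have dpos : 0 < dist p x + 1 by rewrite ltr_wpDl ?dist_ge0.
have NW : \forall k \near \oo, (fun _ : nat => dist p x) k <= dist p x + 1 by apply: nearW.
(* The chosen geodesic [S v] and the minimising one have the same initial velocity; [geo_limit] for
   a constant sequence shows that they end at the same point. *)
have := @geo_limit nat \oo eventually_filter (fun=> gam) (fun=> dist p x) (S v) _ (dist p x + 1) (fun=> Gg) NW spv d1 dpos.
rewrite S0 -/i Sv => /(_ (fun=> g0) (cvg_cst _) 1); rewrite ler01 lexx => /(_ isT) H.
have H2 : (fun _ : nat => gam 1) @ \oo --> gam 1 by exact: cvg_cst.
exact: (cvg_unique hausM H H2).
Qed.

(** The cutoff is 1 within distance [k.+1] of a base point and 0 beyond twice that distance; the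
    slope [1 / k.+1] scales the Lipschitz constant of the distance. *)
Lemma cutoff_exists : exists psi : nat -> M -> R, [/\
 forall k, [/\ continuous (psi k), forall x, 0 <= psi k x <= 1 & loc_lipschitz g (4 / k.+1%:R) (psi k)],
 forall k, exists2 K : set M, compact K & forall x, psi k x != 0 -> K x &
 forall x, exists N, forall k, (N <= k)%N -> psi k x = 1].
Proof.
pose p : M := point; pose psi k x := Num.max 0 (Num.min 1 (2 - dist p x / k.+1%:R)).
have clamp_lip (a b : R) : `|Num.max 0 (Num.min 1 a) - Num.max 0 (Num.min 1 b)| <= `|a - b|.
 rewrite /Num.max /Num.min; do ! case: ifPn => //; rewrite -?leNgt => *; rewrite ?subrr ?normr0 ?normr_ge0//;
 rewrite ler_norml; apply/andP; split; try (by have := ler_norm (a - b); have := ler_norm (b - a); rewrite (distrC b a); lra);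
 by have := ler_norm (a - b); have := ler_norm (b - a); rewrite (distrC b a); lra.
have kp k : 0 < k.+1%:R^-1 :> R by rewrite invr_gt0.
have lip k x y : `|psi k x - psi k y| <= `|dist p x - dist p y| / k.+1%:R.
 rewrite (le_trans (clamp_lip _ _))//.
 have -> : 2 - dist p x / k.+1%:R - (2 - dist p y / k.+1%:R) = - ((dist p x - dist p y) / k.+1%:R).
  by move: (k.+1%:R^-1) => e; ring.
 by rewrite normrN normrM (gtr0_norm (kp k)).
exists psi; split.
- move=> k; split.
 + move=> x; apply/cvgrPdist_le => e e0.
  have e1 : 0 < e * k.+1%:R by rewrite mulr_gt0.
  have /cvgrPdist_le/(_ _ e1) := @dist_cts p x; apply: filterS => z h.
  by rewrite (le_trans (lip k x z))// ler_pdivrMr.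
 + by move=> x; rewrite le_max lexx/= ge_max ler01 ge_min lexx.
 + move=> i y0 Uy0; have [r r0 H] := @dist_loc_lipschitz p i y0 Uy0; exists r => // y z yr zr.
  rewrite (le_trans (lip _ _ _))// -mulrAC ler_pM2r// [leRHS](_ : _ = 4 * Num.sqrt (qf (g i y0) (y - z)))//.
  exact: H.
- move=> k; exists [set x | dist p x <= 2 * k.+1%:R]; first exact: compact_dist_ball.
 move=> x; apply: contra_neqP => /negP; rewrite -ltNge -ltr_pdivlMr// => h.
 by rewrite /psi; apply/max_idPl; rewrite ge_min subr_le0 (ltW h) orbT.
- move=> x; exists (Num.bound (dist p x)) => k Nk.
 have h : dist p x <= k.+1%:R.
  have := archi_boundP (dist_ge0 p x) => /ltW /le_trans; apply.
  by rewrite ler_nat (leq_trans Nk).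
 have h2 : dist p x / k.+1%:R <= 1 by rewrite ler_pdivrMr// mul1r.
 rewrite /psi; have -> : Num.min 1 (2 - dist p x / k.+1%:R) = 1 by apply/min_idPl; move: h2; move: (_ / _) => u; lra.
 by apply/max_idPr; exact: ler01.
Qed.

End Distance.

(** * Integral estimates on shrinking solitons *)
Section RealInequalities.
Context {R : realType}.
Implicit Types (u a X Y Z B N kap al q p : R).

(** Compare [X] with [N * B]. A lower power is traded for a small multiple of the next one plus a
    constant, which is how the cutoff error is absorbed. *)
Lemma power_split (N B X : R) (m : nat) : 1 <= N -> 0 <= B -> 0 <= X ->
 B * X ^+ m <= X ^+ m.+1 / N + (N * B) ^+ m.+1.
Proof.
move=> N1 B0 X0; have N0 : 0 < N by apply: lt_le_trans N1.
have NB0 : 0 <= N * B by rewrite mulr_ge0// ltW.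
have [XB|BX] := leP X (N * B).
 apply: (@le_trans _ _ ((N * B) ^+ m.+1)); last by rewrite lerDr divr_ge0 ?exprn_ge0// ltW.
 rewrite exprS; apply: ler_pM => //; rewrite ?exprn_ge0//; last by rewrite lerXn2r ?nnegrE.
 by rewrite ler_peMl.
apply: (@le_trans _ _ (X ^+ m.+1 / N)); last by rewrite lerDl exprn_ge0.
by rewrite ler_pdivlMr// exprS mulrAC ler_wpM2r ?exprn_ge0// mulrC ltW.
Qed.

Lemma cross_le (X Y Z c p : R) : 0 < p -> 0 <= Y -> 0 <= Z -> X ^+ 2 <= Y * Z ->
 c * X <= p / 2 * Y + c ^+ 2 * Z / (2 * p).
Proof.
move=> p0 Y0 Z0 XYZ.
have S0 : 0 <= p / 2 * Y + c ^+ 2 * Z / (2 * p).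
 apply: addr_ge0; first by rewrite mulr_ge0// divr_ge0// ltW.
 by rewrite divr_ge0// mulr_ge0 ?sqr_ge0// ltW.
have sq : (c * X) ^+ 2 <= (p / 2 * Y + c ^+ 2 * Z / (2 * p)) ^+ 2.
 apply: (@le_trans _ _ (c ^+ 2 * (Y * Z))); first by rewrite exprMn ler_wpM2l ?sqr_ge0.
 rewrite -subr_ge0 (_ : _ - _ = (p / 2 * Y - c ^+ 2 * Z / (2 * p)) ^+ 2) ?sqr_ge0//.
 by field; rewrite gt_eqF.
by rewrite (le_trans (ler_norm _))// -(@ler_pXn2r _ 2) ?nnegrE// real_normK// num_real.
Qed.

(** Here [r] is $R$, [u] its negative part, and [X], [Y], [Z] are $\langle\nabla f,\nabla R\rangle$,
    $|\nabla R|^2$, $|\nabla f|^2$. Half of [p * Y] absorbs the term with [X], the other half the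
    cutoff term. The gain $2u|Ric|^2 \ge 2u^3/N$ pays once for the cubic remainder of the former,
    thanks to [al ^+ 2 * N <= p], and once, through [power_split], for the remainder of the
    latter. *)
Lemma scalar_key (al q ft r S2 X Y Z N kap ps : R) (m : nat) (p := m.+2%:R : R) (u := Num.max (- r) 0) :
 1 <= N -> r ^+ 2 <= N * S2 -> X ^+ 2 <= Y * Z -> 0 <= Y -> Z = ft - r -> 0 <= Z ->
 0 <= q <= 1 -> q * ft <= 1 -> al ^+ 2 * N <= p -> 0 <= ps <= 1 -> 0 <= kap ->
 2^-1 * (ps ^+ (2 * m.+2) * u ^+ m.+3) - (N * (kap ^+ 2 / (2 * p))) ^+ m.+2 * u ^+ 2 <=
 ps ^+ (2 * m.+2) * (u ^+ m.+2 * (2 * S2 - r) - al * q * (u ^+ m.+2 * X) + p * (u ^+ m.+1 * Y))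
 - kap * (ps ^+ (2 * m.+2).-1 * (u ^+ m.+2 * Num.sqrt Y)).
Proof.
move=> N1 rN XYZ Y0 ZE Z0 /andP[q0 q1] qft alp /andP[ps0 ps1] kap0.
have p0 : 0 < p by rewrite ltr0n.
have N0 : 0 < N by apply: lt_le_trans N1.
have [r0|r0] := leP 0 r.
 have u0 : u = 0 by rewrite /u; apply/max_idPr; rewrite oppr_le0.
 by rewrite u0 !(exprS 0) !(mul0r, mulr0, addr0, oppr0).
have uE : u = - r by rewrite /u; apply/max_idPl; rewrite oppr_ge0 ltW.
have u0 : 0 < u by rewrite uE oppr_gt0.
have rE : r = - u by rewrite uE opprK.
clearbody u; subst r.
set B := kap ^+ 2 / (2 * p).
have B0 : 0 <= B by rewrite divr_ge0 ?sqr_ge0// mulr_ge0// ltW.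
have al2 : al ^+ 2 <= p by apply: le_trans alp; rewrite ler_peMr// sqr_ge0.
(* [Z] is [ft + u], and the factor [q] tames the unbounded potential through [q * ft <= 1]. *)
have qZ : q ^+ 2 * Z <= 1 + u.
 have qq : q ^+ 2 <= 1 by rewrite expr_le1.
 rewrite ZE opprK mulrDr; apply: lerD; last by rewrite ler_piMl// ltW.
 have [f0|f0] := leP 0 ft.
  rewrite expr2 -mulrA (le_trans _ qft)// ler_piMl// mulr_ge0//.
 by apply: (@le_trans _ _ 0) => //; rewrite mulr_ge0_le0 ?sqr_ge0// ltW.
have c1 := @cross_le X Y Z (al * q * u) p p0 Y0 Z0 XYZ.
have c2 : (al * q * u) ^+ 2 * Z / (2 * p) <= 2^-1 * u ^+ 2 + u ^+ 3 / N.
 have -> : (al * q * u) ^+ 2 * Z / (2 * p) = (al ^+ 2 / (2 * p)) * (u ^+ 2 * (q ^+ 2 * Z)).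
  by move: p0 => pp; field; rewrite gt_eqF.
 apply: (@le_trans _ _ ((al ^+ 2 / (2 * p)) * (u ^+ 2 * (1 + u)))).
  rewrite ler_wpM2l// ?ler_wpM2l ?sqr_ge0//.
  by rewrite divr_ge0 ?sqr_ge0// mulr_ge0// ltW.
 rewrite (_ : u ^+ 2 * (1 + u) = u ^+ 2 + u ^+ 3); last by ring.
 rewrite mulrDr; apply: lerD.
  rewrite ler_wpM2r ?sqr_ge0// ler_pdivrMr ?mulr_gt0//.
  by rewrite mulrA mulVf// mul1r.
 rewrite mulrC ler_wpM2l ?exprn_ge0 ?(ltW u0)// ler_pdivrMr ?mulr_gt0//.
 rewrite mulrC ler_pdivlMr//; apply: (le_trans alp); rewrite ler_peMl ?ler1n//; exact: ltW.
have c3 : kap * ps * u * Num.sqrt Y <= p / 2 * (ps ^+ 2 * Y) + B * u ^+ 2.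
 have := @cross_le (ps * Num.sqrt Y) (ps ^+ 2 * Y) 1 (kap * u) p p0 _ ler01 _.
 rewrite mulr_ge0 ?sqr_ge0// mulr1 exprMn sqr_sqrtr// lexx => /(_ isT isT).
 rewrite mulr1 (_ : kap * u * (ps * Num.sqrt Y) = kap * ps * u * Num.sqrt Y); last by ring.
 by rewrite (_ : (kap * u) ^+ 2 / (2 * p) = B * u ^+ 2)//; rewrite /B exprMn; ring.
have S2l : u ^+ 2 / N <= S2 by rewrite ler_pdivrMr// mulrC -[u ^+ 2]sqrrN.
set a := ps ^+ 2; have a0 : 0 <= a by exact: sqr_ge0.
have br : a * (2^-1 * u ^+ 2 + u ^+ 3 / N) - B * u ^+ 2 <=
  a * (u * (2 * S2 + u) - al * q * (u * X) + p * Y) - kap * (ps * (u * Num.sqrt Y)).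
 have h1 : 2^-1 * u ^+ 2 + u ^+ 3 / N + p / 2 * Y <= u * (2 * S2 + u) - al * q * (u * X) + p * Y.
  have h : u * (u ^+ 2 / N) <= u * S2 by rewrite ler_wpM2l// ltW.
  rewrite mulrA -exprS in h; rewrite (_ : al * q * (u * X) = al * q * u * X); last by ring.
  move: c1 c2 h; set V1 := al * q * u * X; set V2 := _ * Z / _; set V3 := u ^+ 3 / N.
  have -> : u * (2 * S2 + u) = 2 * (u * S2) + u ^+ 2 by ring.
  have -> : p * Y = p / 2 * Y + p / 2 * Y by field.
  move: (u * S2) (u ^+ 2) (p / 2 * Y) => w1 w2 w3; lra.
 have h2 := ler_wpM2l a0 h1; rewrite mulrDr in h2.
 rewrite (_ : kap * (ps * (u * Num.sqrt Y)) = kap * ps * u * Num.sqrt Y); last by ring.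
 rewrite (_ : p / 2 * (ps ^+ 2 * Y) = a * (p / 2 * Y)) in c3; last by rewrite /a; ring.
 by move: h2 c3; move: (a * _) (a * _) (a * _) (B * _) (kap * ps * u * _) => w1 w2 w3 w4 w5; lra.
have Pm : 0 <= (a * u) ^+ m.+1 by rewrite exprn_ge0// mulr_ge0// ltW.
have := ler_wpM2l Pm br.
have e1 : (2 * m.+2)%N = (2 * m.+1).+2 by rewrite mulnS.
have pw k : ps ^+ (2 * k) = a ^+ k by rewrite exprM.
have -> : ps ^+ (2 * m.+2) = a * a ^+ m.+1 by rewrite pw exprS.
have -> : ps ^+ (2 * m.+2).-1 = ps * a ^+ m.+1 by rewrite e1 -pw -exprS.
rewrite opprK; have sp := power_split m.+1 N1 B0 (mulr_ge0 a0 (ltW u0)).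
have sp2 := ler_wpM2r (sqr_ge0 u) sp.
have -> : (a * u) ^+ m.+1 * (a * (u * (2 * S2 + u) - al * q * (u * X) + p * Y) - kap * (ps * (u * Num.sqrt Y))) =
 a * a ^+ m.+1 * (u ^+ m.+2 * (2 * S2 + u) - al * q * (u ^+ m.+2 * X) + p * (u ^+ m.+1 * Y)) -
 kap * (ps * a ^+ m.+1 * (u ^+ m.+2 * Num.sqrt Y)).
 by rewrite exprMn [u ^+ m.+2]exprS; ring.
apply: le_trans.
clearbody a B.
have -> : (a * u) ^+ m.+1 * (a * (2^-1 * u ^+ 2 + u ^+ 3 / N) - B * u ^+ 2) =
 2^-1 * (a * a ^+ m.+1 * u ^+ m.+3) + ((a * u) ^+ m.+2 / N - B * (a * u) ^+ m.+1) * u ^+ 2.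
 by rewrite !exprMn (exprS a m.+1) (exprS u m.+2) (exprS u m.+1); move: (a ^+ m.+1) (u ^+ m.+1) => v w; field; rewrite gt_eqF.
by rewrite lerD2l; move: sp2; rewrite mulrDl mulrBl; move: (_ * u ^+ 2) (_ * u ^+ 2) (_ * u ^+ 2) => w1 w2 w3; lra.
Qed.

End RealInequalities.

(** * Tensor norms and soliton identities on the manifold *)

Section SolitonManifold.
Context {R : realType} {n : nat} {M : ptopologicalType} {A : smooth_atlas R n M}.
Local Notation rV := 'rV[R]_n.
Implicit Types (i j : chart_idx A) (x : M).
Variable g : riemannian_metric A.

Fixpoint Ck_tens k (U : set rV) : (rV -> tensor R n k) -> Prop :=
 if k is k'.+1 return (rV -> tensor R n k) -> Prop
 then fun T => forall a, Ck_tens U (fun y => T y a) else fun T => Ck_on 0 U T.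

Lemma Ck_tinner k i (S T : rV -> tensor R n k) : Ck_tens (chart_img i) S -> Ck_tens (chart_img i) T ->
 Ck_on 0 (chart_img i) (fun y => tinner (g i y) (S y) (T y)).
Proof.
elim: k S T => [|k IH] S T CS CT; first by apply: CkM => //; exact: open_img.
by apply: Ck_gtrace => a b; exact: (IH (S ^~ a) (T ^~ b)).
Qed.

Definition natural k (T : (rV -> 'M[R]_n) -> rV -> tensor R n k) :=
 forall U V g gt tau, local_metric U g -> coord_change U V g gt tau -> forall y, V y ->
  T gt y = tpull (jac tau y) (T g (tau y)).

Definition tnormM k (T : (rV -> 'M[R]_n) -> rV -> tensor R n k) : M -> R :=
 glue (A := A) (fun i y => tnorm2 (g i y) (T (g i) y)).

Section Norm.
Variables (k : nat) (T : (rV -> 'M[R]_n) -> rV -> tensor R n k).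
Hypothesis nT : natural T.

Lemma cts_tnormM : (forall i, Ck_tens (chart_img i) (T (g i))) -> continuous (tnormM T).
Proof.
move=> cT; apply: (@Ck_fun_cts _ _ _ A 0); apply: glue_Ck => [|i]; last exact: Ck_tinner.
by apply: tnorm_compat => i j y; apply: nT; [exact: metric_at|exact: chart_change].
Qed.

Lemma tnormM_ge0 x : 0 <= tnormM T x.
Proof.
have iy := imgP (chart_atP A x).
exact: tnorm2_ge0 (Defs.metric_sym g iy) (g_posdef g iy).
Qed.

End Norm.

Lemma natural_dric : natural (@dric_tens R n).
Proof. by move=> U V h gt tau lm cc y Vy; exact: (dric_tens_tr lm cc). Qed.

Lemma natural_skew : natural (@skew_tens R n).
Proof. by move=> U V h gt tau lm cc y Vy; exact: (skew_tens_tr lm cc). Qed.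

Lemma natural_riem : natural (@riem_tens R n).
Proof. by move=> U V h gt tau lm cc y Vy; exact: (riem_tens_tr lm cc). Qed.

Definition ric_tens (h : rV -> 'M[R]_n) y : tensor R n 2 := tens2 (ricm h y).

Lemma natural_ric : natural ric_tens.
Proof. by move=> U V h gt tau lm cc y Vy; exact: (ric_tens_tr lm cc). Qed.

Definition scalM : M -> R := glue (A := A) (fun i y => scal (g i) y).
Definition driftM : chart_idx A -> rV -> 'cV[R]_n := fun i => driftW (g i).
Definition dscalM : chart_idx A -> rV -> 'cV[R]_n := fun i => grad (scal (g i)).

Lemma scal_compat : compatible (A := A) (fun i y => scal (g i) y).
Proof. by apply: (scalar_compat_tr (g := g)) => i j y cc Vy; exact: (scal_tr (metric_at g j) cc). Qed.

Lemma at_point_Rm x : at_point g (@Rm_norm2 R n) x = tnormM (@riem_tens R n) x.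
Proof.
rewrite /at_point /Rm_norm2 /tnormM /glue /riem_tens; congr tnorm2.
fext a; fext b; fext c; fext d.
by rewrite /tens4 (riemE (metric_at g _))//; exact/imgP/chart_atP.
Qed.

Lemma at_point_nabla_Ric x : at_point g (@nabla_Ric_norm2 R n) x = tnormM (@dric_tens R n) x.
Proof.
rewrite /at_point /nabla_Ric_norm2 /tnormM /glue /dric_tens; congr tnorm2.
by fext a; fext b; fext c; rewrite nabla_RicE.
Qed.

Lemma vdotZl (G : 'M[R]_n) (a : R) u v : vdot G (a *: u) v = a * vdot G u v.
Proof.
rewrite !vdotE /gtrace mulr_sumr; sumr p; rewrite mulr_sumr; sumr q.
by rewrite mxscaleE; ring.
Qed.

Lemma dotM_comp (h : M -> R) (v v' : R -> R) w x : Ck_fun A 1 h ->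
 (forall t : R, is_der t v (v' t)) -> continuous v' -> covector w ->
 Ck_fun A 1 (fun x => v (h x)) /\ dotM g (gradM (fun x => v (h x))) w x = v' (h x) * dotM g (gradM h) w x.
Proof.
move=> Ch dv cv cw.
have Cvh : Ck_fun A 1 (fun x => v (h x)).
 by move=> i; have [] := C1_comp (open_img i) (Ch i) dv cv.
split=> //; have dx := chart_atP A x.
rewrite (@dotE _ _ _ _ g _ _ _ _ (cov_gradM g Cvh) cw dx).
rewrite (@dotE _ _ _ _ g _ _ _ _ (cov_gradM g Ch) cw dx) -vdotZl; congr vdot.
apply/colP => a; have [_ pE] := C1_comp (open_img _) (Ch (chart_at A x)) dv cv.
by rewrite mxscaleE !mxE (pd_val (pE a _ (imgP dx))) chartK.
Qed.

Lemma dotM_gradM (f1 f2 : M -> R) w x : Ck_fun A 1 f1 -> Ck_fun A 1 f2 -> covector w ->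
 dotM g (gradM (fun x => f1 x * f2 x)) w x = f2 x * dotM g (gradM f1) w x + f1 x * dotM g (gradM f2) w x.
Proof.
move=> C1 C2 cw; have dx := chart_atP A x.
have C12 := Ck_funM C1 C2.
rewrite (@dotE _ _ _ _ g _ _ _ _ (cov_gradM g C12) cw dx).
rewrite (@dotE _ _ _ _ g _ _ _ _ (cov_gradM g C1) cw dx).
rewrite (@dotE _ _ _ _ g _ _ _ _ (cov_gradM g C2) cw dx) -!vdotZl -vdotDl; congr vdot.
apply/colP => a; rewrite mxaddE !mxscaleE !mxE partialM.
- by rewrite chartK// mulrC.
- exact: (Ck_der a (C1 _) (imgP dx)).
- exact: (Ck_der a (C2 _) (imgP dx)).
Qed.

Variable f : M -> R.
Hypothesis connM : connected [set: M].
Hypothesis solf : shrinking_soliton g f.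

Lemma soliton_at i : local_soliton (chart_img i) (g i) (fun y => f (chart_inv i y)).
Proof.
split; [exact: metric_at|exact: (solf.1 i)|move=> y iy; apply/matrixP => a b].
by rewrite mxsubE mxscaleE -(solf.2 i y iy a b) !mxE addrK.
Qed.

Lemma grad_eq_on (U : set rV) (F G : rV -> R) y : open U -> (forall z, U z -> F z = G z) ->
 U y -> grad F y = grad G y.
Proof. by move=> oU FG Uy; apply/colP => a; rewrite !mxE; exact: pd_eq_on FG Uy. Qed.

Let pos i y (iy : chart_img i y) := g_posdef g iy.

Lemma Ck_fun_potential k : Ck_fun A k f.
Proof. by move=> i; exact: (solf.1 i). Qed.

Lemma Ck_fun_scal k : Ck_fun A k scalM.
Proof. by apply: glue_Ck => [|i]; [exact: scal_compat|exact: smooth_scal (soliton_at i) k]. Qed.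

Lemma covector_driftM : covector driftM.
Proof. by move=> i j y Vy; exact: (driftW_tr (metric_at g j) (chart_change g i j)). Qed.

Lemma smooth_driftM : smooth_cov driftM.
Proof. by move=> i; exact: smooth_driftW (soliton_at i). Qed.

Lemma covector_dscalM : covector dscalM.
Proof. by move=> i j y Vy; exact: (grad_scal_tr (soliton_at j) (chart_change g i j)). Qed.

Lemma smooth_dscalM : smooth_cov dscalM.
Proof. by move=> i; exact: (smooth_grad (metric_at g i) (smooth_scal (soliton_at i))). Qed.

Lemma chart_inv_scal i y : chart_img i y -> scalM (chart_inv i y) = scal (g i) y.
Proof. exact: (glue_inv scal_compat). Qed.

Lemma gradM_scalM i y : chart_img i y -> gradM (A := A) scalM i y = dscalM i y.
Proof.
by move=> iy; exact: (grad_eq_on (open_img i) (fun z iz => chart_inv_scal iz) iy).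
Qed.

Lemma dotM_grad_scalM w x : dotM g (gradM (A := A) scalM) w x = dotM g dscalM w x.
Proof.
exact: (f_equal (fun z => vdot (g (chart_at A x) (chart (chart_at A x) x)) z (w _ _)) (gradM_scalM (imgP (chart_atP A x)))).
Qed.

Lemma Ck_ric_tens i : Ck_tens (k := 2) (chart_img i) (ric_tens (g i)).
Proof. by move=> a b; exact: (smooth_ricm (metric_at g i) a b 0). Qed.

Lemma Ck_dric_tens i : Ck_tens (k := 3) (chart_img i) (dric_tens (g i)).
Proof. by move=> a b c; exact: (smooth_dric (soliton_at i) a b c 0). Qed.

Lemma Ck_skew_tens i : Ck_tens (k := 3) (chart_img i) (skew_tens (g i)).
Proof.
move=> a b c; apply: (CkB (k := 0) (open_img i)).
 exact: (smooth_dric (soliton_at i) a b c 0).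
exact: (smooth_dric (soliton_at i) b a c 0).
Qed.

Lemma Ck_riem_tens i : Ck_tens (k := 4) (chart_img i) (riem_tens (g i)).
Proof. by move=> a b c d; exact: (smooth_riem (metric_at g i) a b c d 0). Qed.

Local Notation D2 := (tnormM (@dric_tens R n)).
Local Notation P2 := (tnormM (@skew_tens R n)).
Local Notation S2 := (tnormM ric_tens).
Local Notation Rm2 := (tnormM (@riem_tens R n)).
Local Notation df2 := (dotM g (gradM (A := A) f) (gradM (A := A) f)).

Let cf := cov_gradM g (Ck_fun_potential 1).

Lemma at_point_div_Rm x : at_point g (@div_Rm_norm2 R n) x = P2 x.
Proof. by have iy := imgP (chart_atP A x); exact: (div_tens_norm (soliton_at _) (@pos _) iy). Qed.

Lemma div_driftM x : divM g driftM x - dotM g (gradM (A := A) f) driftM x = D2 x - P2 x.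
Proof. by have iy := imgP (chart_atP A x); exact: (div_driftW (soliton_at _) (@pos _) iy). Qed.

Lemma div_dscalM x : divM g dscalM x - dotM g (gradM (A := A) f) dscalM x = scalM x - 2 * S2 x.
Proof. by have iy := imgP (chart_atP A x); exact: (div_grad_scal (soliton_at _) (@pos _) iy). Qed.

Lemma skew_normM_le x : P2 x <= Rm2 x * df2 x.
Proof. by have iy := imgP (chart_atP A x); exact: (skew_norm_le (soliton_at _) (@pos _) iy). Qed.

Lemma ric_normM_le x : S2 x <= n%:R * Rm2 x.
Proof. by have iy := imgP (chart_atP A x); exact: (ric_norm_le (soliton_at _) (@pos _) iy). Qed.

Lemma scalM_sqr_le x : scalM x ^+ 2 <= n%:R * S2 x.
Proof. by have iy := imgP (chart_atP A x); exact: (scal_sqr_le (soliton_at _) (@pos _) iy). Qed.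

Lemma driftM_norm_le x : dotM g driftM driftM x <= 10 * S2 x * D2 x.
Proof. by have iy := imgP (chart_atP A x); exact: (driftW_norm_le (soliton_at _) (@pos _) iy). Qed.

(** The constant is kept rather than absorbed into [f], because the weights in the theorem refer to
    the given potential. *)
Lemma scalar_equation : exists c, forall x, df2 x + scalM x = f x + c.
Proof.
pose h (x : M) := df2 x + scalM x - f x.
have hE i y : chart_img i y -> h (chart_inv i y) = sconst (g i) (fun y => f (chart_inv i y)) y.
 move=> iy; rewrite /h /sconst; rewrite chart_inv_scal//.
 by rewrite (@dotE _ _ _ _ g _ _ _ _ cf cf (inv_dom iy)) chart_invK.
have Ch : Ck_fun A 1 h.
 move=> i; apply: Ck_on_eq (smooth_sconst (soliton_at i) 1) => [|y iy]; first exact: open_img.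
 by rewrite hE.
have hc : forall x y, h x = h y.
 apply: gradM0_const connM Ch _ => i y iy.
 rewrite -(grad_sconst (soliton_at i) (@pos i) iy).
 exact: (grad_eq_on (open_img i) (hE i) iy).
exists (h point) => x; rewrite (hc point x) /h; ring.
Qed.

End SolitonManifold.

Lemma ctsC {T : topologicalType} {R : realType} (a : R) : continuous (fun _ : T => a).
Proof. by move=> x; exact: cvg_cst. Qed.
Arguments ctsC {T R} a.

Lemma cut_div_algebra {R : realType} {P w b al q p b1 DP DA DB DF DS DW X Y r s : R} :
 DP = b * DA + w * DB -> DA = w * (-1 + al * q) * DF -> DF = X -> DB = - (p * b1) * DS -> DS = Y ->
 DW - X = r - 2 * s ->
 P * (w * b * DW + DP) = - (w * (P * (b * (2 * s - r) - al * q * (b * X) + p * (b1 * Y)))).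
Proof.
move=> -> -> -> -> -> /(canRL (subrK _)) ->; ring.
Qed.

(** * The weight used for the scalar curvature *)

Section ExponentialWeight.
Context {R : realType}.
Implicit Types (al s t : R).

Lemma is_derive_compN (v : R -> R) t d : is_derive (- t) (1 : R) v d -> is_der t (fun s => v (- s)) (- d).
Proof.
have d0 : is_der t (fun s : R => - s) (-1) by apply: is_deriveN.
by move=> dv; have := @is_derive1_comp R v _ t _ _ dv d0; rewrite mulrN1.
Qed.

Lemma cts_compN (v : R -> R) : continuous v -> continuous (fun s : R => v (- s)).
Proof. by move=> cv; apply: (cts_rcomp (F := -%R)) => //; exact: opp_continuous. Qed.

Lemma cts_dexpN : continuous (fun t : R => - expR (- t)).
Proof.
apply: (cts_rcomp (F := fun t => expR (- t)) (h := -%R)); last exact: opp_continuous.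
exact: cts_compN (@continuous_expR R).
Qed.

(** This is $e^{-s}(1+e^{-s})^{-\alpha}$. For $\alpha \ge 0$ it is at most $e^{-(1-\alpha)s}$ on the
    whole line, also where $s$ is very negative, and its logarithmic derivative is $-1 + \alpha q$
    with $q$ the function [wratio]. *)
Definition weight al s : R := expR (- s - al * ln (1 + expR (- s))).
Definition wratio s : R := expR (- s) / (1 + expR (- s)).

Lemma wden_gt0 s : 0 < 1 + expR (- s).
Proof. by rewrite addr_gt0// expR_gt0. Qed.

Lemma is_derive_weight al t : is_der t (weight al) (weight al t * (-1 + al * wratio t)).
Proof.
have d0 : is_der t (fun s : R => - s) (-1) by apply: is_deriveN.
have d1 := is_derive_compN (is_derive_expR (- t)).
have d2 : is_der t (fun s : R => 1 + expR (- s)) (0 + - expR (- t)).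
 by apply: is_deriveD.
have d3 := @is_derive1_comp R (@ln R) (fun s => 1 + expR (- s)) t _ _ (is_derive1_ln (wden_gt0 t)) d2.
have d4 : is_der t (fun s : R => - s - al * ln (1 + expR (- s)))
  (-1 - al * ((1 + expR (- t))^-1 * (0 + - expR (- t)))).
 by apply: is_deriveB; apply: is_deriveZ.
have := is_derive1_comp (is_derive_expR _) d4; congr is_derive.
by rewrite /weight /wratio; ring.
Qed.

Lemma cts_weight al : continuous (weight al).
Proof.
move=> t; have [+ _] := is_derive_weight al t.
by move=> /derivable1_diffP/differentiable_continuous.
Qed.

Lemma cts_wratio : continuous (@wratio).
Proof.
have cN := cts_compN (@continuous_expR R).
move=> t; apply: cvgM; first exact: cN.
by apply: cvgV; [rewrite gt_eqF// wden_gt0|apply: cvgD; [exact: cvg_cst|exact: cN]].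
Qed.

Lemma cts_dweight al : continuous (fun t : R => weight al t * (-1 + al * wratio t)).
Proof. exact: (ctsM (@cts_weight al) (ctsD (ctsC (-1)) (ctsM (ctsC al) cts_wratio))). Qed.

Lemma weight_gt0 al s : 0 < weight al s.
Proof. exact: expR_gt0. Qed.

Lemma weight_le al s : 0 <= al -> weight al s <= expR (- ((1 - al) * s)).
Proof.
move=> al0; rewrite ler_expR.
have h : - s <= ln (1 + expR (- s)).
 by rewrite -[leLHS]expRK ler_ln ?posrE ?expR_gt0 ?wden_gt0// lerDr.
have := ler_wpM2l al0 h; move: (ln _) => l; lra.
Qed.

Lemma wratio01 s : 0 <= wratio s <= 1.
Proof.
rewrite divr_ge0 ?expR_ge0 ?(ltW (wden_gt0 s))//=.
by rewrite ler_pdivrMr ?wden_gt0// mul1r lerDr.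
Qed.

Lemma mul_expRN_le1 s : s * expR (- s) <= 1.
Proof. by rewrite expRN ler_pdivrMr ?expR_gt0// mul1r; have := expR_ge1Dx s; lra. Qed.

Lemma wratioM_le1 s : wratio s * s <= 1.
Proof.
rewrite /wratio mulrAC ler_pdivrMr ?wden_gt0// mul1r mulrC (le_trans (mul_expRN_le1 s))//.
by rewrite lerDl expR_ge0.
Qed.

End ExponentialWeight.

(** * Passing from pointwise to integral inequalities *)

Section IntegralTools.
Context {R : realType} {n : nat} {M : ptopologicalType} {A : smooth_atlas R n M}.
Variable g : riemannian_metric A.
Hypothesis hausM : hausdorff_space M.
Variable vol : {measure set (borel M) -> \bar R}.
Hypothesis volP : riemannian_volume g vol.

Lemma cts_measurable (h : M -> R) : continuous h -> measurable_fun setT (h : borel M -> R).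
Proof. by move=> ch; apply: (ct_borel openT) => x _; exact: ch. Qed.

Lemma int_dominated (h H : M -> R) : continuous h -> (forall x, `|h x| <= H x) ->
 vol.-integrable setT (EFin \o (H : borel M -> R)) ->
 vol.-integrable setT (EFin \o (h : borel M -> R)).
Proof. by move=> ch hH; apply: Rintegrable_le => //; exact: cts_measurable. Qed.

Lemma cut_integrable (psi h : M -> R) (K : set M) (m : nat) : compact K -> (forall x, psi x != 0 -> K x) ->
 continuous psi -> continuous h ->
 vol.-integrable setT (EFin \o ((fun x => psi x ^+ m.+1 * h x) : borel M -> R)).
Proof.
move=> cK psiK cp ch; apply: (integrable_supp hausM volP cK); first exact: (ctsM (ctsX _ cp) ch).
move=> x nK; suff -> : psi x = 0 by rewrite expr0n mul0r.
by apply/eqP; apply: contra_notT nK; exact: psiK.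
Qed.

Lemma fatou_exhaustion (psi : nat -> M -> R) (h : M -> R) (B : R) (m : nat) :
 (forall k, continuous (psi k)) -> (forall k x, 0 <= psi k x) ->
 (forall x, exists N, forall k, (N <= k)%N -> psi k x = 1) ->
 continuous h -> (forall x, 0 <= h x) ->
 (forall k, vol.-integrable setT (EFin \o (fun x : borel M => psi k x ^+ m * h x))) ->
 (forall k, \int[vol]_x (psi k x ^+ m * h x) <= B) ->
 (\int[vol]_x (h x)%:E <= B%:E)%E.
Proof.
move=> cpsi psi0 psi1 ch h0 ih hB.
pose F k (x : borel M) := (psi k x ^+ m * h x)%:E.
have F0 k x : (0 <= F k x)%E by rewrite lee_fin mulr_ge0// exprn_ge0.
have mF k : measurable_fun setT (F k).
 by apply/measurable_EFinP; apply: cts_measurable; exact: (ctsM (ctsX m (cpsi k)) ch).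
have := fatou vol measurableT mF (fun k x _ => F0 k x).
rewrite (_ : (fun x => _) = (fun x : borel M => (h x)%:E)); last first.
 fext x; have [N HN] := psi1 x.
 have cv : F ^~ x @ \oo --> (h x)%:E.
  apply: cvg_near_cst; exists N => // k /= Nk; by rewrite /F HN// expr1n mul1r.
 by rewrite is_cvg_limn_einfE; [exact/cvg_lim|apply/cvg_ex; exists (h x)%:E].
move=> /le_trans; apply; rewrite limn_einf_lim.
apply: lime_le; first exact: is_cvg_einfs.
apply: nearW => k; apply: (@le_trans _ _ (\int[vol]_x F k x)%E).
 by apply: ereal_inf_lbound; exists k => //=.
have := integrable_fin_num measurableT (ih k).
by move=> fk; rewrite -(fineK fk) lee_fin; exact: hB.
Qed.

(** [kap] is the constant of [divergence_estimate], so the right-hand side of the pointwise bound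
    has nonpositive integral; the sign [s] lets the divergence enter in either direction. *)
Lemma cut_comparison (psi : M -> R) w L m (K : set M) (phi a b : M -> R) (s kap : R) :
 compact K -> (forall x, psi x != 0 -> K x) -> continuous psi -> (forall x, 0 <= psi x <= 1) ->
 0 <= L -> loc_lipschitz g L psi -> smooth_cov w -> covector w -> Ck_fun A 1 phi ->
 `|s| <= 1 -> kap = n%:R * (m.+2%:R * L * 2) ->
 vol.-integrable setT (EFin \o (a : borel M -> R)) ->
 vol.-integrable setT (EFin \o (b : borel M -> R)) ->
 (forall x, a x - b x <= s * cut_div g psi w m phi x - kap * cut_norm g psi w m phi x) ->
 \int[vol]_x a x <= \int[vol]_x b x.
Proof.
move=> cK psiK cpsi psi01 L0 psiL sw cw Cphi s1 kapE ia ib ab.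
have bd := divergence_estimate hausM volP m cK psiK cpsi psi01 L0 psiL sw cw Cphi.
have id := cut_div_int hausM volP m cK psiK cpsi sw cw Cphi.
have iN := cut_norm_int hausM volP m cK psiK cpsi sw cw (Ck_fun_cts Cphi).
rewrite -subr_le0 -RintegralB//.
have := @le_Rintegral _ (borel M) R vol setT (fun x => a x - b x)
 (fun x => s * cut_div g psi w m phi x - kap * cut_norm g psi w m phi x).
have isd : vol.-integrable setT (EFin \o (fun x : borel M => s * cut_div g psi w m phi x)).
 exact: (integrableZl measurableT s id).
have ikn : vol.-integrable setT (EFin \o (fun x : borel M => kap * cut_norm g psi w m phi x)).
 exact: (integrableZl measurableT kap iN).
move=> /(_ measurableT (integrableB measurableT ia ib) (integrableB measurableT isd ikn) (fun x _ => ab x)).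
move=> /le_trans; apply; rewrite RintegralB// !RintegralZl// subr_le0 (le_trans (ler_norm _))//.
rewrite normrM (le_trans _ (le_trans bd _))//; first by rewrite ler_piMl.
by rewrite kapE le_eqVlt; apply/orP; left; apply/eqP; ring.
Qed.

End IntegralTools.

Lemma fin_int_integrable (R : realType) (M : ptopologicalType) (vol : {measure set (borel M) -> \bar R})
  (h : M -> R) : continuous h -> (forall x, 0 <= h x) ->
 (\int[vol]_x (h x)%:E < +oo)%E ->
 vol.-integrable setT (EFin \o (h : borel M -> R)).
Proof.
move=> ch h0 fin; apply/integrableP; split; first by apply/measurable_EFinP; exact: cts_measurable.
by under eq_integral do rewrite /= ger0_norm ?h0//.
Qed.

(** * Nonnegative scalar curvature and the integral identity *)

Section Final.
Context {R : realType} {n : nat} {M : ptopologicalType} {A : smooth_atlas R n M}.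
Implicit Types (i j : chart_idx A) (x : M).
Variable g : riemannian_metric A.
Hypotheses (hausM : hausdorff_space M) (connM : connected [set: M]) (complg : complete_metric g).
Variable f : M -> R.
Hypothesis solf : shrinking_soliton g f.
Variable vol : {measure set (borel M) -> \bar R}.
Hypothesis volP : riemannian_volume g vol.
Variable lam : R.
Hypothesis lam1 : lam < 1.

Local Notation D2 := (tnormM g (@dric_tens R n)).
Local Notation P2 := (tnormM g (@skew_tens R n)).
Local Notation S2 := (tnormM g (@ric_tens R n)).
Local Notation Rm2 := (tnormM g (@riem_tens R n)).
Local Notation df2 := (dotM g (gradM (A := A) f) (gradM (A := A) f)).
Local Notation scM := (scalM g).
Local Notation dsc := (dscalM g).
Local Notation integrable h := (vol.-integrable setT (EFin \o (h : borel M -> R))).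

Hypothesis iRm : integrable (fun x => Rm2 x * expR (- (lam * f x))).

Variable c : R.
Hypothesis scE : forall x, df2 x + scM x = f x + c.

Let al := 1 - lam.
(** The normalised potential, equal to $|\nabla f|^2 + R$ by [scE]. *)
Let ft (x : M) := f x + c.

Let al0 : 0 < al. Proof. by rewrite subr_gt0. Qed.

Let Cf : Ck_fun A 1 f. Proof. exact: Ck_fun_potential solf 1. Qed.
Let Cft : Ck_fun A 1 ft. Proof. exact: (Ck_funD Cf (Ck_fun_cst 1 c)). Qed.
Let Csc : Ck_fun A 1 scM. Proof. exact: Ck_fun_scal solf 1. Qed.
Let cf : continuous f := Ck_fun_cts Cf.
Let cft : continuous ft := Ck_fun_cts Cft.
Let csc : continuous scM := Ck_fun_cts Csc.
Let cD2 : continuous D2. Proof. exact: cts_tnormM (@natural_dric R n) (Ck_dric_tens solf). Qed.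
Let cP2 : continuous P2. Proof. exact: cts_tnormM (@natural_skew R n) (Ck_skew_tens solf). Qed.
Let cS2 : continuous S2. Proof. exact: cts_tnormM (@natural_ric R n) (Ck_ric_tens g). Qed.
Let cexp (a : R) : continuous (fun x => expR (- (a * f x))).
Proof.
apply: (cts_rcomp (F := fun x => - (a * f x)) (h := expR)); last exact: continuous_expR.
apply: (cts_rcomp (F := fun x => a * f x) (h := -%R)); last exact: opp_continuous.
exact: (ctsM (ctsC a) cf).
Qed.

Let S2_ge0 x : 0 <= S2 x. Proof. exact: tnormM_ge0. Qed.
Let Rm2_ge0 x : 0 <= Rm2 x. Proof. exact: tnormM_ge0. Qed.
Let D2_ge0 x : 0 <= D2 x. Proof. exact: tnormM_ge0. Qed.
Let P2_ge0 x : 0 <= P2 x. Proof. exact: tnormM_ge0. Qed.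

Lemma dotM_grad_ft w x : covector w -> dotM g (gradM ft) w x = dotM g (gradM f) w x.
Proof.
move=> cw; rewrite (dotM_gradD _ _ Cf (Ck_fun_cst 1 c) cw) -[RHS]addr0; congr (_ + _).
have [_ ->] := @dotM_comp _ _ _ _ g (fun=> c) (fun=> c) (fun=> 0) w x (Ck_fun_cst 1 c)
 (fun t => is_derive_cst c t 1) (ctsC 0) cw.
by rewrite mul0r.
Qed.

Section NonnegativeScalar.
Variable m : nat.
Hypothesis m_large : al ^+ 2 * n.+1%:R <= m.+2%:R.
Let p := m.+2%:R : R.
Let u (x : M) := Num.max (- scM x) 0.
Let phi x := weight al (ft x) * pospow m.+2 (- scM x).

Let Cw : Ck_fun A 1 (fun x => weight al (ft x)).
Proof.
move=> i; have [] // := C1_comp (open_img i) (Cft i) (is_derive_weight al) _.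
exact: cts_dweight.
Qed.

Let is_derive_npow (t : R) : is_der t (fun s : R => pospow m.+2 (- s)) (- (p * pospow m.+1 (- t))).
Proof. exact: is_derive_compN (der_pospow m _). Qed.

Let cts_npow k : continuous (fun t : R => pospow k (- t)).
Proof. exact: cts_compN (@cts_pospow R k). Qed.

Let cts_dnpow : continuous (fun t : R => - (p * pospow m.+1 (- t))).
Proof.
rewrite (_ : (fun t => _) = (fun t : R => - p * pospow m.+1 (- t))); last by fext t; rewrite mulNr.
exact: (ctsM (ctsC (- p)) (@cts_npow _)).
Qed.

Let Cu : Ck_fun A 1 (fun x => pospow m.+2 (- scM x)).
Proof. by move=> i; have [] := C1_comp (open_img i) (Csc i) is_derive_npow cts_dnpow. Qed.

Let Cphi : Ck_fun A 1 phi. Proof. exact: Ck_funM Cw Cu. Qed.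

Let cdsc : covector dsc := covector_dscalM solf.

(** The drift term of the Laplacian cancels the -1 in the logarithmic derivative of the weight,
    leaving only the multiple [al * wratio] of $\nabla f$. *)
Lemma cut_div_dscalM (psi : M -> R) x : cut_div g psi dsc (2 * m.+1) phi x =
 - (weight al (ft x) * (psi x ^+ (2 * m.+2) * (u x ^+ m.+2 * (2 * S2 x - scM x)
 - al * wratio (ft x) * (u x ^+ m.+2 * dotM g (gradM f) dsc x) + p * (u x ^+ m.+1 * dotM g dsc dsc x)))).
Proof.
have h1 := dotM_gradM g x Cw Cu cdsc.
have [_ h2] := dotM_comp g x Cft (is_derive_weight al) (@cts_dweight R al) cdsc.
have [_ h3] := dotM_comp g x Csc is_derive_npow cts_dnpow cdsc.
have ex : ((2 * m.+1).+2 = 2 * m.+2)%N by rewrite [in RHS]mulnS.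
rewrite -ex.
exact: (cut_div_algebra h1 h2 (dotM_grad_ft x cdsc) h3 (dotM_grad_scalM g dsc x) (div_dscalM solf x)).
Qed.

Let u_ge0 x : 0 <= u x. Proof. by rewrite le_max lexx orbT. Qed.

Lemma cut_norm_dscalM (psi : M -> R) x : cut_norm g psi dsc (2 * m.+1) phi x =
 weight al (ft x) * (psi x ^+ (2 * m.+2).-1 * (u x ^+ m.+2 * Num.sqrt (dotM g dsc dsc x))).
Proof.
have ex : ((2 * m.+1).+1 = (2 * m.+2).-1)%N by rewrite [in RHS]mulnS.
rewrite /cut_norm ex ger0_norm; last by rewrite mulr_ge0 ?pospow_ge0// ltW// weight_gt0.
by rewrite /phi /pospow -/(u x); move: (Num.sqrt _) (psi x ^+ _) (u x ^+ _) => q1 q2 q3; ring.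
Qed.

Let cu : continuous u.
Proof.
have -> : u = (fun x => pospow 1 (- scM x)) by fext x; rewrite /pospow expr1.
by apply: (cts_rcomp (F := fun x => scM x) (h := fun t : R => pospow 1 (- t))); [exact: csc|exact: cts_npow].
Qed.

Let cw : continuous (fun x => weight al (ft x)).
Proof. exact: (cts_rcomp (h := weight al) cft (@cts_weight R al)). Qed.

(** Dominates the error term of [scalar_key]. It is integrable since $u^2 \le R^2 \le n|Ric|^2 \le
    n^2|Rm|^2$ and the weight is at most a constant times $e^{-\lambda f}$. *)
Let wu2 x := weight al (ft x) * u x ^+ 2.

Let wu2_integrable : integrable wu2.
Proof.
have iK : integrable (fun x => n%:R ^+ 2 * expR (- (lam * c)) * (Rm2 x * expR (- (lam * f x)))) :=
 integrableZl measurableT _ iRm.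
apply: (int_dominated _ _ iK); first exact: (ctsM cw (ctsX 2 cu)).
move=> x; rewrite ger0_norm; last by rewrite mulr_ge0 ?sqr_ge0// ltW// weight_gt0.
have u2 : u x ^+ 2 <= n%:R ^+ 2 * Rm2 x.
 apply: (@le_trans _ _ (scM x ^+ 2)).
  rewrite /u; case: (leP (- scM x) 0) => _; first by rewrite expr0n sqr_ge0.
  by rewrite sqrrN.
 apply: (le_trans (scalM_sqr_le solf x)); rewrite expr2 -mulrA ler_wpM2l//.
 exact: ric_normM_le solf x.
have wl := weight_le (ft x) (ltW al0).
have wE : expR (- ((1 - al) * ft x)) = expR (- (lam * c)) * expR (- (lam * f x)).
 by rewrite -expRD /al /ft; congr expR; ring.
rewrite wE in wl.
apply: (le_trans (ler_pM (ltW (weight_gt0 _ _)) (sqr_ge0 _) wl u2)).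
by rewrite le_eqVlt; apply/orP; left; apply/eqP; rewrite /=; move: (Rm2 x) => q; ring.
Qed.

(** The integral of [scalar_key] against the weight. Its right-hand side carries a positive power of
    the Lipschitz constant and so vanishes along the cutoffs. *)
Lemma scalar_cut_bound (psi : M -> R) L (K : set M) (N := n.+1%:R : R)
  (kap := n%:R * ((2 * m.+1).+2%:R * L * 2)) :
 compact K -> (forall x, psi x != 0 -> K x) -> continuous psi -> (forall x, 0 <= psi x <= 1) ->
 0 <= L -> loc_lipschitz g L psi ->
 \int[vol]_x (psi x ^+ (2 * m.+2) * (2^-1 * (weight al (ft x) * u x ^+ m.+3))) <=
 (N * (kap ^+ 2 / (2 * p))) ^+ m.+2 * \int[vol]_x wu2 x.
Proof.
move=> cK psiK cpsi psi01 L0 psiL.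
set B := _ ^+ m.+2.
rewrite -RintegralZl//.
have ia := cut_integrable hausM volP (2 * m.+2).-1 cK psiK cpsi
 (ctsM (ctsC 2^-1) (ctsM cw (ctsX m.+3 cu))).
have ib : integrable (fun x => B * wu2 x) := integrableZl measurableT B wu2_integrable.
apply: (cut_comparison hausM volP (m := 2 * m.+1) (s := -1) (kap := kap) cK psiK cpsi psi01 L0 psiL
 (smooth_dscalM solf) cdsc Cphi _ erefl ia ib); first by rewrite normrN normr1.
move=> x; rewrite cut_div_dscalM cut_norm_dscalM.
have kap0 : 0 <= kap by rewrite !mulr_ge0.
have sq : scM x ^+ 2 <= N * S2 x.
 apply: (le_trans (scalM_sqr_le solf x)); by rewrite ler_wpM2r// ler_nat.
have N1 : 1 <= N by rewrite ler1n.
have ZE : df2 x = ft x - scM x by rewrite /ft -scE addrK.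
have cs : dotM g (gradM f) dsc x ^+ 2 <= dotM g dsc dsc x * df2 x by rewrite [leRHS]mulrC; exact: dot_CS.
have := scalar_key N1 sq cs (dot_ge0 g dsc x) ZE (dot_ge0 g (gradM f) x)
 (wratio01 (ft x)) (wratioM_le1 (ft x)) m_large (psi01 x) kap0.
move/(ler_wpM2l (ltW (weight_gt0 al (ft x)))).
rewrite -/(u x) -/p -/B /wu2; set T1 := psi x ^+ _ * (_ + _); set T2 := psi x ^+ (2 * m.+2).-1 * _.
move: T1 T2 => T1 T2; congr (_ <= _); last by ring.
by move: (weight al _) (psi x ^+ _) (u x ^+ m.+3) => q1 q2 q3; ring.
Qed.

Lemma scalM_ge0_of x : 0 <= scM x.
Proof.
have [psi [psiP psiK psi1]] := cutoff_exists hausM connM complg.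
pose h x := 2^-1 * (weight al (ft x) * u x ^+ m.+3).
have ch : continuous h := ctsM (ctsC 2^-1) (ctsM cw (ctsX m.+3 cu)).
have h0 y : 0 <= h y by rewrite mulr_ge0// mulr_ge0 ?exprn_ge0// ltW// weight_gt0.
pose I := \int[vol]_x wu2 x.
(* The right-hand side of [scalar_cut_bound] for the Lipschitz constant [4 * t], as a continuous
   function vanishing at 0. *)
pose G (t : R) := (n.+1%:R * ((n%:R * ((2 * m.+1).+2%:R * (4 * t) * 2)) ^+ 2 / (2 * p))) ^+ m.+2 * I.
have cG : continuous G.
 apply: ctsM (ctsC I); apply: (ctsX m.+2); apply: ctsM (ctsC _) _; apply: ctsM (ctsC _).
 apply: (ctsX 2); apply: ctsM (ctsC _) _; apply: ctsM (ctsC 2); apply: ctsM (ctsC _) _.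
 by apply: ctsM (ctsC 4) _ => t; exact: cvg_id.
have G0 : G 0 = 0 by rewrite /G !(mulr0, mul0r, expr0n).
have cvG : (fun k : nat => G (k.+1%:R^-1)) @ \oo --> (0 : R).
 by rewrite -G0; apply: (cvg_comp _ G (@cvg_harmonic R)); exact: cG.
have ipsi N k : integrable (fun x => psi (k + N)%N x ^+ (2 * m.+2) * h x).
 have [K cK KP] := psiK (k + N)%N; have [cp _ _] := psiP (k + N)%N.
 exact: (cut_integrable hausM volP (2 * m.+2).-1 cK KP cp ch).
(* Discarding the first [N] cutoffs makes the bound at most [e] uniformly, which is the form that
   the Fatou argument takes. *)
have small (e : R) : 0 < e -> (\int[vol]_x (h x)%:E <= e%:E)%E.
 move=> e0; have /cvgrPdist_le/(_ _ e0) [N _ HN] := cvG.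
 apply: (@fatou_exhaustion _ _ vol (fun k => psi (k + N)%N) h e (2 * m.+2) _ _ _ ch h0 (ipsi N)).
 - by move=> k; have [] := psiP (k + N)%N.
 - by move=> k y; have [_ /(_ y)/andP[]] := psiP (k + N)%N.
 - by move=> y; have [K HK] := psi1 y; exists K => k Kk; rewrite HK// (leq_trans Kk)// leq_addr.
 - move=> k; have [cp p01 pL] := psiP (k + N)%N; have [K cK KP] := psiK (k + N)%N.
  have L0 : 0 <= 4 / (k + N).+1%:R :> R by rewrite divr_ge0.
  apply: (le_trans (scalar_cut_bound cK KP cp p01 L0 pL)).
  have /= := HN (k + N)%N (leq_addl _ _); rewrite sub0r normrN; apply: le_trans.
  exact: ler_norm.
have hint0 : (\int[vol]_x (h x)%:E)%E = 0%E.
 apply/eqP; rewrite eq_le integral_ge0 ?andbT; last by move=> y _; rewrite lee_fin.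
 by apply/lee_addgt0Pr => e e0; rewrite add0e; exact: small.
have := integral0_continuous volP ch h0 hint0 x.
rewrite /h => /eqP; rewrite mulf_eq0 invr_eq0 pnatr_eq0/= mulf_eq0 gt_eqF ?weight_gt0//= expf_eq0/=.
rewrite /u => /eqP u0.
by rewrite -oppr_le0 -u0 le_max lexx.
Qed.

End NonnegativeScalar.

(** The power is fixed only here, large enough for the hypothesis [m_large]. *)
Lemma scalM_ge0 x : 0 <= scM x.
Proof.
pose m := Num.bound (al ^+ 2 * n.+1%:R).
apply: (@scalM_ge0_of m); apply: (le_trans (ltW (archi_boundP _))); first by rewrite mulr_ge0 ?sqr_ge0.
by rewrite ler_nat; exact: (leq_trans (leqnSn m) (leqnSn m.+1)).
Qed.

Let ft_ge0 x : 0 <= ft x.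
Proof. by rewrite /ft -scE addr_ge0 ?dot_ge0 ?scalM_ge0. Qed.

Let df2_le x : df2 x <= ft x.
Proof. by rewrite /ft -scE lerDl scalM_ge0. Qed.

Let exp_le x : expR (- f x) <= expR (al * c) * expR (- (lam * f x)).
Proof. by rewrite -expRD ler_expR /al; have := mulr_ge0 (ltW al0) (ft_ge0 x); rewrite /al /ft; lra. Qed.

(** The gap [al = 1 - lam] between the exponents pays for the growth of [ft]: apply $se^{-s} \le 1$
    at [s = al * ft x]. *)
Let ft_exp_le x : ft x * expR (- f x) <= expR (al * c) / al * expR (- (lam * f x)).
Proof.
have -> : expR (- f x) = expR (- (al * ft x)) * (expR (al * c) * expR (- (lam * f x))).
 by rewrite -!expRD; congr expR; rewrite /al /ft; ring.
have h := mul_expRN_le1 (al * ft x).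
rewrite mulrA (_ : expR (al * c) / al * _ = al^-1 * (expR (al * c) * expR (- (lam * f x)))); last by ring.
apply: ler_wpM2r; first by rewrite mulr_ge0 ?expR_ge0.
by rewrite -[leRHS]mulr1 ler_pdivlMl// mulrA.
Qed.

Let C := expR (al * c) * (n%:R + al^-1).

Lemma skew_exp_le x : P2 x * expR (- f x) <= C * (Rm2 x * expR (- (lam * f x))).
Proof.
apply: (@le_trans _ _ (Rm2 x * (expR (al * c) / al * expR (- (lam * f x))))).
 apply: (@le_trans _ _ (Rm2 x * (ft x * expR (- f x)))); last exact: (ler_wpM2l (Rm2_ge0 x) (ft_exp_le x)).
 rewrite mulrA ler_wpM2r ?expR_ge0//; apply: (le_trans (skew_normM_le solf x)).
 exact: (ler_wpM2l (Rm2_ge0 x) (df2_le x)).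
rewrite [leRHS]mulrCA; apply: (ler_wpM2l (Rm2_ge0 x)); rewrite ler_wpM2r ?expR_ge0// /C ler_wpM2l ?expR_ge0//.
by rewrite lerDr.
Qed.

Lemma ric_exp_le x : S2 x * expR (- f x) <= C * (Rm2 x * expR (- (lam * f x))).
Proof.
apply: (@le_trans _ _ (n%:R * Rm2 x * (expR (al * c) * expR (- (lam * f x))))).
 exact: (ler_pM (S2_ge0 x) (expR_ge0 _) (ric_normM_le solf x) (exp_le x)).
rewrite (_ : n%:R * _ * _ = expR (al * c) * n%:R * (Rm2 x * expR (- (lam * f x)))); last by ring.
by rewrite ler_wpM2r ?mulr_ge0 ?Rm2_ge0 ?expR_ge0// /C ler_wpM2l ?expR_ge0// lerDl invr_ge0 ltW.
Qed.

Let cef : continuous (fun x => expR (- f x)).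
Proof. rewrite (_ : (fun x => _) = (fun x => expR (- (1 * f x)))); first exact: (@cexp 1).
by fext x; rewrite mul1r. Qed.

Let weighted_int (h : M -> R) : continuous h -> (forall x, 0 <= h x) ->
 (forall x, h x * expR (- f x) <= C * (Rm2 x * expR (- (lam * f x)))) -> integrable (fun x => h x * expR (- f x)).
Proof.
move=> ch h0 hC.
have iK : integrable (fun x => C * (Rm2 x * expR (- (lam * f x)))) := integrableZl measurableT _ iRm.
apply: (int_dominated _ _ iK) => [|x]; first exact: (ctsM ch cef).
by rewrite ger0_norm ?hC// mulr_ge0 ?expR_ge0.
Qed.

Lemma P2_integrable : integrable (fun x => P2 x * expR (- f x)).
Proof. exact: (weighted_int cP2 P2_ge0 skew_exp_le). Qed.

Let S2_integrable : integrable (fun x => S2 x * expR (- f x)).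
Proof. exact: (weighted_int cS2 S2_ge0 ric_exp_le). Qed.

Let phi x := expR (- f x).
Let cdr : covector (driftM g) := covector_driftM g.

Let Cphi : Ck_fun A 1 phi.
Proof.
move=> i; have [] // := C1_comp (open_img i) (Cf i) (fun t => is_derive_compN (is_derive_expR (- t))) _.
exact: cts_dexpN.
Qed.

(** The derivative of $e^{-f}$ supplies the drift term, so that the divergence identity for $W$
    applies. *)
Lemma cut_div_driftM (psi : M -> R) x :
 cut_div g psi (driftM g) 0 phi x = psi x ^+ 2 * (expR (- f x) * (D2 x - P2 x)).
Proof.
have [_ h] := dotM_comp g x Cf (fun t => is_derive_compN (is_derive_expR (- t))) cts_dexpN cdr.
congr (_ * _); rewrite /phi h -(div_driftM solf); ring.
Qed.

(** [cross_le] with $|W|^2 \le 10|Ric|^2|\nabla Ric|^2$: the 5 is half of 10, and only half of the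
    good term is spent. *)
Lemma driftM_cut_le (ps kap : R) x : 0 <= ps -> 
 kap * (ps * Num.sqrt (dotM g (driftM g) (driftM g) x)) <= 2^-1 * (ps ^+ 2 * D2 x) + 5 * kap ^+ 2 * S2 x.
Proof.
move=> ps0; pose w2 := dotM g (driftM g) (driftM g) x.
have w2le : w2 <= 10 * S2 x * D2 x := driftM_norm_le solf x.
have sq : (ps * Num.sqrt w2) ^+ 2 <= (ps ^+ 2 * D2 x) * (10 * S2 x).
 rewrite exprMn sqr_sqrtr ?dot_ge0// -mulrA ler_wpM2l ?sqr_ge0//.
 by rewrite mulrC.
have := cross_le kap (@ltr01 R) (mulr_ge0 (sqr_ge0 ps) (D2_ge0 x)) (mulr_ge0 (ler0n R 10) (S2_ge0 x)) sq.
rewrite -/w2; move: (ps ^+ 2 * D2 x) (S2 x) (kap ^+ 2) (kap * _) => d s k2 l; lra.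
Qed.

(** [h] is the half of $|\nabla Ric|^2 e^{-f}$ that is not spent on the cutoff error. Its cut
    integrals are bounded uniformly, and Fatou's lemma removes the cutoff. *)
Lemma dric_integrable : integrable (fun x => D2 x * expR (- f x)).
Proof.
have [psi [psiP psiK psi1]] := cutoff_exists hausM connM complg.
pose h x := 2^-1 * (expR (- f x) * D2 x).
have ch : continuous h := ctsM (ctsC 2^-1) (ctsM cef cD2).
have h0 y : 0 <= h y by rewrite mulr_ge0// mulr_ge0 ?expR_ge0.
have ipsi k : integrable (fun x => psi k x ^+ 2 * h x).
 by have [K cK KP] := psiK k; have [cp _ _] := psiP k; exact: (cut_integrable hausM volP 1 cK KP cp ch).
(* The cutoff constant for [k = 0], the largest of all, so that the bound [b] does not depend on
   [k]. *)
pose kap0 := n%:R * (2 * 4 * 2) : R.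
pose b x := P2 x * expR (- f x) + 5 * kap0 ^+ 2 * (S2 x * expR (- f x)).
have ib : integrable b := integrableD measurableT P2_integrable (integrableZl measurableT (5 * kap0 ^+ 2) S2_integrable).
have bound k : \int[vol]_x (psi k x ^+ 2 * h x) <= \int[vol]_x b x.
 have [cp p01 pL] := psiP k; have [K cK KP] := psiK k.
 have L0 : 0 <= 4 / k.+1%:R :> R by rewrite divr_ge0.
 apply: (cut_comparison hausM volP (m := 0) (s := 1) cK KP cp p01 L0 pL
  (smooth_driftM solf) cdr Cphi _ erefl (ipsi k) ib); first by rewrite normr1.
 move=> x; rewrite cut_div_driftM /cut_norm expr1 mul1r; set kap := n%:R * _.
 have kap_ge0 : 0 <= kap by rewrite !mulr_ge0.
 have kap_le : kap ^+ 2 <= kap0 ^+ 2.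
  have kk0 : 0 <= kap0 by rewrite !mulr_ge0.
  rewrite ler_pXn2r// /kap /kap0 ler_wpM2l// ler_wpM2r// ler_wpM2l//.
  by rewrite ler_pdivrMr// ler_peMr// ler1n.
 have /andP[ps0 ps1] := p01 x.
 have := driftM_cut_le kap x ps0; rewrite ger0_norm ?expR_ge0// /h /b /phi.
 have := ler_wpM2r (S2_ge0 x) kap_le.
 have : psi k x ^+ 2 * P2 x <= P2 x by rewrite ler_piMl ?P2_ge0// expr_le1.
 have := expR_ge0 (- f x).
 move: (Num.sqrt _) (expR _) (D2 x) (P2 x) (S2 x) (psi k x) => w e d q s ps e0 h1 h2 h3.
 rewrite -subr_ge0.
 rewrite (_ : _ - _ = e * ((q - ps ^+ 2 * q) + 5 * (kap0 ^+ 2 * s - kap ^+ 2 * s)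
  + (2^-1 * (ps ^+ 2 * d) + 5 * kap ^+ 2 * s - kap * (ps * w)))); last by field.
 apply: mulr_ge0 => //; apply: addr_ge0; last by rewrite subr_ge0.
 by apply: addr_ge0; [rewrite subr_ge0|apply: mulr_ge0 => //; rewrite subr_ge0].
have fin : (\int[vol]_x (h x)%:E < +oo)%E.
 apply: (@le_lt_trans _ _ (\int[vol]_x b x)%:E); last exact: ltry.
 apply: (@fatou_exhaustion _ _ vol psi h _ 2 _ _ psi1 ch h0 ipsi bound).
  by move=> k; have [] := psiP k.
 by move=> k y; have [_ /(_ y)/andP[]] := psiP k.
have ih : integrable h := fin_int_integrable ch h0 fin.
have i2 : integrable (fun x => 2 * h x) := integrableZl measurableT 2 ih.
apply: (int_dominated _ _ i2) => [|x]; first exact: (ctsM cD2 cef).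
rewrite ger0_norm ?mulr_ge0 ?D2_ge0 ?expR_ge0// /h le_eqVlt; apply/orP; left; apply/eqP.
by move: (D2 x) (expR _) => d e; field.
Qed.

(** With both integrands integrable, dominated convergence gives the limit of the cut integrals,
    while the divergence estimate bounds them by a multiple of [1 / k.+1]. *)
Lemma dric_skew_Rintegral :
 \int[vol]_x (D2 x * expR (- f x)) =
 \int[vol]_x (P2 x * expR (- f x)).
Proof.
have [psi [psiP psiK psi1]] := cutoff_exists hausM connM complg.
pose F x := D2 x * expR (- f x) - P2 x * expR (- f x).
have iD := dric_integrable.
pose H x := 2^-1 * (D2 x * expR (- f x)) + 5 * (S2 x * expR (- f x)).
have iH : integrable H := integrableD measurableT (integrableZl measurableT 2^-1 iD)
 (integrableZl measurableT 5 S2_integrable).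
have idom : integrable (fun x => D2 x * expR (- f x) + P2 x * expR (- f x)) := integrableD measurableT iD P2_integrable.
have cF : continuous F.
 rewrite (_ : F = (fun x => (D2 x * expR (- f x)) + (-1) * (P2 x * expR (- f x)))).
  exact: (ctsD (ctsM cD2 cef) (ctsM (ctsC (-1)) (ctsM cP2 cef))).
 by fext x; rewrite /F mulN1r.
pose Fk k x := psi k x ^+ 2 * F x.
have mFk k : measurable_fun setT (Fk k : borel M -> R).
 by have [cp _ _] := psiP k; apply: cts_measurable; exact: (ctsM (ctsX 2 cp) cF).
have cvFk (x : borel M) : (fun k => Fk k x) @ \oo --> F x.
 have [N HN] := psi1 x; apply: cvg_near_cst; exists N => // k /= Nk.
 by rewrite /Fk HN// expr1n mul1r.
have domF k (x : borel M) : `|Fk k x| <= D2 x * expR (- f x) + P2 x * expR (- f x).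
 have [_ /(_ x)/andP[p0 p1] _] := psiP k.
 rewrite normrM ger0_norm ?sqr_ge0//; apply: (@le_trans _ _ `|F x|); first by rewrite ler_piMl// expr_le1.
 apply: (le_trans (ler_normB _ _)).
 by rewrite !ger0_norm// mulr_ge0 ?D2_ge0 ?P2_ge0 ?expR_ge0.
have [_ cvF] := Rintegral_cvg mFk cvFk idom domF.
pose I := \int[vol]_x H x.
(* 16 collects the exponent 2 of the cutoff, the 4 in its Lipschitz constant and the 2 of the
   divergence estimate. *)
have bound k : `|\int[vol]_x Fk k x| <= n%:R * 16 * I * k.+1%:R^-1.
 have [cp p01 pL] := psiP k; have [K cK KP] := psiK k.
 have L0 : 0 <= 4 / k.+1%:R :> R by rewrite divr_ge0.
 have := divergence_estimate hausM volP 0 cK KP cp p01 L0 pL (smooth_driftM solf) cdr Cphi.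
 have iN := cut_norm_int hausM volP 0 cK KP cp (smooth_driftM solf) cdr (Ck_fun_cts Cphi).
 rewrite /cut_bound (_ : cut_div _ _ _ _ _ = Fk k); last first.
  by fext x; rewrite cut_div_driftM /Fk /F; move: (D2 x) (P2 x) => d q; ring.
 move=> /le_trans; apply.
 have NI : \int[vol]_x cut_norm g (psi k) (driftM g) 0 phi x <= I.
  apply: (le_Rintegral measurableT iN iH) => x _.
  have /andP[ps0 ps1] := p01 x.
  have := driftM_cut_le 1 x ps0; rewrite /cut_norm expr1 ger0_norm ?expR_ge0// /phi /H.
  have : psi k x ^+ 2 * D2 x <= D2 x by rewrite ler_piMl ?D2_ge0// expr_le1.
  have := expR_ge0 (- f x).
  move: (Num.sqrt _) (expR _) (D2 x) (S2 x) (psi k x) => w e d s ps e0 h1 h2.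
  rewrite -subr_ge0 (_ : _ - _ = e * (2^-1 * (d - ps ^+ 2 * d)
   + (2^-1 * (ps ^+ 2 * d) + 5 * 1 ^+ 2 * s - 1 * (ps * w)))); last by field.
  by rewrite mulr_ge0// addr_ge0 ?subr_ge0// mulr_ge0 ?subr_ge0.
 rewrite (_ : n%:R * 16 * I * k.+1%:R^-1 = n%:R * (2%:R * (4 / k.+1%:R) * (2 * I))).
  by rewrite ler_wpM2l// ler_wpM2l ?mulr_ge0// ler_wpM2l.
 by move: (k.+1%:R^-1) => t; ring.
have cv0 : (fun k : nat => n%:R * 16 * I * k.+1%:R^-1) @ \oo --> (0 : R).
 rewrite -(mulr0 (n%:R * 16 * I)); apply: cvgM; [exact: cvg_cst|exact: cvg_harmonic].
have cvF0 : (fun k : nat => \int[vol]_x Fk k x) @ \oo --> (0 : R).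
 apply: (squeeze_cvgr _ _ cv0); last by have := cvgN cv0; rewrite oppr0; exact.
 by apply: nearW => k; rewrite -ler_norml; exact: bound.
have : \int[vol]_x F x = 0 by exact: (cvg_unique (@Rhausdorff R) cvF cvF0).
by rewrite (RintegralB measurableT iD P2_integrable) => /eqP; rewrite subr_eq0 => /eqP.
Qed.

End Final.

Theorem theorem1p2 (R : realType) (n : nat) (M : ptopologicalType)
    (hausdorffM : hausdorff_space M)
    (countableM : @second_countable M)
    (connectedM : connected [set: M])
    (A : smooth_atlas R n M) (g : riemannian_metric A)
    (completeg : complete_metric g)
    (f : M -> R) (solitonf : shrinking_soliton g f)
    (vol : {measure set (borel M) -> \bar R}) (volP : riemannian_volume g vol)
    (lam : R) (lam_lt1 : lam < 1)
    (Rm_int : (\int[vol]_(x in [set: borel M])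
       (at_point g (@Rm_norm2 R n) x * expR (- (lam * f x)))%:E < +oo)%E) :
  ((\int[vol]_(x in [set: borel M])
      (at_point g (@nabla_Ric_norm2 R n) x * expR (- f x))%:E =
    \int[vol]_(x in [set: borel M])
      (at_point g (@div_Rm_norm2 R n) x * expR (- f x))%:E) /\
   \int[vol]_(x in [set: borel M])
      (at_point g (@div_Rm_norm2 R n) x * expR (- f x))%:E < +oo)%E.
Proof.
have cf := Ck_fun_cts (Ck_fun_potential solitonf 0).
have ce (a : R) : continuous (fun x => expR (- (a * f x))).
 apply: (cts_rcomp (F := fun x => - (a * f x)) (h := expR)); last exact: continuous_expR.
 apply: (cts_rcomp (F := fun x => a * f x) (h := -%R)); last exact: opp_continuous.
 exact: (ctsM (ctsC a) cf).
have cRm := cts_tnormM (@natural_riem R n) (Ck_riem_tens g).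
have Rm_integrable : vol.-integrable setT
  (EFin \o ((fun x => tnormM g (@riem_tens R n) x * expR (- (lam * f x))) : borel M -> R)).
 apply: fin_int_integrable.
 - exact: (ctsM cRm (ce lam)).
 - by move=> x; rewrite mulr_ge0 ?expR_ge0 ?tnormM_ge0.
 - by under eq_integral do rewrite -at_point_Rm.
have [c cE] := scalar_equation connectedM solitonf.
have iD := dric_integrable hausdorffM connectedM completeg solitonf volP lam_lt1 Rm_integrable cE.
have E := dric_skew_Rintegral hausdorffM connectedM completeg solitonf volP lam_lt1 Rm_integrable cE.
have iP : vol.-integrable setT
  (EFin \o ((fun x => tnormM g (@skew_tens R n) x * expR (- f x)) : borel M -> R)).
 exact: (P2_integrable hausdorffM connectedM completeg solitonf volP lam_lt1 Rm_integrable cE).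
have -> : (fun x : borel M => (at_point g (@nabla_Ric_norm2 R n) x * expR (- f x))%:E) =
  EFin \o (fun x => tnormM g (@dric_tens R n) x * expR (- f x)).
 by fext x; rewrite /= at_point_nabla_Ric.
have -> : (fun x : borel M => (at_point g (@div_Rm_norm2 R n) x * expR (- f x))%:E) =
  EFin \o (fun x => tnormM g (@skew_tens R n) x * expR (- f x)).
 by fext x; rewrite /= (at_point_div_Rm solitonf).
(* Finiteness turns the extended integrals into real numbers, for which the identity was proved. *)
have fD := integrable_fin_num measurableT iD; have fP := integrable_fin_num measurableT iP.
by rewrite -(fineK fD) -(fineK fP) ltry; split=> //; congr EFin.
Qed.
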